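(* Let $Q(\zeta)\,d\zeta^2$ be a quadratic differential on $\overline{\mathbb{C}}$ ($Q\not\equiv0$ rational) and let $\Gamma\subset\mathbb{C}$ be a Jordan curve free of infinite critical points of $Q(\zeta)\,d\zeta^2$ which consists of a finite number of arcs of trajectories and/or orthogonal trajectories of $Q(\zeta)\,d\zeta^2$ and their endpoints. Let $\varphi_\pm$ be the Riemann maps associated with $\Gamma$ and let $Q_-(z)\,dz^2$ and $Q_+(z)\,dz^2$ be the pullbacks of $Q(\zeta)\,d\zeta^2$ under $\varphi_-$ and $\varphi_+$, extended to $\overline{\mathbb{C}}$ by reflection in $\mathbb{T}$; they have the form $$Q_-(z)\,dz^2=C_-\frac{P_-^0(z)B_-^0(z)}{P_-^\infty(z)B_-^\infty(z)}\,dz^2,\qquad Q_+(z)\,dz^2=C_+\frac{P_+^0(z)B_+^0(z)}{P_+^\infty(z)B_+^\infty(z)}\,dz^2$$ with nonzero real constants $C_-$, $C_+$. Then the fingerprint $k=\varphi_+^{-1}\circ\varphi_-:\mathbb{T}\to\mathbb{T}$ of $\Gamma$ is given by a solution to the functional equation $$\mathcal{A}\circ k=\mathcal{B}\quad\text{on }\mathbb{T},$$ where $$\mathcal{A}(z)=\int_{k(z_0)}^z\sqrt{Q_+(\tau)}\,d\tau,\qquad\mathcal{B}(z)=\int_{z_0}^z\sqrt{Q_-(\tau)}\,d\tau,$$ $z_0=e^{i\theta_0}$ with $0\le\theta_0<2\pi$, and the branches of the radicals are appropriately chosen. That is, for every such $z_0$ there is a choice of branches of $\sqrt{Q_-}$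 and $\sqrt{Q_+}$ on $\mathbb{T}$ (a continuous branch on each of the finitely many open arcs complementary to the points corresponding to the critical points of $Q_-(z)\,dz^2$ and $Q_+(z)\,dz^2$ on $\mathbb{T}$) such that the equation holds for all $z=e^{i\theta}$, $\theta_0\le\theta\le\theta_0+2\pi$, with the integral in $\mathcal{B}(z)$ taken counterclockwise along $\{e^{it}:\theta_0\le t\le\theta\}$ and the integral in $\mathcal{A}(k(z))$ taken along the image of this arc under $k$, traversed counterclockwise from $k(z_0)$ to $k(z)$.
   Context: $\mathbb{D}=\{|z|<1\}$, $\mathbb{T}=\partial\mathbb{D}$, $\mathbb{D}_+=\overline{\mathbb{C}}\setminus\overline{\mathbb{D}}$. For a Jordan curve $\Gamma\subset\mathbb{C}$, $\Omega_-$ and $\Omega_+$ are the bounded and unbounded components of $\overline{\mathbb{C}}\setminus\Gamma$; $\varphi_-:\mathbb{D}\to\Omega_-$ and $\varphi_+:\mathbb{D}_+\to\Omega_+$ are conformal bijections, $\varphi_+$ being normalized by $\varphi_+(\infty)=\infty$, $\varphi_+'(\infty)=\lim_{z\to\infty}\varphi_+(z)/z>0$. Both extend to homeomorphisms of the closures. The orientation preserving homeomorphism $k=\varphi_+^{-1}\circ\varphi_-:\mathbb{T}\to\mathbb{T}$ is called a fingerprint of $\Gamma$; it is determined up to precomposition with a Möbius automorphism of $\mathbb{D}$ (reflecting the choice of $\varphi_-$). A quadratic differential on a domain $D\subset\overline{\mathbb{C}}$ is a form $Q(z)\,dz^2$ with $Q$ meromorphic, with pullback under a conformal map $\varphi$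 equal to $Q(\varphi(z))(\varphi'(z))^2\,dz^2$ (at $\infty$ one uses the local coordinate $1/z$). Zeros and simple poles are finite critical points; poles of order $\ge2$ are infinite critical points. A trajectory (respectively orthogonal trajectory) is a closed analytic Jordan curve or maximal open analytic arc along which $Q(z)\,dz^2>0$ (respectively $Q(z)\,dz^2<0$). A whole trajectory or orthogonal trajectory also counts as an arc; $\Gamma$ may consist of a single one, closed or not. Since $\mathbb{T}$ then consists of finitely many arcs on which $Q_\pm(z)\,dz^2$ is real (and their endpoints), the pullbacks extend by the reflection principle to quadratic differentials on $\overline{\mathbb{C}}$ symmetric with respect to $\mathbb{T}$, denoted by the same symbols. In the displayed formulas, for each of the signs $-$ and $+$: $B_\pm^0(z)=\prod_k (z-c_k)(1-\overline{c}_k z)$ over all zeros $c_k\in\mathbb{D}$ of $Q_\pm(z)\,dz^2$; $B_\pm^\infty(z)=\prod_k (z-p_k)(1-\overline{p}_k z)$ over all poles $p_k\in\mathbb{D}$ of $Q_\pm(z)\,dz^2$; $P_\pm^0(z)=\prod_k e^{-i(\pi+\alpha_k)/2}(z-e^{i\alpha_k})$ over all zeros $e^{i\alpha_k}\in\mathbb{T}$ of $Q_\pm(z)\,dz^2$; $P_\pm^\infty(z)=\prod_k e^{-i(\pi+\beta_k)/2}(z-e^{i\beta_k})$ over all poles $e^{i\beta_k}\in\mathbb{T}$ of $Q_\pm(z)\,dz^2$; all counted with multiplicity (the data of course depend on the sign, and empty products equal $1$). *)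

(* Defs.v *)
From HB Require Import structures.
From mathcomp Require Import all_boot all_order all_algebra.
From mathcomp Require Import all_classical all_reals all_analysis.
From mathcomp Require Import complex.

Set Implicit Arguments.
Unset Strict Implicit.
Unset Printing Implicit Defensive.

Import Order.TTheory GRing.Theory Num.Theory.
Import numFieldNormedType.Exports.

Local Open Scope classical_set_scope.
Local Open Scope ring_scope.

(* [R[i]] packed as a [numClosedFieldType], so that it carries the topology
   and the normed module structure over itself that the library attaches to
   every [numFieldType]; [derivable f z 1] and [f^`()] are then the complex
   differentiability and the complex derivative of [f : Cplx R -> Cplx R]. *)
Definition Cplx (R : realType) : numClosedFieldType := R[i]%C.

Section Plane.
Context {R : realType}.
Local Notation C := (Cplx R).

Definition rC (x : R) : C := (x%:C)%C.

Definition cis (t : R) : C := (cos t +i* sin t)%C.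

Definition unit_circle : set C := [set z | `|z| = 1].
Definition unit_disk : set C := [set z | `|z| < 1].
Definition closed_unit_disk : set C := [set z | `|z| <= 1].
Definition unit_exterior : set C := [set z | 1 < `|z|].
Definition closed_unit_exterior : set C := [set z | 1 <= `|z|].

Definition homeomorphism (A B : set C) (f : C -> C) : Prop :=
  [/\ {within A, continuous f}, set_bij A B f &
      exists g : C -> C,
        {within B, continuous g} /\ (forall z, A z -> g (f z) = z)].

Definition conformal_bijection (D E : set C) (f : C -> C) : Prop :=
  (forall z, D z -> derivable f z 1) /\ set_bij D E f.

Definition jordan_curve (Gamma : set C) : Prop :=
  exists gamma : C -> C,
    [/\ {within unit_circle, continuous gamma}, set_inj unit_circle gamma &
        Gamma = gamma @` unit_circle].

Definition component (U V : set C) : Prop :=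
  exists2 z, U z & V = connected_component U z.

(* The Riemann maps are taken together with their homeomorphic extensions to
   the closures; values outside the closed (exterior) disk are irrelevant. *)
Definition interior_riemann_map (Gamma : set C) (phi : C -> C) : Prop :=
  exists Omega : set C,
    [/\ component (~` Gamma) Omega, bounded_set Omega,
        conformal_bijection unit_disk Omega phi &
        homeomorphism closed_unit_disk (closure Omega) phi].

(* The domains are described by their finite points. With z = 1 / w, the last
   clause says that phi z / z has a positive limit at infinity; in particular
   phi extends conformally to infinity, with phi oo = oo. *)
Definition exterior_riemann_map (Gamma : set C) (phi : C -> C) : Prop :=
  exists Omega : set C,
    [/\ component (~` Gamma) Omega, ~ bounded_set Omega,
        conformal_bijection unit_exterior Omega phi,
        homeomorphism closed_unit_exterior (closure Omega) phi &
        exists2 a : R, 0 < a & (fun w => w * phi w^-1) @ 0^' --> rC a].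

(* k = phip^-1 \o phim on the unit circle. *)
Definition fingerprint (phim phip k : C -> C) : Prop :=
  forall z, unit_circle z -> unit_circle (k z) /\ phip (k z) = phim z.

(* A nonzero quadratic differential on the Riemann sphere is given by its
   coefficient in the coordinate z of the plane, a rational function in lowest
   terms. As [x / 0 = 0], [qeval] takes the value 0 at the finite poles. *)
Record qdiff := QDiff {
  qnum : {poly C};
  qden : {poly C};
  qnum_neq0 : qnum != 0;
  qden_neq0 : qden != 0;
  qcoprime : coprimep qnum qden }.

Definition qeval (Q : qdiff) (z : C) : C := (qnum Q).[z] / (qden Q).[z].

Definition critical (Q : qdiff) : set C :=
  [set z | root (qnum Q) z \/ root (qden Q) z].

Definition infinite_critical (Q : qdiff) : set C :=
  [set z | (2 <= mup z (qden Q))%N].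

(* Open analytic arcs, and closed analytic Jordan curves, along which
   f(z) dz^2 > 0. Analyticity of a parametrization means that it is the
   restriction of a function which is holomorphic near the interval (near the
   circle); positivity forces the velocity to be nonzero and, for f = qeval Q
   or its opposite, the points to be non critical. *)
Definition positive_open_arc (f : C -> C) (A : set C) : Prop :=
  exists gamma : C -> C,
    [/\ A = gamma @` (rC @` `]0, 1[),
        set_inj (rC @` `]0, 1[) gamma,
        forall t : R, t \in `]0, 1[ ->
          \forall z \near rC t, derivable gamma z 1 &
        forall t : R, t \in `]0, 1[ ->
          0 < f (gamma (rC t)) * (gamma^`()%classic (rC t)) ^+ 2].

(* At w = cis t the derivative of gamma (cis t) is 'i * w * gamma^`() w. *)
Definition positive_closed_curve (f : C -> C) (A : set C) : Prop :=
  exists gamma : C -> C,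
    [/\ A = gamma @` unit_circle,
        set_inj unit_circle gamma,
        forall w, unit_circle w -> \forall z \near w, derivable gamma z 1 &
        forall w, unit_circle w ->
          0 < f (gamma w) * ('i * w * gamma^`()%classic w) ^+ 2].

(* Trajectories in the finite plane: one passing through infinity is cut
   there, which does not change the arcs contained in the plane. *)
Definition trajectory (f : C -> C) (A : set C) : Prop :=
  positive_closed_curve f A \/
  positive_open_arc f A /\
  (forall B, positive_open_arc f B \/ positive_closed_curve f B ->
     A `<=` B -> B = A).

Definition orthogonal_trajectory (f : C -> C) : set C -> Prop :=
  trajectory (fun z => - f z).

Definition trajectory_arc (f : C -> C) (A : set C) : Prop :=
  exists2 T, trajectory f T & A = T \/ A `<=` T /\ positive_open_arc f A.

Definition orthogonal_trajectory_arc (f : C -> C) (A : set C) : Prop :=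
  exists2 T, orthogonal_trajectory f T &
    A = T \/ A `<=` T /\ positive_open_arc (fun z => - f z) A.

(* For an arc contained in a Jordan curve, the closure adds exactly the
   endpoints. *)
Definition made_of_trajectory_arcs (Q : qdiff) (Gamma : set C) : Prop :=
  exists (n : nat) (A : 'I_n -> set C),
    (forall i, trajectory_arc (qeval Q) (A i) \/
               orthogonal_trajectory_arc (qeval Q) (A i)) /\
    Gamma = \bigcup_(i in [set: 'I_n]) closure (A i).

(* QD coincides on D with the pullback of Q under phi, and is invariant under
   the reflection z |-> 1 / conj z in the unit circle, by which QD(z) dz^2 is
   pulled back to conj (QD (1 / conj z)) z^-4 dz^2. At the poles in D both
   sides of the first equation are 0. *)
Definition reflected_pullback
    (D : set C) (phi : C -> C) (Q QD : qdiff) : Prop :=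
  (forall z, D z -> qeval QD z = qeval Q (phi z) * (phi^`()%classic z) ^+ 2) /\
  (forall z, z != 0 -> (qeval QD (z^*)^-1)^* = z ^+ 4 * qeval QD z).

(* s lists the roots of p lying in S, with multiplicity. *)
Definition lists_roots (S : set C) (p : {poly C}) (s : seq C) : Prop :=
  forall z, count_mem z s = (if z \in S then mup z p else 0)%N.

Definition Bprod (s : seq C) (z : C) : C :=
  \prod_(c <- s) ((z - c) * (1 - c^* * z)).

Definition Pprod (s : seq R) (z : C) : C :=
  \prod_(a <- s) (cis (- (pi + a) / 2) * (z - cis a)).

Definition has_product_form (Q : qdiff) : Prop :=
  exists (c p : seq C) (alpha beta : seq R) (K : R),
    [/\ lists_roots unit_disk (qnum Q) c,
        lists_roots unit_disk (qden Q) p,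
        lists_roots unit_circle (qnum Q) (map cis alpha) &
        lists_roots unit_circle (qden Q) (map cis beta)] /\
    K != 0 /\
    forall z, qeval Q z = rC K * (Pprod alpha z * Bprod c z) /
                                 (Pprod beta z * Bprod p z).

(* E is finite in the intended use, so that unit_circle `\` E is a finite
   union of open arcs. *)
Definition radical_branch (Q : qdiff) (E : set C) (s : C -> C) : Prop :=
  (forall z, unit_circle z -> ~ E z -> s z ^+ 2 = qeval Q z) /\
  {within unit_circle `\` E, continuous s}.

(* The integrand of the integral of s(tau) dtau, for tau = cis t. *)
Definition circle_integrand (s : C -> C) (t : R) : C :=
  s (cis t) * ('i * cis t).

Definition circle_integrable (s : C -> C) : Prop :=
  forall a b : R,
    lebesgue_measure.-integrable `[a, b]
      (fun t => (complex.Re (circle_integrand s t))%:E) /\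
    lebesgue_measure.-integrable `[a, b]
      (fun t => (complex.Im (circle_integrand s t))%:E).

Definition forward_circle_integral (s : C -> C) (a b : R) : C :=
  ((\int[lebesgue_measure]_(t in `[a, b]) complex.Re (circle_integrand s t)) +i*
   (\int[lebesgue_measure]_(t in `[a, b]) complex.Im (circle_integrand s t)))%C.

(* Integral of s(tau) dtau along cis t, t going from a to b. *)
Definition circle_integral (s : C -> C) (a b : R) : C :=
  if a <= b then forward_circle_integral s a b
  else - forward_circle_integral s b a.

(* A continuous determination of the argument of k (cis t) over one turn. *)
Definition argument_lift (k : C -> C) (theta0 : R) (kappa : R -> R) : Prop :=
  {within `[theta0, theta0 + 2 * pi], continuous kappa} /\
  forall t, t \in `[theta0, theta0 + 2 * pi] -> k (cis t) = cis (kappa t).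

End Plane.

Arguments Cplx R : clear implicits.
Arguments qdiff R : clear implicits.

(* Main.v *)
(* Let zeta0 be a point of Gamma. Since Q has at most a simple pole there, the
   square W of the integral of sqrt Q from zeta0 is holomorphic near zeta0, and
   W' ^ 2 = 4 W Q. On the trajectories and orthogonal trajectories W is real,
   so that W \o phi, for a Riemann map phi, is real on the unit circle near the
   preimage of zeta0 and extends across it by reflection. The pullback of Q
   therefore has finitely many poles in the closed disk, and multiplying it by
   a product of factors (z - p) (1 - conj p z) gives a function which reflects
   to an entire function of polynomial growth: the pullback is rational.
   The same W serves both Riemann maps: W \o phi_- = W \o phi_+ \o k. On the
   circle z ^ 2 Q_-(z) is a real number H, and near t0 the integrals from t0 of
   sqrt H and sqrt (- H) are sqrt (- om) and sqrt om up to the sign of t - t0,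
   where om t = Re (W (phi_- (cis t))); likewise for Q_+. So both sides of the
   functional equation vary by the same amount near every point, up to a sign
   which depends only on the orientation of k and is put in the radical of Q_+. *)

(* At a point of [Gamma] the curve may pass from a trajectory to an orthogonal trajectory, and
   around that point a square root of W need not be single-valued. What survives is that on each
   side of the point one of |W| - Re W and |W| + Re W is constant. Both vanish at the point, where W
   = 0, so W is real on either side, with a sign that may change across the point. Hence the
   reflection argument rests on the reality of W alone. Where W changes sign, so does H, and the
   real and imaginary parts of the radical exchange their roles. As [Num.sqrt] is 0 on negative
   numbers, sqrt H and sqrt (- H) can both be integrated over a whole neighbourhood, without
   distinguishing the sides. The rational function is first known to agree with the pullback off a
   finite set only; the equation at the remaining points, with the convention x / 0 = 0 at poles, is
   recovered by taking limits. *)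
Require Import Defs.
From HB Require Import structures.
From mathcomp Require Import all_boot all_order all_algebra.
From mathcomp Require Import all_classical all_reals all_analysis.
From mathcomp Require Import complex.
From mathcomp Require Import measurable_realfun ring lra.
Import Order.TTheory GRing.Theory Num.Theory.
Import numFieldNormedType.Exports.

Set Implicit Arguments.
Unset Strict Implicit.
Unset Printing Implicit Defensive.

Local Open Scope classical_set_scope.
Local Open Scope ring_scope.

(** * Complex numbers *)

Section Basics.
Context {R : realType}.
Local Notation C := (Cplx R).
Implicit Types (z w : C) (t s : R).

(** The norm of [Cplx R] takes its values in [Cplx R]; estimates are carried out with this
    real-valued modulus. *)
Definition cabs z : R := Normc.normc z.

Lemma cabsE z : `|z| = rC (cabs z) :> C.
Proof. by []. Qed.

Lemma rCE (x : R) : rC x = (x%:C)%C. Proof. by []. Qed.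
Lemma rCD (x y : R) : rC (x + y) = rC x + rC y. Proof. exact: (rmorphD (real_complex R)). Qed.
Lemma rCB (x y : R) : rC (x - y) = rC x - rC y. Proof. exact: (rmorphB (real_complex R)). Qed.
Lemma rCN (x : R) : rC (- x) = - rC x. Proof. exact: (rmorphN (real_complex R)). Qed.
Lemma rCM (x y : R) : rC (x * y) = rC x * rC y. Proof. exact: (rmorphM (real_complex R)). Qed.
Lemma rCV (x : R) : rC (x^-1) = (rC x)^-1. Proof. exact: (fmorphV (real_complex R)). Qed.
Lemma rC0 : rC (0 : R) = 0. Proof. by []. Qed.
Lemma rC1 : rC (1 : R) = 1. Proof. by []. Qed.
Lemma rCX (x : R) n : rC (x ^+ n) = rC x ^+ n. Proof. exact: (rmorphXn (real_complex R)). Qed.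
Lemma rC_inj : injective (@rC R). Proof. exact: complexI. Qed.
Lemma rC_eq0 (x : R) : (rC x == 0) = (x == 0). Proof. by rewrite -rC0 (inj_eq rC_inj). Qed.
Lemma rC_lt (x y : R) : (rC x < rC y) = (x < y). Proof. exact: ltcR. Qed.
Lemma rC_le (x y : R) : (rC x <= rC y) = (x <= y). Proof. exact: lecR. Qed.

Lemma cabs_ge0 z : 0 <= cabs z.
Proof. by rewrite -rC_le rC0 -cabsE normr_ge0. Qed.
Lemma cabs0 : cabs 0 = 0. Proof. exact: Normc.normc0. Qed.
Lemma cabs1 : cabs 1 = 1. Proof. exact: Normc.normc1. Qed.
Lemma cabsM z w : cabs (z * w) = cabs z * cabs w.
Proof. by apply: rC_inj; rewrite rCM -!cabsE normrM. Qed.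
Lemma cabsX z n : cabs (z ^+ n) = cabs z ^+ n.
Proof. by apply: rC_inj; rewrite rCX -!cabsE normrX. Qed.
Lemma cabsV z : cabs (z^-1) = (cabs z)^-1.
Proof. by apply: rC_inj; rewrite rCV -!cabsE normfV. Qed.
Lemma cabsN z : cabs (- z) = cabs z.
Proof. by apply: rC_inj; rewrite -!cabsE normrN. Qed.
Lemma cabsC z w : cabs (z - w) = cabs (w - z).
Proof. by apply: rC_inj; rewrite -!cabsE distrC. Qed.
Lemma cabsD z w : cabs (z + w) <= cabs z + cabs w.
Proof. by rewrite -rC_le rCD -!cabsE ler_normD. Qed.
Lemma cabsB z w : cabs z - cabs w <= cabs (z - w).
Proof. by rewrite -rC_le rCB -!cabsE lerB_dist. Qed.
Lemma cabs_eq0 z : (cabs z == 0) = (z == 0).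
Proof. by rewrite -rC_eq0 -cabsE normr_eq0. Qed.
Lemma cabs_gt0 z : (0 < cabs z) = (z != 0).
Proof. by rewrite lt_def cabs_ge0 cabs_eq0 andbT. Qed.
Lemma cabs_rC (x : R) : cabs (rC x) = `|x|.
Proof. by rewrite /cabs /= expr0n addr0 sqrtr_sqr. Qed.
Lemma cabs_conj z : cabs z^* = cabs z.
Proof. by apply: rC_inj; rewrite -!cabsE norm_conjC. Qed.

Lemma conjCE z : z^* = conjc z :> C. Proof. by []. Qed.
Lemma conj_rC (x : R) : (rC x)^* = rC x.
Proof. by rewrite conjCE /= oppr0. Qed.
Lemma Re_rC (x : R) : complex.Re (rC x) = x. Proof. by []. Qed.
Lemma Im_rC (x : R) : complex.Im (rC x) = 0. Proof. by []. Qed.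
Lemma ReD z w : complex.Re (z + w) = complex.Re z + complex.Re w.
Proof. by case: z w => ? ? [? ?]. Qed.
Lemma ImD z w : complex.Im (z + w) = complex.Im z + complex.Im w.
Proof. by case: z w => ? ? [? ?]. Qed.
Lemma ReN z : complex.Re (- z) = - complex.Re z.
Proof. by case: z. Qed.
Lemma ImN z : complex.Im (- z) = - complex.Im z.
Proof. by case: z. Qed.
Lemma cReM z w : complex.Re (z * w) = complex.Re z * complex.Re w - complex.Im z * complex.Im w.
Proof. by case: z w => ? ? [? ?]. Qed.
Lemma cImM z w : complex.Im (z * w) = complex.Re z * complex.Im w + complex.Im z * complex.Re w.
Proof. by case: z w => ? ? [? ?] /=. Qed.
Lemma complex_eq z w : complex.Re z = complex.Re w -> complex.Im z = complex.Im w -> z = w.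
Proof. by case: z w => ? ? [? ?] /= -> ->. Qed.
Lemma real_rC z : complex.Im z = 0 -> z = rC (complex.Re z).
Proof. by move=> h; apply: complex_eq. Qed.
Lemma ImJ z : complex.Im z^* = - complex.Im z. Proof. by case: z. Qed.
Lemma ReJ z : complex.Re z^* = complex.Re z. Proof. by case: z. Qed.
Lemma conj_real z : z^* = z -> z = rC (complex.Re z).
Proof.
move=> h; apply: real_rC; have := congr1 (@complex.Im R) h.
by rewrite ImJ => ?; lra.
Qed.
Lemma iE : 'i = (0 +i* 1)%C :> C.
Proof. exact: esym (@complexiE R). Qed.
Lemma ReIm z : z = rC (complex.Re z) + 'i * rC (complex.Im z).
Proof. by rewrite iE; apply: complex_eq; rewrite ?(ReD, ImD, cReM, cImM) /=; lra. Qed.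

Lemma cabs_sqr z : cabs z ^+ 2 = complex.Re z ^+ 2 + complex.Im z ^+ 2.
Proof. by case: z => a b; rewrite /cabs /= sqr_sqrtr // addr_ge0 ?sqr_ge0. Qed.
Lemma Re_le_cabs z : `|complex.Re z| <= cabs z.
Proof.
rewrite -(ler_pXn2r (n := 2)) ?nnegrE ?cabs_ge0 // cabs_sqr real_normK ?num_real //.
by rewrite lerDl sqr_ge0.
Qed.
Lemma Im_le_cabs z : `|complex.Im z| <= cabs z.
Proof.
rewrite -(ler_pXn2r (n := 2)) ?nnegrE ?cabs_ge0 // cabs_sqr real_normK ?num_real //.
by rewrite lerDr sqr_ge0.
Qed.
Lemma cabsi : cabs 'i = 1 :> R.
Proof. by rewrite iE /cabs /= expr0n expr1n add0r sqrtr1. Qed.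
Lemma cabs_le_ReIm z : cabs z <= `|complex.Re z| + `|complex.Im z|.
Proof.
rewrite {1}[z]ReIm; apply: (le_trans (cabsD _ _)).
by rewrite cabsM !cabs_rC cabsi mul1r.
Qed.
Lemma mulCJ z : z * z^* = rC (cabs z ^+ 2).
Proof. by rewrite -normCK cabsE rCX. Qed.

Lemma nbhs_C z (P : set C) :
  nbhs z P <-> exists2 e : R, 0 < e & forall w, cabs (w - z) < e -> P w.
Proof.
split.
- move=> /nbhs_ballP[e /= e0 he].
  (* A positive element of [Cplx R] is real, so balls may be given real radii. *)
  have [d de] : exists d : R, e = rC d.
    by exists (complex.Re e); apply: real_rC; apply: ger0_Im; exact: ltW.
  move: e0; rewrite de -rC0 rC_lt => d0.
  exists d => // w hw; apply: he; rewrite /ball /= de distrC cabsE rC_lt //.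
- move=> [e e0 he]; apply/nbhs_ballP; exists (rC e) => /=.
    by rewrite -rC0 rC_lt.
  move=> w; rewrite /ball /= distrC cabsE rC_lt; exact: he.
Qed.

Lemma near_C z (P : set C) :
  (\forall w \near z, P w) <-> exists2 e : R, 0 < e & forall w, cabs (w - z) < e -> P w.
Proof. exact: nbhs_C. Qed.

Lemma near_R t (P : set R) :
  (\forall s \near t, P s) <-> exists2 e : R, 0 < e & forall s, `|s - t| < e -> P s.
Proof.
split.
- move=> /nbhs_ballP[e /= e0 he]; exists e => // s hs; apply: he.
  by rewrite /ball /= distrC.
- move=> [e e0 he]; apply/nbhs_ballP; exists e => //= s.
  by rewrite /ball /= distrC; exact: he.
Qed.

Lemma cvg_C {T : Type} (F : set_system T) {FF : Filter F} (f : T -> C) (l : C) :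
  f @ F --> l <-> forall e : R, 0 < e -> \forall x \near F, cabs (f x - l) < e.
Proof.
split.
- by move=> h e e0; apply: (h [set w | cabs (w - l) < e]); apply/nbhs_C; exists e.
- move=> h P /nbhs_C[e e0 he]; move: (h e e0); apply: filterS => x; exact: he.
Qed.

Lemma continuous_rC : continuous (@rC R : R -> C).
Proof.
move=> x; apply/cvg_C => e e0; apply/near_R; exists e => // s.
by rewrite -rCB cabs_rC.
Qed.

Lemma cvg_R {T : Type} (F : set_system T) {FF : Filter F} (f : T -> R) (l : R) :
  f @ F --> l <-> forall e : R, 0 < e -> \forall x \near F, `|f x - l| < e.
Proof.
split.
- by move=> h e e0; apply: (h [set y | `|y - l| < e]); apply/near_R; exists e.
- move=> h P /near_R[e e0 he]; move: (h e e0); apply: filterS => x; exact: he.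
Qed.

Lemma continuous_Re : continuous (@complex.Re R : C -> R).
Proof.
move=> z; apply/(@cvg_R _ (nbhs z)) => e e0; apply/near_C; exists e => // w h.
by rewrite -ReN -ReD; exact: le_lt_trans (Re_le_cabs _) h.
Qed.
Lemma continuous_Im : continuous (@complex.Im R : C -> R).
Proof.
move=> z; apply/(@cvg_R _ (nbhs z)) => e e0; apply/near_C; exists e => // w h.
by rewrite -ImN -ImD; exact: le_lt_trans (Im_le_cabs _) h.
Qed.
Lemma continuous_cabs : continuous (cabs : C -> R).
Proof.
move=> z; apply/(@cvg_R _ (nbhs z)) => e e0; apply/near_C; exists e => // w h.
rewrite ltr_norml; have := cabsB w z; have := cabsB z w; rewrite (cabsC z w).
by move=> ? ?; apply/andP; split; lra.
Qed.
Lemma continuous_conj : continuous (fun z : C => z^*).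
Proof.
move=> z; apply/(@cvg_C _ (nbhs z)) => e e0; apply/near_C; exists e => // w h.
by rewrite -rmorphB cabs_conj.
Qed.

End Basics.

(** * Differentiability *)

Section Caratheodory.
Context {R : realType}.
Local Notation C := (Cplx R).

(* An opaque wrapper: unification would otherwise unfold continuity down to
   neighbourhoods. *)
Variant cont_at {T U : topologicalType} (f : T -> U) (t : T) : Prop :=
  ContAt of f @ t --> f t.

Lemma cont_atP {T U : topologicalType} (f : T -> U) (t : T) :
  cont_at f t <-> f @ t --> f t.
Proof. by split => [[]|]. Qed.

Lemma cont_near {T : topologicalType} {U : topologicalType} (f g : T -> U) (t : T) :
  (\forall s \near t, f s = g s) -> cont_at f t -> cont_at g t.
Proof.
move=> fg [h]; split; suff : g @ t --> f t by rewrite (nbhs_singleton fg).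
by apply: cvg_trans h; apply: near_eq_cvg; apply: filterS fg => s ->.
Qed.

Section ContC.
Context {T : topologicalType}.
Implicit Types (f g : T -> C) (t : T).
Lemma contD f g t : cont_at f t -> cont_at g t -> cont_at (fun s => f s + g s) t.
Proof. by move=> [hf] [hg]; split; exact: (cvgD hf hg). Qed.
Lemma contN f t : cont_at f t -> cont_at (fun s => - f s) t.
Proof. by move=> [hf]; split; exact: (cvgN hf). Qed.
Lemma contB f g t : cont_at f t -> cont_at g t -> cont_at (fun s => f s - g s) t.
Proof. by move=> hf hg; exact: (contD hf (contN hg)). Qed.
Lemma contM f g t : cont_at f t -> cont_at g t -> cont_at (fun s => f s * g s) t.
Proof. by move=> [hf] [hg]; split; exact: (cvgM hf hg). Qed.
Lemma contV f t : f t != 0 -> cont_at f t -> cont_at (fun s => (f s)^-1) t.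
Proof. by move=> f0 [hf]; split; exact: (cvgV f0 hf). Qed.
Lemma cont_cst {T' U : topologicalType} (c : U) (t : T') : cont_at (fun=> c) t.
Proof. by split; exact: cvg_cst. Qed.
Lemma contX f n t : cont_at f t -> cont_at (fun s => f s ^+ n) t.
Proof.
move=> hf; elim: n => [|n IH].
  rewrite (_ : (fun s => _) = fun=> 1); first exact: cont_cst.
  by apply/funext => s; rewrite expr0.
rewrite (_ : (fun s => _) = fun s => f s * f s ^+ n); first exact: contM.
by apply/funext => s; rewrite exprS.
Qed.
Lemma cont_comp {S U V : topologicalType} (g : U -> V) (f : S -> U) (t : S) :
  cont_at f t -> cont_at g (f t) -> cont_at (fun s => g (f s)) t.
Proof. by move=> [hf] [hg]; split; exact: (cvg_comp _ _ hf hg). Qed.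
Lemma cont_rC (f : T -> R) t : cont_at f t -> cont_at (fun s => rC (f s) : C) t.
Proof. by move=> h; apply: (cont_comp (g := @rC R)) h _; split; exact: continuous_rC. Qed.
Lemma cont_id t : cont_at (fun s : T => s) t.
Proof. by split; exact: cvg_id. Qed.
Lemma cont_conj f t : cont_at f t -> cont_at (fun s => (f s)^*) t.
Proof. by move=> h; apply: (cont_comp (g := fun z : C => z^*)) h _; split; exact: continuous_conj. Qed.
Lemma cont_Re f t : cont_at f t -> cont_at (fun s => complex.Re (f s)) t.
Proof. by move=> h; apply: (cont_comp (g := (@complex.Re R : C -> R))) h _; split; exact: continuous_Re. Qed.
Lemma cont_Im f t : cont_at f t -> cont_at (fun s => complex.Im (f s)) t.
Proof. by move=> h; apply: (cont_comp (g := (@complex.Im R : C -> R))) h _; split; exact: continuous_Im. Qed.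
Lemma cont_cabs f t : cont_at f t -> cont_at (fun s => cabs (f s)) t.
Proof. by move=> h; apply: (cont_comp (g := @cabs R)) h _; split; exact: continuous_cabs. Qed.

Lemma cont_eps f t : cont_at f t <->
  forall e : R, 0 < e -> \forall s \near t, cabs (f s - f t) < e.
Proof. by rewrite cont_atP; split => /cvg_C. Qed.

Lemma cont_neq0 f t : cont_at f t -> f t != 0 -> \forall s \near t, f s != 0.
Proof.
move=> /cont_eps h; rewrite -cabs_gt0 => h0; move: (h _ h0); apply: filterS => s hs.
apply/eqP => fs0; move: hs; rewrite fs0 sub0r cabsN; lra.
Qed.
End ContC.

(* Caratheodory's form of differentiability. *)
Definition cder {T : topologicalType} (iota : T -> C) (f : T -> C) (t : T) (d : C) : Prop :=
  exists q : T -> C,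
    [/\ cont_at q t, q t = d &
        forall s, f s = f t + (iota s - iota t) * q s].

Section Generic.
Context {T : topologicalType}.
Variable iota : T -> C.
Hypothesis ciota : forall t, cont_at iota t.
Implicit Types (f g : T -> C) (t : T).

Lemma cder_cont f t d : cder iota f t d -> cont_at f t.
Proof.
move=> [q [cq _ hq]]; rewrite (funext hq).
apply: contD; first exact: cont_cst.
apply: contM => //; apply: contB; [exact: ciota | exact: cont_cst].
Qed.

Lemma cder_near f g t d : (\forall s \near t, f s = g s) ->
  (forall s, iota s = iota t -> s = t) ->
  cder iota f t d -> cder iota g t d.
Proof.
move=> fg hi [q [cq qt hq]].
pose q' s := if iota s == iota t then d else (g s - g t) / (iota s - iota t).
have gt : g t = f t by rewrite (nbhs_singleton fg).
exists q'; split; last first.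
- move=> s; rewrite /q'; case: eqP => [/hi ->|/eqP h]; first by rewrite subrr mul0r addr0.
  by rewrite mulrC divfK ?subr_eq0 // addrC subrK.
- by rewrite /q' eqxx.
- apply: cont_near cq; apply: filterS fg => s fg; rewrite /q'.
  case: eqP => [/hi ->//|/eqP h]; rewrite gt -fg hq addrAC subrr add0r mulrC mulKf //.
  by rewrite subr_eq0.
Qed.

Lemma cder_cst (c : C) t : cder iota (fun=> c) t 0.
Proof.
by exists (fun=> 0); split => [||s] //; [exact: cont_cst | rewrite mulr0 addr0].
Qed.

Lemma cder_iota t : cder iota iota t 1.
Proof.
by exists (fun=> 1); split => [||s] //; [exact: cont_cst | rewrite mulr1 addrC subrK].
Qed.

Lemma cderD f g t a b : cder iota f t a -> cder iota g t b ->
  cder iota (fun s => f s + g s) t (a + b).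
Proof.
move=> [q [cq qt hq]] [r [cr rt hr]]; exists (fun s => q s + r s); split.
- exact: contD.
- by rewrite qt rt.
- by move=> s; rewrite {1}hq {1}hr mulrDr addrACA.
Qed.

Lemma cderN f t a : cder iota f t a -> cder iota (fun s => - f s) t (- a).
Proof.
move=> [q [cq qt hq]]; exists (fun s => - q s); split.
- exact: contN.
- by rewrite qt.
- by move=> s; rewrite {1}hq mulrN opprD.
Qed.

Lemma cderB f g t a b : cder iota f t a -> cder iota g t b ->
  cder iota (fun s => f s - g s) t (a - b).
Proof. by move=> hf hg; apply: cderD => //; apply: cderN. Qed.

Lemma cderM f g t a b : cder iota f t a -> cder iota g t b ->
  cder iota (fun s => f s * g s) t (a * g t + f t * b).
Proof.
move=> hf hg; have cg := cder_cont hg.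
move: hf hg => [q [cq qt hq]] [r [cr rt hr]].
exists (fun s => q s * g s + f t * r s); split.
- by apply: contD; apply: contM => //; exact: cont_cst.
- by rewrite qt rt.
- move=> s; rewrite {1}hq mulrDl {1}hr; ring.
Qed.

Lemma cderZ c f t a : cder iota f t a -> cder iota (fun s => c * f s) t (c * a).
Proof. by move=> h; have := cderM (cder_cst c t) h; rewrite mul0r add0r. Qed.

Lemma cderX f t a n : cder iota f t a ->
  cder iota (fun s => f s ^+ n) t (n%:R * f t ^+ n.-1 * a).
Proof.
move=> hf; elim: n => [|n IH].
  by under eq_fun do rewrite expr0; rewrite !mul0r; exact: cder_cst.
under eq_fun do rewrite exprS.
have -> : n.+1%:R * f t ^+ n.+1.-1 * a = a * f t ^+ n + f t * (n%:R * f t ^+ n.-1 * a).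
  case: n {IH} => [|n] /=; first by rewrite !expr0; ring.
  by rewrite exprS -!natr1; ring.
exact: cderM.
Qed.

Lemma cderV f t a : f t != 0 -> cder iota f t a ->
  cder iota (fun s => (f s)^-1) t (- a / f t ^+ 2).
Proof.
move=> f0 hf; have cf := cder_cont hf.
move: hf => [q [cq qt hq]].
(* [f] may vanish at points [s] away from [t], where the inverse takes the default value 0; the
   first branch is the slope forced there. *)
pose q' s := if f s == 0 then
   (if iota s == iota t then 0 else - (f t)^-1 / (iota s - iota t)) else - q s / (f s * f t).
exists q'; split.
- apply: (@cont_near _ _ (fun s => - q s / (f s * f t))).
    by move: (cont_neq0 cf f0); apply: filterS => s; rewrite /q' => /negPf ->.
  apply: contM; first exact: contN.
  apply: contV; first by rewrite mulf_neq0.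
  by apply: contM => //; exact: cont_cst.
- by rewrite /q' (negPf f0) qt expr2.
- move=> s; rewrite /q'; case: eqP => [fs|/eqP fs].
    have h : iota s != iota t.
      by apply/eqP => h; move: fs; rewrite hq h subrr mul0r addr0; apply/eqP.
    rewrite (negPf h) fs invr0; field; by rewrite f0 subr_eq0 h.
  have -> : (iota s - iota t) * (- q s / (f s * f t)) =
     - ((iota s - iota t) * q s) / (f s * f t) by ring.
  have -> : (iota s - iota t) * q s = f s - f t by rewrite [f s]hq addrAC subrr add0r.
  by field; rewrite fs f0.
Qed.

Lemma cder_eq f t a b : cder iota f t a -> a = b -> cder iota f t b.
Proof. by move=> h <-. Qed.

Lemma cder_eps f t d : (forall s, iota s = iota t -> s = t) ->
  (forall e : R, 0 < e -> \forall s \near t,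
     cabs (f s - f t - (iota s - iota t) * d) <= e * cabs (iota s - iota t)) ->
  cder iota f t d.
Proof.
move=> hi h.
pose q s := if iota s == iota t then d else (f s - f t) / (iota s - iota t).
exists q; split; last first.
- move=> s; rewrite /q; case: eqP => [/hi ->|/eqP h0]; first by rewrite subrr mul0r addr0.
  by rewrite mulrC divfK ?subr_eq0 // addrC subrK.
- by rewrite /q eqxx.
- apply/cont_eps => e e0; have e2 : 0 < e / 2 by lra.
  move: (h _ e2); apply: filterS => s; rewrite /q eqxx; case: eqP => [_|/eqP h0].
    by rewrite subrr cabs0.
  have h1 : iota s - iota t != 0 by rewrite subr_eq0.
  have h2 : 0 < cabs (iota s - iota t) by rewrite cabs_gt0.
  have -> : (f s - f t) / (iota s - iota t) - d =
     (f s - f t - (iota s - iota t) * d) / (iota s - iota t) by field.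
  rewrite cabsM cabsV => h3; apply: (@le_lt_trans _ _ (e / 2)); last lra.
  by rewrite ler_pdivrMr.
Qed.

Lemma cder_bound f t d : cder iota f t d ->
  forall e : R, 0 < e -> \forall s \near t,
     cabs (f s - f t - (iota s - iota t) * d) <= e * cabs (iota s - iota t).
Proof.
move=> [q [cq qt hq]] e e0; move/cont_eps: cq => /(_ _ e0).
apply: filterS => s; rewrite qt => h.
have -> : f s - f t - (iota s - iota t) * d = (q s - d) * (iota s - iota t).
  by rewrite [f s]hq; ring.
by rewrite cabsM ler_wpM2r ?cabs_ge0 // ltW.
Qed.

Lemma cder_unique f t a b : (forall P, nbhs t P -> exists2 s, P s & iota s != iota t) ->
  cder iota f t a -> cder iota f t b -> a = b.
Proof.
move=> acc [q [cq qt hq]] [r [cr rt hr]].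
apply/eqP; rewrite -subr_eq0; apply: contraPT isT => ab.
have hc : cont_at (fun s => q s - r s) t by exact: contB.
have := cont_neq0 hc; rewrite qt rt => /(_ ab) /acc [s hs hs'].
have h : (iota s - iota t) * (q s - r s) == 0.
  have := hq s; rewrite hr => /addrI; rewrite mulrBr => ->; by rewrite subrr.
by move: h; rewrite mulf_eq0 subr_eq0 (negPf hs') (negPf hs).
Qed.

End Generic.

(** With [iota] the identity the general notion is complex differentiability, with [iota = rC] it is
    differentiability of a curve; the rules above serve both. *)
Definition hasd (f : C -> C) (z d : C) := cder (@id C) f z d.
Definition hasdr (f : R -> C) (t : R) (d : C) := cder (@rC R) f t d.

Lemma cder_comp {T : topologicalType} (iota : T -> C) (g : C -> C) (f : T -> C) t a b :
  (forall t, cont_at iota t) -> hasd g (f t) b -> cder iota f t a -> cder iota (fun s => g (f s)) t (b * a).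
Proof.
move=> ci [r [cr rt hr]] hf; have cf := cder_cont ci hf; move: hf => [q [cq qt hq]].
exists (fun s => r (f s) * q s); split.
- by apply: contM => //; exact: cont_comp.
- by rewrite rt qt.
- by move=> s; rewrite hr [in f s - _]hq; ring.
Qed.

Lemma id_C_cont (z : C) : cont_at (@id C) z. Proof. exact: cont_id. Qed.
Lemma rC_cont (t : R) : cont_at (@rC R : R -> C) t.
Proof. by split; exact: continuous_rC. Qed.

Lemma acc_C (z : C) P : nbhs z P -> exists2 w, P w & id w != id z.
Proof.
move=> /nbhs_C [e e0 he]; exists (z + rC (e / 2)).
  by apply: he; rewrite addrAC subrr add0r cabs_rC ger0_norm; lra.
by rewrite /= -subr_eq0 addrAC subrr add0r rC_eq0; apply/eqP; lra.
Qed.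

Lemma hasd_cont f z d : hasd f z d -> cont_at f z.
Proof. exact: (cder_cont id_C_cont). Qed.
Lemma hasdr_cont f t d : hasdr f t d -> cont_at f t.
Proof. exact: (cder_cont rC_cont). Qed.
Lemma hasd_comp g f z a b : hasd g (f z) b -> hasd f z a -> hasd (fun w => g (f w)) z (b * a).
Proof. exact: (cder_comp id_C_cont). Qed.
Lemma hasdr_comp g f t a b : hasd g (f t) b -> hasdr f t a -> hasdr (fun s => g (f s)) t (b * a).
Proof. exact: (cder_comp rC_cont). Qed.
Lemma hasd_unique f z a b : hasd f z a -> hasd f z b -> a = b.
Proof. by apply: cder_unique; exact: acc_C. Qed.

Lemma hasd_near f g z d : (\forall w \near z, f w = g w) -> hasd f z d -> hasd g z d.
Proof. by move=> h; apply: cder_near. Qed.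
Lemma hasdr_near f g t d : (\forall s \near t, f s = g s) -> hasdr f t d -> hasdr g t d.
Proof. by move=> h; apply: cder_near => // s /rC_inj. Qed.

Lemma hasd_derive f z d : hasd f z d -> is_derive (z : C) (1 : C) f d.
Proof.
move=> [q [cq qz hq]].
have h : (fun h : C => h^-1 *: ((f \o shift z) (h *: (1 : C)) - f z)) @ 0^' --> d.
  have h1 : (fun h : C => q (h + z)) @ 0 --> d.
    have [] : cont_at (fun h : C => q (h + z)) 0.
      by apply: (cont_comp (f := fun h : C => h + z)); [exact: contD (cont_id _) (cont_cst _ _)|rewrite add0r].
    by rewrite add0r qz.
  have h2 : (fun h : C => q (h + z)) @ 0^' --> d by apply: cvg_within_filter.
  apply: cvg_trans h2; apply: near_eq_cvg.
  near=> h; rewrite /= hq /= addrAC subrr add0r.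
  have h0 : h != 0 by near: h; exact: nbhs_dnbhs_neq.
  rewrite /GRing.scale /= mulr1 addrK mulKf //.
split; first by apply/cvg_ex; exists d.
exact: cvg_lim.
Unshelve. all: by end_near. Qed.

Lemma derive_hasd f z d : is_derive (z : C) (1 : C) f d -> hasd f z d.
Proof.
move=> [hd <-]; have /cvg_C h := hd.
apply: cder_eps => // e e0; move: (h e e0); rewrite near_withinE => /near_C [r r0 hr].
apply/near_C; exists r => // w hw.
have [->|wz] := eqVneq w z; first by rewrite !subrr mul0r subrr cabs0 mulr0.
have wz0 : w - z != 0 by rewrite subr_eq0.
have := hr (w - z); rewrite subr0 => /(_ hw wz0) /=.
rewrite /GRing.scale /= mulr1 subrK => h1.
have -> : f w - f z - (w - z) * 'D_1 f z =
   (w - z) * ((w - z)^-1 * (f w - f z) - 'D_1 f z) by field.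
by rewrite cabsM mulrC ler_wpM2r ?cabs_ge0 // ltW.
Qed.

Lemma hasdP f z d : hasd f z d <-> derivable f z (1 : C) /\ f^`()%classic z = d.
Proof.
split.
- by move=> /hasd_derive [h1 h2]; split; [exact: h1 | rewrite derive1E; exact: h2].
- by move=> [h <-]; apply: derive_hasd; rewrite derive1E; apply: derivableP.
Qed.

Lemma derivable_hasd f z : derivable f z (1 : C) -> hasd f z (f^`()%classic z).
Proof. by move=> h; apply/hasdP. Qed.

Lemma hasd_derive1 f z d : hasd f z d -> f^`()%classic z = d.
Proof. by move=> /hasdP[]. Qed.

Lemma hasdr_Re f t d : hasdr f t d -> is_derive (t : R) (1 : R) (fun s => complex.Re (f s)) (complex.Re d).
Proof.
move=> [q [cq qt hq]]; apply/is_derive1_caratheodory.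
exists (fun s => complex.Re (q s)); split.
- move=> s; rewrite {1}hq ReD addrAC subrr add0r -rCB cReM Re_rC Im_rC mul0r subr0; exact: mulrC.
- by have [] := cont_Re cq.
- by rewrite qt.
Qed.

Lemma hasdr_Im f t d : hasdr f t d -> is_derive (t : R) (1 : R) (fun s => complex.Im (f s)) (complex.Im d).
Proof.
move=> [q [cq qt hq]]; apply/is_derive1_caratheodory.
exists (fun s => complex.Im (q s)); split.
- move=> s; rewrite {1}hq ImD addrAC subrr add0r -rCB cImM Re_rC Im_rC mul0r addr0; exact: mulrC.
- by have [] := cont_Im cq.
- by rewrite qt.
Qed.

Lemma derive_hasdr (f : R -> R) (t d : R) : is_derive (t : R) (1 : R) f d -> hasdr (fun s => rC (f s)) t (rC d).
Proof.
move=> /is_derive1_caratheodory [q [hq cq qt]]; exists (fun s => rC (q s)); split.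
- by apply: cont_rC; split.
- by rewrite qt.
- by move=> s; rewrite -rCB -rCM mulrC -hq -rCD addrC subrK.
Qed.

Lemma hasdr_ReIm (f g : R -> R) (t a b : R) : is_derive (t : R) (1 : R) f a -> is_derive (t : R) (1 : R) g b ->
  hasdr (fun s => rC (f s) + 'i * rC (g s)) t (rC a + 'i * rC b).
Proof.
move=> hf hg; apply: cderD; first exact: derive_hasdr.
by apply: cderZ; [exact: rC_cont | exact: derive_hasdr].
Qed.

Lemma hasd_poly (p : {poly C}) z : hasd (horner p) z (p^`()).[z].
Proof.
elim/poly_ind: p => [|p c IH].
  rewrite derivC horner0 (_ : horner 0 = fun=> 0); first exact: cder_cst.
  by apply/funext => w; rewrite horner0.
rewrite derivD derivM derivX derivC addr0 mulr1 hornerD hornerM hornerX.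
rewrite (_ : horner (p * 'X + c%:P) = fun w => p.[w] * id w + c); last first.
  by apply/funext => w; rewrite hornerD hornerM hornerX hornerC.
have h := cderD (cderM id_C_cont IH (cder_iota id z)) (cder_cst id c z).
by apply: cder_eq h _; rewrite addr0 mulr1.
Qed.

Lemma cont_horner (p : {poly C}) z : cont_at (horner p) z.
Proof. apply: hasd_cont; exact: hasd_poly. Qed.

End Caratheodory.

(** * Curve integrals and Goursat's theorem *)

Section CurveIntegral.
Context {R : realType}.
Local Notation C := (Cplx R).
Implicit Types (f g P : R -> C) (a b t s : R).

Lemma is_derive_cont_at (f : R -> R) (t d : R) : is_derive t (1 : R) f d -> cont_at f t.
Proof. by move=> [h _]; split; exact: differentiable_continuous (iffLR (derivable1_diffP _ _) h). Qed.

Lemma MVT_R (f df : R -> R) a b : a < b ->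
  (forall t, a <= t <= b -> is_derive t (1 : R) f (df t)) ->
  exists2 c, a < c < b & f b - f a = df c * (b - a).
Proof.
move=> ab h; have [t /itvP tab||c cab hc] := @MVT R f df a b ab.
- by apply: h; rewrite !tab.
- apply: continuous_in_subspaceT => t; rewrite inE /= => /itvP tab.
  have [//] : cont_at f t by apply: (is_derive_cont_at (h t _)); rewrite !tab.
- by exists c => //; rewrite !(itvP cab).
Qed.

(** The mean value theorem fails for complex values; it is applied to Re (conj D * f), the component
    of [f] along its increment [D]. *)
Lemma hasdr_le f (v : R -> C) a b (M : R) : a <= b ->
  (forall t, a <= t <= b -> hasdr f t (v t)) ->
  (forall t, a <= t <= b -> cabs (v t) <= M) ->
  cabs (f b - f a) <= M * (b - a).
Proof.
rewrite le_eqVlt => /orP[/eqP -> _ _|ab hf hv].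
  by rewrite !subrr cabs0 mulr0.
set D := f b - f a.
have [D0|D0] := eqVneq D 0.
  rewrite D0 cabs0 mulr_ge0 ?subr_ge0 ?(ltW ab) //.
  by apply: le_trans (cabs_ge0 _) (hv a _); rewrite lexx ltW.
pose g t := complex.Re (D^* * f t).
have [c cab hc] : exists2 c, a < c < b & g b - g a = complex.Re (D^* * v c) * (b - a).
  apply: MVT_R => // t tab; apply: (hasdr_Re (f := fun t => D^* * f t)).
  by apply: cderZ; [exact: rC_cont|exact: hf].
have eD : g b - g a = cabs D ^+ 2.
  rewrite /g -ReN -ReD -mulrBr -/D mulrC mulCJ Re_rC //.
have Dp : 0 < cabs D by rewrite cabs_gt0.
rewrite -(ler_pM2l Dp) -expr2 -eD hc mulrA ler_wpM2r ?subr_ge0 ?(ltW ab) //.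
apply: (le_trans (ler_norm _)); apply: (le_trans (Re_le_cabs _)).
rewrite cabsM cabs_conj ler_wpM2l ?cabs_ge0 // hv //.
by case/andP: cab => *; rewrite !ltW.
Qed.

Lemma hasdr0_cst f a b : a <= b -> (forall t, a <= t <= b -> hasdr f t 0) -> f b = f a.
Proof.
move=> ab h; apply/eqP; rewrite -subr_eq0 -cabs_eq0 eq_le cabs_ge0 andbT.
apply: le_trans (hasdr_le (M := 0) ab h _) _; first by move=> *; rewrite cabs0.
by rewrite mul0r.
Qed.

Lemma primitive_R_pos (f : R -> R) (a : R) : (forall t, cont_at f t) ->
  exists F : R -> R, forall t, a < t -> is_derive t (1 : R) F (f t).
Proof.
move=> cf; have hc : continuous f by move=> t; have [] := cf t.
exists (fun x => \int[lebesgue_measure]_(t in [set` `[a, x]]) f t) => t at_.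
have t1 : t < t + 1 by lra.
have hi : lebesgue_measure.-integrable [set` `[a, t + 1]] (EFin \o f).
  by apply: continuous_compact_integrable; [exact: segment_compact | exact: continuous_subspaceT].
have ha : (BLeft a < BRight t)%O by rewrite bnd_simp ltW.
have [h1 h2] := continuous_FTC1 t1 hi at_ (hc t).
by split; [exact: h1 | rewrite -derive1E; exact: h2].
Qed.

(** The integral from -1 is a primitive on t > -1 only. The other half line is obtained by
    reflection, and on the overlap []-1, 1[] the two primitives differ by a constant, which leaves
    room to glue them at 0. *)
Lemma primitive_R (f : R -> R) : (forall t, cont_at f t) ->
  exists F : R -> R, forall t, is_derive t (1 : R) F (f t).
Proof.
move=> cf.
have [F hF] := primitive_R_pos (-1) cf.
have cf' t : cont_at (fun s => f (- s)) t.
  apply: cont_comp => //; split; exact: (@continuousN R R^o R (fun x => x) t).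
have [G hG] := primitive_R_pos (-1) cf'.
pose H t := if 0 <= t then F t else F 0 + G 0 - G (- t).
have hG' t : t < 1 -> is_derive t (1 : R) (fun s => F 0 + G 0 - G (- s)) (f t).
  move=> t1; have := hG (- t); rewrite opprK => /(_ _) h.
  have {}h : is_derive (- t) (1 : R) G (f t) by apply: h; lra.
  have h2 : is_derive t (1 : R) (fun s => G (- s)) (- f t).
    have := @is_derive1_comp R G (fun s => - s) t (f t) (-1) h _.
    by rewrite mulrN1; apply.
  have := is_deriveB (is_derive_cst (F 0 + G 0) t (1 : R)) h2.
  by rewrite sub0r opprK.
have agree t : -1 < t < 1 -> F t = F 0 + G 0 - G (- t).
  move=> t1; pose K s := rC (F s - (F 0 + G 0 - G (- s))) : C.
  have hK s : -1 < s < 1 -> hasdr K s 0.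
    move=> /andP[s1 s2]; rewrite -rC0 -(subrr (f s)); apply: derive_hasdr.
    exact: is_deriveB (hF s s1) (hG' s s2).
  have K0 : K 0 = 0 by rewrite /K oppr0; congr rC; lra.
  have Kt : K t = 0.
    rewrite -K0; case: (leP 0 t) => t0.
      by apply: hasdr0_cst => // s hs; apply: hK; lra.
    by apply/esym/hasdr0_cst; [lra|move=> s hs; apply: hK; lra].
  by move: Kt; rewrite /K -rC0 => /rC_inj; lra.
exists H => t; case: (ltP t (1/2)) => t0.
- apply: near_eq_is_derive (hG' t _); last lra.
  apply/near_R; exists (1/2); first lra.
  move=> s; rewrite ltr_norml => hs; rewrite /H; case: ifP => // s0.
  by rewrite (agree s) //; lra.
- apply: near_eq_is_derive (hF t _); last lra.
  apply/near_R; exists (1/2); first lra.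
  by move=> s; rewrite ltr_norml => hs; rewrite /H; case: ifP => // /negbT; lra.
Qed.

Lemma primitive_exists g : (forall t, cont_at g t) -> exists P, forall t, hasdr P t (g t).
Proof.
move=> cg.
have [F hF] := primitive_R (fun t => cont_Re (cg t)).
have [G hG] := primitive_R (fun t => cont_Im (cg t)).
exists (fun t => rC (F t) + 'i * rC (G t)) => t; rewrite [g t]ReIm.
exact: hasdr_ReIm.
Qed.

(** A curve integral is the increment of a chosen primitive, so that its rules reduce to the
    uniqueness of primitives up to a constant and its limits may come in either order. *)
Definition cprim g : R -> C :=
  if pselect (exists P, forall t, hasdr P t (g t)) is left h then projT1 (cid h) else fun=> 0.

Lemma cprimP g : (forall t, cont_at g t) -> forall t, hasdr (cprim g) t (g t).
Proof.
move=> cg; rewrite /cprim; case: pselect => [h|h]; first by case: cid.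
by case: h; exact: primitive_exists.
Qed.

Definition cint g a b : C := cprim g b - cprim g a.

Lemma cintE g P a b : a <= b -> (forall t, cont_at g t) ->
  (forall t, a <= t <= b -> hasdr P t (g t)) -> cint g a b = P b - P a.
Proof.
move=> ab cg hP; rewrite /cint; apply/eqP; rewrite -subr_eq0; apply/eqP.
have -> : cprim g b - cprim g a - (P b - P a) = (cprim g b - P b) - (cprim g a - P a) by ring.
apply/eqP; rewrite subr_eq0; apply/eqP.
apply: (hasdr0_cst (f := fun t => cprim g t - P t)) => // t tab.
by rewrite -(subrr (g t)); apply: cderB; [exact: cprimP|exact: hP].
Qed.

Lemma cint_le g a b M : a <= b -> (forall t, cont_at g t) ->
  (forall t, a <= t <= b -> cabs (g t) <= M) -> cabs (cint g a b) <= M * (b - a).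
Proof.
move=> ab cg hM; apply: (hasdr_le ab _ hM) => t _; exact: cprimP.
Qed.

Lemma cintD g1 g2 a b : (forall t, cont_at g1 t) -> (forall t, cont_at g2 t) -> a <= b ->
  cint (fun t => g1 t + g2 t) a b = cint g1 a b + cint g2 a b.
Proof.
move=> c1 c2 ab; rewrite (cintE (P := fun t => cprim g1 t + cprim g2 t)) //.
- by rewrite /cint; ring.
- by move=> t; exact: contD.
- by move=> t _; apply: cderD; exact: cprimP.
Qed.

Lemma cintZ c g a b : (forall t, cont_at g t) -> a <= b ->
  cint (fun t => c * g t) a b = c * cint g a b.
Proof.
move=> c1 ab; rewrite (cintE (P := fun t => c * cprim g t)) //.
- by rewrite /cint; ring.
- by move=> t; apply: contM => //; exact: cont_cst.
- by move=> t _; apply: cderZ; [exact: rC_cont | exact: cprimP].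
Qed.

Lemma cint_cst c a b : a <= b -> cint (fun=> c) a b = c * rC (b - a).
Proof.
move=> ab; rewrite (cintE (P := fun t => c * rC t)) //.
- by rewrite rCB; ring.
- by move=> t; exact: cont_cst.
- by move=> t _; apply: cder_eq (cderZ rC_cont _ (cder_iota _ _)) _; rewrite mulr1.
Qed.

Lemma cint_cat g a b c : cint g a b + cint g b c = cint g a c.
Proof. by rewrite /cint; ring. Qed.

Lemma cint_eq g1 g2 a b : a <= b -> (forall t, cont_at g1 t) -> (forall t, cont_at g2 t) ->
  (forall t, a <= t <= b -> g1 t = g2 t) -> cint g1 a b = cint g2 a b.
Proof.
move=> ab c1 c2 h; apply: cintE => // t tab; rewrite h //; exact: cprimP.
Qed.

End CurveIntegral.

Section Goursat.
Context {R : realType}.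
Local Notation C := (Cplx R).

Definition mkc (x y : R) : C := (x +i* y)%C.

Lemma mkcE x y : mkc x y = rC x + 'i * rC y.
Proof. by rewrite [LHS]ReIm. Qed.

Lemma mkc_ReIm (z : C) : mkc (complex.Re z) (complex.Im z) = z.
Proof. by case: z. Qed.

Lemma cont_mkc {T : topologicalType} (f g : T -> R) (t : T) :
  cont_at f t -> cont_at g t -> cont_at (fun s => mkc (f s) (g s)) t.
Proof.
move=> cf cg; rewrite (_ : (fun s => _) = fun s => rC (f s) + 'i * rC (g s)).
  by apply: contD; [exact: cont_rC | apply: contM; [exact: cont_cst | exact: cont_rC]].
by apply/funext => s; exact: mkcE.
Qed.

Definition hI (f : C -> C) y a b := cint (fun t => f (mkc t y)) a b.
Definition vI (f : C -> C) x a b := 'i * cint (fun s => f (mkc x s)) a b.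
(** Integral along the boundary of [a, b] x [c, d], counterclockwise; the factor 'i in [vI] is the
    velocity on the vertical sides. *)
Definition rectI f a b c d : C := hI f c a b + vI f b c d - hI f d a b - vI f a c d.

Lemma rectI_splith f a m b c d : rectI f a m c d + rectI f m b c d = rectI f a b c d.
Proof. by rewrite /rectI /hI -!(cint_cat _ a m b); ring. Qed.

Lemma rectI_splitv f a b c m d : rectI f a b c m + rectI f a b m d = rectI f a b c d.
Proof. by rewrite /rectI /vI -!(cint_cat _ c m d); ring. Qed.

Section Cont.
Variable f : C -> C.
Hypothesis cf : forall z, cont_at f z.

Lemma cont_hslice y t : cont_at (fun t => f (mkc t y)) t.
Proof. by apply: cont_comp => //; apply: cont_mkc; [exact: cont_id | exact: cont_cst]. Qed.

Lemma cont_vslice x s : cont_at (fun s => f (mkc x s)) s.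
Proof. by apply: cont_comp => //; apply: cont_mkc; [exact: cont_cst | exact: cont_id]. Qed.
End Cont.

Lemma rectI_le f a b c d M : (forall z, cont_at f z) -> a <= b -> c <= d ->
  (forall x y, a <= x <= b -> c <= y <= d -> cabs (f (mkc x y)) <= M) ->
  cabs (rectI f a b c d) <= 2 * M * ((b - a) + (d - c)).
Proof.
move=> cf ab cd hM.
have h1 y : c <= y <= d -> cabs (hI f y a b) <= M * (b - a).
  by move=> hy; apply: cint_le => // [t|t tab]; [exact: cont_hslice | exact: hM].
have h2 x : a <= x <= b -> cabs (vI f x c d) <= M * (d - c).
  move=> hx; rewrite cabsM cabsi mul1r.
  by apply: cint_le => // [t|t tab]; [exact: cont_vslice | exact: hM].
have {}h1c := h1 c; have {}h1d := h1 d; have {}h2a := h2 a; have {}h2b := h2 b.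
rewrite /rectI.
have := cabsD (hI f c a b + vI f b c d - hI f d a b) (- vI f a c d).
have := cabsD (hI f c a b + vI f b c d) (- hI f d a b).
have := cabsD (hI f c a b) (vI f b c d).
rewrite !cabsN.
move: h1c h1d h2a h2b; rewrite !lexx ab cd => /(_ isT) ? /(_ isT) ? /(_ isT) ? /(_ isT) ?.
lra.
Qed.

Lemma rectI_lin (f g : C -> C) (k : C) (a b c d : R) : (forall z, cont_at f z) -> (forall z, cont_at g z) ->
  a <= b -> c <= d ->
  rectI (fun z => f z + k * g z) a b c d = rectI f a b c d + k * rectI g a b c d.
Proof.
move=> cf cg ab cd; rewrite /rectI /hI /vI.
have hh y : cint (fun t => f (mkc t y) + k * g (mkc t y)) a b =
    cint (fun t => f (mkc t y)) a b + k * cint (fun t => g (mkc t y)) a b.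
  rewrite cintD ?cintZ //; try (by move=> ?; exact: cont_hslice).
  by move=> ?; apply: contM; [exact: cont_cst | exact: cont_hslice].
have hv x : cint (fun t => f (mkc x t) + k * g (mkc x t)) c d =
    cint (fun t => f (mkc x t)) c d + k * cint (fun t => g (mkc x t)) c d.
  rewrite cintD ?cintZ //; try (by move=> ?; exact: cont_vslice).
  by move=> ?; apply: contM; [exact: cont_cst | exact: cont_vslice].
by rewrite !hh !hv; ring.
Qed.

Lemma hasdr_mkch (y t : R) : hasdr (fun t => mkc t y) t 1.
Proof.
rewrite (_ : (fun t => _) = fun t => rC t + 'i * rC y); last by apply/funext => s; exact: mkcE.
by apply: cder_eq (cderD (cder_iota _ _) (cder_cst _ _ _)) _; rewrite addr0.
Qed.

Lemma hasdr_mkcv (x t : R) : hasdr (fun t => mkc x t) t 'i.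
Proof.
rewrite (_ : (fun t => _) = fun t => rC x + 'i * rC t); last by apply/funext => s; exact: mkcE.
apply: cder_eq (cderD (cder_cst _ _ _) (cderZ rC_cont _ (cder_iota _ _))) _.
by rewrite add0r mulr1.
Qed.

Lemma rectI_primitive (f P : C -> C) a b c d : (forall z, cont_at f z) ->
  (forall z, hasd P z (f z)) -> a <= b -> c <= d -> rectI f a b c d = 0.
Proof.
move=> cf hP ab cd; rewrite /rectI.
have hh y : hI f y a b = P (mkc b y) - P (mkc a y).
  rewrite /hI; apply: (cintE (P := fun t => P (mkc t y))) => // [t|t _]; first exact: cont_hslice.
  have := hasdr_comp (f := fun t => mkc t y) (hP (mkc t y)) (hasdr_mkch y t).
  by rewrite mulr1.
have hv x : vI f x c d = P (mkc x d) - P (mkc x c).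
  rewrite /vI -cintZ //; last by move=> t; exact: cont_vslice.
  apply: (cintE (P := fun t => P (mkc x t))) => // [t|t _].
    by apply: contM; [exact: cont_cst | exact: cont_vslice].
  have := hasdr_comp (f := fun t => mkc x t) (hP (mkc x t)) (hasdr_mkcv x t).
  by rewrite mulrC.
by rewrite !hh !hv; ring.
Qed.

Lemma rectI_affine al be a b c d : a <= b -> c <= d ->
  rectI (fun z => al + be * z) a b c d = 0.
Proof.
move=> ab cd; apply: (rectI_primitive (P := fun z => al * z + be / 2 * (z * z))) => //.
- move=> z; apply: contD; first exact: cont_cst.
  by apply: contM; [exact: cont_cst | exact: cont_id].
- move=> z.
  have h := cderM (@id_C_cont R) (cder_iota id z) (cder_iota id z).
  have h2 := cderD (cderZ (@id_C_cont R) al (cder_iota id z)) (cderZ (@id_C_cont R) (be / 2) h).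
  by apply: cder_eq h2 _; field.
Qed.

(* Successive bisection: a rectangle whose boundary integral is large contains
   a quarter with the same defect. *)
Section Bisection.
Variables (f : C -> C) (w h e : R).
Hypotheses (w0 : 0 <= w) (h0 : 0 <= h).

Let sq (p : R * R) n := rectI f p.1 (p.1 + w / 2 ^+ n) p.2 (p.2 + h / 2 ^+ n).
Let bad (p : R * R) n := e / 4 ^+ n < cabs (sq p n).

Lemma bad_step p n : bad p n -> exists p', [/\ bad p' n.+1,
  (p.1 <= p'.1) /\ p'.1 + w / 2 ^+ n.+1 <= p.1 + w / 2 ^+ n &
  (p.2 <= p'.2) /\ p'.2 + h / 2 ^+ n.+1 <= p.2 + h / 2 ^+ n].
Proof.
rewrite /bad /sq; case: p => x y /= hb.
set w' := w / 2 ^+ n.+1; set h' := h / 2 ^+ n.+1.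
have p2 : (2 : R) ^+ n != 0 by rewrite expf_neq0.
have ew : w / 2 ^+ n = w' + w' by rewrite /w' exprS; field.
have eh : h / 2 ^+ n = h' + h' by rewrite /h' exprS; field.
have w'0 : 0 <= w' by rewrite divr_ge0 // exprn_ge0.
have h'0 : 0 <= h' by rewrite divr_ge0 // exprn_ge0.
apply: contrapT => hn.
have small x' y' : (x' = x \/ x' = x + w') -> (y' = y \/ y' = y + h') ->
   cabs (rectI f x' (x' + w') y' (y' + h')) <= e / 4 ^+ n.+1.
  move=> hx hy; rewrite leNgt; apply/negP => hb'; apply: hn; exists (x', y') => /=.
  by split => //; [case: hx => ->|case: hy => ->]; rewrite ?ew ?eh; split; lra.
have e1 := small x y (or_introl erefl) (or_introl erefl).
have e2 := small _ y (or_intror erefl) (or_introl erefl).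
have e3 := small x _ (or_introl erefl) (or_intror erefl).
have e4 := small _ _ (or_intror erefl) (or_intror erefl).
move: hb; rewrite ew eh !addrA.
rewrite -(rectI_splith f x (x + w')) -(rectI_splitv f x (x + w') y (y + h')).
rewrite -(rectI_splitv f (x + w') (x + w' + w') y (y + h')).
set A := rectI f x _ y _ in e1 *; set B := rectI f x _ (y + h') _ in e3 *.
set D := rectI f (x + w') _ y _ in e2 *; set E := rectI f (x + w') _ (y + h') _ in e4 *.
have := cabsD (A + B) (D + E); have := cabsD A B; have := cabsD D E.
have -> : e / 4 ^+ n = 4 * (e / 4 ^+ n.+1).
  by rewrite exprS; field; rewrite expf_neq0.
lra.
Qed.

Variable p0 : R * R.
Hypothesis bad0 : bad p0 0.

Let good_pt := {pn : (R * R) * nat | bad pn.1 pn.2}.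
Let nxt (u : good_pt) : good_pt :=
  exist _ (projT1 (cid (bad_step (svalP u))), (sval u).2.+1)
    (let: And3 b _ _ := projT2 (cid (bad_step (svalP u))) in b).
Let u n : good_pt := iter n nxt (exist _ (p0, 0%N) bad0).

Lemma bisection_limit : exists px py : R, forall n, exists x y, [/\
  x <= px <= x + w / 2 ^+ n, y <= py <= y + h / 2 ^+ n,
  (p0.1 <= x) /\ x + w / 2 ^+ n <= p0.1 + w, (p0.2 <= y) /\ y + h / 2 ^+ n <= p0.2 + h
  & e / 4 ^+ n < cabs (rectI f x (x + w / 2 ^+ n) y (y + h / 2 ^+ n))].
Proof.
have u2 n : (sval (u n)).2 = n by elim: n => //= n ->.
pose X n := (sval (u n)).1.1; pose Y n := (sval (u n)).1.2.
have st n : [/\ bad (X n, Y n) n, (X n <= X n.+1) /\ X n.+1 + w / 2 ^+ n.+1 <= X n + w / 2 ^+ n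
   & (Y n <= Y n.+1) /\ Y n.+1 + h / 2 ^+ n.+1 <= Y n + h / 2 ^+ n].
  rewrite /X /Y /=; case: (cid _) => p' /= [_ h1 h2]; rewrite !u2 in h1 h2.
  split => //; have := svalP (u n); rewrite /= u2; by case: (sval (u n)).1.
have nest (Z : nat -> R) l : 0 <= l ->
    (forall n, Z n <= Z n.+1 /\ Z n.+1 + l / 2 ^+ n.+1 <= Z n + l / 2 ^+ n) ->
    exists2 p, forall n, Z n <= p <= Z n + l / 2 ^+ n &
       forall n, Z 0%N <= Z n /\ Z n + l / 2 ^+ n <= Z 0%N + l.
  move=> l0 hZ.
  have mono n m : (n <= m)%N -> Z n <= Z m /\ Z m + l / 2 ^+ m <= Z n + l / 2 ^+ n.
    elim: m => [|m IH]; first by rewrite leqn0 => /eqP ->.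
    rewrite leq_eqVlt => /orP[/eqP -> //|]; rewrite ltnS => /IH.
    by have := hZ m; lra.
  have pos n : 0 <= l / 2 ^+ n by rewrite divr_ge0 // exprn_ge0.
  have cross n m : Z n <= Z m + l / 2 ^+ m.
    have := mono n (maxn n m) (leq_maxl _ _); have := mono m (maxn n m) (leq_maxr _ _).
    by have := pos (maxn n m); lra.
  have hs : has_sup [set Z n | n in setT].
    split; first by exists (Z 0%N), 0%N.
    by exists (Z 0%N + l / 2 ^+ 0) => _ [n _ <-]; exact: cross.
  exists (sup [set Z n | n in setT]).
    move=> n; apply/andP; split; first by apply: ub_le_sup; [case: hs|exists n].
    by apply: ge_sup; [case: hs|move=> _ [m _ <-]; exact: cross].
  by move=> n; have := mono 0%N n (leq0n n); rewrite expr0 divr1.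
have [px hx hx0] := nest X w w0 (fun n => let: And3 _ a _ := st n in a).
have [py hy hy0] := nest Y h h0 (fun n => let: And3 _ _ a := st n in a).
exists px, py => n; exists (X n), (Y n); split => //.
by have [] := st n.
Qed.

End Bisection.

Lemma exp2_small (l d : R) : 0 <= l -> 0 < d -> exists n, l / 2 ^+ n < d.
Proof.
move=> l0 d0; exists (Num.truncn (l / d)).+1.
set n := Num.truncn (l / d).
have h1 : l / d < n.+1%:R by exact: truncnS_gt.
have h2 : (n.+1%:R : R) <= 2 ^+ n.+1.
  by rewrite -natrX ler_nat ltnW // ltn_expl.
rewrite ltr_pdivrMr ?exprn_gt0 // mulrC -ltr_pdivrMr //.
exact: lt_le_trans h1 h2.
Qed.

Lemma Goursat (f : C -> C) a b c d : (forall z, cont_at f z) -> a <= b -> c <= d ->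
  (forall x y, a <= x <= b -> c <= y <= d -> exists k, hasd f (mkc x y) k) ->
  rectI f a b c d = 0.
Proof.
move=> cf ab cd hd; apply/eqP; rewrite -cabs_eq0 eq_le cabs_ge0 andbT leNgt; apply/negP => h0.
(* Halving provides the strict inequality with which the bisection starts. *)
set e := cabs (rectI f a b c d) / 2; have e0 : 0 < e by rewrite /e; lra.
pose w := b - a; pose h := d - c.
have w0 : 0 <= w by rewrite subr_ge0.
have hh0 : 0 <= h by rewrite subr_ge0.
have bad0 : e / 4 ^+ 0 < cabs (rectI f (a, c).1 ((a, c).1 + w / 2 ^+ 0) (a, c).2 ((a, c).2 + h / 2 ^+ 0)).
  by rewrite !expr0 !divr1 /= /w /h !(addrC _ (_ - _)) !subrK /e; lra.
have [px [py hp]] := bisection_limit w0 hh0 bad0.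
have [k hk] : exists k, hasd f (mkc px py) k.
  have [x [y [hx hy [hx1 hx2] [hy1 hy2] _]]] := hp 0%N; apply: hd.
  - by move: hx hx1 hx2; rewrite expr0 divr1 /= /w; lra.
  - by move: hy hy1 hy2; rewrite expr0 divr1 /= /h; lra.
set p := mkc px py in hk.
(* Without its affine part at [p], whose boundary integral vanishes, [f] is at most e' l on the n-th
   rectangle, of half perimeter l = (w + h) / 2^n. Its integral is then at most 2 e' l^2, and this
   [e'] makes it at most e / 4^n; the term 1 covers w = h = 0. *)
set e' := e / (4 * (w + h) ^+ 2 + 1).
have den : 0 < 4 * (w + h) ^+ 2 + 1 by rewrite ltr_wpDl // mulr_ge0 // sqr_ge0.
have e'0 : 0 < e' by rewrite divr_gt0.
have /near_C [r r0 hr] := cder_bound hk e'0.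
have [n hn] := exp2_small (addr_ge0 w0 hh0) r0.
have [x [y [hx hy _ _ hb]]] := hp n.
move: hb; apply/negP; rewrite -leNgt.
pose g z := f z + (-1) * ((f p - k * p) + k * z).
have caff z : cont_at (fun z => (f p - k * p) + k * z) z.
  by apply: contD; [exact: cont_cst | apply: contM; [exact: cont_cst | exact: cont_id]].
have P2 : 0 < (2 : R) ^+ n by rewrite exprn_gt0.
have wn0 : 0 <= w / 2 ^+ n by rewrite divr_ge0 // ltW.
have hn0 : 0 <= h / 2 ^+ n by rewrite divr_ge0 // ltW.
have xx : x <= x + w / 2 ^+ n by lra.
have yy : y <= y + h / 2 ^+ n by lra.
have -> : rectI f x (x + w / 2 ^+ n) y (y + h / 2 ^+ n) =
          rectI g x (x + w / 2 ^+ n) y (y + h / 2 ^+ n).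
  by rewrite rectI_lin // rectI_affine // mulr0 addr0.
have cg z : cont_at g z.
  by apply: contD => //; apply: contM; [exact: cont_cst | exact: caff].
pose l := (w + h) / 2 ^+ n.
have el : l = w / 2 ^+ n + h / 2 ^+ n by rewrite /l mulrDl.
apply: (le_trans (rectI_le (M := e' * l) cg xx yy _)).
  move=> x' y' hx' hy'.
  have hl : cabs (mkc x' y' - p) <= l.
    apply: (le_trans (cabs_le_ReIm _)); rewrite ReD ReN ImD ImN /= el lerD //.
      by rewrite ler_norml; lra.
    by rewrite ler_norml; lra.
  have -> : g (mkc x' y') = f (mkc x' y') - f p - (id (mkc x' y') - id p) * k by rewrite /g /=; ring.
  apply: (le_trans (hr _ _)); first by apply: le_lt_trans hl _.
  by rewrite ler_wpM2l // ltW.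
rewrite (_ : x + _ - x + _ = l); last by rewrite el; ring.
have -> : 2 * (e' * l) * l = e' * (2 * (w + h) ^+ 2) / 4 ^+ n.
  rewrite /l (_ : (4 : R) = 2 * 2); last by rewrite -natrM.
  by rewrite exprMn; field; rewrite gt_eqF.
rewrite ler_pM2r ?invr_gt0 ?exprn_gt0 //.
rewrite /e' mulrAC ler_pdivrMr // ler_wpM2l ?(ltW e0) //.
by have := sqr_ge0 (w + h); lra.
Qed.

End Goursat.

(** * Primitives and Morera's theorem *)

Section Primitive.
Context {R : realType}.
Local Notation C := (Cplx R).
Implicit Types (f : C -> C) (a b c d e x y t : R).

Lemma cint_abs g a b : cint g a b = - cint g b a :> C.
Proof. by rewrite /cint opprB. Qed.

(** Uniformity in [x] comes from the compactness of [a, b]. *)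
Lemma hI_uniform f a b c e : (forall z, cont_at f z) -> 0 < e ->
  \forall y \near c, forall x, a <= x <= b -> cabs (f (mkc x y) - f (mkc x c)) < e.
Proof.
move=> cf e0.
have : near_covering `[a, b] by apply/compact_near_coveringP; exact: segment_compact.
move=> /(_ R (nbhs c) (fun y x => cabs (f (mkc x y) - f (mkc x c)) < e) _).
have H : forall x, `[a, b]%classic x ->
    \forall x' \near x & y \near c, cabs (f (mkc x' y) - f (mkc x' c)) < e.
  move=> x _; have e2 : 0 < e / 2 by lra.
  have /cont_eps/(_ _ e2)/near_C[r r0 hr] := cf (mkc x c).
  exists ([set x' | `|x' - x| < r / 2], [set y | `|y - c| < r / 2]) => /=.
    by split; apply/near_R; exists (r / 2) => //; lra.
  move=> [x' y] /= [hx hy].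
  have h1 : cabs (mkc x' y - mkc x c) < r.
    apply: (le_lt_trans (cabs_le_ReIm _)); rewrite ReD ReN ImD ImN /=; lra.
  have h2 : cabs (mkc x' c - mkc x c) < r.
    apply: (le_lt_trans (cabs_le_ReIm _)); rewrite ReD ReN ImD ImN /= subrr normr0; lra.
  have := hr _ h1; have := hr _ h2; rewrite (cabsC (f (mkc x' c))) => h3 h4.
  have := cabsD (f (mkc x' y) - f (mkc x c)) (f (mkc x c) - f (mkc x' c)).
  by rewrite addrA subrK; lra.
move=> /(_ H); apply: filterS => y hy x hx; apply: hy; rewrite /= in_itv /=; exact: hx.
Qed.

Lemma hI_cont f a b c e : (forall z, cont_at f z) -> a <= b -> 0 < e ->
  \forall y \near c, cabs (hI f y a b - hI f c a b) <= e * (b - a).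
Proof.
move=> cf ab e0; apply: filterS (hI_uniform a b c cf e0) => y hy.
rewrite /hI -[- cint _ _ _]mulN1r -cintZ // -?cintD //; first last.
- by move=> t; exact: cont_hslice.
- by move=> t; apply: contM; [exact: cont_cst | exact: cont_hslice].
- by move=> t; exact: cont_hslice.
apply: cint_le => // [t|t tab].
  by apply: contD; [exact: cont_hslice | apply: contM; [exact: cont_cst | exact: cont_hslice]].
by rewrite mulN1r ltW // hy.
Qed.

Lemma vI_small f x c e : (forall z, cont_at f z) -> 0 < e ->
  \forall y \near c, cabs (vI f x c y) <= e.
Proof.
move=> cf e0.
have h : cont_at (cprim (fun s => f (mkc x s))) c.
  by apply: hasdr_cont; apply: cprimP => s; exact: cont_vslice.
move: h => /cont_eps /(_ _ e0); apply: filterS => y hy.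
by rewrite /vI cabsM cabsi mul1r /cint ltW.
Qed.

Lemma rectI_cont f a b c e : (forall z, cont_at f z) -> a <= b -> 0 < e ->
  \forall y \near c, cabs (rectI f a b c y) <= e * (b - a + 2).
Proof.
move=> cf ab e0.
near=> y.
have h1 : cabs (hI f y a b - hI f c a b) <= e * (b - a) by near: y; exact: hI_cont.
have h2 : cabs (vI f a c y) <= e by near: y; exact: vI_small.
have h3 : cabs (vI f b c y) <= e by near: y; exact: vI_small.
rewrite /rectI.
have -> : hI f c a b + vI f b c y - hI f y a b - vI f a c y =
  (vI f b c y - vI f a c y) - (hI f y a b - hI f c a b) by ring.
have := cabsD (vI f b c y - vI f a c y) (- (hI f y a b - hI f c a b)).
have := cabsD (vI f b c y) (- vI f a c y).
by rewrite !cabsN; lra.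
Unshelve. all: by end_near. Qed.

Lemma rectI_swapv f a b c d : rectI f a b c d = - rectI f a b d c.
Proof. by rewrite /rectI /vI (cint_abs _ c d) (cint_abs (fun s => f (mkc a s)) c d); ring. Qed.

Lemma rectI_swaph f a b c d : rectI f a b c d = - rectI f b a c d.
Proof. by rewrite /rectI /hI (cint_abs _ a b) (cint_abs (fun s => f (mkc s d)) a b); ring. Qed.

Lemma cabs_small_eq0 (z : C) (k : R) : (forall e, 0 < e -> cabs z <= e * k) -> z = 0.
Proof.
move=> h; apply/eqP; rewrite -cabs_eq0 eq_le cabs_ge0 andbT leNgt; apply/negP => z0.
have k0 : 0 < k by have := h 1 ltr01; lra.
have e0 : 0 < cabs z / (2 * k) by rewrite divr_gt0 // mulr_gt0.
have := h _ e0; rewrite (_ : cabs z / (2 * k) * k = cabs z / 2); first lra.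
by field; rewrite gt_eqF.
Qed.

(* A segment on which f is merely continuous does not contribute, by
   approximating it with nearby parallel segments. *)
Lemma Goursat_line f a b c d y0 : (forall z, cont_at f z) -> a <= b -> c <= d ->
  (forall x y, a <= x <= b -> c <= y <= d -> y <> y0 -> exists k, hasd f (mkc x y) k) ->
  rectI f a b c d = 0.
Proof.
move=> cf ab cd hd.
have edge y1 : c <= y0 <= d -> c <= y1 <= d -> y1 <> y0 -> rectI f a b y0 y1 = 0.
  move=> hy0 hy1 ne; apply: (@cabs_small_eq0 _ (b - a + 2)) => e e0.
  have /near_R[r r0 hr] := rectI_cont y0 cf ab e0.
  (* The ordinate m = y0 + s (y1 - y0) lies between y0 and y1, so close to y0 that the thin
     rectangle is negligible; the other rectangle does not touch the line, and Goursat's theorem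
     applies to it. *)
  pose s := Num.min (1 / 2) (r / (2 * `|y1 - y0|)).
  have D0 : 0 < `|y1 - y0| by rewrite normr_gt0 subr_eq0; apply/eqP.
  have s0 : 0 < s.
    rewrite /s lt_min; apply/andP; split; first lra.
    by rewrite divr_gt0 // mulr_gt0.
  have s1 : s <= 1 / 2 by rewrite /s ge_min lexx.
  have s2 : s * `|y1 - y0| < r.
    apply: (@le_lt_trans _ _ (r / (2 * `|y1 - y0|) * `|y1 - y0|)).
      by rewrite ler_wpM2r // /s ge_min lexx orbT.
    rewrite (_ : _ * _ = r / 2); first lra.
    by field; rewrite gt_eqF.
  set m := y0 + s * (y1 - y0).
  have -> : rectI f a b y0 y1 = rectI f a b y0 m + rectI f a b m y1 by rewrite rectI_splitv.
  have -> : rectI f a b m y1 = 0.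
    case: (ltP y0 y1) => y01.
      have h1 : 0 < s * (y1 - y0) by rewrite mulr_gt0 // subr_gt0.
      have h2 : s * (y1 - y0) <= 1 / 2 * (y1 - y0) by rewrite ler_wpM2r // subr_ge0 ltW.
      apply: Goursat => //; first by rewrite /m; lra.
      move=> x y hx hy; apply: hd => //; first by rewrite /m in hy; lra.
      by move=> yy; rewrite /m in hy; lra.
    have {}y01 : y1 < y0 by rewrite lt_neqAle y01 andbT; apply/eqP.
    have h1 : 0 < s * (y0 - y1) by rewrite mulr_gt0 // subr_gt0.
    have h2 : s * (y0 - y1) <= 1 / 2 * (y0 - y1) by rewrite ler_wpM2r // subr_ge0 ltW.
    have em : m = y0 - s * (y0 - y1) by rewrite /m; ring.
    rewrite rectI_swapv Goursat ?oppr0 //; first by rewrite em; lra.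
    move=> x y hx hy; apply: hd => //; first by rewrite em in hy; lra.
    by move=> yy; rewrite em in hy; lra.
  rewrite addr0; apply: hr.
  by rewrite /m addrAC subrr add0r normrM (ger0_norm (ltW s0)).
have [hy0|hy0] := boolP (c <= y0 <= d); last first.
  apply: Goursat => // x y hx hy; apply: hd => // yy; move: hy0; rewrite -yy; lra.
rewrite -(rectI_splitv f a b c y0 d).
have -> : rectI f a b c y0 = 0.
  have [->|/eqP ne] := eqVneq c y0; last by rewrite rectI_swapv edge ?oppr0 //; lra.
  by rewrite /rectI /vI /cint !subrr mulr0; ring.
rewrite add0r; have [->|/eqP ne] := eqVneq d y0; last by rewrite edge //; lra.
by rewrite /rectI /vI /cint !subrr mulr0; ring.
Qed.

Lemma cint_near (g : R -> C) (k : C) a b e : (forall t, cont_at g t) ->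
  (forall t, Num.min a b <= t <= Num.max a b -> cabs (g t - k) <= e) ->
  cabs (cint g a b - k * rC (b - a)) <= e * `|b - a|.
Proof.
move=> cg; wlog ab : a b / a <= b.
  move=> H he; case: (leP a b) => ab; first exact: H.
  have := H b a (ltW ab); rewrite minC maxC => /(_ he).
  rewrite (cint_abs _ a b) distrC -cabsN !rCB => h; apply: le_trans h.
  by rewrite le_eqVlt; apply/orP; left; apply/eqP; congr cabs; ring.
rewrite (min_idPl ab) (max_idPr ab) => he.
rewrite -cint_cst // -mulN1r -cintZ // -?cintD //; first last.
- by move=> t; exact: cont_cst.
- by move=> t; apply: contM; exact: cont_cst.
rewrite ger0_norm ?subr_ge0 //; apply: cint_le => // [t|t tab].
  by apply: contD => //; apply: contM; exact: cont_cst.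
by rewrite mulN1r he.
Qed.

(** The primitive integrates from the corner (a, c) horizontally, then vertically. Since rectangles
    contribute nothing, its increment near (x, y) is an integral along a short path close to (x, y),
    where f is almost constant. *)
Lemma rect_primitive f a b c d : (forall z, cont_at f z) ->
  (forall x1 x2 y1 y2, a <= x1 -> x1 <= x2 -> x2 <= b -> c <= y1 -> y1 <= y2 -> y2 <= d ->
     rectI f x1 x2 y1 y2 = 0) ->
  exists P, forall x y, a < x < b -> c < y < d -> hasd P (mkc x y) (f (mkc x y)).
Proof.
move=> cf h0.
pose P (z : C) := hI f c a (complex.Re z) + vI f (complex.Re z) c (complex.Im z).
exists P => x y hx hy.
have any x1 x2 y1 y2 : a <= x1 <= b -> a <= x2 <= b -> c <= y1 <= d -> c <= y2 <= d ->
    rectI f x1 x2 y1 y2 = 0.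
  move=> h1 h2 h3 h4; case: (leP x1 x2) => xx; case: (leP y1 y2) => yy.
  - by apply: h0; lra.
  - by rewrite rectI_swapv h0 ?oppr0 //; lra.
  - by rewrite rectI_swaph h0 ?oppr0 //; lra.
  - by rewrite rectI_swapv rectI_swaph h0 ?oppr0 //; lra.
apply: cder_eps => // e e0; have e2 : 0 < e / 2 by lra.
have /cont_eps/(_ _ e2)/near_C[r r0 hr] := cf (mkc x y).
apply/near_C.
pose r' := Num.min (r / 2) (Num.min (Num.min (x - a) (b - x)) (Num.min (y - c) (d - y))).
have hr' : [/\ r' <= r / 2, r' <= x - a, r' <= b - x, r' <= y - c & r' <= d - y].
  by rewrite /r'; split; rewrite !ge_min lexx ?orbT.
have r'0 : 0 < r' by rewrite /r' !lt_min; lra.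
case: hr' => l1 l2 l3 l4 l5.
exists r' => // w hw.
set x' := complex.Re w; set y' := complex.Im w.
have hX : `|x' - x| < r' by have := Re_le_cabs (w - mkc x y); rewrite ReD ReN => h; exact: le_lt_trans h hw.
have hY : `|y' - y| < r' by have := Im_le_cabs (w - mkc x y); rewrite ImD ImN => h; exact: le_lt_trans h hw.
move: (hX) (hY); rewrite !ltr_norml => hX' hY'.
have eP : P w - P (mkc x y) = hI f y x x' + vI f x' y y'.
  have : rectI f x x' c y = 0 by apply: any; lra.
  rewrite /rectI /P /= -/x' -/y' => hz.
  rewrite /hI -(cint_cat _ a x x') -/(hI f c a x) -/(hI f c x x').
  have -> : vI f x' c y' = vI f x' c y + vI f x' y y' by rewrite /vI -(cint_cat _ c y y') mulrDr.
  by apply/eqP; rewrite -subr_eq0; apply/eqP; rewrite -[RHS]hz /hI; ring.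
rewrite eP.
have ew : w - mkc x y = rC (x' - x) + 'i * rC (y' - y).
  by rewrite -[w]mkc_ReIm -/x' -/y' !mkcE !rCB; ring.
rewrite /= ew.
have B1 : cabs (hI f y x x' - f (mkc x y) * rC (x' - x)) <= e / 2 * `|x' - x|.
  apply: cint_near => [t|t ht]; first exact: cont_hslice.
  apply/ltW/hr; apply: (le_lt_trans (cabs_le_ReIm _)); rewrite ReD ReN ImD ImN /= subrr normr0 addr0.
  rewrite ltr_norml; move: ht; case: (leP x x'); lra.
have B2 : cabs (cint (fun s => f (mkc x' s)) y y' - f (mkc x y) * rC (y' - y)) <= e / 2 * `|y' - y|.
  apply: cint_near => [t|t ht]; first exact: cont_vslice.
  apply/ltW/hr; apply: (le_lt_trans (cabs_le_ReIm _)); rewrite ReD ReN ImD ImN /=.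
  have : `|t - y| < r' by rewrite ltr_norml; move: ht; case: (leP y y'); lra.
  lra.
have -> : hI f y x x' + vI f x' y y' - (rC (x' - x) + 'i * rC (y' - y)) * f (mkc x y) =
   (hI f y x x' - f (mkc x y) * rC (x' - x)) +
   'i * (cint (fun s => f (mkc x' s)) y y' - f (mkc x y) * rC (y' - y)).
  by rewrite /vI; ring.
apply: (le_trans (cabsD _ _)); rewrite (cabsM 'i) cabsi mul1r.
have R1 := Re_le_cabs (w - mkc x y); have I1 := Im_le_cabs (w - mkc x y).
rewrite ReD ReN /= -/x' in R1; rewrite ImD ImN /= -/y' in I1; rewrite -ew.
apply: (le_trans (lerD B1 B2)).
have -> : e * cabs (w - mkc x y) = e / 2 * cabs (w - mkc x y) + e / 2 * cabs (w - mkc x y) by field.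
by apply: lerD; apply: ler_wpM2l => //; exact: ltW.
Qed.

(** Composition with clamps replaces a function on a square or an interval by one that is continuous
    everywhere, as [cint] requires of its integrands. *)
Definition clamp (c r t : R) : R := Num.max (c - r) (Num.min t (c + r)).

Lemma clampP c r t : 0 <= r -> [\/ t <= c - r /\ clamp c r t = c - r,
  c - r <= t <= c + r /\ clamp c r t = t | c + r <= t /\ clamp c r t = c + r].
Proof.
move=> r0; rewrite /clamp; case: (leP t (c + r)) => h.
  case: (leP (c - r) t) => h'; first by constructor 2.
  by constructor 1; split => //; lra.
by constructor 3; split; [lra | case: (leP (c - r) (c + r)); lra].
Qed.

Lemma clamp_id c r t : c - r <= t <= c + r -> clamp c r t = t.
Proof. by move=> h; case: (@clampP c r t) => [|[]|[]|[]]; lra. Qed.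

Lemma clamp_in c r t : 0 <= r -> c - r <= clamp c r t <= c + r.
Proof. by move=> h; case: (clampP c t h) => [[]|[]|[]]; lra. Qed.

Lemma cont_clamp c r t : 0 <= r -> cont_at (clamp c r) t.
Proof.
move=> r0; split; apply/cvg_R => e e0; apply/near_R; exists e => // s.
rewrite !ltr_norml; case: (clampP c t r0) => [[? ->]|[? ->]|[? ->]];
  case: (clampP c s r0) => [[? ->]|[? ->]|[? ->]]; lra.
Qed.

Theorem Morera_line f (z0 : C) (r y0 : R) : 0 < r ->
  (forall z, cabs (z - z0) < r -> cont_at f z) ->
  (forall z, cabs (z - z0) < r -> complex.Im z <> y0 -> exists k, hasd f z k) ->
  exists P, forall z, cabs (z - z0) < r / 3 -> hasd P z (f z).
Proof.
move=> r0 cf df.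
set x1 := complex.Re z0; set y1 := complex.Im z0.
(* The half side r / 2 - r / 12 = 5 r / 12 is less than r / 2, so that the square stays in the disk
   of radius r, and more than r / 3, so that it contains the disk of radius r / 3 with a margin. *)
pose cl (z : C) := mkc (clamp x1 (r / 2 - r / 12) (complex.Re z)) (clamp y1 (r / 2 - r / 12) (complex.Im z)).
pose g z := f (cl z).
have near_sq (z : C) : `|complex.Re z - x1| < r / 2 -> `|complex.Im z - y1| < r / 2 -> cabs (z - z0) < r.
  move=> h1 h2; apply: le_lt_trans (cabs_le_ReIm _) _; rewrite ReD ReN ImD ImN; rewrite -/x1 -/y1; lra.
have cg z : cont_at g z.
  apply: cont_comp.
    apply: cont_mkc.
      apply: (cont_comp (g := clamp x1 _)); first exact: cont_Re (cont_id _).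
      by apply: cont_clamp; lra.
    apply: (cont_comp (g := clamp y1 _)); first exact: cont_Im (cont_id _).
    by apply: cont_clamp; lra.
  have hr : 0 <= r / 2 - r / 12 by lra.
  apply: cf; apply: near_sq; rewrite /=.
    by have := clamp_in x1 (complex.Re z) hr; rewrite ltr_norml; lra.
  by have := clamp_in y1 (complex.Im z) hr; rewrite ltr_norml; lra.
have fg z : `|complex.Re z - x1| <= r / 2 - r / 12 -> `|complex.Im z - y1| <= r / 2 - r / 12 -> g z = f z.
  rewrite !ler_norml => h1 h2; rewrite /g /cl !clamp_id ?mkc_ReIm //; lra.
have hg x y : `|x - x1| < r / 2 - r / 12 -> `|y - y1| < r / 2 - r / 12 -> y <> y0 -> exists k, hasd g (mkc x y) k.
  move=> hx hy ne; have [||k hk] := df (mkc x y) _ _ => //.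
    by apply: near_sq => /=; lra.
  exists k; apply: hasd_near hk.
  apply/near_C; pose r' := Num.min (r / 2 - r / 12 - `|x - x1|) (r / 2 - r / 12 - `|y - y1|).
  have [l1 l2] : r' <= r / 2 - r / 12 - `|x - x1| /\ r' <= r / 2 - r / 12 - `|y - y1|.
    by rewrite /r' !ge_min !lexx orbT.
  exists r'; first by rewrite /r' lt_min; lra.
  move=> w hw; apply/esym/fg.
    have := Re_le_cabs (w - mkc x y); rewrite ReD ReN /=.
    have := ler_normD (complex.Re w - x) (x - x1); rewrite addrA subrK; lra.
  have := Im_le_cabs (w - mkc x y); rewrite ImD ImN /=.
  have := ler_normD (complex.Im w - y) (y - y1); rewrite addrA subrK; lra.
have [P hP] : exists P, forall x y, x1 - r / 3 < x < x1 + r / 3 ->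
    y1 - r / 3 < y < y1 + r / 3 -> hasd P (mkc x y) (g (mkc x y)).
  apply: rect_primitive => // xa xb ya yb *; apply: (@Goursat_line _ _ _ _ _ y0) => // x y hx hy ne.
  by apply: hg => //; rewrite ltr_norml; lra.
exists P => z hz.
have := Re_le_cabs (z - z0); have := Im_le_cabs (z - z0); rewrite ReD ReN ImD ImN -/x1 -/y1 => h1 h2.
rewrite -fg; try lra.
by rewrite -[z]mkc_ReIm; apply: hP; move: h1 h2 hz; rewrite !ler_norml; lra.
Qed.

End Primitive.

(** * Cauchy's formula and its consequences *)

Section Circle.
Context {R : realType}.
Local Notation C := (Cplx R).

Lemma cisE (t : R) : cis t = mkc (cos t) (sin t). Proof. by []. Qed.

Lemma cisD (s t : R) : cis (s + t) = cis s * cis t.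
Proof. by apply: complex_eq; rewrite ?cReM ?cImM /= ?cosD ?sinD; lra. Qed.

Lemma cis0 : cis (0 : R) = 1. Proof. by rewrite cisE cos0 sin0. Qed.

Lemma cis2pi : cis (2 * pi : R) = 1.
Proof. by rewrite mulr_natl cisE cos2pi sin2pi. Qed.

Lemma conj_cis (t : R) : (cis t)^* = cis (- t).
Proof. by rewrite conjCE /= cisE cosN sinN. Qed.

Lemma cabs_cis (t : R) : cabs (cis t) = 1.
Proof. by rewrite /cabs /= cos2Dsin2 sqrtr1. Qed.

Lemma cis_neq0 (t : R) : cis t != 0.
Proof. by rewrite -cabs_gt0 cabs_cis. Qed.

Lemma cisN (t : R) : cis (- t) = (cis t)^-1.
Proof.
by apply: (mulfI (cis_neq0 t)); rewrite divff ?cis_neq0 // -cisD subrr cis0.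
Qed.

Lemma cisB (s t : R) : cis (s - t) = cis s / cis t.
Proof. by rewrite cisD cisN. Qed.

Lemma cabs1_cis (z : C) : cabs z = 1 -> exists2 t : R, - pi <= t <= pi & z = cis t.
Proof.
move=> z1; have := cabs_sqr z; rewrite z1 expr1n => h.
have h1 : -1 <= complex.Re z <= 1 by rewrite -ler_norml -z1; exact: Re_le_cabs.
have [h2 h3] := acos_def h1.
have h4 : complex.Im z = sin (acos (complex.Re z)) \/ complex.Im z = - sin (acos (complex.Re z)).
  have : complex.Im z ^+ 2 == sin (acos (complex.Re z)) ^+ 2.
    by apply/eqP; have := cos2Dsin2 (acos (complex.Re z)); rewrite h3; lra.
  by rewrite eqf_sqr => /orP[] /eqP ->; [left | right].
case: h4 => h4.
  exists (acos (complex.Re z)); first lra.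
  by apply: complex_eq; rewrite /= ?h3 ?h4.
exists (- acos (complex.Re z)); first lra.
by apply: complex_eq; rewrite /= ?cosN ?sinN ?h3 ?h4.
Qed.

Lemma cis_inj (s t : R) : `|s - t| < 2 * pi -> cis s = cis t -> s = t.
Proof.
move=> st hc; have h1 : cis (s - t) = 1 by rewrite cisB hc divff // cis_neq0.
have h2 : cos `|s - t| = 1.
  have := congr1 (@complex.Re R) h1; rewrite /= => h.
  by case: (ger0P (s - t)) => _; rewrite ?cosN.
have p0 := @pi_gt0 R.
have : `|s - t| = 0.
  case: (leP `|s - t| pi) => h.
    by apply: (@cos_inj R); rewrite ?cos0 // !in_itv /= ?normr_ge0 ?lexx //= ltW.
  have h3 : cos (2 * pi - `|s - t|) = 1.
    by rewrite cosB mulr_natl cos2pi sin2pi h2; lra.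
  have : 2 * pi - `|s - t| = 0.
    apply: (@cos_inj R); rewrite ?cos0 // !in_itv /=; lra.
  lra.
by move/eqP; rewrite normr_eq0 subr_eq0 => /eqP.
Qed.

Lemma hasdr_cis (t : R) : hasdr cis t ('i * cis t).
Proof.
have h := hasdr_ReIm (is_derive_cos t) (is_derive_sin t).
have -> : cis = (fun s : R => rC (cos s) + 'i * rC (sin s)) by apply/funext => s; rewrite cisE mkcE.
by apply: cder_eq h _; rewrite iE; apply: complex_eq; rewrite ?ReD ?ImD ?cReM ?cImM /=; lra.
Qed.

Lemma cont_cis (t : R) : cont_at cis t.
Proof. exact: hasdr_cont (hasdr_cis t). Qed.

Lemma cis_near (t : R) (e : R) : 0 < e -> exists2 r : R, 0 < r &
  forall z : C, cabs z = 1 -> cabs (z - cis t) < r -> exists2 s, `|s - t| < e & z = cis s.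
Proof.
move=> e0; pose d := Num.min e pi.
have p0 := @pi_gt0 R.
have d0 : 0 < d by rewrite lt_min e0.
have [de dp] : d <= e /\ d <= pi by rewrite !ge_min !lexx orbT.
(* For d <= |s| <= pi the real part of cis s is at most cos d, so that cis s is at distance at least
   1 - cos d from 1. *)
exists (1 - cos d).
  have := @ltr_cos R 0 d; rewrite !in_itv /= cos0 lexx (ltW p0) (ltW d0) dp => /(_ isT isT).
  by rewrite d0 => /esym; lra.
move=> z z1 hz; have h : cabs (z / cis t) = 1 by rewrite cabsM cabsV cabs_cis z1 invr1 mulr1.
have [s hs es] := cabs1_cis h.
exists (s + t); last by rewrite cisD -es divfK ?cis_neq0.
rewrite addrK; case: (ltP `|s| d) => hd; first exact: lt_le_trans hd de.
have h1 : cabs (z / cis t - 1) < 1 - cos d.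
  rewrite -(divff (cis_neq0 t)) -mulrBl cabsM cabsV cabs_cis invr1 mulr1 //.
have h2 : cos `|s| <= cos d.
  have := @ltr_cos R d `|s|; rewrite !in_itv /= normr_ge0 (ltW d0) dp ler_norml hs => /(_ isT isT).
  move: hd; rewrite le_eqVlt => /orP[/eqP -> //|hd].
  by rewrite hd => hh; apply: ltW; rewrite hh.
have : `|cos s - 1| <= cabs (z / cis t - 1).
  by have := Re_le_cabs (z / cis t - 1); rewrite {1}es ReD ReN.
have -> : cos s = cos `|s| by case: (ger0P s); rewrite ?cosN.
rewrite ler_norml; lra.
Qed.

End Circle.

Lemma cintB {R : realType} (g1 g2 : R -> Cplx R) (a b : R) :
  (forall t, cont_at g1 t) -> (forall t, cont_at g2 t) -> a <= b ->
  cint (fun t => g1 t - g2 t) a b = cint g1 a b - cint g2 a b.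
Proof.
move=> c1 c2 ab; rewrite (cintE (P := fun t => cprim g1 t - cprim g2 t)) //.
- by rewrite /cint; ring.
- by move=> t; exact: contB.
- by move=> t _; apply: cderB; exact: cprimP.
Qed.

Section Cauchy.
Context {R : realType}.
Local Notation C := (Cplx R).
Implicit Types (f : C -> C) (c z a : C) (r t : R).

Definition circ c r t : C := c + rC r * cis t.

Lemma circ_dist c r t : 0 <= r -> cabs (circ c r t - c) = r.
Proof. by move=> r0; rewrite /circ addrAC subrr add0r cabsM cabs_cis cabs_rC mulr1 ger0_norm. Qed.

Lemma hasdr_circ c r t : hasdr (circ c r) t ('i * (circ c r t - c)).
Proof.
apply: cder_eq (cderD (cder_cst _ _ _) (cderZ rC_cont _ (hasdr_cis t))) _.
by rewrite /circ; ring.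
Qed.

Lemma cont_circ c r t : cont_at (circ c r) t.
Proof. exact: hasdr_cont (hasdr_circ c r t). Qed.

Lemma circ_2pi c r : circ c r (2 * pi) = circ c r 0.
Proof. by rewrite /circ cis2pi cis0. Qed.

Lemma circ_far c r t a : 0 <= r -> cabs (a - c) < r -> r - cabs (a - c) <= cabs (circ c r t - a).
Proof.
move=> r0 ar; have := cabsD (circ c r t - a) (a - c); rewrite addrA subrK circ_dist //.
lra.
Qed.

Lemma circ_neq c r t a : 0 <= r -> cabs (a - c) < r -> circ c r t - a != 0.
Proof. by move=> r0 h; rewrite -cabs_gt0; have := circ_far t r0 h; lra. Qed.

Section Kernel.
Variables (h : R -> C) (c : C) (r : R).
Hypotheses (ch : forall t, cont_at h t) (r0 : 0 < r).
Let K (m : nat) a := cint (fun t => h t / (circ c r t - a) ^+ m) 0 (2 * pi).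

Lemma cont_kernel m a t : cabs (a - c) < r -> cont_at (fun t => h t / (circ c r t - a) ^+ m) t.
Proof.
move=> ar; apply: contM; first exact: ch.
apply: contV; first by rewrite expf_neq0 // circ_neq // ltW.
by apply: contX; apply: contB; [exact: cont_circ | exact: cont_cst].
Qed.

Lemma bounded_h : exists2 M, 0 < M & forall t, 0 <= t <= 2 * pi -> cabs (h t) <= M.
Proof.
have p0 : (0 : R) <= 2 * pi by rewrite mulr_ge0 // ltW // pi_gt0.
have [|x _ hx] := @EVT_max R (fun t => cabs (h t)) 0 (2 * pi) p0.
  apply: continuous_subspaceT => t; by have [] := cont_cabs (ch t).
exists (cabs (h x) + 1); first by rewrite ltr_wpDl // cabs_ge0.
by move=> t ht; have := hx t; rewrite in_itv /= => /(_ ht); lra.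
Qed.

(** Differentiation under the integral sign: with u = circ c r t - a and v = w - a, the hypothesis
    bounds the second order Taylor remainder of u^-m uniformly on the circle. *)
Lemma hasd_K m a : cabs (a - c) < r -> (forall e, 0 < e -> e <= r -> exists2 M, 0 < M &
    forall u v : C, e <= cabs u -> cabs u <= 2 * r -> e <= cabs (u - v) -> cabs (u - v) <= 2 * r -> 
     cabs ((u - v) ^- m - u ^- m - m%:R * v / u ^+ m.+1) <= M * cabs v ^+ 2) ->
  hasd (K m) a (m%:R * K m.+1 a).
Proof.
move=> ar hk.
have [M0 M00 hM0] := bounded_h.
(* Half the distance from [a] to the circle: points within [e] of [a] keep the distance [e] from the
   circle. *)
pose e := (r - cabs (a - c)) / 2; have e0 : 0 < e by rewrite /e; lra.
have er : e <= r by rewrite /e; have := cabs_ge0 (a - c); lra.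
have [M1 M10 hM1] := hk _ e0 er.
have p0 : (0 : R) < 2 * pi by rewrite mulr_gt0 // pi_gt0.
apply: cder_eps => // eps eps0.
pose B := M0 * M1 * (2 * pi).
have B0 : 0 < B by rewrite /B !mulr_gt0 // pi_gt0.
apply/near_C; exists (Num.min e (eps / B)); first by rewrite lt_min e0 divr_gt0.
move=> w; rewrite lt_min => /andP[we wB] /=.
have wr : cabs (w - c) < r.
  have := cabsD (w - a) (a - c); rewrite addrA subrK; move: we; rewrite /e; lra.
have k1 t : cont_at (fun t => h t / (circ c r t - w) ^+ m) t by exact: cont_kernel.
have k2 t : cont_at (fun t => h t / (circ c r t - a) ^+ m) t by exact: cont_kernel.
have k3 t : cont_at (fun t => m%:R * (h t / (circ c r t - a) ^+ m.+1)) t.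
  by apply: contM; [exact: cont_cst|exact: cont_kernel].
have k4 t : cont_at (fun t => (w - a) * (m%:R * (h t / (circ c r t - a) ^+ m.+1))) t.
  by apply: contM; [exact: cont_cst|exact: k3].
rewrite /K -[m%:R * cint _ _ _]cintZ; [|by move=> t; exact: cont_kernel|exact: ltW].
rewrite -[(w - a) * cint _ _ _]cintZ; [|exact: k3|exact: ltW].
rewrite -cintB; [|exact: k1|exact: k2|exact: ltW].
rewrite -cintB; [|by move=> t; apply: contB; [exact: k1|exact: k2]|exact: k4|exact: ltW].
apply: (@le_trans _ _ (M0 * (M1 * cabs (w - a) ^+ 2) * (2 * pi - 0))).
  apply: cint_le; first exact: ltW.
    by move=> t; apply: contB; [apply: contB; [exact: k1|exact: k2]|exact: k4].
  move=> t ht.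
  have -> : h t / (circ c r t - w) ^+ m - h t / (circ c r t - a) ^+ m -
     (w - a) * (m%:R * (h t / (circ c r t - a) ^+ m.+1)) =
     h t * (((circ c r t - a) - (w - a)) ^- m - (circ c r t - a) ^- m
        - m%:R * (w - a) / (circ c r t - a) ^+ m.+1).
    by rewrite opprB addrA subrK; ring.
  rewrite cabsM; apply: ler_pM; rewrite ?cabs_ge0 //; first exact: hM0.
  have a1 := circ_far t (ltW r0) ar; have a2 := circ_far t (ltW r0) wr.
  have a3 := circ_dist c t (ltW r0).
  have a4 := cabsD (circ c r t - c) (c - a); rewrite addrA subrK in a4.
  have a5 := cabsD (circ c r t - c) (c - w); rewrite addrA subrK in a5.
  have a6 := cabsD (w - a) (a - c); rewrite addrA subrK in a6.
  have c1 := cabsC c a; have c2 := cabsC c w.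
  have ww : circ c r t - a - (w - a) = circ c r t - w by rewrite opprB addrA subrK.
  by apply: hM1; rewrite ?ww; move: we; rewrite /e; lra.
rewrite subr0 -/B.
have -> : M0 * (M1 * cabs (w - a) ^+ 2) * (2 * pi) = B * cabs (w - a) * cabs (w - a) by rewrite /B; ring.
apply: ler_wpM2r; first exact: cabs_ge0.
by rewrite mulrC -ler_pdivlMr // ltW.
Qed.

Lemma hasd_K1 a : cabs (a - c) < r -> hasd (K 1) a (K 2 a).
Proof.
move=> ar; rewrite -[K 2 a]mul1r; apply: hasd_K => // e e0 _.
exists (e ^- 3); first by rewrite invr_gt0 exprn_gt0.
move=> u v h1 _ h2 _.
have u0 : u != 0 by rewrite -cabs_gt0; lra.
have uv0 : u - v != 0 by rewrite -cabs_gt0; lra.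
have -> : (u - v) ^- 1 - u ^- 1 - 1%:R * v / u ^+ 2 = (u ^+ 2 * (u - v))^-1 * v ^+ 2.
  by rewrite !expr1 mul1r; field; rewrite u0 uv0.
rewrite cabsM cabsX ler_wpM2r ?exprn_ge0 ?cabs_ge0 //.
rewrite cabsV cabsM cabsX lef_pV2 ?posrE ?exprn_gt0 ?mulr_gt0 ?exprn_gt0 //; try lra.
by rewrite exprSr ler_pM ?exprn_ge0 ?(ltW e0) // ler_pXn2r // ?nnegrE ?cabs_ge0 // ltW.
Qed.

Lemma derivable_K2 a : cabs (a - c) < r -> hasd (K 2) a (2%:R * K 3 a).
Proof.
move=> ar; apply: hasd_K => // e e0 er.
(* The remainder is v^2 (u + 2 (u - v)) / (u^3 (u - v)^2), whose factor u + 2 (u - v) is at most 6 r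
   in modulus. *)
exists (10 * r / e ^+ 5); first by rewrite divr_gt0 ?exprn_gt0 // mulr_gt0.
move=> u v h1 h1' h2 h2'.
have u0 : u != 0 by rewrite -cabs_gt0; lra.
have uv0 : u - v != 0 by rewrite -cabs_gt0; lra.
have -> : (u - v) ^- 2 - u ^- 2 - 2%:R * v / u ^+ 3 =
    (u + 2%:R * (u - v)) * (u ^+ 3 * (u - v) ^+ 2)^-1 * v ^+ 2.
  by field; rewrite u0 uv0.
rewrite cabsM (cabsX v) ler_wpM2r ?exprn_ge0 ?cabs_ge0 //.
rewrite cabsM ler_pM ?cabs_ge0 //.
  have := cabsD u (2%:R * (u - v)); rewrite (cabsM 2%:R).
  have -> : cabs (2%:R : C) = 2 by rewrite (_ : 2%:R = rC 2) ?cabs_rC ?ger0_norm // rCE rmorph_nat.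
  lra.
rewrite cabsV cabsM !cabsX lef_pV2 ?posrE ?exprn_gt0 ?mulr_gt0 ?exprn_gt0 //; try lra.
rewrite (_ : e ^+ 5 = e ^+ 3 * e ^+ 2); last by rewrite -exprD.
by rewrite ler_pM ?exprn_ge0 ?(ltW e0) // ler_pXn2r // ?nnegrE ?cabs_ge0 // ltW.
Qed.

End Kernel.

Lemma ball_path (J : C -> C) c a r : cabs (a - c) < r ->
  (forall z, cabs (z - c) < r -> hasd J z 0) -> J a = J c.
Proof.
move=> ar hJ; pose p t := c + rC t * (a - c).
have -> : a = p 1 by rewrite /p mul1r addrC subrK.
have -> : J c = J (p 0) by rewrite /p mul0r addr0.
apply: (hasdr0_cst (f := fun t => J (p t))) => // t t01.
have hp : hasdr p t (a - c).
  have := cderD (cder_cst rC c t) (cderM rC_cont (cder_iota _ t) (cder_cst rC (a - c) t)).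
  by move=> h; apply: cder_eq h _; rewrite mulr0 mul1r addr0 add0r.
have := hasdr_comp (f := p) (hJ (p t) _) hp; rewrite mul0r; apply.
rewrite /p addrAC subrr add0r cabsM cabs_rC ger0_norm; last by case/andP: t01.
apply: le_lt_trans ar; rewrite ler_piMl ?cabs_ge0 //; by case/andP: t01.
Qed.

(** The derivative of the integral in [a] is the integral of circ' / (circ - a)^2, which has the
    periodic primitive - 1 / (circ - a) and so vanishes. The value is therefore the one at the
    centre, where the integrand is constant. *)
Lemma winding c a r : 0 < r -> cabs (a - c) < r ->
  cint (fun t => 'i * (circ c r t - c) / (circ c r t - a) ^+ 1) 0 (2 * pi) = 'i * rC (2 * pi).
Proof.
move=> r0 ar; have p0 : (0 : R) <= 2 * pi by rewrite mulr_ge0 // ltW // pi_gt0.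
pose h t := 'i * (circ c r t - c).
have ch t : cont_at h t.
  by apply: contM; [exact: cont_cst | apply: contB; [exact: cont_circ | exact: cont_cst]].
pose J a := cint (fun t => h t / (circ c r t - a) ^+ 1) 0 (2 * pi).
rewrite -[LHS]/(J a) (@ball_path J c a r) //; last first.
  move=> z zr; apply: cder_eq (hasd_K1 ch r0 zr) _.
  rewrite (cintE (P := fun t => - (circ c r t - z)^-1)) //.
  - by rewrite circ_2pi; ring.
  - by move=> t; exact: cont_kernel.
  - move=> t _; have hz := circ_neq t (ltW r0) zr.
    have := cderN (cderV rC_cont hz (cderB (hasdr_circ c r t) (cder_cst _ z t))).
    by move=> hh; apply: cder_eq hh _; rewrite /h subr0; field.
rewrite /J (@cint_eq _ _ (fun=> 'i)) //.
- by rewrite cint_cst // subr0.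
- by move=> t; apply: cont_kernel => //; rewrite subrr cabs0.
- by move=> t; exact: cont_cst.
- move=> t _; rewrite /h expr1 mulfK //.
  by apply: circ_neq; [exact: ltW | rewrite subrr cabs0].
Qed.

Section Formula.
Variables (f : C -> C) (c : C) (r0 : R).
Hypotheses (r00 : 0 < r0) (df : forall z, cabs (z - c) < r0 -> exists k, hasd f z k).
(** [Morera_line] yields a primitive on the disk of radius r0 / 3, which contains this circle. *)
Let r := r0 / 4.
Let rp : 0 < r. Proof. by rewrite /r divr_gt0. Qed.
Let p0 : (0 : R) <= 2 * pi. Proof. by rewrite mulr_ge0 // ltW // pi_gt0. Qed.
Let h t := f (circ c r t) * ('i * (circ c r t - c)).

Let ch t : cont_at h t.
Proof.
apply: contM; last first.
  by apply: contM; [exact: cont_cst | apply: contB; [exact: cont_circ | exact: cont_cst]].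
apply: cont_comp; first exact: cont_circ.
have [|k hk] := df (z := circ c r t); last exact: hasd_cont hk.
by rewrite circ_dist ?(ltW rp) // /r; have := r00; lra.
Qed.

(** The difference quotient of [f] at [a] is continuous, and differentiable off the horizontal line
    through [a]. It therefore has a primitive, and its integral along the circle is 0; [winding]
    evaluates the part with f a. *)
Lemma Cauchy_formula a : cabs (a - c) < r ->
  'i * rC (2 * pi) * f a = cint (fun t => h t / (circ c r t - a) ^+ 1) 0 (2 * pi).
Proof.
move=> ar; have [|fa hfa] := df (z := a); first by have := r00; move: ar; rewrite /r; lra.
pose g z := if z == a then fa else (f z - f a) / (z - a).
have gE z : z != a -> g z = (f z - f a) / (z - a) by rewrite /g => /negPf ->.
have cg z : cabs (z - c) < r0 -> cont_at g z.
  move=> zr; have [->|za] := eqVneq z a.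
    move: hfa => [q [cq qa hq]]; apply: cont_near cq.
    apply: filterE => w; rewrite /g; case: eqP => [-> //|/eqP wa].
    by rewrite [f w]hq /= addrAC subrr add0r mulrC mulKf // subr_eq0.
  have [k hk] := df zr.
  apply: (cont_near (f := fun z => (f z - f a) / (z - a))).
    have := cont_neq0 (contB (cont_id z) (cont_cst a z)).
    by rewrite subr_eq0 => /(_ za); apply: filterS => w; rewrite subr_eq0 => /gE ->.
  apply: contM; first by apply: contB; [exact: hasd_cont hk | exact: cont_cst].
  by apply: contV; [rewrite subr_eq0 | apply: contB; [exact: cont_id | exact: cont_cst]].
have dg z : cabs (z - c) < r0 -> complex.Im z <> complex.Im a -> exists k, hasd g z k.
  move=> zr hz; have za : z != a by apply/eqP => e; apply: hz; rewrite e.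
  have [k hk] := df zr; eexists.
  apply: (hasd_near (f := fun z => (f z - f a) / (z - a))).
    have := cont_neq0 (contB (cont_id z) (cont_cst a z)).
    by rewrite subr_eq0 => /(_ za); apply: filterS => w; rewrite subr_eq0 => /gE ->.
  apply: cderM; first exact: id_C_cont.
    by apply: cderB; [exact: hk | exact: cder_cst].
  by apply: cderV; [exact: id_C_cont | rewrite subr_eq0 | apply: cderB; [exact: cder_iota | exact: cder_cst]].
have [P hP] := Morera_line r00 cg dg.
have cin t : cabs (circ c r t - c) < r0 / 3 by rewrite circ_dist ?(ltW rp) // /r; have := r00; lra.
have hcirc t : hasdr (fun t => P (circ c r t)) t (g (circ c r t) * ('i * (circ c r t - c))).
  by apply: (hasdr_comp (f := circ c r)); [exact: hP | exact: hasdr_circ].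
have cw t : cont_at (fun t => 'i * (circ c r t - c) / (circ c r t - a) ^+ 1) t.
  apply: (cont_kernel (h := fun t => 'i * (circ c r t - c))) => //.
  by move=> s; apply: contM; [exact: cont_cst | apply: contB; [exact: cont_circ | exact: cont_cst]].
have hz : cint (fun t => h t / (circ c r t - a) ^+ 1 +
     (- f a) * ('i * (circ c r t - c) / (circ c r t - a) ^+ 1)) 0 (2 * pi) = 0.
  rewrite (cintE (P := fun t => P (circ c r t))) // ?circ_2pi ?subrr //.
    move=> t; apply: contD; first exact: cont_kernel.
    by apply: contM; [exact: cont_cst | exact: cw].
  move=> t _; apply: cder_eq (hcirc t) _.
  have ne := circ_neq t (ltW rp) ar.
  rewrite (gE (circ c r t)); last by rewrite -subr_eq0.
  rewrite /h expr1; move: (circ c r t) => u.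
  by move: ('i * (u - c)) ((u - a)^-1) => v w; ring.
move: hz; rewrite cintD // ?cintZ //; last 2 first.
- by move=> t; exact: cont_kernel.
- by move=> t; apply: contM; [exact: cont_cst | exact: cw].
rewrite winding // => /eqP; rewrite mulNr subr_eq0 => /eqP ->; ring.
Qed.

Lemma holo_derive2 : exists k, hasd (f^`()%classic : C -> C) c k.
Proof.
pose K m a := cint (fun t => h t / (circ c r t - a) ^+ m) 0 (2 * pi).
have i0 : 'i * rC (2 * pi) != 0 :> C.
  by rewrite mulf_neq0 // ?neq0Ci // rC_eq0 mulf_neq0 // gt_eqF // pi_gt0.
have e1 z : cabs (z - c) < r -> hasd f z (('i * rC (2 * pi))^-1 * K 2 z).
  move=> zr; apply: (hasd_near (f := fun a => ('i * rC (2 * pi))^-1 * K 1 a)).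
    apply/near_C; exists (r - cabs (z - c)); first by lra.
    move=> w hw; rewrite /K -Cauchy_formula ?mulKf //.
    by have := cabsD (w - z) (z - c); rewrite addrA subrK; lra.
  by apply: cderZ; [exact: id_C_cont | exact: (hasd_K1 ch rp zr)].
exists (('i * rC (2 * pi))^-1 * (2%:R * K 3 c)).
apply: (hasd_near (f := fun a => ('i * rC (2 * pi))^-1 * K 2 a)).
  apply/near_C; exists r => // w hw; symmetry; apply: hasd_derive1; exact: e1.
apply: cderZ; first exact: id_C_cont.
by apply: derivable_K2 => //; rewrite subrr cabs0.
Qed.

(** At distance at least r / 2 from the circle the kernel 1 / (circ - a) is at most 2 / r. *)
Lemma Cauchy_le M a : (forall z, cabs (z - c) = r -> cabs (f z) <= M) ->
  cabs (a - c) <= r / 2 -> cabs (f a) <= 2 * M.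
Proof.
move=> hM ar; have ar' : cabs (a - c) < r by have := rp; lra.
have M0 : 0 <= M by apply: le_trans (cabs_ge0 _) (hM (circ c r 0) _); exact: circ_dist (ltW rp).
have pp : 0 < 2 * pi :> R by rewrite mulr_gt0 // pi_gt0.
have e1 : cabs ('i * rC (2 * pi) * f a) = 2 * pi * cabs (f a).
  by rewrite !cabsM cabsi mul1r cabs_rC ger0_norm.
rewrite -(ler_pM2l pp) -e1 Cauchy_formula //.
have -> : 2 * pi * (2 * M) = 2 * M * (2 * pi - 0) :> R by ring.
apply: cint_le => // [t|t _]; first exact: cont_kernel.
rewrite /h expr1 !cabsM cabsV cabsi mul1r circ_dist ?(ltW rp) //.
have := circ_far t (ltW rp) ar' => far.
rewrite ler_pdivrMr; last by lra.
rewrite -mulrA [2 * _]mulrCA ler_pM ?cabs_ge0 ?(ltW rp) //; last by lra.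
by apply: hM; exact: circ_dist (ltW rp).
Qed.

End Formula.
End Cauchy.

(** * Holomorphic functions: removable singularities, order of a zero, Liouville's theorem, gluing
    along the circle *)

Section Holomorphic.
Context {R : realType}.
Local Notation C := (Cplx R).
Implicit Types (f g : C -> C) (c z a w : C) (r e : R).

Definition holo f c r := forall z, cabs (z - c) < r -> exists k, hasd f z k.

Lemma holo_sub f c r c' r' : holo f c r -> cabs (c' - c) + r' <= r -> holo f c' r'.
Proof.
move=> h hr z hz; apply: h; have := cabsD (z - c') (c' - c); rewrite addrA subrK; lra.
Qed.

Lemma holo_le f c r r' : r' <= r -> holo f c r -> holo f c r'.
Proof. by move=> rr h; apply: (holo_sub h); rewrite subrr cabs0 add0r. Qed.

Lemma holo_cont f c r z : holo f c r -> cabs (z - c) < r -> cont_at f z.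
Proof. by move=> h /h [k /hasd_cont]. Qed.

Lemma holo_derive f c r : holo f c r -> holo (f^`()%classic : C -> C) c r.
Proof.
move=> h z zr; apply: (@holo_derive2 _ f z (r - cabs (z - c))); first lra.
by apply: (holo_sub h); lra.
Qed.

Lemma holo_hasd f c r z : holo f c r -> cabs (z - c) < r -> hasd f z (f^`()%classic z).
Proof. by move=> h /h [k hk]; rewrite (hasd_derive1 hk). Qed.

(** Near each point [f] is the derivative of the primitive given by [Morera_line], and derivatives
    of holomorphic functions are holomorphic. *)
Lemma holo_line f c r y0 :
  (forall z, cabs (z - c) < r -> cont_at f z) ->
  (forall z, cabs (z - c) < r -> complex.Im z <> y0 -> exists k, hasd f z k) ->
  holo f c r.
Proof.
move=> cf df z zr; set r' := r - cabs (z - c); have r'0 : 0 < r' by rewrite /r'; lra.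
have sub w : cabs (w - z) < r' -> cabs (w - c) < r.
  by move=> h; have := cabsD (w - z) (z - c); rewrite addrA subrK /r' in h *; lra.
have [P hP] := Morera_line r'0 (fun w hw => cf w (sub w hw)) (fun w hw => df w (sub w hw)).
have r3 : 0 < r' / 3 by lra.
have [k hk] : exists k, hasd (P^`()%classic : C -> C) z k.
  by apply: (@holo_derive2 _ P z (r' / 3)) => // w hw; exists (f w); exact: hP.
exists k; apply: hasd_near hk; apply/near_C; exists (r' / 3) => // w hw.
exact: hasd_derive1 (hP w hw).
Qed.

Lemma holo_removable f c r :
  (forall z, cabs (z - c) < r -> cont_at f z) ->
  (forall z, cabs (z - c) < r -> z != c -> exists k, hasd f z k) ->
  holo f c r.
Proof.
move=> cf df; apply: (@holo_line _ _ _ (complex.Im c)) => // z zr hz; apply: df => //.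
by apply/eqP => e; apply: hz; rewrite e.
Qed.

Lemma cabs_near z c r : cabs (z - c) < r -> \forall w \near z, cabs (w - c) < r.
Proof.
move=> h; apply/near_C; exists (r - cabs (z - c)); first lra.
by move=> w hw; have := cabsD (w - z) (z - c); rewrite addrA subrK; lra.
Qed.

Lemma near_neq z c : z != c -> \forall w \near z, w != c.
Proof.
move=> zc; have := cont_neq0 (contB (cont_id z) (cont_cst c z)).
by rewrite subr_eq0 => /(_ zc); apply: filterS => w; rewrite subr_eq0.
Qed.

Lemma holo_factor f c r : 0 < r -> holo f c r ->
  exists2 g, holo g c r & forall z, f z = f c + (z - c) * g z.
Proof.
move=> r0 h; have [|k [q [cq qc hq]]] := h c; first by rewrite subrr cabs0.
exists q => //.
have qE w : w != c -> q w = (f w - f c) / (w - c).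
  by move=> wc; rewrite [f w]hq addrAC subrr add0r mulrC mulKf // subr_eq0.
have qd z : cabs (z - c) < r -> z != c -> exists k, hasd q z k.
  move=> zr zc; have [k' hk'] := h z zr; eexists.
  apply: (hasd_near (f := fun w => (f w - f c) / (w - c))).
    by apply: filterS (near_neq zc) => w /qE.
  apply: cderM; first exact: id_C_cont.
    by apply: cderB; [exact: hk' | exact: cder_cst].
  by apply: cderV; [exact: id_C_cont | rewrite subr_eq0 | apply: cderB; [exact: cder_iota | exact: cder_cst]].
apply: holo_removable => // z zr.
by have [-> //|zc] := eqVneq z c; have [k' /hasd_cont] := qd z zr zc.
Qed.

Lemma holo_cst (k : C) c r : holo (fun=> k) c r.
Proof. by move=> z _; exists 0; exact: cder_cst. Qed.
Lemma holo_id c r : holo (fun z => z) c r.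
Proof. by move=> z _; exists 1; exact: cder_iota. Qed.
Lemma holoD f g c r : holo f c r -> holo g c r -> holo (fun z => f z + g z) c r.
Proof. by move=> hf hg z zr; have [a ha] := hf z zr; have [b hb] := hg z zr; exists (a + b); exact: cderD. Qed.
Lemma holoN f c r : holo f c r -> holo (fun z => - f z) c r.
Proof. by move=> hf z zr; have [a ha] := hf z zr; exists (- a); exact: cderN. Qed.
Lemma holoB f g c r : holo f c r -> holo g c r -> holo (fun z => f z - g z) c r.
Proof. by move=> hf hg; exact: holoD hf (holoN hg). Qed.
Lemma holoM f g c r : holo f c r -> holo g c r -> holo (fun z => f z * g z) c r.
Proof.
move=> hf hg z zr; have [a ha] := hf z zr; have [b hb] := hg z zr.
by eexists; apply: cderM; [exact: id_C_cont | exact: ha | exact: hb].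
Qed.
Lemma holoX f n c r : holo f c r -> holo (fun z => f z ^+ n) c r.
Proof. by move=> hf z zr; have [a ha] := hf z zr; eexists; apply: cderX; [exact: id_C_cont | exact: ha]. Qed.
Lemma holoV f c r : (forall z, cabs (z - c) < r -> f z != 0) -> holo f c r ->
  holo (fun z => (f z)^-1) c r.
Proof.
by move=> f0 hf z zr; have [a ha] := hf z zr; eexists; apply: cderV; [exact: id_C_cont | exact: f0 | exact: ha].
Qed.
Lemma holo_poly (p : {poly C}) c r : holo (horner p) c r.
Proof. by move=> z _; eexists; exact: hasd_poly. Qed.

Lemma bounded_circ f c r : (forall t : R, cont_at f (circ c r t)) ->
  exists2 M : R, 0 <= M & forall z, cabs (z - c) = r -> cabs (f z) <= M.
Proof.
move=> cf; have p0 : (- pi : R) <= pi by have := @pi_gt0 R; lra.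
have [|x _ hx] := @EVT_max R (fun t => cabs (f (circ c r t))) (- pi) pi p0.
  apply: continuous_subspaceT => t.
  by have [] := cont_cabs (cont_comp (cont_circ c r t) (cf t)).
exists (cabs (f (circ c r x))); first exact: cabs_ge0.
move=> z hz; have [t ht ->] : exists2 t : R, - pi <= t <= pi & z = circ c r t.
  have [r0|r0] := eqVneq r 0.
    exists 0; first by have := @pi_gt0 R; lra.
    by move/eqP: hz; rewrite r0 cabs_eq0 subr_eq0 => /eqP ->; rewrite /circ mul0r addr0.
  have rr : rC r != 0 :> C by rewrite rC_eq0.
  have [|t ht et] := @cabs1_cis R ((z - c) / rC r).
    by rewrite cabsM cabsV cabs_rC -hz ger0_norm ?cabs_ge0 // divff // hz.
  by exists t => //; rewrite /circ -et mulrC divfK // addrC subrK.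
by apply: hx; rewrite in_itv.
Qed.

Lemma half_pow_small (M x : R) : (forall n, x <= M / 2 ^+ n) -> x <= 0.
Proof.
move=> h; rewrite leNgt; apply/negP => x0.
have M0 : 0 <= M by have := h 0%N; rewrite expr0 divr1; lra.
by have [n hn] := exp2_small M0 x0; have := h n; lra.
Qed.

(** If [f] were divisible by every power (z - c)^n, [Cauchy_le] for the quotients on a circle of
    radius rho would give |f z| <= 2 M / 2^n for |z - c| < rho / 2 and all n, so that f = 0
    there. *)
Lemma zero_order f c r : 0 < r -> holo f c r ->
  (forall e, 0 < e -> exists2 z, cabs (z - c) < e & f z != 0) ->
  exists m g, [/\ holo g c r, g c != 0 & forall z, f z = (z - c) ^+ m * g z].
Proof.
move=> r0 hf nz; apply: contrapT => hn.
have fac n : exists2 g, holo g c r & forall z, f z = (z - c) ^+ n * g z.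
  elim: n => [|n [g hg e]]; first by exists f => // z; rewrite expr0 mul1r.
  have [gc|gc] := eqVneq (g c) 0; last by case: hn; exists n, g.
  have [g' hg' e'] := holo_factor r0 hg.
  by exists g' => // z; rewrite e e' gc add0r mulrA -exprSr.
set rho := r / 4; have rho0 : 0 < rho by rewrite /rho; lra.
have cdist t : cabs (circ c rho t - c) < r by rewrite circ_dist ?ltW // /rho; lra.
have [M M0 hM] := bounded_circ (fun t => holo_cont hf (cdist t)).
have [|z zc] := nz (rho / 2); first lra.
rewrite -cabs_gt0 ltNge => /negP; apply; apply: (@half_pow_small (2 * M)) => n.
have [g hg e] := fac n.
have bg : cabs (g z) <= 2 * (M / rho ^+ n).
  apply: (Cauchy_le r0 hg); last exact: ltW.
  move=> w hw; have := hM w hw; rewrite e cabsM cabsX hw mulrC => h.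
  by rewrite ler_pdivlMr // exprn_gt0.
rewrite e cabsM cabsX.
apply: (@le_trans _ _ ((rho / 2) ^+ n * (2 * (M / rho ^+ n)))).
  by apply: ler_pM; rewrite ?exprn_ge0 ?cabs_ge0 // lerXn2r ?nnegrE ?cabs_ge0 //; lra.
rewrite le_eqVlt; apply/orP; left; apply/eqP; rewrite expr_div_n; field.
by rewrite !expf_neq0 // ?gt_eqF.
Qed.

(* The growth bound passes to the difference quotient at 0 with a smaller
   exponent. *)
Lemma Liouville_poly n f (M : R) : (forall r, holo f 0 r) ->
  (forall z, cabs (f z) <= M * (1 + cabs z) ^+ n) -> exists p : {poly C}, forall z, f z = p.[z].
Proof.
elim: n f M => [|n IH] f M hf hM; last first.
  have [g hg e] := holo_factor ltr01 (hf 1).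
  have gE w : w != 0 -> g w = (f w - f 0) / w.
    by move=> w0; rewrite (e w) addrAC subrr add0r subr0 mulrC mulKf.
  have hg' r : holo g 0 r.
    move=> z _; have [->|z0] := eqVneq z 0; first by apply: hg; rewrite subrr cabs0.
    have [|k hk] := hf (cabs z + 1) z; first by rewrite subr0; lra.
    eexists; apply: (hasd_near (f := fun w => (f w - f 0) / w)).
      by apply: filterS (near_neq z0) => w /gE.
    apply: cderM; [exact: id_C_cont | by apply: cderB; [exact: hk | exact: cder_cst]|].
    by apply: cderV; [exact: id_C_cont| exact: z0 | exact: cder_iota].
  have M0 : 0 <= M by apply: le_trans (cabs_ge0 _) (le_trans (hM 0) _); rewrite cabs0 addr0 expr1n mulr1.
  have big z : 1 <= cabs z -> cabs (g z) <= 4 * M * (1 + cabs z) ^+ n.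
    move=> z1; have z0 : z != 0 by rewrite -cabs_gt0; lra.
    rewrite gE // cabsM cabsV ler_pdivrMr; last lra.
    have h1 := cabsD (f z) (- f 0); rewrite cabsN in h1; apply: (le_trans h1).
    have h2 := hM z; have h3 := hM 0; rewrite cabs0 addr0 expr1n mulr1 in h3.
    have h4 : 1 <= (1 + cabs z) ^+ n.+1 by rewrite exprn_ege1 //; lra.
    have h5 : M <= M * (1 + cabs z) ^+ n.+1 by rewrite ler_peMr.
    have h6 : M * (1 + cabs z) ^+ n.+1 <= M * (1 + cabs z) ^+ n * (2 * cabs z).
      rewrite exprSr mulrA ler_wpM2l //; last lra.
      by rewrite mulr_ge0 // exprn_ge0 //; lra.
    lra.
  (* Near 0 the division by z spoils the estimate; the bound comes from the circle of radius 8 / 4 =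
     2, on which 1 + |w| = 3. *)
  have small z : cabs z < 1 -> cabs (g z) <= 2 * (4 * M * 3 ^+ n).
    move=> z1; apply: (@Cauchy_le _ g 0 8 _ (hg' 8)) => //; last by rewrite subr0; lra.
    move=> w; rewrite subr0 => hw; apply: (le_trans (big w _)); first by rewrite hw; lra.
    by rewrite hw (_ : 1 + 8 / 4 = 3) //; field.
  have [p hp] : exists p : {poly C}, forall z, g z = p.[z].
    apply: (IH g (8 * M * 3 ^+ n) hg') => z.
    have p3 : 1 <= (3 : R) ^+ n by rewrite exprn_ege1 //; lra.
    have h4 : 1 <= (1 + cabs z) ^+ n by rewrite exprn_ege1 //; have := cabs_ge0 z; lra.
    have M3 : M <= M * 3 ^+ n by rewrite ler_peMr.
    case: (leP 1 (cabs z)) => z1.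
      apply: (le_trans (big z z1)); rewrite ler_wpM2r //; last by rewrite -mulrA; lra.
      by lra.
    apply: (le_trans (small z z1)).
    have : 8 * M * 3 ^+ n <= 8 * M * 3 ^+ n * (1 + cabs z) ^+ n.
      by rewrite ler_peMr // !mulr_ge0 // exprn_ge0.
    lra.
  exists ((f 0)%:P + 'X * p) => z.
  by rewrite e hp subr0 hornerD hornerM hornerX hornerC.
exists (f 0)%:P => z; rewrite hornerC.
have [g hg e] := holo_factor ltr01 (hf 1).
have gE w : w != 0 -> g w = (f w - f 0) / w.
  by move=> w0; rewrite (e w) addrAC subrr add0r subr0 mulrC mulKf.
have hg' r : holo g 0 r.
  move=> w _; have [->|z0] := eqVneq w 0; first by apply: hg; rewrite subrr cabs0.
  have [|k hk] := hf (cabs w + 1) w; first by rewrite subr0; lra.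
  eexists; apply: (hasd_near (f := fun w => (f w - f 0) / w)).
    by apply: filterS (near_neq z0) => v /gE.
  apply: cderM; [exact: id_C_cont | by apply: cderB; [exact: hk | exact: cder_cst]|].
  by apply: cderV; [exact: id_C_cont| exact: z0 | exact: cder_iota].
have M0 : 0 <= M by apply: le_trans (cabs_ge0 _) (le_trans (hM 0) _); rewrite expr0 mulr1.
have gz : g z = 0.
  apply/eqP; rewrite -cabs_eq0 eq_le cabs_ge0 andbT.
  apply: (@half_pow_small (4 * M)) => n.
  pose rho := 2 ^+ n + 2 * cabs z.
  have rho0 : 0 < rho by rewrite /rho ltr_pwDl ?exprn_gt0 // mulr_ge0 // cabs_ge0.
  have r4 : 0 < 4 * rho by lra.
  have : cabs (g z) <= 2 * (2 * M / rho).
    apply: (@Cauchy_le _ g 0 _ r4 (hg' _)).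
      move=> w; rewrite subr0 => hw.
      have wr : cabs w = rho by rewrite hw; field.
      rewrite gE; last by rewrite -cabs_gt0 wr.
      rewrite cabsM cabsV wr ler_wpM2r ?invr_ge0 ?(ltW rho0) //.
      have h1 := cabsD (f w) (- f 0); rewrite cabsN in h1; apply: (le_trans h1).
      by have := hM w; have := hM 0; rewrite !expr0; lra.
    rewrite subr0 (_ : 4 * rho / 4 = rho); last by field.
    have : 0 < (2 : R) ^+ n by rewrite exprn_gt0.
    by rewrite /rho; lra.
  move/le_trans; apply; rewrite (_ : 2 * (2 * M / rho) = 4 * M / rho); last by ring.
  apply: ler_wpM2l; first by rewrite mulr_ge0.
  by rewrite lef_pV2 ?posrE ?exprn_gt0 // /rho lerDl mulr_ge0 // cabs_ge0.
by rewrite e gz mulr0 addr0.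
Qed.

Lemma cJD z w : (z + w)^* = z^* + w^*. Proof. exact: rmorphD. Qed.
Lemma cJB z w : (z - w)^* = z^* - w^*. Proof. exact: rmorphB. Qed.
Lemma cJM z w : (z * w)^* = z^* * w^*. Proof. exact: rmorphM. Qed.
Lemma cJK z : (z^*)^* = z. Proof. exact: conjCK. Qed.
Lemma cJV z : (z^-1)^* = (z^*)^-1. Proof. exact: fmorphV. Qed.
Lemma cJX z n : (z ^+ n)^* = z^* ^+ n. Proof. exact: rmorphXn. Qed.

Lemma hasd_conj f z k : hasd f z^* k -> hasd (fun w => (f w^*)^*) z k^*.
Proof.
move=> [q [cq qz hq]]; exists (fun w => (q w^*)^*); split.
- by apply: cont_conj; apply: cont_comp => //; apply: cont_conj; exact: cont_id.
- by rewrite qz.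
- by move=> w; rewrite hq cJD cJM cJB !cJK.
Qed.

Lemma hasd_inv z : z != 0 -> hasd (fun w => w^-1) z (- z ^- 2).
Proof.
move=> z0; have h := cderV (@id_C_cont R) z0 (cder_iota id z).
by apply: cder_eq h _; rewrite mulN1r.
Qed.

Lemma hasd_reflect f z k : z != 0 -> hasd f (z^*)^-1 k ->
  exists k', hasd (fun w => (f (w^*)^-1)^*) z k'.
Proof.
move=> z0 hf; eexists; apply: (hasd_conj (f := fun w => f w^-1)).
apply: (hasd_comp (f := fun w => w^-1)); first exact: hf.
by apply: hasd_inv; rewrite conjC_eq0.
Qed.

Definition cont_in (A : set C) f z := forall e, 0 < e -> exists2 d, 0 < d &
  forall w, A w -> cabs (w - z) < d -> cabs (f w - f z) < e.

Lemma cont_in_at A f z : cont_at f z -> cont_in A f z.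
Proof. by move=> /cont_eps h e /h /near_C[d d0 hd]; exists d => // w _; exact: hd. Qed.

Definition circ_glue f g z := if cabs z <= 1 then f z else g z.

Lemma cont_glue f g z : cabs z = 1 -> f z = g z ->
  cont_in [set w | cabs w <= 1] f z -> cont_in [set w | 1 <= cabs w] g z -> cont_at (circ_glue f g) z.
Proof.
move=> z1 fg cf cg; apply/cont_eps => e e0; apply/near_C.
have [d d0 hd] := cf e e0; have [d' d'0 hd'] := cg e e0.
exists (Num.min d d'); first by rewrite lt_min d0.
move=> w; rewrite lt_min => /andP[h1 h2]; rewrite /circ_glue z1 lexx.
by case: (leP (cabs w) 1) => hw; [exact: hd | rewrite fg; apply: hd' => //=; exact: ltW].
Qed.

(** The Cayley transform [m] takes 0 to z0 and, in the unit disk, maps only real points to the unit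
    circle. Thus f o m is differentiable off a line, [holo_line] applies, and [mu], the inverse of
    [m], carries the result back. *)
Lemma hasd_line_circle f z0 r : 0 < r -> cabs z0 = 1 ->
  (forall z, cabs (z - z0) < r -> cont_at f z) ->
  (forall z, cabs (z - z0) < r -> cabs z != 1 -> exists k, hasd f z k) ->
  exists k, hasd f z0 k.
Proof.
move=> r0 z01 cf df.
have z00 : z0 != 0 by rewrite -cabs_gt0 z01.
pose m w : C := z0 * (1 + 'i * w) / (1 - 'i * w).
have den w : cabs w < 1 -> 1 - 'i * w != 0.
  move=> w1; rewrite -cabs_gt0; have := cabsB 1 ('i * w); rewrite cabs1 cabsM cabsi; lra.
have hm w : cabs w < 1 -> exists k, hasd m w k.
  move=> w1; eexists; apply: cderM; first exact: id_C_cont.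
    apply: cderZ; first exact: id_C_cont.
    by apply: cderD; [exact: cder_cst | apply: cderZ; [exact: id_C_cont | exact: cder_iota]].
  apply: cderV; [exact: id_C_cont | exact: den |].
  by apply: cderB; [exact: cder_cst | apply: cderZ; [exact: id_C_cont | exact: cder_iota]].
have m0 : m 0 = z0 by rewrite /m !mulr0 addr0 subr0 divr1 mulr1.
have cm0 : cont_at m 0 by have [|k /hasd_cont] := hm 0; rewrite ?cabs0.
have /cont_eps/(_ r r0)/near_C[d d0 hd] := cm0; rewrite m0 in hd.
pose d' := Num.min d 1; have d'0 : 0 < d' by rewrite lt_min d0 ltr01.
have cmabs w : cabs w < 1 -> cabs (m w) = 1 -> complex.Im w = 0.
  move=> w1; rewrite /m !cabsM z01 mul1r cabsV => h.
  have h0 : cabs (1 - 'i * w) != 0 by rewrite cabs_eq0 den.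
  have {}h : cabs (1 + 'i * w) ^+ 2 = cabs (1 - 'i * w) ^+ 2.
    by congr (_ ^+ 2); rewrite -[LHS](divfK h0) h mul1r.
  move: h; rewrite !cabs_sqr !ReD !ImD ReN ImN iE !cReM !cImM /=; lra.
have [k hk] : exists k, hasd (fun w => f (m w)) 0 k.
  apply: (@holo_line _ 0 d' 0); last by rewrite subrr cabs0.
  - move=> w; rewrite subr0 lt_min => /andP[w1 w2]; apply: cont_comp.
      by have [k /hasd_cont] := hm w w2.
    by apply: cf; apply: hd; rewrite subr0.
  - move=> w; rewrite subr0 lt_min => /andP[w1 w2] iw.
    have [k hk] := hm w w2.
    have [||k' hk'] := df (m w).
    + by apply: hd; rewrite subr0.
    + by apply/eqP => /(cmabs _ w2).
    by exists (k' * k); exact: hasd_comp hk.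
pose mu z : C := 'i * (z0 - z) / (z0 + z).
have mu0 : mu z0 = 0 by rewrite /mu subrr mulr0 mul0r.
have zz : z0 + z0 != 0 by rewrite -mulr2n -mulr_natl mulf_neq0 // pnatr_eq0.
have [k' hk'] : exists k, hasd mu z0 k.
  eexists; apply: cderM; first exact: id_C_cont.
    apply: cderZ; first exact: id_C_cont.
    by apply: cderB; [exact: cder_cst | exact: cder_iota].
  apply: cderV; [exact: id_C_cont | exact: zz |].
  by apply: cderD; [exact: cder_cst | exact: cder_iota].
exists (k * k'); rewrite -mu0 in hk; have := hasd_comp hk hk'.
apply: hasd_near; have := cont_neq0 (contD (cont_cst z0 z0) (cont_id z0)) zz.
apply: filterS => z hz; congr (f _); rewrite /m /mu.
have ii : 'i * 'i = -1 :> C by rewrite -expr2 sqrCi.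
have e1 : 1 + 'i * ('i * (z0 - z) / (z0 + z)) = 2%:R * z / (z0 + z).
  by rewrite !mulrA ii; field.
have e2 : 1 - 'i * ('i * (z0 - z) / (z0 + z)) = 2%:R * z0 / (z0 + z).
  by rewrite !mulrA ii; field.
rewrite e1 e2; field; by rewrite hz z00.
Qed.

(** Off the circle the glued function is locally [f] or [g]; on the circle it is continuous, and
    [hasd_line_circle] applies. With [g] obtained from [f] by reflection this is the reflection
    principle. *)
Lemma glue_holo f g z0 r : 0 < r -> cabs z0 = 1 ->
  (forall z, cabs (z - z0) < r -> cabs z <= 1 -> cont_in [set w | cabs w <= 1] f z) ->
  (forall z, cabs (z - z0) < r -> 1 <= cabs z -> cont_in [set w | 1 <= cabs w] g z) ->
  (forall z, cabs (z - z0) < r -> cabs z < 1 -> exists k, hasd f z k) ->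
  (forall z, cabs (z - z0) < r -> 1 < cabs z -> exists k, hasd g z k) ->
  (forall z, cabs (z - z0) < r -> cabs z = 1 -> f z = g z) ->
  holo (circ_glue f g) z0 r.
Proof.
move=> r0 z01 cf cg df dg fg.
have inn z : cabs z < 1 -> \forall w \near z, f w = circ_glue f g w.
  move=> z1; have := @cabs_near z 0 1; rewrite subr0 => /(_ z1).
  by apply: filterS => w; rewrite subr0 /circ_glue => /ltW ->.
have out z : 1 < cabs z -> \forall w \near z, g w = circ_glue f g w.
  move=> z1; apply/near_C; exists (cabs z - 1); first lra.
  move=> w hw; rewrite /circ_glue; case: leP => // w1.
  by exfalso; have := cabsB z w; rewrite cabsC in hw; lra.
have hn z : cabs (z - z0) < r -> cabs z != 1 -> exists k, hasd (circ_glue f g) z k.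
  move=> zr; rewrite neq_lt => /orP[z1|z1].
    by have [k hk] := df z zr z1; exists k; apply: hasd_near hk; exact: inn.
  by have [k hk] := dg z zr z1; exists k; apply: hasd_near hk; exact: out.
have cn z : cabs (z - z0) < r -> cont_at (circ_glue f g) z.
  move=> zr; have [z1|z1] := eqVneq (cabs z) 1; last by have [k /hasd_cont] := hn z zr z1.
  apply: cont_glue => //; first exact: fg.
    by apply: cf; rewrite ?z1.
  by apply: cg; rewrite ?z1.
move=> z zr; have [z1|z1] := eqVneq (cabs z) 1; last exact: hn.
apply: (@hasd_line_circle _ z (r - cabs (z - z0))) => //; first lra.
  move=> w hw; apply: cn; have := cabsD (w - z) (z - z0); rewrite addrA subrK; lra.
move=> w hw; apply: hn; have := cabsD (w - z) (z - z0); rewrite addrA subrK; lra.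
Qed.

End Holomorphic.

(** * The square of the abelian integral *)

Section Roots.
Context {R : realType}.
Local Notation C := (Cplx R).
Implicit Types (f g : C -> C) (c z a w : C) (r e : R).

(** [sqrtC] normalised to a nonnegative real part, which makes it holomorphic on the right half
    plane. *)
Definition psqrt z : C := if 0 <= complex.Re (sqrtC z : C) then sqrtC z else - sqrtC z.

Lemma psqrtK z : psqrt z ^+ 2 = z.
Proof. by rewrite /psqrt; case: ifP => _; rewrite ?sqrrN sqrtCK. Qed.

Lemma psqrt_Re_ge0 z : 0 <= complex.Re (psqrt z).
Proof. by rewrite /psqrt; case: ifP => // /negbT; rewrite ReN -ltNge; lra. Qed.

Lemma psqrt_Re_gt0 z : 0 < complex.Re z -> 0 < complex.Re (psqrt z).
Proof.
move=> z0; rewrite lt_def psqrt_Re_ge0 andbT; apply/eqP => h.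
by move: z0; rewrite -[z]psqrtK expr2 cReM h; have := sqr_ge0 (complex.Im (psqrt z)); lra.
Qed.

Lemma psqrt1 : psqrt 1 = 1.
Proof. by rewrite /psqrt sqrtC1 /= ler01. Qed.

Lemma hasd_psqrt z : 0 < complex.Re z -> hasd psqrt z ((psqrt z + psqrt z)^-1).
Proof.
move=> z0; have p0 := psqrt_Re_gt0 z0; set s := psqrt z in p0 *.
have ge w : complex.Re s <= cabs (psqrt w + s).
  apply: le_trans (Re_le_cabs _); apply: le_trans (ler_norm _).
  by rewrite ReD; have := psqrt_Re_ge0 w; lra.
have ne w : psqrt w + s != 0 by rewrite -cabs_gt0; have := ge w; lra.
have dE w : psqrt w = s + (w - z) * (psqrt w + s)^-1.
  have <- : (psqrt w - s) * (psqrt w + s) = w - z by rewrite -subr_sqr !psqrtK.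
  by rewrite mulfK // addrC subrK.
have cp : cont_at psqrt z.
  apply/cont_eps => e e0; apply/near_C; exists (e * complex.Re s); first by rewrite mulr_gt0.
  move=> w hw; rewrite (dE w) -/s addrAC subrr add0r cabsM cabsV ltr_pdivrMr ?cabs_gt0 //.
  by apply: lt_le_trans hw _; rewrite ler_pM2l.
exists (fun w => (psqrt w + s)^-1); split => //.
by apply: contV; [exact: ne | apply: contD => //; exact: cont_cst].
Qed.

Lemma near_Re_gt0 f c : cont_at f c -> 0 < complex.Re (f c) -> \forall w \near c, 0 < complex.Re (f w).
Proof.
move=> /cont_eps h h0; apply: filterS (h _ h0) => w hw.
by have := Re_le_cabs (f w - f c); rewrite ReD ReN ler_norml; lra.
Qed.

Lemma holo_sqrt f c r : 0 < r -> holo f c r -> f c != 0 ->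
  exists r' s, [/\ 0 < r', r' <= r, holo s c r' &
    forall z, cabs (z - c) < r' -> s z ^+ 2 = f z /\ f z != 0].
Proof.
move=> r0 hf fc; have cc : cabs (c - c) < r by rewrite subrr cabs0.
have cf : cont_at (fun z => f z / f c) c.
  by apply: contM; [exact: holo_cont hf cc | exact: cont_cst].
have /near_C[d d0 hd] : \forall w \near c, 0 < complex.Re (f w / f c).
  by apply: near_Re_gt0 => //; rewrite divff.
pose s z := sqrtC (f c) * psqrt (f z / f c).
exists (Num.min d r), s; split => [|||z].
- by rewrite lt_min d0.
- by rewrite ge_min lexx orbT.
- move=> z; rewrite lt_min => /andP[zd zr]; have [k hk] := hf z zr; eexists.
  apply: cderZ; first exact: id_C_cont.
  apply: (hasd_comp (f := fun z => f z / f c)); first by apply: hasd_psqrt; exact: hd.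
  by apply: cderM; [exact: id_C_cont | exact: hk | exact: cder_cst].
- rewrite lt_min => /andP[/hd zd _]; rewrite /s exprMn sqrtCK psqrtK mulrC divfK //; split => //.
  by apply/eqP => h; move: zd; rewrite h mul0r /=; lra.
Qed.

Lemma poly_mup (p : {poly C}) z : p != 0 ->
  exists q : {poly C}, [/\ p = q * ('X - z%:P) ^+ mup z p & q.[z] != 0].
Proof.
move=> p0; case: (multiplicity_XsubC p z) => m [q]; rewrite p0 /= => hq e.
exists q; split; last exact: hq.
by rewrite {2}e mupMr // mup_XsubCX eqxx.
Qed.

Lemma near_ball_exists c (P : C -> Prop) : (\forall z \near c, P z) ->
  exists2 d, 0 < d & forall z, cabs (z - c) < d -> P z.
Proof. by move/near_C. Qed.

(** The factor z - z0 on the left absorbs a possible simple pole: the order of Q at z0 is n - 1 >=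
    -1. *)
Lemma qeval_local (Q : qdiff R) z0 : ~ infinite_critical Q z0 ->
  exists n q d, [/\ 0 < d, holo q z0 d, q z0 != 0 &
    forall z, cabs (z - z0) < d -> z != z0 ->
      [/\ (z - z0) * qeval Q z = (z - z0) ^+ n * q z, (qnum Q).[z] != 0 & (qden Q).[z] != 0]].
Proof.
move=> hc; have [p1 [ep p10]] := poly_mup z0 (qnum_neq0 Q).
have [d1 [ed d10]] := poly_mup z0 (qden_neq0 Q).
set a := mup z0 (qnum Q) in ep; set b := mup z0 (qden Q) in ed.
have hb : (b <= 1)%N by rewrite leqNgt; apply/negP.
have np : \forall z \near z0, p1.[z] != 0 by apply: cont_neq0 => //; exact: cont_horner.
have nd : \forall z \near z0, d1.[z] != 0 by apply: cont_neq0 => //; exact: cont_horner.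
have [d d0 hd] : exists2 d, 0 < d & forall z, cabs (z - z0) < d -> p1.[z] != 0 /\ d1.[z] != 0.
  by apply/near_ball_exists; near=> z; split; near: z.
exists (a + (1 - b))%N, (fun z => p1.[z] / d1.[z]), d; split => //.
- apply: holoM; first exact: holo_poly.
  by apply: holoV; [move=> z /hd [] | exact: holo_poly].
- by rewrite mulf_neq0 // invr_eq0.
- move=> z zd zz; have [h1 h2] := hd z zd; have zz0 : z - z0 != 0 by rewrite subr_eq0.
  have eh (q : {poly C}) n : (q * ('X - z0%:P) ^+ n).[z] = q.[z] * (z - z0) ^+ n.
    by rewrite hornerM horner_exp hornerXsubC.
  rewrite /qeval ep ed !eh; split; last 2 first.
  + by rewrite mulf_neq0 // expf_neq0.
  + by rewrite mulf_neq0 // expf_neq0.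
  + have hb' : b = 0%N \/ b = 1%N by case: (b) hb => [|[|]] //; [left | right].
    move: (p1.[z]) (d1.[z]) (z - z0) h2 zz0 => u v x v0 x0.
    case: hb' => ->; rewrite ?subn0 ?subnn ?addn1 ?addn0 ?exprS ?expr0; move: (x ^+ a) => t.
      by field.
    by field; rewrite x0 v0.
Unshelve. all: by end_near. Qed.

Lemma holo_primitive f c r : 0 < r -> holo f c r ->
  exists P, [/\ holo P c (r / 3), P c = 0 & forall z, cabs (z - c) < r / 3 -> hasd P z (f z)].
Proof.
move=> r0 hf; have [||P hP] := @Morera_line _ f c r 0 r0.
- by move=> z; exact: holo_cont.
- by move=> z zr _; exact: hf.
have hP' z : cabs (z - c) < r / 3 -> hasd (fun w => P w - P c) z (f z).
  by move=> zr; rewrite -[f z]subr0; apply: cderB; [exact: hP | exact: cder_cst].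
exists (fun w => P w - P c); split => //; last by rewrite subrr.
by move=> z /hP' h; exists (f z).
Qed.

(* With zeta = z0 + y^2 the integral of sqrt Q is a holomorphic function P of
   y which is even or odd, so that its square W is a holomorphic function of
   zeta. *)
Lemma square_of_abelian_integral (Q : qdiff R) z0 : ~ infinite_critical Q z0 ->
  exists rho W, [/\ 0 < rho, holo W z0 rho, W z0 = 0 &
    forall z, cabs (z - z0) < rho -> z != z0 ->
      [/\ W z != 0, (qnum Q).[z] != 0, (qden Q).[z] != 0 &
          (W^`()%classic z) ^+ 2 = 4 * W z * qeval Q z]].
Proof.
move=> hc; have [n [q [d [d0 hq q0 hQ]]]] := qeval_local hc.
have [d1 [r [d10 d1d hr er]]] := holo_sqrt d0 hq q0.
pose e := Num.min 1 d1; have e0 : 0 < e by rewrite lt_min ltr01.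
have sq_small y : cabs y < e -> cabs (y ^+ 2) < d1.
  rewrite lt_min => /andP[y1 yd]; rewrite cabsX expr2; apply: le_lt_trans yd.
  by rewrite ler_piMl ?cabs_ge0 // ltW.
(* With zeta = z0 + y^2 one has Q = y^(2 n - 2) r^2, so that sqrt Q dzeta = y^(n - 1) r * 2 y dy = h
   dy. *)
pose h y := 2 * (y ^+ n * r (z0 + y ^+ 2)).
have hh : holo h 0 e.
  apply: holoM; first exact: holo_cst.
  apply: holoM; first by apply: holoX; exact: holo_id.
  move=> y; rewrite subr0 => /sq_small hy.
  have [|k hk] := hr (z0 + y ^+ 2); first by rewrite addrAC subrr add0r.
  eexists; apply: (hasd_comp (f := fun y => z0 + y ^+ 2)); first exact: hk.
  apply: cderD; first exact: cder_cst.
  by apply: cderX; [exact: id_C_cont | exact: cder_iota].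
have [P [hP P0 dP]] := holo_primitive e0 hh.
set e3 := e / 3 in hP dP; have e30 : 0 < e3 by rewrite /e3; lra.
(* [h] has the parity of n, hence its primitive [P] with P 0 = 0 has that of n + 1. *)
have parity y : cabs y < e3 -> P (- y) ^+ 2 = P y ^+ 2.
  move=> hy.
  have hz : P (- y) - (-1) ^+ n.+1 * P y = 0.
    have hb0 : P (- y) - (-1) ^+ n.+1 * P y = P (- 0) - (-1) ^+ n.+1 * P 0; last first.
      by rewrite hb0 oppr0 P0 mulr0 subrr.
    apply: (@ball_path R (fun y => P (- y) - (-1) ^+ n.+1 * P y) 0 y e3); first by rewrite subr0.
    move=> w; rewrite subr0 => hw.
    have h1 : hasd (fun y => P (- y)) w (h (- w) * -1).
      apply: (hasd_comp (f := fun y => - y)); first by apply: dP; rewrite subr0 cabsN.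
      exact: cderN (cder_iota _ _).
    have := cderB h1 (cderZ (@id_C_cont R) ((-1) ^+ n.+1) (dP w _)).
    rewrite subr0 => /(_ hw) h2; apply: cder_eq h2 _.
    rewrite /h sqrrN (exprS (-1) n) (exprNn w n).
    by move: ((-1) ^+ n : C) (w ^+ n) (r _) => u v x; ring.
  move/eqP: hz; rewrite subr_eq0 => /eqP ->.
  by rewrite exprMn -exprM mulnC exprM sqrrN !expr1n mul1r.
pose W z := P (sqrtC (z - z0)) ^+ 2.
have WE y : cabs y < e3 -> W (z0 + y ^+ 2) = P y ^+ 2.
  move=> hy; rewrite /W addrAC subrr add0r.
  have := sqrtCK (y ^+ 2) => /eqP; rewrite eqf_sqr => /orP[/eqP -> //|/eqP ->].
  exact: parity.
have h_neq0 y : cabs y < e -> y != 0 -> h y != 0.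
  move=> hy y0; rewrite /h mulf_neq0 ?pnatr_eq0 // mulf_neq0 ?expf_neq0 //.
  have [|h1 h2] := er (z0 + y ^+ 2); first by rewrite addrAC subrr add0r sq_small.
  by apply/eqP => h3; move: h2; rewrite -h1 h3 expr0n eqxx.
(* [P] is not identically 0, its derivative [h] being nonzero off 0; its zero at 0 is therefore
   isolated. *)
have Pnz : exists2 e4, 0 < e4 & forall y, cabs y < e4 -> y != 0 -> P y != 0.
  have [m [g [hg g0 eg]]] : exists m g, [/\ holo g 0 e3, g 0 != 0 & forall y, P y = (y - 0) ^+ m * g y].
    apply: zero_order => // eps eps0; apply: contrapT => hn.
    have P_0 y : cabs y < eps -> P y = 0.
      move=> hy; apply/eqP; apply: contrapT => /negP hy'; apply: hn; exists y => //.
      by rewrite subr0.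
    pose t := Num.min eps e3 / 2; have t0 : 0 < t by rewrite divr_gt0 // lt_min eps0.
    have [te te3] : t < eps /\ t < e3.
      have : Num.min eps e3 <= eps /\ Num.min eps e3 <= e3 by rewrite !ge_min !lexx orbT.
      by rewrite /t; lra.
    have ct : cabs (rC t : C) = t by rewrite cabs_rC ger0_norm // ltW.
    have h1 : hasd P (rC t) (h (rC t)) by apply: dP; rewrite subr0 ct.
    have h2 : hasd P (rC t) 0.
      apply: (hasd_near (f := fun=> 0)); last exact: cder_cst.
      have := @cabs_near R (rC t) 0 eps; rewrite subr0 ct => /(_ te).
      by apply: filterS => w; rewrite subr0 => /P_0.
    have := h_neq0 (rC t); rewrite ct rC_eq0 (hasd_unique h1 h2) eqxx => hf.
    have te' : t < e by move: te3; rewrite /e3; lra.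
    by have := hf te'; rewrite gt_eqF // => /(_ isT).
  have /near_C[e4 e40 he4] : \forall y \near 0, g y != 0.
    by apply: cont_neq0 => //; apply: (holo_cont hg); rewrite subrr cabs0.
  exists e4 => // y hy y0; rewrite eg subr0 mulf_neq0 ?expf_neq0 //.
  by apply: he4; rewrite subr0.
case: Pnz => e4 e40 hP4.
pose e5 := Num.min e3 e4; have e50 : 0 < e5 by rewrite lt_min e30.
have e53 : e5 <= e3 by rewrite ge_min lexx.
have e54 : e5 <= e4 by rewrite ge_min lexx orbT.
pose rho := Num.min (e5 ^+ 2) d; have rho0 : 0 < rho by rewrite lt_min exprn_gt0.
have root_small z : cabs (z - z0) < rho -> cabs (sqrtC (z - z0) : C) < e5.
  rewrite lt_min => /andP[+ _]; rewrite -[z - z0 in X in X -> _]sqrtCK cabsX.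
  by rewrite ltr_pXn2r ?nnegrE ?cabs_ge0 // ltW.
have W0 : W z0 = 0 by rewrite /W subrr sqrtC0 P0 expr0n.
have dW z : cabs (z - z0) < rho -> z != z0 ->
    hasd W z (2%:R * P (sqrtC (z - z0)) * (h (sqrtC (z - z0)) * (sqrtC (z - z0) / 2 / (z - z0)))).
  move=> zr zz; have zz0 : z - z0 != 0 by rewrite subr_eq0.
  have hy := root_small z zr; set y := sqrtC (z - z0) in hy *.
  have yy : y ^+ 2 = z - z0 by rewrite sqrtCK.
  (* A holomorphic branch of sqrt (w - z0) near z, in place of the discontinuous [sqrtC]; by parity
     P^2 does not distinguish the two. *)
  pose Y w := y * psqrt ((w - z0) / (z - z0)).
  have Yz : Y z = y by rewrite /Y divff // psqrt1 mulr1.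
  have hY : hasd Y z (y / 2 / (z - z0)).
    have hi : hasd (fun w => (w - z0) / (z - z0)) z (1 / (z - z0)).
      have := cderM (@id_C_cont R) (cderB (cder_iota id z) (cder_cst id z0 z)) (cder_cst id (z - z0)^-1 z).
      by move=> h1; apply: cder_eq h1 _; rewrite subr0 mulr0 addr0.
    have h1 : hasd psqrt ((fun w => (w - z0) / (z - z0)) z) (1 + 1)^-1.
      have := @hasd_psqrt 1; rewrite psqrt1 /= divff //; apply; exact: ltr01.
    have := cderZ (@id_C_cont R) y (hasd_comp (f := fun w => (w - z0) / (z - z0)) h1 hi).
    by move=> h2; apply: cder_eq h2 _; field; rewrite ?zz0.
  have hPY : hasd (fun w => P (Y w)) z (h y * (y / 2 / (z - z0))).
    apply: (hasd_comp (f := Y)) => //; rewrite Yz; apply: dP; rewrite subr0; lra.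
  have cY : cont_at Y z := hasd_cont hY.
  have := cderX (@id_C_cont R) 2 hPY; rewrite /= expr1 Yz mulrA.
  move=> h1; apply: cder_eq (hasd_near _ h1) _; last by rewrite !mulrA.
  have hYe : cabs (Y z) < e3 by rewrite Yz; lra.
  have /cont_eps/(_ (e3 - cabs (Y z)) _) h2 := cY.
  have {h2} := h2 _; rewrite subr_gt0 => /(_ hYe); apply: filterS => w hw.
  have eYw : z0 + Y w ^+ 2 = w.
    by rewrite /Y exprMn psqrtK yy mulrC divfK // addrC subrK.
  rewrite -{2}eYw WE //; have := cabsD (Y w - Y z) (Y z); rewrite subrK; lra.
exists rho, W; split => //.
  apply: holo_removable => [z zr|z zr zz]; last by eexists; exact: dW.
  have [->|zz] := eqVneq z z0; last by exact: hasd_cont (dW z zr zz).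
  have cP : cont_at P 0 by apply: (holo_cont hP); rewrite subrr cabs0.
  apply/cont_eps => eps eps0; pose eps1 := Num.min 1 eps.
  have eps10 : 0 < eps1 by rewrite lt_min ltr01.
  move/cont_eps: cP => /(_ _ eps10) /near_C[de de0 hde].
  apply/near_C; exists (Num.min rho (de ^+ 2)); first by rewrite lt_min rho0 exprn_gt0.
  move=> w; rewrite lt_min => /andP[w1 w2]; rewrite W0 subr0 /W cabsX.
  have w3 : cabs (sqrtC (w - z0) : C) < de.
    move: w2; rewrite -[w - z0 in X in X -> _]sqrtCK cabsX.
    by rewrite ltr_pXn2r ?nnegrE ?cabs_ge0 // ltW.
  have := hde (sqrtC (w - z0)); rewrite subr0 P0 subr0 => /(_ w3).
  rewrite lt_min => /andP[p1 p2]; apply: le_lt_trans p2; rewrite expr2 ler_piMl ?cabs_ge0 //.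
  exact: ltW.
move=> z zr zz; have zz0 : z - z0 != 0 by rewrite subr_eq0.
have zd : cabs (z - z0) < d by apply: lt_le_trans zr _; rewrite ge_min lexx orbT.
have [eQ nz dz] := hQ z zd zz.
have hy := root_small z zr; have dWz := hasd_derive1 (dW z zr zz).
set y := sqrtC (z - z0) in hy dWz.
have yy : y ^+ 2 = z - z0 by rewrite sqrtCK.
have y0 : y != 0 by apply/eqP => y0; move: zz0; rewrite -yy y0 expr0n eqxx.
split => //.
  by rewrite /W expf_neq0 // hP4 //; lra.
rewrite dWz.
have [r2 _] : r (z0 + y ^+ 2) ^+ 2 = q (z0 + y ^+ 2) /\ q (z0 + y ^+ 2) != 0.
  by apply: er; rewrite addrAC subrr add0r; apply: sq_small; rewrite /e3 in e53; lra.
have ez : z0 + y ^+ 2 = z by rewrite yy addrC subrK.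
rewrite ez in r2.
have -> : qeval Q z = (z - z0) ^+ n * q z / (z - z0) by rewrite -eQ mulrAC mulfV // mul1r.
rewrite -[W z]/(P y ^+ 2) /h ez -yy -r2 exprAC.
by move: (y ^+ n) (P y) (r z) => u v x; field; rewrite y0.
Qed.

End Roots.

(** * Arcs of a Jordan curve *)

Section CurveTopology.
Context {R : realType}.
Local Notation C := (Cplx R).
Implicit Types (z u v q w : C) (s t e a b : R).

Lemma within_cont_in (A : set C) (f : C -> C) : {within A, continuous f} ->
  forall z, A z -> cont_in A f z.
Proof.
move=> /subspace_continuousP h z Az e e0.
have /cvg_C/(_ e e0) := h z Az.
by rewrite near_withinE => /near_C[d d0 hd]; exists d => // w Aw wd; exact: hd.
Qed.

Lemma cont_in_comp (T : topologicalType) (A : set C) (f : C -> C) (p : T -> C) (x : T) :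
  cont_in A f (p x) -> cont_at p x -> (\forall y \near x, A (p y)) -> cont_at (fun y => f (p y)) x.
Proof.
move=> cf cp nA; apply/cont_eps => e e0; have [d d0 hd] := cf e e0.
move/cont_eps: cp => /(_ d d0); apply: filterS2 nA => s; exact: hd.
Qed.

(** Stereographic projection of the unit circle from [q], after the rotation that takes [q] to 1: a
    real coordinate on the circle without [q]. *)
Definition stereo q u : R := complex.Im (u / q) / (1 - complex.Re (u / q)).
Lemma unit_Re1 w : cabs w = 1 -> complex.Re w = 1 -> w = 1.
Proof.
move=> w1 h; apply: complex_eq => //=; have := cabs_sqr w; rewrite w1 h !expr1n => h2.
by apply/eqP; rewrite -sqrf_eq0; apply/eqP; lra.
Qed.

Lemma stereo_den q u : cabs q = 1 -> cabs u = 1 -> u <> q -> 1 - complex.Re (u / q) != 0.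
Proof.
move=> q1 u1 uq; rewrite subr_eq0 eq_sym; apply/eqP => h; apply: uq.
have q0 : q != 0 by rewrite -cabs_gt0 q1.
have w1 : cabs (u / q) = 1 by rewrite cabsM cabsV q1 u1 invr1 mulr1.
by rewrite -[u](divfK q0) (unit_Re1 w1 h) mul1r.
Qed.

Lemma stereo_inj q u v : cabs q = 1 -> cabs u = 1 -> cabs v = 1 -> u <> q -> v <> q ->
  stereo q u = stereo q v -> u = v.
Proof.
move=> q1 u1 v1 uq vq; have d1 := stereo_den q1 u1 uq; have d2 := stereo_den q1 v1 vq.
have q0 : q != 0 by rewrite -cabs_gt0 q1.
suff : stereo q u = stereo q v -> u / q = v / q by move=> h /h /(mulIf (invr_neq0 q0)).
have := cabs_sqr (u / q); have := cabs_sqr (v / q).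
rewrite !cabsM !cabsV q1 u1 v1 invr1 mulr1 expr1n.
move: d1 d2; rewrite /stereo; case: (u / q) => x y; case: (v / q) => x' y' /= d1 d2 h1 h2 h.
set k := y / (1 - x) in h.
have ey : y = k * (1 - x) by rewrite /k divfK.
have ey' : y' = k * (1 - x') by rewrite h divfK.
clearbody k.
have e1 : (1 + k ^+ 2) * x = k ^+ 2 - 1.
  by apply: (mulfI d1); rewrite ey in h2; lra.
have e2 : (1 + k ^+ 2) * x' = k ^+ 2 - 1.
  by apply: (mulfI d2); rewrite ey' in h1; lra.
have k0 : 1 + k ^+ 2 != 0 by rewrite gt_eqF // ltr_pwDl // sqr_ge0.
have ex : x = x' by apply: (mulfI k0); rewrite e1 e2.
by apply: complex_eq => //=; rewrite ey ey' ex.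
Qed.

Lemma cont_stereo (T : topologicalType) q (p : T -> C) (x : T) : cabs q = 1 -> cabs (p x) = 1 ->
  p x <> q -> cont_at p x -> cont_at (fun y => stereo q (p y)) x.
Proof.
move=> q1 u1 uq cp; have d := stereo_den q1 u1 uq.
have c1 : cont_at (fun y => p y / q) x by apply: contM => //; exact: cont_cst.
have [r1] := cont_Re c1; have [i1] := cont_Im c1.
split; apply: cvgM => //; apply: cvgV => //.
by apply: cvgB => //; exact: cvg_cst.
Qed.

Lemma cont_within_itv (f : R -> R) a b : (forall t, a <= t <= b -> cont_at f t) ->
  {within `[a, b], continuous f}.
Proof.
move=> h; apply: continuous_in_subspaceT => t; rewrite inE /= in_itv /= => tab.
by have [] := h t tab.
Qed.

Lemma IVT_between (f : R -> R) a b y : a <= b -> (forall t, a <= t <= b -> cont_at f t) ->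
  f a <= y <= f b \/ f b <= y <= f a -> exists2 t, a <= t <= b & f t = y.
Proof.
move=> ab cf h; have [|t tab ft] := @IVT R f a b y ab (cont_within_itv cf).
  by case: (leP (f a) (f b)); case: h; lra.
by exists t => //; move: tab; rewrite in_itv.
Qed.

Lemma cont_inj_mono (f : R -> R) a b : (forall t, a <= t <= b -> cont_at f t) ->
  (forall s t, a <= s <= b -> a <= t <= b -> f s = f t -> s = t) ->
  (forall s t, a <= s -> s < t -> t <= b -> f s < f t) \/
  (forall s t, a <= s -> s < t -> t <= b -> f t < f s).
Proof.
move=> cf fi; have inj : {in `[a, b] &, injective f}.
  by move=> s t; rewrite !in_itv /= => hs ht; exact: fi.
case: (itv_continuous_inj_mono (cont_within_itv cf) inj) => h.
- by left=> s t sa st tb; apply: h => //; rewrite in_itv /=; lra.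
- by right=> s t sa st tb; apply: h => //; rewrite in_itv /=; lra.
Qed.

Section Jordan.
Variables (Gamma : set C) (gam : C -> C).
Hypotheses (cgam : forall v, cabs v = 1 -> cont_in [set v | cabs v = 1] gam v)
  (igam : forall u v, cabs u = 1 -> cabs v = 1 -> gam u = gam v -> u = v)
  (egam : forall z, Gamma z <-> exists2 v, cabs v = 1 & z = gam v).

Lemma cont_gam_cis t : cont_at (fun s => gam (cis s)) t.
Proof.
apply: (cont_in_comp (A := [set v | cabs v = 1])); first by apply: cgam; exact: cabs_cis.
  exact: cont_cis.
by apply: filterE => s /=; exact: cabs_cis.
Qed.

(** A continuous injection of a compact set has a continuous inverse; the compactness used is that
    of the interval of arguments. *)
Lemma gam_inv_cont v0 e : cabs v0 = 1 -> 0 < e ->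
  exists2 d, 0 < d & forall v, cabs v = 1 -> cabs (gam v - gam v0) < d -> cabs (v - v0) < e.
Proof.
move=> v01 e0.
have : near_covering `[- pi : R, pi] by apply/compact_near_coveringP; exact: segment_compact.
move=> /(_ R (0 : R)^'+ (fun d t => cabs (gam (cis t) - gam v0) < d -> cabs (cis t - v0) < e) _).
have H : forall t, `[- pi : R, pi]%classic t ->
    \forall t' \near t & d \near (0 : R)^'+, cabs (gam (cis t') - gam v0) < d -> cabs (cis t' - v0) < e.
  move=> t _; have [ev|ev] := eqVneq (cis t) v0.
    have /cont_eps/(_ e e0) h := cont_cis t.
    exists ([set t' | cabs (cis t' - v0) < e], [set: R]) => /=.
      by split; [rewrite -ev | exact: filterT].
    by move=> [t' d] /= [].
  have m0 : 0 < cabs (gam (cis t) - gam v0).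
    rewrite cabs_gt0 subr_eq0; apply/eqP => /igam h; move/eqP: ev; apply; apply: h => //.
    exact: cabs_cis.
  set m := cabs (gam (cis t) - gam v0) in m0.
  have m2 : 0 < m / 2 by lra.
  have /cont_eps/(_ _ m2) h := cont_gam_cis t.
  exists ([set t' | cabs (gam (cis t') - gam (cis t)) < m / 2], [set d | d < m / 2]) => /=.
    split => //; apply: nbhs_right_lt; exact: m2.
  move=> [t' d] /= [h1 h2] h3; exfalso.
  have := cabsD (gam (cis t) - gam (cis t')) (gam (cis t') - gam v0).
  rewrite addrA subrK -/m (cabsC (gam (cis t))); lra.
move=> /(_ H) h; have /filter_ex : \forall d \near (0 : R)^'+, 0 < d /\
    (forall t, `[- pi : R, pi]%classic t -> cabs (gam (cis t) - gam v0) < d -> cabs (cis t - v0) < e).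
  by near=> d; split; near: d; [exact: nbhs_right_gt | exact: h].
move=> [d [d0 hd]]; exists d => // v v1; have [t ht ->] := cabs1_cis v1.
by apply: hd; rewrite /= in_itv.
Unshelve. all: by end_near. Qed.

Variables (c : R -> C) (a b : R).
Hypotheses (cc : forall s, a < s < b -> cont_at c s) (cG : forall s, a < s < b -> Gamma (c s)).

Lemma arc_lift : exists th : R -> C, forall s, a < s < b ->
  [/\ cabs (th s) = 1, gam (th s) = c s & cont_at th s].
Proof.
pose P s v := cabs v = 1 /\ gam v = c s.
have hP s : a < s < b -> exists v, P s v.
  by move=> /cG /egam [v v1 e]; exists v.
pose th s := xget 0 [set v | P s v].
have hth s : a < s < b -> P s (th s).
  by move=> /hP [v hv]; have := @xgetPex _ 0 [set v | P s v]; apply; exists v.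
exists th => s sab; have [h1 h2] := hth s sab; split => //.
apply/cont_eps => e e0; have [d d0 hd] := gam_inv_cont h1 e0.
have /cont_eps/(_ d d0) := cc sab.
have : \forall s' \near s, a < s' < b.
  apply/near_R; exists (Num.min (s - a) (b - s)); first by rewrite lt_min; lra.
  by move=> s'; rewrite lt_min !ltr_norml; lra.
by apply: filterS2 => s' /hth [h3 h4] h5; apply: hd => //; rewrite h2 h4.
Qed.

Hypothesis ci : forall s t, a < s < b -> a < t < b -> c s = c t -> s = t.

(** In a stereographic coordinate of the circle the lifted arc becomes a continuous injective real
    function. It is monotone, and by the intermediate value theorem its image contains a
    neighbourhood of the point. *)
Lemma arc_open s1 eta : a < s1 < b -> 0 < eta ->
  exists2 d, 0 < d & forall z, Gamma z -> cabs (z - c s1) < d ->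
    exists s, [/\ a < s < b, `|s - s1| < eta & z = c s].
Proof.
move=> s1ab eta0; have [th hth] := arc_lift.
have [v1 gv1 cv1] := hth s1 s1ab; set v := th s1 in v1 gv1.
(* The centre of projection is antipodal to [v]: points at distance less than 1 from [v] differ from
   it. *)
pose q := - v; have q1 : cabs q = 1 by rewrite cabsN.
have near_ne u : cabs (u - v) < 1 -> u <> q.
  move=> h e; move: h; rewrite e /q -opprD cabsN -mulr2n -mulr_natl cabsM v1 mulr1.
  by rewrite (_ : 2%:R = rC 2) ?cabs_rC ?ger0_norm // ?rCE ?rmorph_nat //; lra.
have /cont_eps/(_ 1 ltr01)/near_R[d1 d10 hd1] := cv1; rewrite -/v in hd1.
pose m := Num.min (Num.min (d1 / 2) (eta / 2)) (Num.min ((s1 - a) / 2) ((b - s1) / 2)).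
have m0 : 0 < m by rewrite !lt_min; lra.
have [l1 l2 l3 l4] : [/\ m <= d1 / 2, m <= eta / 2, m <= (s1 - a) / 2 & m <= (b - s1) / 2].
  by rewrite /m; split; rewrite !ge_min lexx ?orbT.
pose X s := stereo q (th s).
have ins s : s1 - m <= s <= s1 + m -> a < s < b by lra.
have hX s : s1 - m <= s <= s1 + m -> cabs (th s - v) < 1.
  by move=> hs; apply: hd1; rewrite ltr_norml; lra.
have cX s : s1 - m <= s <= s1 + m -> cont_at X s.
  move=> hs; have [h1 h2 h3] := hth s (ins s hs); apply: cont_stereo => //.
  by apply: near_ne; exact: hX.
have iX s t : s1 - m <= s <= s1 + m -> s1 - m <= t <= s1 + m -> X s = X t -> s = t.
  move=> hs ht e; apply: ci; [exact: ins|exact: ins|].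
  have [h1 h2 _] := hth s (ins s hs); have [h1' h2' _] := hth t (ins t ht).
  rewrite -h2 -h2'; congr gam; apply: stereo_inj e => //.
    by apply: near_ne; exact: hX.
  by apply: near_ne; exact: hX.
have sandwich : exists2 e, 0 < e & forall x, `|x - X s1| < e -> exists2 s, s1 - m <= s <= s1 + m & X s = x.
  have mm : s1 - m <= s1 + m by lra.
  case: (cont_inj_mono cX iX) => mono.
    have h1 : X (s1 - m) < X s1 by apply: mono; lra.
    have h2 : X s1 < X (s1 + m) by apply: mono; lra.
    exists (Num.min (X s1 - X (s1 - m)) (X (s1 + m) - X s1)); first by rewrite lt_min; lra.
    move=> x; rewrite lt_min !ltr_norml => hx; apply: IVT_between => //; left; lra.
  have h1 : X s1 < X (s1 - m) by apply: mono; lra.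
  have h2 : X (s1 + m) < X s1 by apply: mono; lra.
  exists (Num.min (X (s1 - m) - X s1) (X s1 - X (s1 + m))); first by rewrite lt_min; lra.
  move=> x; rewrite lt_min !ltr_norml => hx; apply: IVT_between => //; right; lra.
case: sandwich => e e0 he.
have vq : v <> q by apply: near_ne; rewrite subrr cabs0.
have [/cvg_R/(_ e e0)/near_C[d2 d20 hd2]] := @cont_stereo C q id v q1 v1 vq (cont_id v).
pose d3 := Num.min d2 1; have d30 : 0 < d3 by rewrite lt_min d20 ltr01.
have [d d0 hd] := gam_inv_cont v1 d30.
exists d => // z /egam [u u1 ->]; rewrite -gv1 => /(hd u u1); rewrite lt_min => /andP[u2 u3].
have [s hs es] := he _ (hd2 u u2).
have [h1 h2 _] := hth s (ins s hs).
exists s; split; [exact: ins|by rewrite ltr_norml; lra|].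
rewrite -h2; congr gam; apply: (stereo_inj q1 u1 h1 (near_ne _ u3) _ (esym es)).
by apply: near_ne; exact: hX.
Qed.

End Jordan.

(* J is path connected; only the two ends of the corresponding interval can be
   boundary points. *)
Lemma path_connected_boundary (J : set C) :
  (forall v, J v -> cabs v = 1) ->
  (forall v w, J v -> J w -> exists p a b, [/\ a <= b, p a = v, p b = w &
     forall t, a <= t <= b -> J (p t) /\ cont_at p t]) ->
  finite_set [set v | [/\ cabs v = 1, ~ J v & forall e, 0 < e -> exists2 w, J w & cabs (w - v) < e]].
Proof.
move=> J1 Jp; set B := [set v | _].
(* A boundary point [q] is outside [J], so that the projection from [q] is defined on [J]; its image
   [S] is convex because [J] is path connected. *)
have [[q [q1 Jq hq]]|hB] := pselect (exists q, B q); last first.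
  by rewrite (_ : B = set0) //; apply/seteqP; split => // v Bv; case: hB; exists v.
have Jne v : J v -> v <> q by move=> Jv e; apply: Jq; rewrite -e.
pose S := [set x | exists2 v, J v & stereo q v = x].
have between (x y z : R) : S x -> S z -> x < y < z -> S y.
  move=> [v Jv ev] [w Jw ew] xyz; have [p [a [b [ab pa pb hp]]]] := Jp v w Jv Jw.
  have [||t tab et] := @IVT_between (fun t => stereo q (p t)) a b y ab.
  - move=> t tab; have [h1 h2] := hp t tab; apply: cont_stereo => //; [exact: J1 | exact: Jne].
  - by left; rewrite pa pb ev ew; lra.
  - by exists (p t) => //; have [] := hp t tab.
pose A := [set x | ~ S x /\ forall e, 0 < e -> exists2 y, S y & `|y - x| < e].
(* The middle one of three limit points of [S] would lie between two points of [S], hence in [S]. *)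
have noMid (x y z : R) : A x -> A y -> A z -> x < y -> y < z -> False.
  move=> [_ hx] [Sy _] [_ hz] xy yz; apply: Sy.
  have [|x' Sx' hx'] := hx (y - x); first lra.
  have [|z' Sz' hz'] := hz (z - y); first lra.
  by apply: (between x' y z') => //; move: hx' hz'; rewrite !ltr_norml; lra.
have BA v : B v -> v <> q -> A (stereo q v).
  move=> [v1 Jv hv] vq; split.
    by move=> [w Jw e]; apply: Jv; rewrite -(stereo_inj q1 (J1 _ Jw) v1 (Jne _ Jw) vq e).
  move=> e e0; have [/cvg_R/(_ e e0)/near_C[d d0 hd]] := @cont_stereo C q id v q1 v1 vq (cont_id v).
  by have [w Jw wd] := hv d d0; exists (stereo q w); [exists w | exact: hd].
have distinct u v w : B u -> B v -> B w -> u <> q -> v <> q -> w <> q ->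
    u <> v -> v <> w -> u <> w -> False.
  move=> Bu Bv Bw uq vq wq uv vw uw.
  have hne x y : B x -> B y -> x <> q -> y <> q -> x <> y -> stereo q x <> stereo q y.
    by move=> [x1 _ _] [y1 _ _] xq yq xy e; apply: xy; exact: (stereo_inj q1 x1 y1 xq yq e).
  have := hne u v Bu Bv uq vq uv; have := hne v w Bv Bw vq wq vw; have := hne u w Bu Bw uq wq uw.
  have := BA u Bu uq; have := BA v Bv vq; have := BA w Bw wq.
  move: (stereo q u) (stereo q v) (stereo q w) => x y z Az Ay Ax /eqP xz /eqP yz /eqP xy.
  move: xz yz xy; rewrite !neq_lt => /orP[?|?] /orP[?|?] /orP[?|?];
   solve [exact: (noMid x y z)|exact: (noMid x z y)|exact: (noMid y x z)|
          exact: (noMid y z x)|exact: (noMid z x y)|exact: (noMid z y x)|lra].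
have [[u [Bu uq]]|h1] := pselect (exists u, B u /\ u <> q); last first.
  apply: (sub_finite_set (B := [set q])); last exact: finite_set1.
  by move=> v Bv /=; apply: contrapT => vq; apply: h1; exists v.
have [[v [Bv vq uv]]|h2] := pselect (exists v, [/\ B v, v <> q & u <> v]); last first.
  apply: (sub_finite_set (B := [set q; u])); last exact: finite_set2.
  move=> v Bv /=; apply: contrapT => hn; apply: h2; exists v; split => // e; apply: hn; [by left|by right].
apply: (sub_finite_set (B := [set q; u; v])); last exact: finite_set3.
move=> w Bw /=; apply: contrapT => hn.
have wq : w <> q by move=> e; apply: hn; left; left.
have wu : w <> u by move=> e; apply: hn; left; right.
have wv : w <> v by move=> e; apply: hn; right.
by apply: (distinct u v w Bu Bv Bw uq vq wq uv) => e; [apply: wv|apply: wu].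
Qed.

End CurveTopology.

(** * Trajectory arcs, and the reality of W along them *)

Section Arcs.
Context {R : realType}.
Local Notation C := (Cplx R).
Implicit Types (z u v w : C) (s t e a b : R).

(** A common form for open arcs and closed curves, with [sg] true for the orthogonal ones.
    Injectivity is asked at distances less than 1 only, so that a closed curve can be parametrised
    by more than one period, with each of its points interior to the interval. *)
Definition arc_curve (Q : qdiff R) (A : set C) : Prop :=
  exists (c vel : R -> C) (a b : R) (sg : bool),
   [/\ forall z, A z <-> exists2 s, a < s < b & z = c s,
       forall s, a < s < b -> hasdr c s (vel s),
       forall s, a < s < b -> 0 < (-1) ^+ sg * (qeval Q (c s) * vel s ^+ 2) &
       forall s t, a < s < b -> a < t < b -> `|s - t| < 1 -> c s = c t -> s = t].

(** The last clause excludes any other branch of [Gamma] near z1, including one with a parameter far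
    from s1. *)
Definition regular_arc (Q : qdiff R) (Gamma : set C) z1 : Prop :=
  exists (c vel : R -> C) (s1 eta : R) (sg : bool),
   [/\ 0 < eta, c s1 = z1,
       forall s, `|s - s1| < eta -> hasdr c s (vel s),
       forall s, `|s - s1| < eta -> 0 < (-1) ^+ sg * (qeval Q (c s) * vel s ^+ 2) &
       forall e, 0 < e -> exists2 d, 0 < d & forall z, Gamma z -> cabs (z - z1) < d ->
          exists2 s, `|s - s1| < e & z = c s].

Lemma open_arc_curve Q (sg : bool) (f : C -> C) A : (forall z, f z = (-1) ^+ sg * qeval Q z) ->
  positive_open_arc f A -> arc_curve Q A.
Proof.
move=> ef [gam [eA inj der pos]].
have mem s : 0 < s < 1 -> (rC @` `]0, 1[) (rC s : C).
  by move=> s01; exists s => //; rewrite /= in_itv.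
exists (fun s => gam (rC s)), (fun s => gam^`()%classic (rC s)), 0, 1, sg; split.
- move=> z; rewrite eA; split.
    by move=> [_ [s /= s01 <-] <-]; exists s => //; move: s01; rewrite in_itv.
  by move=> [s s01 ->]; exists (rC s) => //; exact: mem.
- move=> s s01; have [|e e0 he] := iffLR (near_C (rC s) _) (der s _); first by rewrite in_itv.
  have hd : hasd gam (rC s) (gam^`()%classic (rC s)).
    by apply: derivable_hasd; apply: he; rewrite subrr cabs0.
  by have := hasdr_comp hd (cder_iota rC s); rewrite mulr1.
- by move=> s s01; rewrite mulrA -ef; apply: pos; rewrite in_itv.
- move=> s t hs ht _ /inj; rewrite !inE => h; apply: rC_inj; apply: h; exact: mem.
Qed.

Lemma closed_arc_curve Q (sg : bool) (f : C -> C) A : (forall z, f z = (-1) ^+ sg * qeval Q z) ->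
  positive_closed_curve f A -> arc_curve Q A.
Proof.
move=> ef [gam [eA inj der pos]].
have p0 := @pi_gt0 R; have p1 := @pihalf_ge1 R.
exists (fun s => gam (cis s)), (fun s => 'i * cis s * gam^`()%classic (cis s)), (- pi - 1), (pi + 1), sg; split.
- move=> z; rewrite eA; split.
    move=> [w w1 <-]; have [|t ht ->] := @cabs1_cis R w.
      by apply: rC_inj; rewrite -cabsE.
    by exists t => //; lra.
  by move=> [s _ ->]; exists (cis s) => //=; rewrite /unit_circle /= cabsE cabs_cis.
- move=> s _; have [|e e0 he] := iffLR (near_C (cis s) _) (der (cis s) _).
    by rewrite /unit_circle /= cabsE cabs_cis.
  have hd : hasd gam (cis s) (gam^`()%classic (cis s)).
    by apply: derivable_hasd; apply: he; rewrite subrr cabs0.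
  by have := hasdr_comp hd (hasdr_cis s); rewrite mulrC.
- move=> s _; rewrite mulrA -ef; apply: pos.
  by rewrite /unit_circle /= cabsE cabs_cis.
- move=> s t _ _ st /inj; rewrite !inE /unit_circle /= !cabsE !cabs_cis => h.
  by apply: cis_inj; [lra | exact: h].
Qed.

Lemma trajectory_arc_curve Q A :
  trajectory_arc (qeval Q) A \/ orthogonal_trajectory_arc (qeval Q) A -> arc_curve Q A.
Proof.
have key (sg : bool) (f : C -> C) T : (forall z, f z = (-1) ^+ sg * qeval Q z) ->
    trajectory f T -> A = T \/ A `<=` T /\ positive_open_arc f A -> arc_curve Q A.
  move=> ef hT [->|[_ hA]]; last exact: (@open_arc_curve _ sg f).
  by case: hT => [h|[h _]]; [exact: (@closed_arc_curve _ sg f) | exact: (@open_arc_curve _ sg f)].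
case=> [[T hT hA]|[T hT hA]].
  by apply: (key false) hT hA => z; rewrite expr0 mul1r.
by apply: (key true) hT hA => z; rewrite expr1 mulN1r.
Qed.

(** The preimage of an arc on the circle is path connected, hence has finitely many boundary points
    outside itself; their images form [X]. A point on an arc is regular by [arc_open]. *)
Lemma arcs_structure Q Gamma : jordan_curve Gamma -> made_of_trajectory_arcs Q Gamma ->
  exists2 X : set C, finite_set X &
    forall z, Gamma z -> ~ X z -> regular_arc Q Gamma z.
Proof.
move=> [gam [cg ig eG]] [n [A [hA eA]]].
have T1 v : cabs v = 1 <-> (unit_circle : set C) v.
  rewrite /unit_circle /= cabsE -(rC1 (R := R)); split=> [->//|]; exact: rC_inj.
have cgam v : cabs v = 1 -> cont_in [set v | cabs v = 1] gam v.
  move=> v1 e e0; have [d d0 hd] := within_cont_in cg (iffLR (T1 v) v1) e0.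
  by exists d => // w /T1 w1; exact: hd.
have igam u v : cabs u = 1 -> cabs v = 1 -> gam u = gam v -> u = v.
  by move=> /T1 u1 /T1 v1; apply: ig; rewrite inE.
have egam z : Gamma z <-> exists2 v, cabs v = 1 & z = gam v.
  rewrite eG; split=> [[v /T1 v1 <-]|[v /T1 v1 ->]]; by exists v.
have AG i z : A i z -> Gamma z.
  by move=> Az; rewrite eA; exists i => //; exact: subset_closure.
have hc i := trajectory_arc_curve (hA i).
pose J i := [set v | cabs v = 1 /\ A i (gam v)].
pose B i := [set v | [/\ cabs v = 1, ~ J i v & forall e, 0 < e -> exists2 w, J i w & cabs (w - v) < e]].
have fB i : finite_set (B i).
  apply: path_connected_boundary => [v []//|v w [v1 Av] [w1 Aw]].
  have [c [vel [a [b [sg [hAc dc _ _]]]]]] := hc i.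
  have [th hth] := arc_lift cgam igam egam (fun s hs => hasdr_cont (dc s hs))
     (fun s hs => AG i (c s) (iffRL (hAc _) (ex_intro2 _ _ s hs erefl))).
  move/hAc: Av => [s hs es]; move/hAc: Aw => [s' hs' es'].
  have lift_eq t x : a < t < b -> cabs x = 1 -> gam x = c t -> th t = x.
    by move=> /hth[h1 h2 _] x1 ex; apply: igam => //; rewrite h2.
  have Jth t : a < t < b -> J i (th t) /\ cont_at th t.
    by move=> ht; have [h1 h2 h3] := hth t ht; split => //; split => //; rewrite h2; apply/hAc; exists t.
  case: (leP s s') => ss.
    exists th, s, s'; split => //; [exact: lift_eq|exact: lift_eq|].
    by move=> t tt; apply: Jth; lra.
  exists (fun t => th (- t)), (- s), (- s'); rewrite !opprK; split.
  - lra.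
  - exact: lift_eq.
  - exact: lift_eq.
  - move=> t tt; have [h1 h2] := Jth (- t) ltac:(lra); split => //.
    apply: (cont_comp (g := th)) => //; split; exact: (@continuousN R R^o R (fun x => x) t).
exists (\bigcup_(i in [set: 'I_n]) (gam @` B i)).
  by apply: bigcup_finite => // i _; apply: finite_image; exact: fB.
move=> z Gz; have [v v1 ez] := iffLR (egam z) Gz.
(* A point on none of the arcs is in the closure of one of them, hence in [X]. *)
have [[i Ai]|none] := pselect (exists i, A i z); last first.
  case; move: (Gz); rewrite eA => -[i _ ci]; exists i => //; exists v => //; split => //.
    by move=> [_]; rewrite -ez => h; apply: none; exists i.
  move=> e e0; have [d d0 hd] := gam_inv_cont cgam igam v1 e0.
  have [z' [Az' zz']] := ci [set y | cabs (y - z) < d] (iffRL (nbhs_C _ _) (ex_intro2 _ _ d d0 (fun w h => h))).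
  have [w w1 ew] := iffLR (egam z') (AG i z' Az').
  exists w; first by split => //; rewrite -ew.
  by apply: hd => //; rewrite -ew -ez.
move=> _; have [c [vel [a [b [sg [hAc dc pc ic]]]]]] := hc i.
move/hAc: Ai => [s1 hs1 es1].
(* Parameters within 1 / 2 of s1 differ by less than 1, where [arc_curve] provides injectivity. *)
pose eta := Num.min (1 / 2) (Num.min (s1 - a) (b - s1)).
have eta0 : 0 < eta by rewrite !lt_min; lra.
have [l1 l2 l3] : [/\ eta <= 1 / 2, eta <= s1 - a & eta <= b - s1].
  by rewrite /eta; split; rewrite !ge_min lexx ?orbT.
exists c, vel, s1, eta, sg; split => //.
- by move=> s; rewrite ltr_norml => hs; apply: dc; lra.
- by move=> s; rewrite ltr_norml => hs; apply: pc; lra.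
- move=> e e0; have ss : s1 - eta < s1 < s1 + eta by lra.
  have cc s : s1 - eta < s < s1 + eta -> cont_at c s by move=> hs; apply: (hasdr_cont (dc s _)); lra.
  have cG s : s1 - eta < s < s1 + eta -> Gamma (c s).
    by move=> hs; apply: (AG i); apply/hAc; exists s => //; lra.
  have ci s t : s1 - eta < s < s1 + eta -> s1 - eta < t < s1 + eta -> c s = c t -> s = t.
    by move=> hs ht; apply: ic; rewrite ?ltr_norml; lra.
  have [d d0 hd] := arc_open cgam igam egam cc cG ci ss e0.
  rewrite -es1 in hd; exists d => // z' Gz' zz'; have [s [_ h1 h2]] := hd z' Gz' zz'.
  by exists s.
Qed.

Lemma finite_dist (X : set C) z : finite_set X -> ~ X z ->
  exists2 d, 0 < d & forall x, X x -> d <= cabs (x - z).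
Proof.
move=> /finite_seqP[l ->]; elim: l => [|y l IH] /= nX; first by exists 1.
have [|d d0 hd] := IH; first by move=> zl; apply: nX; rewrite inE zl orbT.
have yz : 0 < cabs (y - z).
  by rewrite cabs_gt0 subr_eq0; apply/eqP => e; apply: nX; rewrite e inE eqxx.
exists (Num.min d (cabs (y - z))); first by rewrite lt_min d0.
move=> x; rewrite inE => /orP[/eqP ->|xl]; first by rewrite ge_min lexx orbT.
by rewrite ge_min hd.
Qed.

(** The indicator of the set where f equals f s has derivative 0, hence is constant. *)
Lemma locally_constant (T : Type) (f : R -> T) a b :
  (forall t, a < t < b -> exists2 e, 0 < e & forall s, `|s - t| < e -> f s = f t) ->
  forall s t, a < s < b -> a < t < b -> f s = f t.
Proof.
move=> h s t hs ht.
wlog st : s t hs ht / s < t.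
  move=> H; case: (ltgtP s t) => [|ts|->] //; first exact: H.
  by apply/esym/H.
pose g x : C := if `[< f x = f s >] then 1 else 0.
have gts : g t = g s.
  apply: hasdr0_cst => [|x hx]; first exact: ltW.
  have [|e e0 he] := h x; first lra.
  apply: (hasdr_near (f := fun=> g x)); last exact: cder_cst.
  by apply/near_R; exists e => // y /he eq; rewrite /g eq.
move: gts; rewrite /g (asboolT (erefl (f s))); case: asboolP => [-> //|_] /eqP.
by rewrite eq_sym oner_eq0.
Qed.

Lemma pos_square_real (z : C) : 0 < z ^+ 2 -> complex.Im z = 0 /\ complex.Re z <> 0.
Proof.
move=> h; have := h; rewrite ltcE expr2 cImM cReM /= => /andP[/eqP h1 h2].
have {}h2 : 0 < complex.Re z * complex.Re z - complex.Im z * complex.Im z := h2.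
have h3 : complex.Re z * complex.Im z = 0 by move: h1; lra.
move/eqP: h3; rewrite mulf_eq0 => /orP[/eqP e|/eqP e].
  by move: h2; rewrite e mul0r; have := sqr_ge0 (complex.Im z); rewrite expr2; lra.
by split => // e2; move: h2; rewrite e e2; lra.
Qed.

Lemma neg_square_imag (z : C) : 0 < - z ^+ 2 -> complex.Re z = 0 /\ complex.Im z <> 0.
Proof.
move=> h; have h2 : 0 < ('i * z) ^+ 2 by rewrite exprMn sqrCi mulN1r.
have [h3 h4] := pos_square_real h2.
move: h3 h4; rewrite iE cImM cReM /=; split; first lra.
by move=> e; apply: h4; rewrite e; lra.
Qed.

Lemma cont_nbhs {T : topologicalType} (f : T -> C) (x : T) (P : C -> Prop) : cont_at f x ->
  (\forall z \near f x, P z) -> \forall y \near x, P (f y).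
Proof. by move=> [h] hP; exact: h. Qed.

(* |z| - Re z = 2 (Im s)^2 and |z| + Re z = 2 (Re s)^2 if s^2 = z, which makes
   these two quantities a substitute for the choice of a square root of z. *)
Definition half_sq (sg : bool) (z : C) : R := cabs z - (-1) ^+ sg * complex.Re z.

Lemma half_sqE sg (s : C) : half_sq sg (s ^+ 2) =
  2 * (if sg then complex.Re s else complex.Im s) ^+ 2.
Proof.
rewrite /half_sq cabsX cabs_sqr [s ^+ 2]expr2 cReM.
by case: sg; rewrite ?expr0 ?expr1; ring.
Qed.

Lemma half_sq0 sg (z : C) : half_sq sg z = 0 -> complex.Im z = 0.
Proof.
rewrite /half_sq => h; have h1 : cabs z = (-1) ^+ sg * complex.Re z by lra.
have := cabs_sqr z; rewrite h1 exprMn -exprM mulnC exprM sqrrN !expr1n mul1r => h2.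
by apply/eqP; rewrite -sqrf_eq0; apply/eqP; lra.
Qed.

Lemma cont_half_sq (T : topologicalType) sg (f : T -> C) (x : T) : cont_at f x ->
  cont_at (fun y => half_sq sg (f y)) x.
Proof.
move=> cf; have [c1] := cont_cabs cf; have [c2] := cont_Re cf.
by split; apply: cvgB => //; apply: cvgM => //; exact: cvg_cst.
Qed.

Lemma real_derive_inj (f df : R -> R) a b :
  (forall t, a < t < b -> is_derive t (1 : R) f (df t)) ->
  (forall t, a < t < b -> df t <> 0) ->
  forall s t, a < s < b -> a < t < b -> f s = f t -> s = t.
Proof.
move=> hf h0 s t hs ht; wlog st : s t hs ht / s < t.
  move=> H e; case: (ltgtP s t) => [st|ts|//]; first exact: H.
  by apply/esym/H.
move=> e; exfalso; have [|c hc] := @MVT_R R f df s t st; first by move=> x hx; apply: hf; lra.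
rewrite e subrr => /esym/eqP; rewrite mulf_eq0 => /orP[/eqP h|/eqP]; last lra.
by apply: (h0 c) => //; lra.
Qed.

Section Side.
Variables (Q : qdiff R) (Gamma : set C) (z0 : C) (rho : R) (W : C -> C).
Hypotheses (hW : holo W z0 rho)
  (WQ : forall z, cabs (z - z0) < rho -> z != z0 ->
      [/\ W z != 0, (qnum Q).[z] != 0, (qden Q).[z] != 0 &
          (W^`()%classic z) ^+ 2 = 4 * W z * qeval Q z]).

(* On a trajectory a square root of W has constant imaginary part, on an
   orthogonal trajectory constant real part. *)
Lemma regular_arc_W z1 : regular_arc Q Gamma z1 -> cabs (z1 - z0) < rho -> z1 != z0 ->
  exists sg d, [/\ 0 < d,
    forall z, Gamma z -> cabs (z - z1) < d -> half_sq sg (W z) = half_sq sg (W z1) &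
    forall z w, Gamma z -> Gamma w -> cabs (z - z1) < d -> cabs (w - z1) < d -> W z = W w -> z = w].
Proof.
move=> [c [vel [s1 [eta [sg [eta0 es1 dc pc op]]]]]] zr zz.
have [W1 _ _ _] := WQ zr zz.
have s1s1 : `|s1 - s1| < eta by rewrite subrr normr0.
have cc1 : cont_at c s1 := hasdr_cont (dc s1 s1s1).
have cW1 : cont_at (fun s => W (c s)) s1.
  by apply: cont_comp => //; rewrite es1; exact: holo_cont hW zr.
have [e1 e10 he1] : exists2 e1, 0 < e1 & forall s, `|s - s1| < e1 ->
    [/\ `|s - s1| < eta, cabs (c s - z0) < rho, c s != z0 & 0 < complex.Re (W (c s) / W z1)].
  apply/near_R; near=> s; split.
  - by near: s; apply/near_R; exists eta.
  - near: s; apply: (cont_nbhs (P := fun w => cabs (w - z0) < rho) cc1); rewrite es1; exact: cabs_near.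
  - near: s; apply: (cont_nbhs (P := fun w => w != z0) cc1); rewrite es1; exact: near_neq.
  - near: s; move: (contM cW1 (cont_cst (W z1)^-1 s1)) => /cont_eps/(_ 1 ltr01).
    apply: filterS => s; rewrite es1 divff // => h.
    by have := Re_le_cabs (W (c s) / W z1 - 1); rewrite ReD ReN /= ler_norml; lra.
(* A differentiable square root of W along the arc. From W'^2 = 4 W Q the square of its derivative
   is Q(c) c'^2, positive or negative according to [sg]; so the derivative is real or imaginary, and
   one of the two parts of [sig] is constant, the other injective. *)
pose sig s := sqrtC (W z1) * psqrt (W (c s) / W z1).
have sigsq s : sig s ^+ 2 = W (c s).
  by rewrite /sig exprMn sqrtCK psqrtK mulrC divfK.
pose dsig s := sqrtC (W z1) * ((psqrt (W (c s) / W z1) + psqrt (W (c s) / W z1))^-1 *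
   (W^`()%classic (c s) * vel s / W z1)).
have hsig s : `|s - s1| < e1 -> hasdr sig s (dsig s).
  move=> /he1 [h1 h2 h3 h4]; apply: cderZ; first exact: rC_cont.
  apply: (hasdr_comp (f := fun s => W (c s) / W z1)); first exact: hasd_psqrt.
  have := cderM rC_cont (hasdr_comp (holo_hasd hW h2) (dc s h1)) (cder_cst rC (W z1)^-1 s).
  by rewrite mulr0 addr0.
have pos s : `|s - s1| < e1 -> 0 < (-1) ^+ sg * dsig s ^+ 2.
  move=> hs; have [h1 h2 h3 h4] := he1 s hs.
  have [Wn _ _ WW] := WQ h2 h3.
  have h5 : (dsig s + dsig s) * sig s = W^`()%classic (c s) * vel s.
    have p0 : psqrt (W (c s) / W z1) != 0.
      by apply/eqP => e; have := psqrtK (W (c s) / W z1); rewrite e expr0n => /esym e'; move: h4; rewrite e' /=; lra.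
    rewrite /dsig /sig; have := sqrtCK (W z1); have : sqrtC (W z1) != 0 by rewrite sqrtC_eq0.
    move: (sqrtC (W z1)) (psqrt _) p0 (W^`()%classic (c s)) => x y y0 dw x0 <-.
    have yy : y + y != 0 by rewrite -mulr2n mulrn_eq0.
    by field; rewrite ?x0 ?y0 ?yy.
  have h6 : dsig s ^+ 2 = qeval Q (c s) * vel s ^+ 2.
    have h7 : 4 * W (c s) != 0 by rewrite mulf_neq0 // pnatr_eq0.
    apply: (mulfI h7).
    have -> : 4 * W (c s) * (qeval Q (c s) * vel s ^+ 2) = (4 * W (c s) * qeval Q (c s)) * vel s ^+ 2.
      by move: (4 * W (c s)) (qeval Q _) (vel s ^+ 2) => x y z; exact: mulrA.
    rewrite -WW -exprMn -h5 -(sigsq s).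
    by move: (dsig s) (sig s) => x y; ring.
  by rewrite h6; exact: pc.
have [d d0 hd] := op e1 e10.
exists sg, d; have in_e1 s : s1 - e1 < s < s1 + e1 <-> `|s - s1| < e1 by rewrite ltr_norml; split; lra.
have part s : `|s - s1| < e1 -> (if sg then complex.Re (dsig s) else complex.Im (dsig s)) = 0 /\
   (if sg then complex.Im (dsig s) else complex.Re (dsig s)) <> 0.
  move=> /pos; case: (sg); rewrite ?expr0 ?expr1 ?mul1r ?mulN1r; first exact: neg_square_imag.
  exact: pos_square_real.
pose P1 s := if sg then complex.Re (sig s) else complex.Im (sig s).
pose P2 s := if sg then complex.Im (sig s) else complex.Re (sig s).
have dP1 s : `|s - s1| < e1 -> is_derive s (1 : R) P1 0.
  by move=> hs; have [<- _] := part s hs; rewrite /P1; case: (sg); [exact: hasdr_Re (hsig s hs)|exact: hasdr_Im (hsig s hs)].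
have dP2 s : `|s - s1| < e1 -> is_derive s (1 : R) P2 (if sg then complex.Im (dsig s) else complex.Re (dsig s)).
  by move=> hs; rewrite /P2; case: (sg); [exact: hasdr_Im (hsig s hs)|exact: hasdr_Re (hsig s hs)].
split=> //.
- move=> z Gz zd; have [s hs ->] := hd z Gz zd.
  rewrite -es1 -!sigsq !half_sqE; congr (2 * _ ^+ 2); rewrite -/(P1 s) -/(P1 s1).
  have s1e : `|s1 - s1| < e1 by rewrite subrr normr0.
  case: (ltgtP s s1) => [ss|ss|-> //].
  + have [x hx] := @MVT_R R P1 (fun=> 0) s s1 ss (fun t ht => dP1 t ltac:(by move: hs; rewrite !ltr_norml; lra)).
    by rewrite mul0r => /eqP; rewrite subr_eq0 => /eqP.
  + have [x hx] := @MVT_R R P1 (fun=> 0) s1 s ss (fun t ht => dP1 t ltac:(by move: hs; rewrite !ltr_norml; lra)).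
    by rewrite mul0r => /eqP; rewrite subr_eq0 => /eqP.
- move=> z w Gz Gw zd wd; have [s hs ->] := hd z Gz zd; have [t ht ->] := hd w Gw wd => e.
  congr c; have [_ _ _ ps] := he1 s hs; have [_ _ _ pt] := he1 t ht.
  have es : sig s = sig t.
    by rewrite /sig e.
  apply: (real_derive_inj (f := P2) (a := s1 - e1) (b := s1 + e1)).
  + by move=> x /in_e1; exact: dP2.
  + by move=> x /in_e1 /part [].
  + exact/in_e1.
  + exact/in_e1.
  + by rewrite /P2 es.
Unshelve. all: by end_near. Qed.

Hypothesis W0 : W z0 = 0.
Variable X : set C.
Hypothesis reg : forall z, Gamma z -> ~ X z -> regular_arc Q Gamma z.
Hypothesis rho0 : 0 < rho.

(** Near each t one of |W| - Re W and |W| + Re W is constant, and never both, W being locally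
    injective along the curve. By connectedness it is the same one for all t; its constant value is
    its limit at t0, which is 0, and then W is real. *)
Lemma side_real (p : R -> C) t0 b : t0 < b -> cont_at p t0 -> p t0 = z0 ->
  (forall t, t0 < t < b -> [/\ cont_at p t, Gamma (p t), ~ X (p t), p t != z0 & cabs (p t - z0) < rho]) ->
  (forall s t, t0 < s < b -> t0 < t < b -> p s = p t -> s = t) ->
  forall t, t0 < t < b -> complex.Im (W (p t)) = 0.
Proof.
move=> tb cp0 pt0 hp pinj.
pose om t := W (p t).
have loc t1 : t0 < t1 < b -> exists sg e, [/\ 0 < e, 
    forall t, `|t - t1| < e -> t0 < t < b /\ half_sq sg (om t) = half_sq sg (om t1) &
    forall s t, `|s - t1| < e -> `|t - t1| < e -> om s = om t -> s = t].
  move=> ht; have [cp Gp Xp pz pr] := hp t1 ht.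
  have [sg [d [d0 h1 h2]]] := regular_arc_W (reg Gp Xp) pr pz.
  have [e e0 he] : exists2 e, 0 < e & forall t, `|t - t1| < e -> t0 < t < b /\ cabs (p t - p t1) < d.
    apply/near_R; near=> t; split; last by near: t; move/cont_eps: cp => /(_ d d0).
    near: t; apply/near_R; exists (Num.min (t1 - t0) (b - t1)); first by rewrite lt_min; lra.
    by move=> t; rewrite lt_min !ltr_norml; lra.
  exists sg, e; split => //.
    move=> t /he [tb' td]; split => //; apply: h1 => //; by have [] := hp t tb'.
  move=> s t /he [sb sd] /he [tb' td] eq; apply: pinj => //; apply: h2 => //.
    by have [] := hp s sb.
  by have [] := hp t tb'.
pose cst sg t := exists2 e, 0 < e & forall t', `|t' - t| < e -> half_sq sg (om t') = half_sq sg (om t).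
(* If both are constant, so are Re om and (Im om)^2, and om takes at most two values; three nearby
   parameters contradict its injectivity. *)
have excl t : t0 < t < b -> cst true t -> cst false t -> False.
  move=> /loc [sg [e [e0 _ inj]]] [e1 e10 h1] [e2 e20 h2].
  pose m := Num.min e (Num.min e1 e2); have m0 : 0 < m by rewrite !lt_min e0 e10 e20.
  have [l1 l2 l3] : [/\ m <= e, m <= e1 & m <= e2] by rewrite /m; split; rewrite !ge_min lexx ?orbT.
  have hm x : 0 <= x <= 1 -> `|t + m * x / 2 - t| < m.
    move=> hx; rewrite addrAC subrr add0r ger0_norm; last by rewrite divr_ge0 ?mulr_ge0 ?(ltW m0); lra.
    have h : m * x <= m * 1 by rewrite ler_pM2l //; case/andP: hx.
    lra.
  have key x : 0 <= x <= 1 -> complex.Re (om (t + m * x / 2)) = complex.Re (om t) /\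
      complex.Im (om (t + m * x / 2)) ^+ 2 = complex.Im (om t) ^+ 2.
    move=> hx; have := h1 (t + m * x / 2) (lt_le_trans (hm x hx) l2).
    have := h2 (t + m * x / 2) (lt_le_trans (hm x hx) l3).
    rewrite /half_sq expr0 expr1 => a1 a2.
    have a3 : cabs (om (t + m * x / 2)) = cabs (om t) by lra.
    have := cabs_sqr (om (t + m * x / 2)); have := cabs_sqr (om t); rewrite a3 => -> a4.
    have a5 : complex.Re (om (t + m * x / 2)) = complex.Re (om t) by lra.
    by split => //; rewrite a5 in a4; lra.
  have two x y : 0 <= x <= 1 -> 0 <= y <= 1 -> complex.Im (om (t + m * x / 2)) = complex.Im (om (t + m * y / 2)) -> x = y.
    move=> hx hy eI; have eo : om (t + m * x / 2) = om (t + m * y / 2).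
      by apply: complex_eq => //; have [-> _] := key x hx; have [-> _] := key y hy.
    have := inj _ _ (lt_le_trans (hm x hx) l1) (lt_le_trans (hm y hy) l1) eo => e3.
    have : m * (x - y) = 0 by lra.
    by move/eqP; rewrite mulf_eq0 gt_eqF //= subr_eq0 => /eqP.
  have sq (x y : R) : x ^+ 2 = y ^+ 2 -> x = y \/ x = - y.
    by move/eqP; rewrite eqf_sqr => /orP[] /eqP; [left|right].
  have k0 := key 0 ltac:(by lra); have k1 := key 1 ltac:(by lra); have k2 := key (1 / 2) ltac:(by lra).
  have t01 : complex.Im (om (t + m * 0 / 2)) <> complex.Im (om (t + m * 1 / 2)).
    by move/(two 0 1); lra.
  have t02 : complex.Im (om (t + m * 0 / 2)) <> complex.Im (om (t + m * (1 / 2) / 2)).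
    by move/(two 0 (1 / 2)); lra.
  have t12 : complex.Im (om (t + m * 1 / 2)) <> complex.Im (om (t + m * (1 / 2) / 2)).
    by move/(two 1 (1 / 2)); lra.
  move: k0 k1 k2 t01 t02 t12 => [_ +] [_ +] [_ +].
  move: (complex.Im _) (complex.Im _) (complex.Im _) (complex.Im _) => x y z w.
  move=> /sq q0 /sq q1 /sq q2.
  by case: q0 => ->; case: q1 => ->; case: q2 => ->.
have cst_near sg t : t0 < t < b -> cst sg t -> exists2 e, 0 < e & forall t', `|t' - t| < e -> cst sg t'.
  move=> ht [e e0 he]; exists (e / 2); first lra.
  move=> t' h'; exists (e / 2); first lra.
  move=> s hs; rewrite [RHS]he; last lra.
  by apply: he; have := ler_normD (s - t') (t' - t); rewrite addrA subrK; lra.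
have some t : t0 < t < b -> exists sg, cst sg t.
  by move=> /loc [sg [e [e0 h _]]]; exists sg, e => // t' /h [].
pose B t := `[< cst true t >].
have Bloc t : t0 < t < b -> exists2 e, 0 < e & forall s, `|s - t| < e -> B s = B t.
  move=> ht; have [[] hsg] := some t ht; have [e e0 he] := cst_near _ t ht hsg.
    by exists e => // s /he h; rewrite /B !asboolT.
  have [e' e'0 he'] : exists2 e', 0 < e' & forall s, `|s - t| < e' -> t0 < s < b.
    exists (Num.min (t - t0) (b - t)); first by rewrite lt_min; lra.
    by move=> s; rewrite lt_min !ltr_norml; lra.
  exists (Num.min e e'); first by rewrite lt_min e0.
  move=> s; rewrite lt_min => /andP[/he h /he' h'].
  by rewrite /B !asboolF //; [move=> h2; exact: excl ht h2 hsg | move=> h2; exact: excl h' h2 h].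
have [sg allsg] : exists sg, forall t, t0 < t < b -> cst sg t.
  have mid : t0 < (t0 + b) / 2 < b by lra.
  have [hB|hB] := boolP (B ((t0 + b) / 2)).
    exists true => t ht; apply/asboolP; by rewrite -/(B t) (locally_constant Bloc ht mid).
  exists false => t ht; have [[] //] := some t ht => h.
  by move: hB; rewrite -(locally_constant Bloc ht mid) /B asboolT.
move=> t ht; apply: (@half_sq0 sg); rewrite -/(om t).
have cN : cont_at (fun t => half_sq sg (om t)) t0.
  apply: cont_half_sq; apply: cont_comp => //; rewrite pt0; apply: (holo_cont hW).
  by rewrite subrr cabs0.
apply/eqP; rewrite -normr_eq0 eq_le normr_ge0 andbT leNgt; apply/negP => h0.
case: cN => /cvg_R/(_ _ h0)/near_R[e e0 he].
pose s := Num.min (t0 + e / 2) t.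
have hs : t0 < s < b.
  have h1 : s <= t by rewrite ge_min lexx orbT.
  have h2 : t0 < s by rewrite lt_min; lra.
  lra.
have : `|s - t0| < e.
  have h1 : s <= t0 + e / 2 by rewrite ge_min lexx.
  rewrite ger0_norm; lra.
move/he; have -> : half_sq sg (om t0) = 0 by rewrite /om pt0 W0 /half_sq cabs0 /= mulr0 subrr.
by rewrite subr0 (locally_constant allsg hs ht) ltxx.
Unshelve. all: by end_near. Qed.

End Side.

End Arcs.

(** * The abelian integral on the circle *)

Section Boundary.
Context {R : realType}.
Local Notation C := (Cplx R).
Implicit Types (z u v w : C) (s t e r : R).

(* The maps under consideration: the interior Riemann map, and the exterior one
   precomposed with the inversion, which has a pole at 0. *)
Definition disk_map (Gamma : set C) (psi : C -> C) : Prop :=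
  [/\ forall z, cabs z <= 1 -> z != 0 -> cont_in [set w | cabs w <= 1] psi z,
      forall z, cabs z < 1 -> z != 0 -> exists k, hasd psi z k,
      forall z w, cabs z <= 1 -> cabs w <= 1 -> z != 0 -> w != 0 -> psi z = psi w -> z = w &
      forall z, cabs z = 1 -> Gamma (psi z)].

Definition pullback (Q : qdiff R) (psi : C -> C) z : C :=
  qeval Q (psi z) * (psi^`()%classic z) ^+ 2.

Lemma cont_in_post (A : set C) (g f : C -> C) z : cont_at g (f z) -> cont_in A f z ->
  cont_in A (fun w => g (f w)) z.
Proof.
move=> /cont_eps cg cf e /cg /near_C[d d0 hd]; have [d' d'0 hd'] := cf d d0.
by exists d' => // w Aw wd; apply: hd; exact: hd'.
Qed.

Lemma cont_in_pre (A B : set C) (f g : C -> C) z : cont_at g z -> (forall w, A w -> B (g w)) ->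
  cont_in B f (g z) -> cont_in A (fun w => f (g w)) z.
Proof.
move=> /cont_eps cg AB cf e e0; have [d d0 hd] := cf e e0.
have /near_C[d' d'0 hd'] := cg d d0.
by exists d' => // w Aw wd; apply: hd; [exact: AB | exact: hd'].
Qed.

Definition refl z : C := (z^*)^-1.

Lemma cabs_refl z : cabs (refl z) = (cabs z)^-1.
Proof. by rewrite /refl cabsV cabs_conj. Qed.

Lemma refl_unit z : cabs z = 1 -> refl z = z.
Proof.
move=> z1; have z0 : z != 0 by rewrite -cabs_gt0 z1.
apply: (mulfI z0); have := mulCJ z; rewrite z1 expr1n => h.
have zJ : z^* = z^-1 by apply: (mulfI z0); rewrite h divff.
by rewrite /refl zJ invrK.
Qed.

Lemma refl_dist z z0 : cabs z0 = 1 -> 1 <= cabs z -> cabs (refl z - z0) <= cabs (z - z0).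
Proof.
move=> z01 z1; have zn : z != 0 by rewrite -cabs_gt0; lra.
have zJ : z^* != 0 by rewrite conjC_eq0.
have h : z0 * z0^* = 1 by rewrite mulCJ z01 expr1n.
have -> : refl z - z0 = - (z0 * (z - z0)^* / z^*).
  by rewrite cJB mulrBr h /refl; field.
rewrite cabsN !cabsM cabsV !cabs_conj z01 mul1r ler_pdivrMr; last lra.
by rewrite ler_peMr ?cabs_ge0.
Qed.

Lemma cont_refl z : z != 0 -> cont_at refl z.
Proof.
move=> z0; apply: contV; first by rewrite conjC_eq0.
by apply: cont_conj; exact: cont_id.
Qed.

Section Point.
Variables (Q : qdiff R) (Gamma X : set C) (psi W : C -> C) (t0 rho : R).
Hypotheses (hpsi : disk_map Gamma psi) (fX : finite_set X)
  (reg : forall z, Gamma z -> ~ X z -> regular_arc Q Gamma z).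
Let z0 : C := cis t0.
Let zeta0 := psi z0.
Hypotheses (rho0 : 0 < rho) (hW : holo W zeta0 rho) (W0 : W zeta0 = 0)
  (WQ : forall z, cabs (z - zeta0) < rho -> z != zeta0 ->
      [/\ W z != 0, (qnum Q).[z] != 0, (qden Q).[z] != 0 &
          (W^`()%classic z) ^+ 2 = 4 * W z * qeval Q z]).

Let p t := psi (cis t).

Lemma cont_p t : cont_at p t.
Proof.
have [h _ _ _] := hpsi; apply: (cont_in_comp (A := [set w | cabs w <= 1])).
- by apply: h; rewrite ?cabs_cis ?cis_neq0.
- exact: cont_cis.
- have hh s : cabs (cis s) <= 1 :> R by rewrite cabs_cis.
  by apply: filterE => s; exact: hh.
Qed.

Lemma inj_p s t : `|s - t| < 2 * pi -> p s = p t -> s = t.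
Proof.
have [_ _ h _] := hpsi; move=> st e; apply: cis_inj => //; apply: h => //; by rewrite ?cabs_cis ?cis_neq0.
Qed.

(** The points of [X] other than zeta0 keep a positive distance from it, so that none is met near t0
    on either side. The left side is reduced to the right one by s |-> 2 t0 - s. *)
Lemma boundary_real : exists2 e, 0 < e & forall t, `|t - t0| < e -> complex.Im (W (p t)) = 0.
Proof.
have pp := @pi_gt0 R.
pose X' := [set x | X x /\ x <> zeta0].
have fX' : finite_set X' by apply: (sub_finite_set _ fX) => x [].
have nX' : ~ X' zeta0 by case.
have [d d0 hd] := finite_dist fX' nX'.
have cp := cont_p t0.
have m0 : 0 < Num.min d rho by rewrite lt_min d0.
have /cont_eps/(_ _ m0)/near_R[e e0 he] := cp.
pose e1 := Num.min e pi; have e10 : 0 < e1 by rewrite lt_min e0.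
have le1 : e1 <= e by rewrite ge_min lexx.
have le2 : e1 <= pi by rewrite ge_min lexx orbT.
have good t : `|t - t0| < e1 -> t != t0 ->
   [/\ cont_at p t, Gamma (p t), ~ X (p t), p t != zeta0 & cabs (p t - zeta0) < rho].
  move=> ht tt; have := he t (lt_le_trans ht le1); rewrite lt_min => /andP[h1 h2].
  have pz : p t != zeta0.
    apply/eqP => /inj_p h; move/eqP: tt; apply; apply: h; lra.
  split => //; first exact: cont_p.
    by have [_ _ _ h] := hpsi; apply: h; exact: cabs_cis.
  move=> Xp; have := hd (p t); rewrite /X' /= => /(_ (conj Xp _)) h.
  have := h (elimN eqP pz); move: h1; rewrite /p -/z0 -/zeta0; lra.
have inj s t : `|s - t0| < e1 -> `|t - t0| < e1 -> p s = p t -> s = t.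
  move=> hs ht; apply: inj_p; have := ler_normB (s - t0) (t - t0).
  by rewrite opprB addrA subrK; lra.
exists e1 => // t; case: (ltgtP t t0) => [tt|tt|->] ht; last by rewrite -/zeta0 W0.
- have te : t0 < t0 + e1 by lra.
  have ref s : 2 * t0 - s - t0 = - (s - t0) by ring.
  have := @side_real R Q Gamma zeta0 rho W hW WQ W0 X reg rho0 (fun s => p (2 * t0 - s)) t0 (t0 + e1) te.
  move=> /(_ _ _ _ _ (2 * t0 - t)); rewrite (_ : 2 * t0 - (2 * t0 - t) = t); last by ring.
  apply.
  + apply: (cont_comp (g := p)); last exact: cont_p.
    split; apply: cvgB; [exact: cvg_cst | exact: cvg_id].
  + by rewrite (_ : 2 * t0 - t0 = t0) //; ring.
  + move=> s hs; have [|//|h1 h2 h3 h4 h5] := good (2 * t0 - s).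
    * by rewrite ref normrN ltr_norml; lra.
    * by apply/eqP; lra.
    split => //; apply: (cont_comp (g := p)) => //.
    split; apply: cvgB; [exact: cvg_cst | exact: cvg_id].
  + move=> s s' hs hs' /inj h; have : 2 * t0 - s = 2 * t0 - s'; last lra.
    by apply: h; rewrite ref normrN ltr_norml; lra.
  + by move: ht; rewrite ltr_norml; lra.
- have te : t0 < t0 + e1 by lra.
  apply: (@side_real R Q Gamma zeta0 rho W hW WQ W0 X reg rho0 p t0 (t0 + e1) te) => //.
  + by move=> s hs; apply: good; [rewrite ltr_norml; lra | apply/eqP; lra].
  + by move=> s s' hs hs'; apply: inj; rewrite ltr_norml; lra.
  + by move: ht; rewrite ltr_norml; lra.
Qed.

Lemma boundary_extension : exists r (G : C -> C), [/\ 0 < r <= 1, holo G z0 r,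
  forall z, cabs (z - z0) < r -> cabs z <= 1 -> cabs (psi z - zeta0) < rho /\ G z = W (psi z),
  forall z, cabs (z - z0) < r -> cabs z = 1 -> complex.Im (G z) = 0 &
  forall z, cabs (z - z0) < r -> cabs z < 1 -> (G^`()%classic z) ^+ 2 = 4 * G z * pullback Q psi z].
Proof.
have [cpsi dpsi ipsi Gpsi] := hpsi.
have [e e0 he] := boundary_real.
have z01 : cabs z0 = 1 := cabs_cis t0.
have z0n : z0 != 0 := cis_neq0 t0.
have [r1 r10 hr1] := cis_near t0 e0.
have [r2 r20 hr2] := cpsi z0 (eq_ind_r (fun x => x <= 1) (lexx 1) z01) z0n rho rho0.
(* The bound 1 keeps the disk away from 0, where psi may have a pole. *)
pose r := Num.min 1 (Num.min r1 r2).
have r0 : 0 < r by rewrite !lt_min ltr01 r10.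
have [l1 l2 l3] : [/\ r <= 1, r <= r1 & r <= r2] by rewrite /r; split; rewrite !ge_min lexx ?orbT.
have nz z : cabs (z - z0) < r -> z != 0.
  by move=> h; rewrite -cabs_gt0; have := cabsB z0 (z0 - z); rewrite subKr cabsC; lra.
have inr z : cabs (z - z0) < r -> cabs z <= 1 -> cabs (psi z - zeta0) < rho.
  by move=> h z1; apply: hr2 => //=; lra.
have real z : cabs (z - z0) < r -> cabs z = 1 -> complex.Im (W (psi z)) = 0.
  move=> h z1; have [|s hs ->] := hr1 z z1; first lra.
  exact: he.
pose G1 z := W (psi z); pose G2 z := (W (psi (refl z)))^*.
have out z : cabs (z - z0) < r -> 1 <= cabs z -> cabs (refl z - z0) < r /\ cabs (refl z) <= 1.
  move=> h z1; split; first exact: le_lt_trans (refl_dist z01 z1) h.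
  by rewrite cabs_refl invf_le1 //; lra.
have dG1 z : cabs (z - z0) < r -> cabs z < 1 -> hasd G1 z (W^`()%classic (psi z) * psi^`()%classic z).
  move=> zr z1; have [k hk] := dpsi z z1 (nz z zr).
  rewrite (hasd_derive1 hk); apply: hasd_comp => //; apply: (holo_hasd hW).
  by apply: inr => //; exact: ltW.
have hG : holo (circ_glue G1 G2) z0 r.
  apply: glue_holo => //.
  - move=> z zr z1; apply: cont_in_post; last by apply: cpsi => //; exact: nz.
    by apply: (holo_cont hW); exact: inr.
  - move=> z zr z1; have [h1 h2] := out z zr z1.
    apply: (cont_in_post (g := fun z => z^*)); first by apply: cont_conj; exact: cont_id.
    apply: (cont_in_pre (B := [set w | cabs w <= 1]) (f := G1)).
    + by apply: cont_refl; exact: nz.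
    + by move=> w /= w1; rewrite cabs_refl invf_le1 //; lra.
    + apply: cont_in_post; last by apply: cpsi => //; exact: nz.
      by apply: (holo_cont hW); exact: inr.
  - by move=> z zr z1; eexists; exact: dG1.
  - move=> z zr z1; have [h1 h2] := out z zr (ltW z1).
    have h3 : cabs (refl z) < 1 by rewrite cabs_refl invf_lt1 //; lra.
    exact: hasd_reflect (nz z zr) (dG1 _ h1 h3).
  - move=> z zr z1; rewrite /G1 /G2 (refl_unit z1).
    by rewrite {2}(real_rC (real z zr z1)) conj_rC -real_rC // real.
exists r, (circ_glue G1 G2); split => //.
- by rewrite r0.
- by move=> z zr z1; rewrite /circ_glue z1; split => //; exact: inr.
- by move=> z zr z1; rewrite /circ_glue z1 lexx; exact: real.
- move=> z zr z1.
  have gl : hasd (circ_glue G1 G2) z (W^`()%classic (psi z) * psi^`()%classic z).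
    apply: hasd_near (dG1 z zr z1); have := @cabs_near R z 0 1; rewrite subr0 => /(_ z1).
    by apply: filterS => w; rewrite subr0 /circ_glue => /ltW ->.
  rewrite (hasd_derive1 gl) exprMn.
  have pz : psi z != zeta0.
    apply/eqP => /ipsi e1; have e2 : z = z0 by apply: e1 => //; [exact: ltW | rewrite z01 | exact: nz].
    by move: z1; rewrite e2 z01 ltxx.
  have [_ _ _ e4] := WQ (inr z zr (ltW z1)) pz.
  rewrite /circ_glue (ltW z1) /pullback /G1.
  exact: etrans (congr1 (fun a => a * psi^`()%classic z ^+ 2) e4) (esym (mulrA _ _ _)).
Qed.

(** G vanishes at z0 to some order m + 1 >= 1, so that the pullback G'^2 / (4 G) has order m - 1 >=
    -1. On the circle i z G' is the derivative of G (cis t), which is real, and z^2 G'^2 / (4 G) is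
    minus its square divided by 4 G. *)
Lemma boundary_pole : exists r (u : C -> C), [/\ 0 < r, holo u z0 r,
  forall z, cabs (z - z0) < r -> cabs z < 1 -> (z - z0) * pullback Q psi z = u z &
  forall z, cabs (z - z0) < r -> cabs z = 1 -> z != z0 -> complex.Im (z ^+ 2 * u z / (z - z0)) = 0].
Proof.
have [cpsi dpsi ipsi Gpsi] := hpsi.
have z01 : cabs z0 = 1 := cabs_cis t0.
have z0n : z0 != 0 := cis_neq0 t0.
have [r [G [/andP[r0 r1] hG eG realG dG]]] := boundary_extension.
have z00 : cabs (z0 - z0) < r by rewrite subrr cabs0.
have G0 : G z0 = 0 by have [|_ ->] := eG z0 z00; rewrite ?z01.
have nz z : cabs (z - z0) < r -> z != 0.
  by move=> h; rewrite -cabs_gt0; have := cabsB z0 (z0 - z); rewrite subKr cabsC; lra.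
have Gn z : cabs (z - z0) < r -> cabs z <= 1 -> z != z0 -> G z != 0.
  move=> zr z1 zz; have [h1 ->] := eG z zr z1.
  have [|] := WQ h1; last by [].
  by apply/eqP => /ipsi e1; move/eqP: zz; apply; apply: e1; rewrite ?z01 ?nz.
have [m [g [hg g0 gE]]] : exists m g, [/\ holo g z0 r, g z0 != 0 & forall z, G z = (z - z0) ^+ m * g z].
  (* G does not vanish identically near z0: it is nonzero at the points (1 - s) z0 of the open
     disk. *)
  apply: zero_order => // e e0; pose s := Num.min (1 / 2) (Num.min (e / 2) (r / 2)).
  have s0 : 0 < s by rewrite !lt_min; lra.
  have [l1 l2 l3] : [/\ s <= 1 / 2, s <= e / 2 & s <= r / 2] by rewrite /s; split; rewrite !ge_min lexx ?orbT.
  pose z := rC (1 - s) * z0.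
  have ez : z - z0 = - (rC s * z0) by rewrite /z rCB rC1; ring.
  have dz : cabs (z - z0) = s by rewrite ez cabsN cabsM z01 cabs_rC mulr1 ger0_norm // ltW.
  exists z; first by rewrite dz; lra.
  apply: Gn; first by rewrite dz; lra.
    by rewrite /z cabsM z01 cabs_rC mulr1 ger0_norm; lra.
  by rewrite -subr_eq0 -cabs_eq0 dz gt_eqF.
case: m gE => [|m] gE; first by move: g0; rewrite -[g z0]mul1r -(expr0 (z0 - z0)) -gE G0 eqxx.
pose k z := m.+1%:R * g z + (z - z0) * g^`()%classic z.
have hk : holo k z0 r.
  apply: holoD; first by apply: holoM; [exact: holo_cst | exact: hg].
  apply: holoM; last exact: holo_derive.
  by apply: holoB; [exact: holo_id | exact: holo_cst].
have dGE z : cabs (z - z0) < r -> G^`()%classic z = (z - z0) ^+ m * k z.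
  move=> zr; apply: hasd_derive1.
  have h1 := cderX (@id_C_cont R) m.+1 (cderB (cder_iota id z) (cder_cst id z0 z)).
  have := cderM (@id_C_cont R) h1 (holo_hasd hg zr).
  rewrite (_ : G = fun w => (w - z0) ^+ m.+1 * g w); last exact/funext.
  move=> h2; apply: cder_eq h2 _; rewrite /k /= subr0 mulr1 exprS.
  by move: (g z) (g^`()%classic z) ((z - z0) ^+ m) (m.+1%:R : C) => a b c d; ring.
have [r' [r'0 r'r gn]] : exists r', [/\ 0 < r', r' <= r & forall z, cabs (z - z0) < r' -> g z != 0].
  have /near_C[d d0 hd] := cont_neq0 (holo_cont hg z00) g0.
  exists (Num.min d r); rewrite lt_min d0 r0 ge_min lexx orbT; split => // z.
  by rewrite lt_min => /andP[/hd].
pose u z := (z - z0) ^+ m * k z ^+ 2 / (4 * g z).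
exists r', u; split => //.
- apply: holoM.
    apply: holoM; first by apply: holoX; apply: holoB; [exact: holo_id | exact: holo_cst].
    by apply: holoX; exact: holo_le hk.
  apply: holoV; first by move=> z /gn gz; rewrite mulf_neq0 // pnatr_eq0.
  by apply: holoM; [exact: holo_cst | exact: holo_le hg].
- move=> z zr z1; have zr' := lt_le_trans zr r'r; have gz := gn z zr.
  have zz : z - z0 != 0 by rewrite subr_eq0; apply/eqP => e; move: z1; rewrite e z01 ltxx.
  have := dG z zr' z1; rewrite dGE // gE => h.
  have zm : (z - z0) ^+ m != 0 by rewrite expf_neq0.
  have h4 : 4 * ((z - z0) ^+ m.+1 * g z) != 0 by rewrite !mulf_neq0 ?expf_neq0 // pnatr_eq0.
  apply: (mulfI h4); rewrite mulrCA -h /u (exprS _ m).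
  by move: zz gz; move: (z - z0) (g z) ((z - z0) ^+ m) (k z) => x y a b x0 y0; field.
- move=> z zr z1 zz; have zr' := lt_le_trans zr r'r; have gz := gn z zr.
  have zz0 : z - z0 != 0 by rewrite subr_eq0.
  have zm : (z - z0) ^+ m != 0 by rewrite expf_neq0.
  have -> : z ^+ 2 * u z / (z - z0) = (z * G^`()%classic z) ^+ 2 / (4 * G z).
    rewrite dGE // gE /u (exprS _ m).
    by move: zz0 gz zm; move: (z - z0) (g z) ((z - z0) ^+ m) (k z) => x y a b x0 y0 a0; field; rewrite ?x0 ?y0 ?a0.
  have [t _ et] := cabs1_cis z1.
  have hder : hasdr (fun t => G (cis t)) t (G^`()%classic z * ('i * z)).
    by rewrite et; apply: hasdr_comp (hasdr_cis t); apply: (holo_hasd hG); rewrite -et.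
  have i0 : complex.Im (G^`()%classic z * ('i * z)) = 0.
    have h1 := hasdr_Im hder.
    have h2 : is_derive t (1 : R) (fun s => complex.Im (G (cis s))) 0.
      apply: near_eq_is_derive (is_derive_cst (0 : R) _ _).
      have : \forall s \near t, cabs (cis s - z0) < r.
        by apply: (cont_nbhs (P := fun w => cabs (w - z0) < r) (cont_cis t)); rewrite -et; exact: cabs_near.
      by apply: filterS => s hs; rewrite realG // cabs_cis.
    by case: h1 => _ <-; case: h2 => _ ->.
  have eq2 : (z * G^`()%classic z) ^+ 2 = - (G^`()%classic z * ('i * z)) ^+ 2.
    by rewrite !exprMn sqrCi; move: (G^`()%classic z ^+ 2) (z ^+ 2) => a b; ring.
  rewrite eq2 (real_rC i0) (real_rC (realG z zr' z1)) -rCX -rCN.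
  by rewrite (_ : 4 = rC 4) -?rCM -?rCV -?rCM //; rewrite rCE rmorph_nat.
Qed.

End Point.
End Boundary.

(** * Riemann maps *)

Section Univalent.
Context {R : realType}.
Local Notation C := (Cplx R).
Implicit Types (f g : C -> C) (z w p : C) (r e d : R).

Lemma hasd_inverse f g z k : hasd f (g z) k -> k != 0 -> cont_at g z ->
  (\forall w \near z, f (g w) = w) -> hasd g z k^-1.
Proof.
move=> [q [cq qk hq]] k0 cg fg.
have fz : f (g z) = z by exact: nbhs_singleton fg.
have cqg : cont_at (fun w => q (g w)) z by exact: cont_comp.
have q0 : q (g z) != 0 by rewrite qk.
pose q' w := if w == z then k^-1 else (g w - g z) / (w - z).
exists q'; split.
- apply: (cont_near (f := fun w => (q (g w))^-1)); last exact: contV.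
  move: (cont_neq0 cqg q0) fg; apply: filterS2 => w qw fw; rewrite /q'.
  have := hq (g w); rewrite fw fz => e.
  case: eqP => [->|/eqP wz]; first by rewrite qk.
  have gz : g w - g z != 0.
    by apply/eqP => e0; move: e; rewrite e0 mul0r addr0; apply/eqP.
  have -> : w - z = (g w - g z) * q (g w) by rewrite {1}e addrAC subrr add0r.
  by rewrite invfM mulrA divff // mul1r.
- by rewrite /q' eqxx.
- move=> w; rewrite /q'; case: eqP => [->|/eqP wz]; first by rewrite subrr mul0r addr0.
  by rewrite mulrC divfK ?subr_eq0 // addrC subrK.
Qed.

(* The inverse is continuous, hence its singularity at f p is removable. *)
Lemma univalent_derive f g p r e : 0 < r -> 0 < e -> holo f p r ->
  (forall z, cabs (z - p) < r -> g (f z) = z) ->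
  (forall w, cabs (w - f p) < e -> cont_at g w /\ f (g w) = w) ->
  f^`()%classic p != 0.
Proof.
move=> r0 e0 hf gf hg; have pp : cabs (p - p) < r by rewrite subrr cabs0.
have fpp : cabs (f p - f p) < e by rewrite subrr cabs0.
have gfp := gf p pp.
have [m [h [hh h0 hE]]] : exists m (h : C -> C), [/\ holo h p r, h p != 0 &
    forall z, f^`()%classic z = (z - p) ^+ m * h z].
  apply: zero_order => //; first exact: holo_derive.
  (* If f' vanished near p, f would be constant there, against its left inverse [g]. *)
  move=> d d0; apply: contrapT => hn.
  have f0 z : cabs (z - p) < Num.min d r -> hasd f z 0.
    rewrite lt_min => /andP[zd zr]; have := holo_hasd hf zr.
    suff -> : f^`()%classic z = 0 by [].
    by apply/eqP; apply: contrapT => /negP fz; apply: hn; exists z.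
  pose s := Num.min d r / 2; have m0 : 0 < Num.min d r by rewrite lt_min d0.
  have s0 : 0 < s by rewrite /s; lra.
  have ds : cabs (p + rC s - p) = s by rewrite addrAC subrr add0r cabs_rC ger0_norm // ltW.
  have h1 : f (p + rC s) = f p.
    by apply: (@ball_path R f p (p + rC s) (Num.min d r)) => //; rewrite ds /s; lra.
  have : p + rC s = p.
    rewrite -[LHS]gf ?h1 // ds /s.
    have mr : Num.min d r <= r by rewrite ge_min lexx orbT.
    by lra.
  by move/eqP; rewrite -subr_eq0 -cabs_eq0 ds gt_eqF.
have /near_C[d d0 hd] := cont_neq0 (holo_cont hh pp) h0.
pose d' := Num.min d r; have d'0 : 0 < d' by rewrite lt_min d0.
have nz z : cabs (z - p) < d' -> z != p -> f^`()%classic z != 0.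
  rewrite lt_min => /andP[zd zr] zp; rewrite hE mulf_neq0 ?expf_neq0 ?subr_eq0 //.
  exact: hd.
have [cg _] := hg (f p) fpp.
have /cont_eps/(_ d' d'0)/near_C[e' e'0 he'] := cg; rewrite gfp in he'.
pose e1 := Num.min e e'; have e10 : 0 < e1 by rewrite lt_min e0.
have hgo : holo g (f p) e1.
  apply: holo_removable => [w|w].
    by rewrite lt_min => /andP[/hg []].
  move=> we; have := we; rewrite lt_min => /andP[w1 w2] wp.
  have [cgw fgw] := hg w w1; exists (f^`()%classic (g w))^-1.
  have gw : cabs (g w - p) < d' := he' w w2.
  apply: (hasd_inverse (f := f)) => //.
  - by apply: (holo_hasd hf); apply: lt_le_trans gw _; rewrite ge_min lexx orbT.
  - by apply: nz => //; apply/eqP => gp; move/eqP: wp; apply; rewrite -fgw gp.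
  - by apply: filterS (cabs_near w1) => v /hg [].
have fe1 : cabs (f p - f p) < e1 by rewrite subrr cabs0.
have [k hk] := hgo (f p) fe1.
have h1 := hasd_comp hk (holo_hasd hf pp).
have h2 : hasd (fun z => g (f z)) p 1.
  apply: (hasd_near (f := fun z => z)); last exact: cder_iota.
  by apply: filterS (cabs_near pp) => z /gf ->.
have := hasd_unique h1 h2 => kf; apply/eqP => f0; move: kf; rewrite f0 mulr0 => /eqP.
by rewrite eq_sym oner_eq0.
Qed.

Lemma segment_in (A : set C) z w d : (forall v, cabs (v - z) < d -> A v) -> cabs (w - z) < d ->
  exists S : set C, [/\ connected S, S z, S w & S `<=` A].
Proof.
move=> hA wd; pose p (t : R) := z + rC t * (w - z).
exists (p @` `[0, 1]); split.
- apply: connected_continuous_connected; first exact: segment_connected.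
  apply: continuous_subspaceT => t; suff [] : cont_at p t by [].
  apply: contD; first exact: cont_cst.
  by apply: contM; [exact: rC_cont | exact: cont_cst].
- by exists 0; [rewrite /= in_itv /= lexx ler01|rewrite /p rC0 mul0r addr0].
- by exists 1; [rewrite /= in_itv /= lexx ler01|rewrite /p rC1 mul1r addrC subrK].
- move=> _ [t ht <-]; move: ht; rewrite /= in_itv /= => /andP[t0 t1]; apply: hA.
  rewrite /p addrAC subrr add0r cabsM cabs_rC ger0_norm //.
  by apply: le_lt_trans wd; rewrite ler_piMl ?cabs_ge0.
Qed.

Lemma jordan_closed (Gamma : set C) z : jordan_curve Gamma -> ~ Gamma z ->
  exists2 d, 0 < d & forall w, cabs (w - z) < d -> ~ Gamma w.
Proof.
move=> [gam [cg ig eG]] nz.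
have T1 (v : C) : cabs v = 1 <-> (unit_circle : set C) v.
  rewrite /unit_circle /= cabsE -(rC1 (R := R)); split=> [->//|]; exact: rC_inj.
have cgam t : cont_at (fun s : R => gam (cis s)) t.
  apply: (cont_in_comp (A := unit_circle)).
  - by apply: within_cont_in => //; apply/T1; exact: cabs_cis.
  - exact: cont_cis.
  - by apply: filterE => s; apply/T1; exact: cabs_cis.
have p0 : (- pi : R) <= pi by have := @pi_gt0 R; lra.
have [|x _ hx] := @EVT_min R (fun t => cabs (gam (cis t) - z)) (- pi) pi p0.
  apply: continuous_subspaceT => t.
  by have [] := cont_cabs (contB (cgam t) (cont_cst z t)).
exists (cabs (gam (cis x) - z)).
  rewrite cabs_gt0 subr_eq0; apply/eqP => e; apply: nz; rewrite -e eG.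
  by exists (cis x) => //; apply/T1; exact: cabs_cis.
move=> w wd; rewrite eG => -[v /T1 v1 ew]; have [t ht et] := cabs1_cis v1.
by have := hx t; rewrite in_itv /= => /(_ ht); rewrite -et ew leNgt wd.
Qed.

Section Component.
Variables (Gamma Omega : set C).
Hypotheses (hG : jordan_curve Gamma) (hO : component (~` Gamma) Omega).

Lemma component_ball z w d : (forall v, cabs (v - z) < d -> ~ Gamma v) -> cabs (w - z) < d ->
  (Omega z <-> Omega w).
Proof.
move=> hd wd; have [S [cS Sz Sw SG]] := segment_in (A := ~` Gamma) hd wd.
have [x xG ->] := hO.
have key u v : S u -> S v -> connected_component (~` Gamma) x u -> connected_component (~` Gamma) x v.
  move=> Su Sv xu; apply: (connected_component_trans xu).
  by exists S => //; split.
by split; exact: key.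
Qed.

Lemma component_sub z : Omega z -> ~ Gamma z.
Proof. by have [x xG ->] := hO => /connected_component_sub. Qed.

Lemma component_open z : Omega z -> exists2 d, 0 < d & forall w, cabs (w - z) < d -> Omega w.
Proof.
move=> Oz; have [d d0 hd] := jordan_closed hG (component_sub Oz).
by exists d => // w wd; apply/(component_ball hd wd).
Qed.

Lemma component_closure z : closure Omega z -> ~ Gamma z -> Omega z.
Proof.
move=> cz nz; have [d d0 hd] := jordan_closed hG nz.
have [w [Ow wd]] := cz [set y | cabs (y - z) < d] (iffRL (nbhs_C _ _) (ex_intro2 _ _ d d0 (fun w h => h))).
by apply/(component_ball hd wd).
Qed.

End Component.

Lemma unit_diskE z : (unit_disk : set C) z <-> cabs z < 1.
Proof. by rewrite /unit_disk /= cabsE -(rC1 (R := R)) rC_lt. Qed.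
Lemma closed_unit_diskE z : (closed_unit_disk : set C) z <-> cabs z <= 1.
Proof. by rewrite /closed_unit_disk /= cabsE -(rC1 (R := R)) rC_le. Qed.
Lemma unit_exteriorE z : (unit_exterior : set C) z <-> 1 < cabs z.
Proof. by rewrite /unit_exterior /= cabsE -(rC1 (R := R)) rC_lt. Qed.
Lemma closed_unit_exteriorE z : (closed_unit_exterior : set C) z <-> 1 <= cabs z.
Proof. by rewrite /closed_unit_exterior /= cabsE -(rC1 (R := R)) rC_le. Qed.
Lemma unit_circleE z : (unit_circle : set C) z <-> cabs z = 1.
Proof. by rewrite /unit_circle /= cabsE -(rC1 (R := R)); split=> [|->//]; exact: rC_inj. Qed.

(* What the two Riemann maps have in common: U is the open disk or the exterior
   of the closed one, and K its closure. *)
Section Riemann.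
Variables (Gamma Omega U K : set C) (phi : C -> C).
Hypotheses (hG : jordan_curve Gamma) (hO : component (~` Gamma) Omega)
  (hU : conformal_bijection U Omega phi) (hK : homeomorphism K (closure Omega) phi)
  (UK : U `<=` K) (Uo : forall z, U z -> exists2 d, 0 < d & forall w, cabs (w - z) < d -> U w).

Lemma riemann_inj z w : K z -> K w -> phi z = phi w -> z = w.
Proof. by have [_ [_ i _] _] := hK => Kz Kw; apply: i; rewrite inE. Qed.

Lemma riemann_cont z : K z -> cont_in K phi z.
Proof. by have [c _ _] := hK; exact: within_cont_in. Qed.

(** A value off [Gamma] would lie in [Omega], hence be taken already at a point of [U], against
    injectivity on [K]. *)
Lemma riemann_boundary z : K z -> ~ U z -> Gamma (phi z).
Proof.
move=> Kz Uz; apply: contrapT => nG; apply: Uz.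
have [_ [f _ _] _] := hK; have [_ [_ _ s]] := hU.
have [w Uw ew] := s _ (component_closure hG hO (f z Kz) nG).
by rewrite -(riemann_inj (UK Uw) Kz ew).
Qed.

Lemma riemann_holo z : U z -> exists2 d, 0 < d & holo phi z d.
Proof.
move=> /Uo [d d0 hd]; exists d => // w /hd Uw; have [h _] := hU.
by exists (phi^`()%classic w); apply: derivable_hasd; exact: h.
Qed.

Lemma riemann_derive_neq0 z : U z -> phi^`()%classic z != 0.
Proof.
move=> Uz; have [d d0 hd] := riemann_holo Uz; have [d' d'0 hd'] := Uo Uz.
have [_ [f _ s]] := hU; have [_ _ [g [cg gK]]] := hK.
have Oz := f z Uz; have [e e0 he] := component_open hG hO Oz.
apply: (@univalent_derive phi g z (Num.min d d') e) => //.
- by rewrite lt_min d0.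
- by apply: holo_le hd; rewrite ge_min lexx.
- by move=> w; rewrite lt_min => /andP[_ /hd' /UK]; exact: gK.
- move=> w we; have Ow := he w we; split.
    have [e' e'0 he'] := component_open hG hO Ow.
    apply/cont_eps => eps eps0.
    have [d1 d10 hd1] := within_cont_in cg (subset_closure Ow) eps0.
    apply/near_C; exists (Num.min d1 e'); first by rewrite lt_min d10.
    by move=> v; rewrite lt_min => /andP[v1 /he' v2]; apply: hd1 => //; exact: subset_closure.
  by have [v Uv <-] := s w Ow; rewrite gK //; exact: UK.
Qed.

End Riemann.

Lemma disk_open z : (unit_disk : set C) z -> exists2 d, 0 < d & forall w, cabs (w - z) < d -> (unit_disk : set C) w.
Proof.
move=> /unit_diskE z1; exists (1 - cabs z); first lra.
by move=> w hw; apply/unit_diskE; have := cabsD (w - z) z; rewrite subrK; lra.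
Qed.

Lemma exterior_open z : (unit_exterior : set C) z ->
  exists2 d, 0 < d & forall w, cabs (w - z) < d -> (unit_exterior : set C) w.
Proof.
move=> /unit_exteriorE z1; exists (cabs z - 1); first lra.
by move=> w hw; apply/unit_exteriorE; have := cabsB z (z - w); rewrite subKr cabsC; lra.
Qed.

Lemma interior_disk_map Gamma phi : jordan_curve Gamma -> interior_riemann_map Gamma phi ->
  [/\ disk_map Gamma phi, forall z, cabs z < 1 -> exists k, hasd phi z k &
      forall z, cabs z < 1 -> phi^`()%classic z != 0].
Proof.
move=> hG [Om [hO _ hU hK]].
have UK : (unit_disk : set C) `<=` closed_unit_disk.
  by move=> z /unit_diskE /ltW h; apply/closed_unit_diskE.
have dphi z : cabs z < 1 -> exists k, hasd phi z k.
  move=> /unit_diskE /(riemann_holo hU disk_open) [d d0 hd].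
  by apply: hd; rewrite subrr cabs0.
split => //.
- split.
  + move=> z /closed_unit_diskE Kz _ e e0; have [d d0 hd] := riemann_cont hK Kz e0.
    by exists d => // w /closed_unit_diskE; exact: hd.
  + by move=> z z1 _; exact: dphi.
  + by move=> z w /closed_unit_diskE z1 /closed_unit_diskE w1 _ _; exact: (riemann_inj hK).
  + move=> z z1; apply: (riemann_boundary hG hO hU hK UK).
      by apply/closed_unit_diskE; rewrite z1.
    by move=> /unit_diskE; rewrite z1 ltxx.
- by move=> z /unit_diskE; exact: (riemann_derive_neq0 hG hO hU hK UK disk_open).
Qed.

Lemma exterior_disk_map Gamma phi : jordan_curve Gamma -> exterior_riemann_map Gamma phi ->
  [/\ disk_map Gamma (fun w => phi w^-1), forall z, 1 < cabs z -> exists k, hasd phi z k &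
      forall z, 1 < cabs z -> phi^`()%classic z != 0].
Proof.
move=> hG [Om [hO _ hU hK _]].
have UK : (unit_exterior : set C) `<=` closed_unit_exterior.
  by move=> z /unit_exteriorE /ltW h; apply/closed_unit_exteriorE.
have dphi z : 1 < cabs z -> exists k, hasd phi z k.
  move=> /unit_exteriorE /(riemann_holo hU exterior_open) [d d0 hd].
  by apply: hd; rewrite subrr cabs0.
have inv1 z : cabs z <= 1 -> z != 0 -> 1 <= cabs z^-1.
  by move=> z1; rewrite -cabs_gt0 => z0; rewrite cabsV invf_ge1.
split => //.
- split.
  + move=> z z1 z0; have /closed_unit_exteriorE Kz := inv1 z z1 z0.
    move=> e e0; have [d d0 hd] := riemann_cont hK Kz e0.
    have /cont_eps/(_ d d0)/near_C[d' d'0 hd'] := contV z0 (cont_id z).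
    have z00 : 0 < cabs z by rewrite cabs_gt0.
    (* The second bound excludes w = 0, whose default inverse 0 is not in the exterior. *)
    exists (Num.min d' (cabs z)); first by rewrite lt_min d'0.
    move=> w w1; rewrite lt_min => /andP[wd wz]; apply: hd; last exact: hd'.
    apply/closed_unit_exteriorE; apply: inv1 => //; rewrite -cabs_gt0.
    by have := cabsB z (z - w); rewrite subKr cabsC; lra.
  + move=> z z1 z0; have [|k hk] := dphi z^-1.
      by rewrite cabsV invf_gt1 ?cabs_gt0.
    by eexists; apply: (hasd_comp (f := fun w => w^-1)); [exact: hk | exact: hasd_inv].
  + move=> z w z1 w1 z0 w0 e; apply: invr_inj; apply: (riemann_inj hK) => //.
      by apply/closed_unit_exteriorE; exact: inv1.
    by apply/closed_unit_exteriorE; exact: inv1.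
  + move=> z z1; have z1' : cabs z^-1 = 1 by rewrite cabsV z1 invr1.
    apply: (riemann_boundary hG hO hU hK UK).
      by apply/closed_unit_exteriorE; rewrite z1'.
    by move=> /unit_exteriorE; rewrite z1' ltxx.
- by move=> z /unit_exteriorE; exact: (riemann_derive_neq0 hG hO hU hK UK exterior_open).
Qed.

End Univalent.

(** * Rationality of the pullbacks *)

Section Meromorphic.
Context {R : realType}.
Local Notation C := (Cplx R).
Implicit Types (f g u : C -> C) (z w p : C) (r d e : R) (s : seq C).

(** The value at [p] is left free, since functions written as quotients take a default value at
    their poles. *)
Definition meromorphic f p := exists n r u, [/\ 0 < r, holo u p r &
  forall z, cabs (z - p) < r -> z != p -> (z - p) ^+ n * f z = u z].

Lemma mero_holo f p r : 0 < r -> holo f p r -> meromorphic f p.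
Proof. by move=> r0 hf; exists 0%N, r, f; split=> // z _ _; rewrite expr0 mul1r. Qed.

Lemma mero_cst (c : C) p : meromorphic (fun=> c) p.
Proof. apply: (@mero_holo _ p 1); [exact: ltr01 | exact: holo_cst]. Qed.

Lemma meroD f g p : meromorphic f p -> meromorphic g p -> meromorphic (fun z => f z + g z) p.
Proof.
move=> [n [r [u [r0 hu fu]]]] [m [r' [v [r'0 hv gv]]]].
exists (n + m)%N, (Num.min r r'), (fun z => (z - p) ^+ m * u z + (z - p) ^+ n * v z).
have [l1 l2] : Num.min r r' <= r /\ Num.min r r' <= r' by rewrite !ge_min !lexx orbT.
split; first by rewrite lt_min r0.
  have hz k : holo (fun z => (z - p) ^+ k) p (Num.min r r').
    by apply: holoX; apply: holoB; [exact: holo_id | exact: holo_cst].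
  by apply: holoD; apply: holoM => //; [exact: holo_le hu | exact: holo_le hv].
move=> z; rewrite lt_min => /andP[zr zr'] zp.
by rewrite -(fu z zr zp) -(gv z zr' zp) exprD; move: (_ ^+ n) (_ ^+ m) => a b; ring.
Qed.

Lemma meroM f g p : meromorphic f p -> meromorphic g p -> meromorphic (fun z => f z * g z) p.
Proof.
move=> [n [r [u [r0 hu fu]]]] [m [r' [v [r'0 hv gv]]]].
exists (n + m)%N, (Num.min r r'), (fun z => u z * v z).
have [l1 l2] : Num.min r r' <= r /\ Num.min r r' <= r' by rewrite !ge_min !lexx orbT.
split; first by rewrite lt_min r0.
  by apply: holoM; [exact: holo_le hu | exact: holo_le hv].
move=> z; rewrite lt_min => /andP[zr zr'] zp.
by rewrite -(fu z zr zp) -(gv z zr' zp) exprD; move: (_ ^+ n) (_ ^+ m) => a b; ring.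
Qed.

Lemma mero_poly f p (q : {poly C}) : meromorphic f p -> meromorphic (fun z => q.[f z]) p.
Proof.
move=> mf; elim/poly_ind: q => [|q c ih].
  have -> : (fun z => (0 : {poly C}).[f z]) = fun=> 0 by apply/funext => z; rewrite horner0.
  exact: mero_cst.
have -> : (fun z => (q * 'X + c%:P).[f z]) = fun z => q.[f z] * f z + c.
  by apply/funext => z; rewrite hornerMXaddC.
by apply: meroD; [exact: meroM | exact: mero_cst].
Qed.

Lemma meroV f p : meromorphic f p ->
  (forall e, 0 < e -> exists z, [/\ cabs (z - p) < e, z != p & f z != 0]) ->
  meromorphic (fun z => (f z)^-1) p.
Proof.
move=> [n [r [u [r0 hu fu]]]] f0.
have [|m [g [hg g0 ug]]] := zero_order r0 hu.
  move=> e e0; have [|z [ze zp fz]] := f0 (Num.min e r); first by rewrite lt_min e0.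
  move: ze; rewrite lt_min => /andP[ze zr].
  by exists z => //; rewrite -fu // mulf_neq0 ?expf_neq0 ?subr_eq0.
have pp : cabs (p - p) < r by rewrite subrr cabs0.
have /near_C[d d0 hd] := cont_neq0 (holo_cont hg pp) g0.
exists m, (Num.min d r), (fun z => (z - p) ^+ n * (g z)^-1); split.
- by rewrite lt_min d0.
- apply: holoM; first by apply: holoX; apply: holoB; [exact: holo_id | exact: holo_cst].
  apply: holoV; first by move=> z; rewrite lt_min => /andP[/hd].
  by apply: holo_le hg; rewrite ge_min lexx orbT.
- move=> z; rewrite lt_min => /andP[zd zr] zp; have gz := hd z zd.
  have := fu z zr zp; rewrite ug.
  have := expf_neq0 n (_ : z - p != 0); have := expf_neq0 m (_ : z - p != 0).
  rewrite subr_eq0 => /(_ zp) + /(_ zp).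
  move: (_ ^+ n) (_ ^+ m) => a b b0 a0 e.
  have -> : f z = b * g z / a by rewrite -e mulrC mulKf.
  by field; rewrite a0 b0 gz.
Qed.

Lemma mero_derive f p r : 0 < r -> (forall z, cabs (z - p) < r -> z != p -> exists k, hasd f z k) ->
  meromorphic f p -> meromorphic (f^`()%classic : C -> C) p.
Proof.
move=> r0 hf [n [r' [u [r'0 hu fu]]]].
exists n.+1, (Num.min r r'), (fun z => (z - p) * u^`()%classic z - n%:R * u z).
have l2 : Num.min r r' <= r' by rewrite ge_min lexx orbT.
split; first by rewrite lt_min r0.
  apply: holoB; apply: holoM; [|exact: holo_le (holo_derive hu)|exact: holo_cst|exact: holo_le hu].
  by apply: holoB; [exact: holo_id | exact: holo_cst].
move=> z; rewrite lt_min => /andP[zr zr'] zp.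
have [k hk] := hf z zr zp; have -> := hasd_derive1 hk.
have h1 : hasd (fun w => (w - p) ^+ n * f w) z (n%:R * (z - p) ^+ n.-1 * (1 - 0) * f z + (z - p) ^+ n * k).
  apply: cderM; [exact: id_C_cont | | exact: hk].
  apply: cderX; first exact: id_C_cont.
  by apply: cderB; [exact: cder_iota | exact: cder_cst].
have h2 : hasd (fun w => (w - p) ^+ n * f w) z (u^`()%classic z).
  apply: (hasd_near (f := u)); last exact: (holo_hasd hu).
  by apply: filterS2 (near_neq zp) (cabs_near zr') => w wp wr; rewrite fu.
have <- := hasd_unique h1 h2; rewrite -(fu z zr' zp) subr0 mulr1 exprS.
case: n {fu h1 h2} => [|n] /=; first by rewrite !expr0; ring.
by rewrite exprS; move: (_ ^+ n) => a; ring.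
Qed.

(** The points lie on the segment from z1 to [b], at the fractions t / (i + 1) of its length. The
    end [b] is 0, or 1 / 2 if z1 = 0, which keeps them distinct from z1 and from 0. Having as many
    as desired lets one of them avoid a finite set. *)
Lemma disk_points z1 e N : cabs z1 <= 1 -> 0 < e -> exists s, [/\ uniq s, size s = N &
  forall z, z \in s -> [/\ cabs (z - z1) < e, cabs z < 1, z != z1 & z != 0]].
Proof.
move=> z11 e0; pose b : C := if z1 == 0 then rC 2^-1 else 0.
have b2 : cabs b <= 2^-1.
  by rewrite /b; case: ifP => _; rewrite ?cabs_rC ?cabs0 ?ger0_norm; lra.
have bz : b - z1 != 0.
  rewrite subr_eq0 /b; case: (z1 =P 0) => [->|/eqP z10]; last by rewrite eq_sym.
  by rewrite rC_eq0 invr_eq0 pnatr_eq0.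
have bz0 : 0 < cabs (b - z1) by rewrite cabs_gt0.
pose t := Num.min 1 (e / cabs (b - z1)) / 2.
have t0 : 0 < Num.min 1 (e / cabs (b - z1)) by rewrite lt_min ltr01 divr_gt0.
have t1 : Num.min 1 (e / cabs (b - z1)) <= 1 by rewrite ge_min lexx.
have te : t * cabs (b - z1) < e.
  rewrite -ltr_pdivlMr //; apply: (@lt_le_trans _ _ (Num.min 1 (e / cabs (b - z1)))); last by rewrite ge_min lexx orbT.
  by rewrite /t; lra.
have tp : 0 < t < 1 by rewrite /t; apply/andP; split; lra.
pose x (i : nat) := t / i.+1%:R.
have xp i : 0 < x i <= t.
  have i0 : 0 < i.+1%:R :> R by rewrite ltr0n.
  move: tp => /andP[tp _]; rewrite divr_gt0 //= ler_pdivrMr // ler_peMr ?ler1n //.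
  exact: ltW.
exists [seq z1 + rC (x i) * (b - z1) | i <- iota 0 N]; split.
- rewrite map_inj_uniq ?iota_uniq // => i j /addrI /(mulIf bz) /rC_inj.
  move: tp => /andP[/gt_eqF/negbT tn0 _].
  by rewrite /x => /(mulfI tn0) /invr_inj /eqP; rewrite eqr_nat eqSS => /eqP.
- by rewrite size_map size_iota.
- move=> _ /mapP[i _ ->]; have /andP[x0 xt] := xp i; move: tp => /andP[tp1 tp2].
  split.
  + rewrite addrAC subrr add0r cabsM cabs_rC (ger0_norm (ltW x0)).
    by apply: le_lt_trans te; rewrite ler_pM2r.
  + have -> : z1 + rC (x i) * (b - z1) = rC (1 - x i) * z1 + rC (x i) * b by rewrite rCB rC1; ring.
    have := cabsD (rC (1 - x i) * z1) (rC (x i) * b); rewrite !cabsM !cabs_rC (ger0_norm (ltW x0)) ger0_norm; last lra.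
    by have := cabs_ge0 z1; have := cabs_ge0 b; move: xt; move: (x i) x0 => y y0 yt; nra.
  + by rewrite -subr_eq0 addrAC subrr add0r mulf_neq0 // rC_eq0 gt_eqF.
  + rewrite /b; case: (z1 =P 0) => [->|/eqP z10].
      by rewrite add0r subr0 mulf_neq0 // rC_eq0 gt_eqF // invr_gt0.
    have -> : z1 + rC (x i) * (0 - z1) = rC (1 - x i) * z1 by rewrite rCB rC1; ring.
    by rewrite mulf_neq0 // rC_eq0 gt_eqF //; lra.
Qed.

Lemma disk_avoid z1 e s : cabs z1 <= 1 -> 0 < e ->
  exists z, [/\ cabs (z - z1) < e, cabs z < 1, z != z1 & z \notin s].
Proof.
move=> z11 e0; have [l [ul sl hl]] := disk_points (size s).+1 z11 e0.
have /allPn[z zl zs] : ~~ all (fun z => z \in s) l.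
  apply/negP => /allP h; have := uniq_leq_size ul h.
  by rewrite sl ltnn.
by have [a b c _] := hl z zl; exists z.
Qed.

Lemma disk_dense_eq z1 r s f g : cabs z1 <= 1 -> 0 < r -> cont_at f z1 -> cont_at g z1 ->
  (forall z, cabs (z - z1) < r -> cabs z < 1 -> z \notin s -> f z = g z) -> f z1 = g z1.
Proof.
move=> z11 r0 cf cg fg; apply/eqP; rewrite -subr_eq0; apply: contrapT => /negP ne.
have /near_C[d d0 hd] := cont_neq0 (contB cf cg) ne.
have [|z [zd z1' _ zs]] := disk_avoid s z11 (e := Num.min d r); first by rewrite lt_min d0.
move: zd; rewrite lt_min => /andP[zd zr].
by have := hd z zd; rewrite fg // subrr eqxx.
Qed.

(** The closed disk is covered through the square that contains it, whose compactness comes from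
    that of intervals. *)
Lemma disk_cover (r : C -> R) : (forall z, 0 < r z) ->
  exists s, forall z, cabs z <= 1 -> exists2 p, p \in s & cabs (z - p) < r p.
Proof.
move=> r0; pose I := `[(-1 : R), 1]%classic.
pose m (x : R * R) : C := rC x.1 + 'i * rC x.2.
have cK : compact (m @` (I `*` I)).
  apply: continuous_compact; last by apply: compact_setX; exact: segment_compact.
  apply: continuous_subspaceT => x; suff [] : cont_at m x by [].
  apply: contD; first by apply: cont_rC; split; exact: cvg_fst.
  by apply: contM; [exact: cont_cst | apply: cont_rC; split; exact: cvg_snd].
have ballE (p z : C) (e : R) : ball p (rC e) z <-> cabs (z - p) < e.
  by rewrite -ball_normE /= cabsE rC_lt cabsC.
move: cK; rewrite compact_cover => /(_ C setT (fun p => ball p (rC (r p)))) [].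
- by move=> p _; apply: ball_open; rewrite -rC0 rC_lt.
- by move=> z _; exists z => //; apply/ballE; rewrite subrr cabs0.
- move=> D _ hD; exists (finmap.enum_fset D) => z z1.
  have [|p pD /ballE h] := hD z; last by exists p.
  exists (complex.Re z, complex.Im z); last by rewrite /m /= -ReIm.
  have := Re_le_cabs z; have := Im_le_cabs z; rewrite /I /= !in_itv /= !ler_norml.
  by move=> /andP[a b] /andP[c d]; split; apply/andP; split; lra.
Qed.

End Meromorphic.

(** * From local data on the closed disk to a rational function *)

Section Rationality.
Context {R : realType}.
Local Notation C := (Cplx R).
Implicit Types (f g u : C -> C) (z w p : C) (r d e : R).

Lemma circle_avoid z1 e (s : seq C) : cabs z1 = 1 -> 0 < e ->
  exists z, [/\ cabs (z - z1) < e, cabs z = 1 & z \notin s].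
Proof.
move=> z11 e0; have [t _ ->] := cabs1_cis z11.
have /cont_eps/(_ e e0)/near_R[d d0 hd] := cont_cis t.
pose d' := Num.min d 1; have d'0 : 0 < d' by rewrite lt_min d0 ltr01.
have [d1 d2] : d' <= d /\ d' <= 1 by rewrite !ge_min !lexx orbT.
pose x (i : nat) := d' / 2 / i.+1%:R.
have xp i : 0 < x i <= d' / 2.
  have i0 : 0 < i.+1%:R :> R by rewrite ltr0n.
  by rewrite !divr_gt0 //= ler_pdivrMr // ler_peMr ?ler1n //; lra.
pose l := [seq cis (t + x i) | i <- iota 0 (size s).+1].
have ul : uniq l.
  rewrite map_inj_in_uniq ?iota_uniq // => i j _ _ /cis_inj h.
  have /addrI : t + x i = t + x j.
    apply: h; have := xp i; have := xp j => /andP[a b] /andP[c f].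
    by rewrite ltr_norml; have := @pi_ge2 R => p2; apply/andP; split; lra.
  have dn : d' / 2 != 0 by rewrite gt_eqF // divr_gt0.
  by rewrite /x => /(mulfI dn) /invr_inj /eqP; rewrite eqr_nat eqSS => /eqP.
have /allPn[z zl zs] : ~~ all (fun z => z \in s) l.
  apply/negP => /allP h; have := uniq_leq_size ul h.
  by rewrite size_map size_iota ltnn.
exists z; move: zl zs => /mapP[i _ ->] zs; rewrite cabs_cis; split=> //.
by apply: hd; have /andP[a b] := xp i; rewrite addrAC subrr add0r gtr0_norm //; lra.
Qed.

Lemma cont_inM (A : set C) f g z : A z -> cont_in A f z -> cont_in A g z -> cont_in A (fun w => f w * g w) z.
Proof.
move=> Az cf cg; pose ext (h : C -> C) w := if `[< A w >] then h w else h z.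
have cext h : cont_in A h z -> cont_at (ext h) z.
  move=> ch; apply/cont_eps => e e0; have [d d0 hd] := ch e e0.
  apply/near_C; exists d => // w wd; rewrite /ext.
  by case: (asboolP (A w)) (asboolP (A z)) => Aw [] // _; [exact: hd | rewrite subrr cabs0].
have /cont_eps h := contM (cext f cf) (cext g cg).
move=> e /h /near_C[d d0 hd]; exists d => // w Aw /hd.
by rewrite /ext !asboolT.
Qed.

Section Local.
Variables (F : C -> C).
Hypothesis locF : forall p, cabs p <= 1 -> exists n r u, [/\ 0 < r, holo u p r,
  forall z, cabs (z - p) < r -> cabs z < 1 -> z != p -> (z - p) ^+ n * F z = u z &
  forall z, cabs (z - p) < r -> cabs z = 1 -> z != p -> complex.Im (z ^+ 2 * u z / (z - p) ^+ n) = 0].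

Definition local_data p (D : nat * R * (C -> C)) : Prop := [/\ 0 < D.1.2, holo D.2 p D.1.2,
  forall z, cabs (z - p) < D.1.2 -> cabs z < 1 -> z != p -> (z - p) ^+ D.1.1 * F z = D.2 z &
  forall z, cabs (z - p) < D.1.2 -> cabs z = 1 -> z != p ->
    complex.Im (z ^+ 2 * D.2 z / (z - p) ^+ D.1.1) = 0].

Lemma choose_local_data : exists D : C -> nat * R * (C -> C), forall p, local_data p (D p).
Proof.
have h : forall p, exists D, local_data p D; last by have [D hD] := choice h; exists D.
move=> p; case: (lerP (cabs p) 1) => p1.
  by have [n [r [u h]]] := locF p1; exists (n, r, u).
have far z : cabs (z - p) < cabs p - 1 -> 1 < cabs z.
  by have := cabsB p (p - z); rewrite subKr cabsC; lra.
(* For [p] outside the closed disk, the disk of radius |p| - 1 does not meet it and the conditions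
   are void. *)
exists (0%N, cabs p - 1, fun=> 0); split => /=; first lra.
- exact: holo_cst.
- by move=> z /far h1 h2; move: (lt_trans h1 h2); rewrite ltxx.
- by move=> z /far + h2; rewrite h2 ltxx.
Qed.

Definition sym_factor p : {poly C} := ('X - p%:P) * (1 - p^* *: 'X).

Lemma sym_factorE p z : (sym_factor p).[z] = (z - p) * (1 - p^* * z).
Proof. by rewrite !hornerE. Qed.

(** On the circle this says that the factor divided by z is real, so that multiplication by it
    respects the reflection up to a power of z. *)
Lemma sym_factor_refl p z : z != 0 -> (sym_factor p).[z] = z ^+ 2 * ((sym_factor p).[refl z])^*.
Proof.
move=> z0; rewrite !sym_factorE cJM !cJB cJM cJK rmorph1 /refl cJV cJK.
by move: p^* => q; field.
Qed.

Lemma sym_factor_neq0 p : sym_factor p != 0.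
Proof.
rewrite mulf_neq0 ?polyXsubC_eq0 //; apply/eqP => /(congr1 (horner^~ 0)).
by rewrite !hornerE => /eqP; rewrite ?mulr0 ?subr0 oner_eq0.
Qed.

(** Multiplied by z^2 M, with M a product of symmetric factors over a finite cover, F becomes a
    function Phi that is regular up to the circle. Since z^2 F is real there, Phi z = z^(2 S) conj
    (Phi z), which dictates the extension [Ext] and its growth of order 2 S. The exponents N for h
    and N + 4 for m differ by the z^4 in the reflection law of a quadratic differential. *)
Lemma rational_of_local : exists (h m : {poly C}) (s : seq C) N,
  [/\ m != 0, forall z, cabs z < 1 -> z \notin s -> m.[z] * F z = h.[z],
      forall z, z != 0 -> h.[z] = z ^+ N * (h.[refl z])^* &
      forall z, z != 0 -> m.[z] = z ^+ (N + 4) * (m.[refl z])^*].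
Proof.
have [D hD] := choose_local_data.
pose n p := (D p).1.1; pose r p := (D p).1.2; pose u p := (D p).2.
have r0 p : 0 < r p by have [] := hD p.
have hu p : holo (u p) p (r p) by have [] := hD p.
have [s cov] := disk_cover r0.
pose M := \prod_(p <- s) sym_factor p ^+ n p.
pose S := (\sum_(p <- s) n p)%N.
have Mrefl z : z != 0 -> M.[z] = z ^+ (2 * S) * (M.[refl z])^*.
  move=> z0; rewrite /M /S; elim: s {cov M S} => [|p s ih].
    by rewrite !big_nil muln0 expr0 mul1r !hornerE rmorph1.
  rewrite !big_cons mulnDr exprD !hornerM !horner_exp ih (sym_factor_refl p z0) exprMn cJM cJX.
  by rewrite (exprM z 2 (n p)) mulrACA.
have M0 : M != 0.
  rewrite /M; elim: s {cov M S Mrefl} => [|p s ih]; first by rewrite big_nil oner_neq0.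
  by rewrite big_cons mulf_neq0 // expf_neq0 // sym_factor_neq0.
(* The cofactor of (z - p)^(n p) in M is a polynomial; with it z^2 F M is defined on the whole disk
   around [p], centre included. *)
pose rest p := (1 - p^* *: 'X) ^+ n p * \prod_(q <- rem p s) sym_factor q ^+ n q.
have Mrest p z : p \in s -> M.[z] = (z - p) ^+ n p * (rest p).[z].
  move=> ps; rewrite /M (big_rem p ps) /= /sym_factor exprMn -mulrA hornerM.
  by rewrite horner_exp hornerXsubC.
pose g z := z ^+ 2 * F z * M.[z].
pose v p z := z ^+ 2 * u p z * (rest p).[z].
have cv p z : cabs (z - p) < r p -> cont_at (v p) z.
  move=> zr; apply: contM; last exact: cont_horner.
  apply: contM; last exact: holo_cont (hu p) zr.
  by apply: contX; exact: cont_id.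
have dv p z : cabs (z - p) < r p -> exists k, hasd (v p) z k.
  move=> zr; have : holo (v p) p (r p); last exact.
  by apply: holoM; [apply: holoM => //; apply: holoX; exact: holo_id | exact: holo_poly].
have vg p z : p \in s -> cabs (z - p) < r p -> cabs z < 1 -> z \notin s -> v p z = g z.
  move=> ps zr z1 zs; have zp : z != p by apply: contra zs => /eqP ->.
  have [_ _ /(_ z zr z1 zp) h _] := hD p.
  rewrite /v /g -[u p z]h (Mrest p z ps) -/(n p).
  by move: (_ ^+ n p) => a; ring.
(* One disk of the cover is chosen for each z; by [Phiv] the value of Phi does not depend on the
   choice. *)
have [P hP] : {P : C -> C & forall z, cabs z <= 1 -> P z \in s /\ cabs (z - P z) < r (P z)}.
  have h z : exists p, cabs z <= 1 -> p \in s /\ cabs (z - p) < r p; last by have [P hP] := choice h; exists P.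
   case: (lerP (cabs z) 1) => z1; last by exists 0.
  by have [p ps pr] := cov z z1; exists p.
pose Phi z := v (P z) z.
have Phiv p z : p \in s -> cabs (z - p) < r p -> cabs z <= 1 -> Phi z = v p z.
  move=> ps zr z1; have [Ps Pr] := hP z z1.
  have cut q : cabs (z - q) < r q -> forall w, cabs (w - z) < r q - cabs (z - q) -> cabs (w - q) < r q.
    by move=> _ w; have := cabsD (w - z) (z - q); rewrite addrA subrK; lra.
  change (v (P z) z = v p z).
  apply: (@disk_dense_eq _ z (Num.min (r (P z) - cabs (z - P z)) (r p - cabs (z - p))) s (v (P z)) (v p)) => //.
  - by rewrite lt_min !subr_gt0 zr Pr.
  - exact: cv.
  - exact: cv.
  - move=> w; rewrite lt_min => /andP[w1 w2] w3 ws.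
    by rewrite !vg //; [exact: cut w2 | exact: cut w1].
(* Off the centres this combines the reality of z^2 u / (z - p)^n with [Mrefl]; at the centres it
   follows by continuity along the circle. *)
have Phireal z : cabs z = 1 -> Phi z = z ^+ (2 * S) * (Phi z)^*.
  have half w p : p \in s -> cabs (w - p) < r p -> cabs w = 1 -> w \notin s ->
      v p w = w ^+ (2 * S) * (v p w)^*.
    move=> ps wr w1 ws; have wp : w != p by apply: contra ws => /eqP ->.
    have [_ _ _ /(_ w wr w1 wp) h] := hD p.
    have wpn : (w - p) ^+ n p != 0 by rewrite expf_neq0 // subr_eq0.
    have -> : v p w = w ^+ 2 * u p w / (w - p) ^+ n p * M.[w].
      rewrite (Mrest p w ps) /v; move: wpn; move: (_ ^+ n p) => a a0; move: (u p w) => b; by field.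
    have w0 : w != 0 by rewrite -cabs_gt0 w1.
    rewrite (real_rC h) cJM conj_rC {1}(Mrefl w w0) (refl_unit w1); ring.
  move=> z1; have zl : cabs z <= 1 by rewrite z1.
  have [ps pr] := hP z zl.
  rewrite /Phi; move: (P z) ps pr => p ps pr; apply/eqP; rewrite -subr_eq0; apply: contrapT => /negP ne.
  have cd : cont_at (fun w => v p w - w ^+ (2 * S) * (v p w)^*) z.
    have := cv p z pr => c1; apply: contB => //; apply: contM; last exact: cont_conj.
    by apply: contX; exact: cont_id.
  have /near_C[d d0 hd] := cont_neq0 cd ne.
  have [|w [wd w1 ws]] := circle_avoid s z1 (e := Num.min d (r p - cabs (z - p))).
    by rewrite lt_min d0 subr_gt0.
  move: wd; rewrite lt_min => /andP[wd wr].
  have := hd w wd; rewrite -half ?subrr ?eqxx //.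
  by have := cabsD (w - z) (z - p); rewrite addrA subrK; lra.
pose Ext z := z ^+ (2 * S) * (Phi (refl z))^*.
pose E := circ_glue Phi Ext.
have reflK z : refl (refl z) = z by rewrite /refl cJV cJK invrK.
have cPhi z : cabs z <= 1 -> cont_in [set w | cabs w <= 1] Phi z.
  move=> z1 e e0; have [ps pr] := hP z z1.
  have [d d0 hd] : exists2 d, 0 < d & forall w, cabs (w - z) < d -> cabs (v (P z) w - v (P z) z) < e.
    by have /cont_eps/(_ e e0)/near_C := cv _ _ pr.
  exists (Num.min d (r (P z) - cabs (z - P z))); first by rewrite lt_min d0 subr_gt0.
  move=> w /= w1; rewrite lt_min => /andP[wd wr].
  rewrite (Phiv (P z) w) //; first by apply: hd.
  by have := cabsD (w - z) (z - P z); rewrite addrA subrK; lra.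
have dPhi z : cabs z < 1 -> exists k, hasd Phi z k.
  move=> z1; have [ps pr] := hP z (ltW z1); have [k hk] := dv _ _ pr.
  exists k; apply: (hasd_near (f := v (P z))) hk.
  have z1' : cabs (z - 0) < 1 by rewrite subr0.
  apply: filterS2 (cabs_near pr) (cabs_near z1') => w wr; rewrite subr0 => /ltW w1.
  by rewrite (Phiv (P z) w).
have refl1 z : 1 <= cabs z -> cabs (refl z) <= 1 /\ z != 0.
  move=> z1; have p : 0 < cabs z by lra.
  by rewrite cabs_refl invf_le1 // -cabs_gt0.
have dExt z : 1 < cabs z -> exists k, hasd Ext z k.
  move=> z1; have z0 : z != 0 by have [] := refl1 z (ltW z1).
  have [|k hk] := dPhi (refl z); first by rewrite cabs_refl invf_lt1 // cabs_gt0.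
  have [k' hk'] := hasd_reflect z0 hk.
  eexists; apply: cderM; [exact: id_C_cont | apply: cderX; [exact: id_C_cont | exact: cder_iota] | exact: hk'].
have cExt z : 1 <= cabs z -> cont_in [set w | 1 <= cabs w] Ext z.
  move=> z1; have [z2 z0] := refl1 z z1.
  have ca : cont_in [set w | 1 <= cabs w] (fun w => Phi (refl w)) z.
    apply: (cont_in_pre (B := [set w | cabs w <= 1])); first exact: cont_refl.
      by move=> w /= /refl1 [].
    exact: cPhi.
  apply: (cont_inM (f := fun w => w ^+ (2 * S))) => //.
    by apply: cont_in_at; apply: contX; exact: cont_id.
  by apply: (cont_in_post (g := fun w => w^*)) => //; apply: cont_conj; exact: cont_id.
have hE c d : holo E c d.
  move=> z _; have [z1|z1|z1] := ltgtP (cabs z) 1.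
  - have [k hk] := dPhi z z1; exists k; apply: hasd_near hk.
    have z1' : cabs (z - 0) < 1 by rewrite subr0.
    by apply: filterS (cabs_near z1') => w; rewrite subr0 /E /circ_glue => /ltW ->.
  - have [k hk] := dExt z z1; exists k; apply: hasd_near hk.
    have [e e0 he] := exterior_open (iffRL (unit_exteriorE z) z1).
    apply/near_C; exists e => // w /he /unit_exteriorE.
    by rewrite /E /circ_glue ltNge => /negbTE ->.
  - have := @glue_holo R Phi Ext z 1 ltr01 z1; apply => //.
    + by move=> w _; exact: cPhi.
    + by move=> w _; exact: cExt.
    + by move=> w _; exact: dPhi.
    + by move=> w _; exact: dExt.
    + by move=> w _ w1; rewrite /Ext refl_unit //; exact: Phireal.
    + by rewrite subrr cabs0.
have Erefl z : z != 0 -> E z = z ^+ (2 * S) * (E (refl z))^*.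
  move=> z0; rewrite /E /circ_glue cabs_refl; have [z1|z1|z1] := ltgtP (cabs z) 1.
  - rewrite leNgt invf_gt1 ?cabs_gt0 // z1 /= /Ext reflK cJM cJX cJK /refl cJV cJK exprVn.
    by rewrite mulrA divff ?mul1r // expf_neq0.
  - by rewrite invf_le1 ?cabs_gt0 // (ltW z1).
  - by rewrite z1 invr1 lexx refl_unit //; exact: Phireal.
have [B B0 hB] : exists2 B, 0 <= B & forall z, cabs z <= 1 -> cabs (E z) <= B.
  have [t|B B0 hB] := @bounded_circ R E 0 4.
    have [|k /hasd_cont //] := hE (circ 0 4 t) 1 (circ 0 4 t).
    by rewrite subrr cabs0.
  exists (2 * B); first by rewrite mulr_ge0.
  (* With 16, [Cauchy_le] uses the circle of radius 4 and bounds E on the disk of radius 2. *)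
  move=> z z1; have r16 : 0 < 16 :> R by [].
  have e4 : 16 / 4 = 4 :> R by lra.
  by apply: (Cauchy_le r16 (hE 0 16)); rewrite e4 //; rewrite subr0; lra.
have [r'|z|h hh] := @Liouville_poly R (2 * S) E B.
- exact: hE.
- have [z1|z1] := lerP (cabs z) 1.
    by apply: le_trans (hB z z1) _; rewrite ler_peMr // exprn_ege1 // lerDl cabs_ge0.
  have [z2 z0] := refl1 z (ltW z1).
  rewrite Erefl // cabsM cabsX cabs_conj mulrC; apply: ler_pM => //.
  - exact: cabs_ge0.
  - by rewrite exprn_ge0 // cabs_ge0.
  - exact: hB.
  - by rewrite lerXn2r ?nnegrE ?addr_ge0 ?cabs_ge0 // lerDr.
exists h, ('X ^+ 2 * M), s, (2 * S)%N; split.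
- by rewrite mulf_neq0 // expf_neq0 // polyX_eq0.
- move=> z z1 zs; rewrite -hh /E /circ_glue (ltW z1).
  have [ps pr] := hP z (ltW z1); rewrite /Phi vg // /g !hornerE; ring.
- by move=> z z0; rewrite -!hh Erefl.
- move=> z z0; rewrite !hornerE (Mrefl z z0) cJM cJX /refl cJV cJK exprD exprVn.
  by move: (_ ^+ (2 * S)) (_^*) => a b; field.
Qed.

End Local.
End Rationality.

(** * The pullback as a quadratic differential in lowest terms *)

Section Pullback.
Context {R : realType}.
Local Notation C := (Cplx R).
Implicit Types (f g : C -> C) (z w p : C) (r d e : R) (Q : qdiff R).

Lemma isolated_zero f c r : 0 < r -> holo f c r ->
  (forall e, 0 < e -> exists2 z, cabs (z - c) < e & f z != 0) ->
  \forall w \near c, w != c -> f w != 0.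
Proof.
move=> r0 hf /(zero_order r0 hf) [m [g [hg g0 fE]]].
have cc : cabs (c - c) < r by rewrite subrr cabs0.
apply: filterS (cont_neq0 (holo_cont hg cc) g0) => w gw wc.
by rewrite fE mulf_neq0 ?expf_neq0 ?subr_eq0.
Qed.

Lemma near_root_free (p : {poly C}) z : p != 0 -> \forall w \near z, w != z -> p.[w] != 0.
Proof.
move=> p0; have [q [pE qz]] := poly_mup z p0.
apply: filterS (cont_neq0 (cont_horner q z) qz) => w qw wz.
by rewrite pE hornerM horner_exp hornerXsubC mulf_neq0 ?expf_neq0 ?subr_eq0.
Qed.

Lemma near_notin z (s : seq C) : \forall w \near z, w != z -> w \notin s.
Proof.
elim: s => [|x s ih]; first exact: filterE.
case: (z =P x) => [<-|/eqP zx].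
  by apply: filterS ih => w h wz; rewrite inE negb_or wz h.
by apply: filterS2 ih (near_neq zx) => w h wx wz; rewrite inE negb_or wx h.
Qed.

Lemma near_punctured_eq f g z : cont_at f z -> cont_at g z ->
  (\forall w \near z, w != z -> f w = g w) -> f z = g z.
Proof.
move=> cf cg h; apply/eqP; rewrite -subr_eq0; apply: contrapT => /negP ne.
have /near_C[d d0 hd] : \forall w \near z, (w != z -> f w = g w) /\ f w - g w != 0.
  by apply: filterI h _; exact: (cont_neq0 (contB cf cg) ne).
have d2 : cabs (z + rC (d / 2) - z) = d / 2 by rewrite addrAC subrr add0r cabs_rC gtr0_norm ?divr_gt0.
have [|fg] := hd (z + rC (d / 2)); first by rewrite d2; lra.
by rewrite fg ?subrr ?eqxx // -subr_eq0 -cabs_eq0 d2 gt_eqF // divr_gt0.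
Qed.

(* When g2 z = 0 both sides are 0, since x / 0 = 0. *)
Lemma qeval_limit Q z g1 g2 : cont_at g1 z -> cont_at g2 z -> (g1 z != 0) || (g2 z != 0) ->
  (\forall w \near z, w != z -> (qden Q).[w] * g1 w = (qnum Q).[w] * g2 w) ->
  qeval Q z = g1 z / g2 z.
Proof.
move=> c1 c2 n0 hw.
have := near_punctured_eq (contM (cont_horner (qden Q) z) c1) (contM (cont_horner (qnum Q) z) c2) hw.
rewrite /qeval => e; have nd : (qnum Q).[z] = 0 -> (qden Q).[z] = 0 -> False.
  by move=> a b; have := coprimep_root (qcoprime Q) (x := z); rewrite /root a b eqxx => /(_ isT).
case: (eqVneq (qden Q).[z] 0) e => [d0|d0] e.
  move: e; rewrite d0 mul0r => /esym/eqP; rewrite mulf_eq0 => /orP[/eqP /nd /(_ d0) //|/eqP ->].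
  by rewrite !invr0 !mulr0.
case: (eqVneq (g2 z) 0) e n0 => [->|g20] e n0.
  by move: e n0; rewrite mulr0 => /eqP; rewrite mulf_eq0 (negbTE d0) /= => ->.
by apply/eqP; rewrite eqr_div // -e mulrC.
Qed.

Lemma reduced_fraction (h m : {poly C}) : h != 0 -> m != 0 -> exists Q, h * qden Q = qnum Q * m.
Proof.
move=> h0 m0; have g0 : gcdp h m != 0 by rewrite gcdp_eq0 negb_and h0.
have hE := divpK (dvdp_gcdl h m); have mE := divpK (dvdp_gcdr h m).
have n0 : h %/ gcdp h m != 0 by apply: contra h0 => /eqP e; rewrite -hE e mul0r.
have d0 : m %/ gcdp h m != 0 by apply: contra m0 => /eqP e; rewrite -mE e mul0r.
have cp : coprimep (h %/ gcdp h m) (m %/ gcdp h m) by rewrite coprimep_div_gcd // h0.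
exists (QDiff n0 d0 cp) => /=; have -> : forall x, h * x = h %/ gcdp h m * gcdp h m * x by rewrite hE.
by rewrite mulrAC -mulrA mE.
Qed.

Section Map.
Variables (Q : qdiff R) (Gamma : set C) (psi : C -> C).
Hypotheses (hGamma : jordan_curve Gamma) (hfree : forall z, Gamma z -> ~ infinite_critical Q z)
  (harcs : made_of_trajectory_arcs Q Gamma) (hpsi : disk_map Gamma psi) (psi0 : meromorphic psi 0)
  (dpsi : forall z, cabs z < 1 -> z != 0 -> psi^`()%classic z != 0).

(** The size of [q] exceeds the number of its roots, and psi is injective: one among that many
    points is sent to no root. *)
Lemma disk_map_avoid (q : {poly C}) z1 e : q != 0 -> cabs z1 <= 1 -> 0 < e ->
  exists z, [/\ cabs (z - z1) < e, cabs z < 1, z != z1, z != 0 & q.[psi z] != 0].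
Proof.
move=> q0 z11 e0; have [s [us ss hs]] := disk_points (size q) z11 e0.
have /allPn[z zs zq] : ~~ all (root q) (map psi s).
  apply/negP => ra; have := max_poly_roots q0 ra.
  rewrite map_inj_in_uniq ?us ?size_map ?ss ?ltnn; first by move/(_ isT).
  have [_ _ ipsi _] := hpsi.
  by move=> x y /hs [_ /ltW a _ b] /hs [_ /ltW c _ d]; exact: ipsi.
by move: zs zq => /mapP[x /hs [a b c d] ->] zq; exists x.
Qed.

Lemma pullback_mero p : cabs p < 1 -> meromorphic (pullback Q psi) p.
Proof.
move=> p1; have [_ hd _ _] := hpsi.
have mpsi : meromorphic psi p.
  case: (eqVneq p 0) => [->//|p0].
  apply: (@mero_holo _ _ _ (Num.min (cabs p) (1 - cabs p))); first by rewrite lt_min cabs_gt0 p0 subr_gt0.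
  move=> z; rewrite lt_min => /andP[a b]; apply: hd.
    by have := cabsD (z - p) p; rewrite subrK; lra.
  by rewrite -cabs_gt0; have := cabsB p (p - z); rewrite subKr cabsC; lra.
have mder : meromorphic (psi^`()%classic : C -> C) p.
  case: (eqVneq p 0) mpsi => [-> mpsi|p0 mpsi].
    apply: (@mero_derive _ _ _ 1) => // z; rewrite subr0; exact: hd.
  apply: (@mero_derive _ _ _ (Num.min (cabs p) (1 - cabs p))) => //.
    by rewrite lt_min cabs_gt0 p0 subr_gt0.
  move=> z; rewrite lt_min => /andP[a b] _; apply: hd.
    by have := cabsD (z - p) p; rewrite subrK; lra.
  by rewrite -cabs_gt0; have := cabsB p (p - z); rewrite subKr cabsC; lra.
apply: meroM; last exact: meroM.
apply: meroM; first exact: mero_poly.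
apply: meroV; first exact: mero_poly.
move=> e e0; have [z [a b c d f]] := disk_map_avoid (qden_neq0 Q) (ltW p1) e0.
by exists z.
Qed.

(** Interior points contribute the poles of a meromorphic function, boundary points at most the
    simple pole of [boundary_pole]. Agreement is obtained off a finite list; [pullback_eq] extends
    it later to the points of the list. *)
Lemma pullback_rational : exists QD : qdiff R,
  [/\ exists s : seq C, forall z, cabs z < 1 -> z \notin s -> (qden QD).[z] * pullback Q psi z = (qnum QD).[z] &
      forall z, z != 0 -> (qeval QD (z^*)^-1)^* = z ^+ 4 * qeval QD z].
Proof.
have [|h [m [s [N [m0 mF hr mr]]]]] := @rational_of_local R (pullback Q psi).
  move=> p p1; case: (ltrP (cabs p) 1) => p2.
    have [n [r [u [r0 hu uF]]]] := pullback_mero p2.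
    exists n, (Num.min r (1 - cabs p)), u; split.
    - by rewrite lt_min r0 subr_gt0.
    - by apply: holo_le hu; rewrite ge_min lexx.
    - by move=> z; rewrite lt_min => /andP[zr _] _; exact: uF.
    - move=> z; rewrite lt_min => /andP[_ zr] z1.
      by have := cabsD (z - p) p; rewrite subrK; lra.
  have {p1 p2}p1 : cabs p = 1 by lra.
  have [t _ ep] := cabs1_cis p1.
  have [X fX reg] := arcs_structure hGamma harcs.
  have [_ _ _ Gpsi] := hpsi.
  have [rho [W [rho0 hW W0 WQ]]] := square_of_abelian_integral (hfree (Gpsi p p1)).
  rewrite ep in rho0 hW W0 WQ *.
  have [r [u [r0 hu uF ui]]] := boundary_pole hpsi fX reg rho0 hW W0 WQ.
  exists 1%N, r, u; split => // z zr z1; first by rewrite expr1 => _; exact: uF.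
(* The pullback is not identically 0: arbitrarily near 0 there are points that psi sends to no root
   of either polynomial of [Q], and psi' has no zero off 0. *)
have h0 : h != 0.
  apply/negP => /eqP h0.
  have nz : qnum Q * qden Q != 0 by rewrite mulf_neq0 ?qnum_neq0 ?qden_neq0.
  have z01 : cabs (0 : C) <= 1 by rewrite cabs0.
  have /near_C[d d0 hd] : \forall w \near (0 : C), (w != 0 -> w \notin s) /\ (w != 0 -> m.[w] != 0).
    by apply: filterI; [exact: near_notin | exact: near_root_free].
  have [z [zd z1 zz z0 qz]] := disk_map_avoid nz z01 d0.
  have [zs mz] := hd z zd.
  have := mF z z1 (zs zz); rewrite h0 horner0 => /eqP; rewrite mulf_eq0 (negbTE (mz zz)) /=.
  apply/negP; move: qz; rewrite hornerM mulf_eq0 negb_or /pullback /qeval => /andP[a b].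
  by rewrite !mulf_neq0 ?invr_neq0 ?expf_neq0 ?dpsi.
have [QD hQ] := reduced_fraction h0 m0; exists QD; split.
  have [l ml] : exists l : seq C, forall z, z \notin l -> m.[z] != 0.
    have [l ->] := closed_field_poly_normal m; exists l => z.
    rewrite -root_prod_XsubC rootE => zl; rewrite hornerZ mulf_neq0 // lead_coef_eq0 //.
  exists (s ++ l) => z z1; rewrite mem_cat negb_or => /andP[zs zl].
  apply: (mulfI (ml z zl)); rewrite mulrCA mF // mulrC.
  by have /(congr1 (horner^~ z)) := hQ; rewrite !hornerM mulrC => ->; rewrite mulrC.
move=> z z0; have zr : refl z != 0 by rewrite /refl invr_eq0 conjC_eq0.
have z4 : z ^+ 4 != 0 by rewrite expf_neq0.
(* The law holds in a punctured neighbourhood of z; [qeval_limit] carries it to z, poles with their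
   default value included. *)
rewrite (@qeval_limit QD z (fun w => ((qnum QD).[refl w])^*) (fun w => w ^+ 4 * ((qden QD).[refl w])^*)).
- rewrite /qeval cJM cJV -/(refl z); move: ((qnum QD).[refl z]^*) ((qden QD).[refl z]^*) => a b.
  by rewrite invfM (mulrCA a) (mulrA (z ^+ 4)) divff ?mul1r.
- by apply: cont_conj; apply: cont_comp (cont_refl z0) (cont_horner _ _).
- apply: contM; first by apply: contX; exact: cont_id.
  by apply: cont_conj; apply: cont_comp (cont_refl z0) (cont_horner _ _).
- rewrite mulf_eq0 (negbTE z4) /= !conjC_eq0 -negb_and; apply/negP => /andP[/eqP a /eqP b].
  by have := coprimep_root (qcoprime QD) (x := refl z); rewrite /root a b eqxx => /(_ isT).
- near=> w => wz; have w0 : w != 0 by near: w; exact: near_neq.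
  have mw : m.[w] != 0 by move: wz; near: w; exact: near_root_free.
  have /(congr1 (horner^~ w)) := hQ; have /(congr1 (horner^~ (refl w))) := hQ.
  rewrite !hornerM (hr w w0) (mr w w0) exprD => /(congr1 (@Num.conj C)); rewrite !cJM.
  move: mw; rewrite (mr w w0) exprD !mulf_eq0 !negb_or => /andP[/andP[wN w4] mw].
  move: wN w4 mw; move: (w ^+ N) (w ^+ 4) (m.[_]^*) (h.[_]^*) ((qden QD).[_]^*) ((qnum QD).[_]^*) => a b c d f g a0 b0 c0.
  move: (qnum QD).[w] (qden QD).[w] => k l e1 e2.
  apply: (mulfI a0); apply: (mulfI c0).
  have -> : c * (a * (l * g)) = l * a * (g * c) by ring.
  have -> : c * (a * (k * (b * f))) = f * (k * (a * b * c)) by ring.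
  by rewrite -e1 -e2; ring.
Unshelve. all: by end_near.
Qed.

End Map.
End Pullback.

(** * Primitives of the real radicals *)

Section DefiniteIntegral.
Context {R : realType}.
Implicit Types (f F : R -> R) (a b c u v t : R).
Local Notation mu := (@lebesgue_measure R).

Definition defint f a b v : Prop := mu.-integrable `[a, b] (EFin \o f) /\
  (\int[mu]_(x in `[a, b]) f x = v)%R.

Lemma defint_nil f a : defint f a a 0.
Proof.
rewrite /defint set_itv1; split; last by rewrite Rintegral_set1.
apply/integrableP; split; first exact: measurable_fun_set1.
by rewrite integral_set1.
Qed.

Lemma defint_cat f a b c u v : a <= b -> b <= c -> defint f a b u -> defint f b c v ->
  defint f a c (u + v).
Proof.
move=> ab bc [i1 <-] [i2 <-].
have U : `[a, c]%classic = `[a, b] `|` `]b, c].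
  by rewrite -itv_bndbnd_setU // bnd_simp.
have i2' : mu.-integrable `]b, c] (EFin \o f).
  by apply: integrableS i2 => //; apply: subset_itvr; rewrite bnd_simp.
have iU : mu.-integrable `[a, c] (EFin \o f).
  have m1 : measurable_fun (`[a, b] `|` `]b, c]) (EFin \o f).
    by apply/measurable_funU => //; split; [case/integrableP: i1 | case/integrableP: i2'].
  rewrite U; apply/integrableP; split => //.
  rewrite ge0_integral_setU //.
  - by apply: lte_add_pinfty; [case/integrableP: i1 | case/integrableP: i2'].
  - exact: (measurableT_comp (@abse_measurable R setT) m1).
  - by apply/disj_setPS => t [] /=; rewrite !in_itv /= => /andP[_ h1] /andP[/lt_geF]; rewrite h1.
have e : \int[mu]_(x in `[b, c]) f x = \int[mu]_(x in `]b, c]) f x by rewrite Rintegral_itv_obnd_cbnd.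
split => //; rewrite e.
by rewrite -(@Rintegral_itvB R f (BLeft a) (BRight c) b) ?bnd_simp // addrC subrK.
Qed.

(** sqrt H is unbounded at a simple pole on the circle, so F is merely continuous at the ends. The
    fundamental theorem is used on [a + h n, b - h n], and monotone convergence, as f >= 0, yields
    both integrability and the value. *)
Lemma defint_ftc f F a b : a < b -> (forall t, 0 <= f t) ->
  (forall t, a < t < b -> cont_at f t) -> (forall t, a < t < b -> is_derive t (1 : R) F (f t)) ->
  cont_at F a -> cont_at F b -> defint f a b (F b - F a).
Proof.
move=> ab f0 cf dF [Fa] [Fb]; pose h n : R := (b - a) / 3 * harmonic n.
have p3 : 0 < (b - a) / 3 by rewrite divr_gt0 ?subr_gt0.
have h0 n : 0 < h n by rewrite mulr_gt0 ?harmonic_gt0.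
have h3 n : 3 * h n <= b - a.
  have : h n <= (b - a) / 3 by rewrite /h ler_piMr ?(ltW p3) // invf_le1 ?ltr0n // ler1n.
  by lra.
have hd n m : (n <= m)%N -> h m <= h n.
  by move=> nm; rewrite /h ler_pM2l // lef_pV2 ?posrE ?ltr0n // ler_nat.
have hcvg : h @ \oo --> 0.
  by rewrite -(mulr0 ((b - a) / 3)); apply: cvgM; [exact: cvg_cst | exact: cvg_harmonic].
pose I n := `[a + h n, b - h n]%classic.
have inI n t : I n t -> a < t < b.
  rewrite /I /= in_itv /= => /andP[t1 t2]; have := h0 n; lra.
have UI : \bigcup_n I n = `]a, b[%classic.
  apply/seteqP; split => t; first by case=> n _ /inI; rewrite /= in_itv.
  rewrite /= in_itv /= => /andP[ta tb].
  have m0 : 0 < Num.min (t - a) (b - t) by rewrite lt_min !subr_gt0 ta.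
  have /cvg_R/(_ _ m0) [n _ hn] := hcvg.
  have := hn n (leqnn n); rewrite /= subr0 lt_min gtr0_norm // => /andP[l1 l2].
  by exists n => //; rewrite /I /= in_itv /=; apply/andP; split; lra.
have mfo : measurable_fun `]a, b[ f.
  apply: open_continuous_measurable_fun => // t; rewrite inE /= in_itv /=.
  by move=> /cf [].
have mfc : measurable_fun `[a, b] f.
  by apply/measurable_fun_itv_obnd_cbndP/measurable_fun_itv_bndo_bndcP.
have mfI n : measurable_fun (I n) (EFin \o f).
  apply/measurable_EFinP; apply: measurable_funS mfo => // t /inI.
  by rewrite /= in_itv.
have intI n : (\int[mu]_(x in I n) (EFin \o f) x = (F (b - h n))%:E - (F (a + h n))%:E)%E.
  have h1 := h0 n; have h2 := h3 n.
  have cF t : a < t < b -> cont_at F t by move=> /dF; exact: is_derive_cont_at.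
  apply: continuous_FTC2.
  - lra.
  - by apply: cont_within_itv => t /andP[t1 t2]; apply: cf; apply/andP; split; lra.
  - split.
    + move=> t; rewrite in_itv /= => /andP[t1 t2].
      by have [] : is_derive t (1 : R) F (f t) by apply: dF; apply/andP; split; lra.
    + apply: cvg_at_right_filter; have [] : cont_at F (a + h n) => //; apply: cF; apply/andP; split; lra.
    + apply: cvg_at_left_filter; have [] : cont_at F (b - h n) => //; apply: cF; apply/andP; split; lra.
  - move=> t; rewrite in_itv /= => /andP[t1 t2].
    have ? : is_derive t (1 : R) F (f t) by apply: dF; apply/andP; split; lra.
    by rewrite derive1E derive_val.
have lim1 : (\int[mu]_(x in I n) (EFin \o f) x)%E @[n --> \oo] --> (\int[mu]_(x in `]a, b[) (EFin \o f) x)%E.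
  rewrite -UI; apply: ge0_nondecreasing_set_cvg_integral => //.
  - move=> n m nm; rewrite subsetEset => t; rewrite /I /= !in_itv /= => /andP[t1 t2].
    by have := hd n m nm => l; apply/andP; split; lra.
  - by move=> n; exact: measurable_itv.
  - by move=> n t _; rewrite lee_fin.
have lim2 : (\int[mu]_(x in I n) (EFin \o f) x)%E @[n --> \oo] --> (F b - F a)%:E.
  under eq_fun do rewrite intI -EFinB.
  apply: cvg_EFin; first exact: nearW.
  have lb : (b - h n) @[n --> \oo] --> b.
    by rewrite -[X in _ --> X]subr0; apply: cvgB => //; exact: cvg_cst.
  have la : (a + h n) @[n --> \oo] --> a.
    by rewrite -[X in _ --> X]addr0; apply: cvgD => //; exact: cvg_cst.
  have lF : (F (b - h n) - F (a + h n)) @[n --> \oo] --> F b - F a.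
    by apply: cvgB; [exact: (cvg_comp _ _ lb Fb) | exact: (cvg_comp _ _ la Fa)].
  exact: lF.
have intE : (\int[mu]_(x in `[a, b]) (EFin \o f) x)%E = (F b - F a)%:E.
  rewrite -integral_itv_obnd_cbnd; last exact/measurable_EFinP/measurable_fun_itv_bndo_bndcP.
  rewrite -integral_itv_bndo_bndc; last exact/measurable_EFinP.
  exact: (cvg_unique _ lim1 lim2).
split; last by rewrite /Rintegral intE.
apply/integrableP; split; first exact/measurable_EFinP.
under eq_integral do rewrite gee0_abs ?lee_fin //.
by rewrite intE ltry.
Qed.

(** This passes from local to global for properties that can be chained. At the supremum s of the t
    with P a t, the local hypothesis chained with P a t for some t close to s reaches s, and goes
    beyond it unless s = b. *)
Lemma interval_induction (P : R -> R -> Prop) a b : a <= b ->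
  (forall x y z, a <= x -> x <= y -> y <= z -> z <= b -> P x y -> P y z -> P x z) ->
  (forall t, a <= t <= b -> exists2 e, 0 < e & forall x y, a <= x -> x <= y -> y <= b ->
     `|x - t| < e -> `|y - t| < e -> P x y) -> P a b.
Proof.
move=> ab tr loc; pose S := [set t | a <= t <= b /\ P a t].
have Sa : S a.
  split; first by rewrite lexx.
  have [|e e0] := loc a; first by rewrite lexx.
  by apply; rewrite ?subrr ?normr0.
have hS : has_sup S by split; [exists a | exists b => t [/andP[]]].
pose s := sup S.
have as_ : a <= s by exact: ub_le_sup hS.2 _ Sa.
have sb : s <= b by apply: ge_sup; [exists a | move=> t [/andP[]]].
have [|e e0 he] := loc s; first by rewrite as_.
have [t [/andP[ta tb] Pt] ts] := sup_adherent e0 hS.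
have ts' : t <= s by apply: ub_le_sup hS.2 _ _; split=> //; apply/andP.
pose y := Num.min b (s + e / 2).
have [y1 y2] : y <= b /\ y <= s + e / 2 by rewrite !ge_min !lexx orbT.
have sy : s <= y by rewrite le_min sb; lra.
have Py : P a y.
  apply: (tr a t y) => //; first exact: le_trans ts' sy.
  apply: he => //; first exact: le_trans ts' sy.
    by rewrite ler0_norm; rewrite -/s in ts; lra.
  by rewrite ger0_norm; lra.
have ys : y <= s.
  apply: ub_le_sup hS.2 _ _; split=> //.
  by rewrite y1 (le_trans as_).
suff <- : y = b by [].
have [h|h] := lerP b (s + e / 2); first by rewrite /y min_l.
by exfalso; move: ys; rewrite /y min_r ?(ltW h) //; lra.
Qed.

End DefiniteIntegral.

Section LocalPrimitive.
Context {R : realType}.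
Variables (om dom H : R -> R) (t0 e : R).
Implicit Types (a b s t : R).
Hypotheses (der : forall t, `|t - t0| < e -> is_derive t (1 : R) om (dom t))
  (cdom : forall t, `|t - t0| < e -> cont_at dom t) (om0 : om t0 = 0)
  (omN : forall t, `|t - t0| < e -> t != t0 -> om t != 0)
  (HN : forall t, `|t - t0| < e -> t != t0 -> [/\ H t != 0, cont_at H t & dom t ^+ 2 = - 4 * om t * H t]).

(** A primitive of sqrt H on both sides of t0: where om > 0 one has H < 0, and [Num.sqrt] makes both
    radicals vanish; where om < 0 the sign makes it increasing. *)
Definition signed_root t := Num.sg (t - t0) * Num.sqrt (- om t).

Lemma contR_M (T : topologicalType) (f g : T -> R) (t : T) : cont_at f t -> cont_at g t -> cont_at (fun s : T => f s * g s) t.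
Proof. by move=> [f1] [g1]; split; exact: cvgM. Qed.

Lemma cont_sqrt (T : topologicalType) (f : T -> R) (t : T) : cont_at f t -> cont_at (fun s : T => Num.sqrt (f s)) t.
Proof. by move=> cf; apply: cont_comp cf _; split; exact: sqrt_continuous. Qed.

Lemma cont_om t : `|t - t0| < e -> cont_at om t.
Proof. by move=> /der; exact: is_derive_cont_at. Qed.

Lemma cont_oppr (T : topologicalType) (f : T -> R) (t : T) : cont_at f t -> cont_at (fun s : T => - f s) t.
Proof. by move=> [f1]; split; exact: cvgN. Qed.

Lemma near_sg t : t != t0 -> \forall s \near t, Num.sg (s - t0) = Num.sg (t - t0).
Proof.
move=> tt; apply/near_R; exists (`|t - t0|) => [|s]; first by rewrite normr_gt0 subr_eq0.
have [t1|t1|e0] := ltgtP t t0; last by rewrite e0 eqxx in tt.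
  rewrite (ltr0_norm (_ : t - t0 < 0)) ?subr_lt0 // ltr_norml => /andP[a b].
  by rewrite !ltr0_sg //; lra.
rewrite (gtr0_norm (_ : 0 < t - t0)) ?subr_gt0 // ltr_norml => /andP[a b].
by rewrite !gtr0_sg //; lra.
Qed.

Lemma cont_signed_root t : `|t - t0| < e -> cont_at signed_root t.
Proof.
move=> te; have [cg] := cont_sqrt (cont_oppr (cont_om te)).
case: (eqVneq t t0) => [tt|tt].
  split; apply/cvg_R => d d0; move/cvg_R/(_ d d0): cg; rewrite tt om0 oppr0 sqrtr0.
  apply: filterS => s; rewrite /signed_root subrr sgr0 mul0r !subr0 normrM.
  by apply: le_lt_trans; rewrite ler_piMl // normr_sg; case: (_ != 0); rewrite ?ler01.
apply: (cont_near (f := fun s => Num.sg (t - t0) * Num.sqrt (- om s))).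
  by apply: filterS (near_sg tt) => s hs; rewrite /signed_root hs.
by apply: contR_M; [exact: cont_cst | split].
Qed.

Lemma between_ball t c : `|t - t0| < e -> (t0 <= c <= t) || (t <= c <= t0) -> `|c - t0| < e.
Proof. by rewrite !ltr_norml => /andP[a b] /orP[] /andP[l1 l2]; apply/andP; split; lra. Qed.

(* Otherwise om, which leaves 0 downwards, would have a critical point between t0 and t. *)
Lemma derive_sign t : `|t - t0| < e -> t != t0 -> om t < 0 -> Num.sg (t - t0) * dom t < 0.
Proof.
move=> te tt omt.
have dn c : `|c - t0| < e -> c != t0 -> dom c != 0.
  move=> ce ct; have [h0 _ hd] := HN ce ct.
  by rewrite -sqrf_eq0 hd !mulf_neq0 ?omN // oppr_eq0 pnatr_eq0.
rewrite ltNge; apply/negP => pos.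
have [t1|t1|e0] := ltgtP t t0; last by rewrite e0 eqxx in tt.
  have [c /andP[c1 c2] hc] : exists2 c, t < c < t0 & om t0 - om t = dom c * (t0 - t).
    by apply: MVT_R => // s hs; apply: der; apply: (between_ball te); rewrite hs orbT.
  have dc : 0 < dom c.
    have : 0 < dom c * (t0 - t) by rewrite -hc om0; lra.
    by rewrite pmulr_lgt0 // subr_gt0.
  have dt : dom t <= 0 by move: pos; rewrite ltr0_sg ?subr_lt0 // mulN1r oppr_ge0.
  have [r /andP[r1 r2] r0] : exists2 r, t <= r <= c & dom r = 0.
    apply: IVT_between; [exact: ltW| |by left; rewrite dt ltW].
    by move=> s /andP[s1 s2]; apply: cdom; apply: (between_ball te); apply/orP; right; apply/andP; split; lra.
  have := dn r; rewrite r0 eqxx => /(_ (between_ball te _)) h.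
  by have : false by apply: h; [apply/orP; right; apply/andP; split; lra | rewrite lt_eqF //; lra].
have [c /andP[c1 c2] hc] : exists2 c, t0 < c < t & om t - om t0 = dom c * (t - t0).
  by apply: MVT_R => // s hs; apply: der; apply: (between_ball te); rewrite hs.
have dc : dom c < 0.
  have : dom c * (t - t0) < 0 by rewrite -hc om0; lra.
  by rewrite pmulr_llt0 // subr_gt0.
have dt : 0 <= dom t by move: pos; rewrite gtr0_sg ?subr_gt0 // mul1r.
have [r /andP[r1 r2] r0] : exists2 r, c <= r <= t & dom r = 0.
  apply: IVT_between; [exact: ltW| |by left; rewrite dt ltW].
  by move=> s /andP[s1 s2]; apply: cdom; apply: (between_ball te); apply/orP; left; apply/andP; split; lra.
have := dn r; rewrite r0 eqxx => /(_ (between_ball te _)) h.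
by have : false by apply: h; [apply/orP; left; apply/andP; split; lra | rewrite gt_eqF //; lra].
Qed.

(** Where om < 0 the derivative of sqrt (- om) has the square dom^2 / (- 4 om) = H, and
    [derive_sign] settles its sign; where om > 0 both sides are 0. *)
Lemma derive_signed_root t : `|t - t0| < e -> t != t0 ->
  is_derive t (1 : R) signed_root (Num.sqrt (H t)).
Proof.
move=> te tt; have [H0 _ hd] := HN te tt; have ot := omN te tt.
have [op|on|o0] := ltgtP (om t) 0; last by rewrite o0 eqxx in ot.
- have sg1 := derive_sign te tt op; have st : 0 < Num.sqrt (- om t) by rewrite sqrtr_gt0 oppr_gt0.
  apply: (near_eq_is_derive (f := fun s => Num.sg (t - t0) * Num.sqrt (- om s))).
    by apply: filterS (near_sg tt) => s hs; rewrite /signed_root hs.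
  have d1 := der te; have d2 : is_derive (- om t) (1 : R) Num.sqrt (2 * Num.sqrt (- om t))^-1.
    by apply: is_derive1_sqrt; rewrite oppr_gt0.
  have d3 : is_derive t (1 : R) (fun s => - om s) (- dom t) by exact: is_deriveN.
  have d4 := @is_derive1_comp _ Num.sqrt (fun s => - om s) t _ _ d2 d3.
  have d5 := @is_deriveZ _ _ _ _ (Num.sg (t - t0)) _ _ _ d4.
  apply: is_derive_eq d5 _.
  have Ht : 0 < H t.
    rewrite lt_neqAle eq_sym H0 /= leNgt; apply/negP => Hn.
    have : 0 <= - 4 * om t * H t by rewrite -hd sqr_ge0.
    nra.
  set g := Num.sqrt (- om t); set v := _ *: _.
  have v0 : 0 <= v.
    rewrite /v /GRing.scale /= mulrCA mulrN mulr_ge0 ?invr_ge0 ?mulr_ge0 ?(ltW st) //.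
    by rewrite oppr_ge0 ltW.
  rewrite -[v]ger0_norm // -sqrtr_sqr; congr Num.sqrt.
  have g2 : g ^+ 2 = - om t by rewrite sqr_sqrtr // oppr_ge0 ltW.
  have sg2 : Num.sg (t - t0) ^+ 2 = 1 by rewrite sqr_sg subr_eq0 tt.
  rewrite /v /GRing.scale /= !exprMn sg2 exprVn exprMn g2 sqrrN hd.
  by field; rewrite ot.
- apply: (near_eq_is_derive (f := fun=> 0)).
    have [co] := cont_om te; apply: filterS (cvgr_gt _ co _ on) => s hs.
    by rewrite /signed_root ler0_sqrtr ?mulr0 // oppr_le0 ltW.
  have -> : Num.sqrt (H t) = 0.
    apply: ler0_sqrtr.
    have : 0 <= - 4 * om t * H t by rewrite -hd sqr_ge0.
    nra.
  exact: is_derive_cst.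
Qed.

(** Nothing is known of H at t0 itself, so the interval is cut there and [defint_ftc] is applied to
    each piece. *)
Lemma defint_sqrt a b : `|a - t0| < e -> `|b - t0| < e -> a <= b ->
  defint (fun t => Num.sqrt (H t)) a b (signed_root b - signed_root a).
Proof.
have base x y : `|x - t0| < e -> `|y - t0| < e -> x <= y -> (y <= t0) || (t0 <= x) ->
    defint (fun t => Num.sqrt (H t)) x y (signed_root y - signed_root x).
  move=> xe ye; rewrite le_eqVlt => /orP[/eqP <- _|xy side]; first by rewrite subrr; exact: defint_nil.
  have inb t : x < t < y -> `|t - t0| < e /\ t != t0.
    move: xe ye; rewrite !ltr_norml => /andP[x1 x2] /andP[y1 y2] /andP[t1 t2]; split.
      by apply/andP; split; lra.
    by case/orP: side => h; [rewrite lt_eqF // | rewrite gt_eqF //]; lra.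
  apply: defint_ftc => //.
  - by move=> t /inb [te tt]; apply: cont_sqrt; have [] := HN te tt.
  - by move=> t /inb [te tt]; exact: derive_signed_root.
  - exact: cont_signed_root.
  - exact: cont_signed_root.
move=> ae be ab; have [b0|b0] := lerP b t0; first by apply: base; rewrite ?b0.
have [a0|a0] := lerP t0 a; first by apply: base; rewrite ?a0 ?orbT.
have t0e : `|t0 - t0| < e by rewrite subrr normr0; apply: le_lt_trans ae; exact: normr_ge0.
have -> : signed_root b - signed_root a = (signed_root t0 - signed_root a) + (signed_root b - signed_root t0) by ring.
by apply: (@defint_cat R _ a t0 b); [exact: ltW|exact: ltW|apply: base|apply: base] => //; rewrite ?lexx ?orbT // ltW.
Qed.

End LocalPrimitive.

(** * Product forms *)

Section ProductForm.
Context {R : realType}.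
Local Notation C := (Cplx R).
Implicit Types (z w c : C) (p q : {poly C}) (Q : qdiff R).

Lemma mup_sym_factor c z : cabs c < 1 -> cabs z <= 1 -> mup z (sym_factor c) = (c == z).
Proof.
move=> c1 z1; rewrite /sym_factor mupMl ?(@mup_XsubCX _ 1); first by case: (_ == _).
rewrite /root !hornerE subr_eq0; apply/eqP => /(congr1 cabs).
rewrite cabs1 cabsM cabs_conj => h.
have := cabs_ge0 c; have := cabs_ge0 z; nra.
Qed.

Lemma cispi : cis pi = -1 :> C.
Proof. by rewrite cisE cospi sinpi; apply: complex_eq; rewrite ?ReN ?ImN //= oppr0. Qed.

Definition Pfactor (a : R) : {poly C} := cis (- (pi + a) / 2) *: ('X - (cis a)%:P).

Lemma Pfactor_neq0 a : Pfactor a != 0.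
Proof. by rewrite scaler_eq0 negb_or polyXsubC_eq0 cis_neq0. Qed.

(** The unimodular constant of the factor is a square root of - conj (cis a), which gives the law
    with exponent 1 and without a further constant. *)
Lemma Pfactor_refl a z : z != 0 -> (Pfactor a).[z] = z * ((Pfactor a).[refl z])^*.
Proof.
move=> z0; rewrite !hornerZ !hornerXsubC cJM cJB !conj_cis /refl cJV cJK.
have -> : - (- (pi + a) / 2) = pi + (- (pi + a) / 2 + a) by field.
rewrite (cisD pi) (cisD (- (pi + a) / 2) a) cispi cisN.
by field; rewrite z0 cis_neq0.
Qed.

Lemma mup_Pfactor a z : mup z (Pfactor a) = (cis a == z).
Proof.
rewrite /Pfactor -mul_polyC mupMr ?(@mup_XsubCX _ 1); first by case: (_ == _).
by rewrite rootC cis_neq0.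
Qed.

(** [q] takes the zeros of [p] in the closed disk, those of the open disk together with their
    reflections; the last clause traces a zero of [q] back to one of [p]. *)
Lemma symmetric_part p : p != 0 -> exists (c : seq C) (alpha : seq R) q n,
  [/\ lists_roots unit_disk p c, lists_roots unit_circle p (map cis alpha),
      q != 0 & forall z, q.[z] = Pprod alpha z * Bprod c z] /\
  [/\ forall z, z != 0 -> q.[z] = z ^+ n * (q.[refl z])^*,
      forall z, cabs z <= 1 -> mup z q = mup z p &
      forall z, q.[z] = 0 -> root p (if cabs z <= 1 then z else refl z)].
Proof.
move=> p0; have [s ps] := closed_field_poly_normal p.
have mups z : mup z p = count_mem z s.
  rewrite ps -mul_polyC mupMr ?mu_prod_XsubC //.
  by rewrite rootC lead_coef_eq0.
have [arg hsarg] : {arg : C -> R & forall z, cabs z = 1 -> cis (arg z) = z}.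
  have h z : exists t, cabs z = 1 -> cis t = z; last by have [g hg] := choice h; exists g.
  case: (eqVneq (cabs z) 1) => [/cabs1_cis [t _ ->]|z1]; first by exists t.
  by exists 0 => e; rewrite e eqxx in z1.
pose c := [seq z <- s | cabs z < 1]; pose l := [seq z <- s | cabs z == 1].
pose alpha := map arg l.
have cl : map cis alpha = l.
  rewrite -map_comp -[RHS]map_id; apply/eq_in_map => z; rewrite mem_filter => /andP[/eqP z1 _].
  exact: hsarg.
have cnt (a : pred C) z : count_mem z [seq x <- s | a x] = if a z then count_mem z s else 0%N.
  rewrite count_filter; case: ifP => az.
    by apply: eq_count => w /=; case: eqP => // ->.
  rewrite -(count_pred0 s); apply: eq_count => w /=.
  by case: eqP => // ->; rewrite az.
have c1 z : z \in c -> cabs z < 1 by rewrite mem_filter => /andP[].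
have l1 z : z \in l -> cabs z = 1 by rewrite mem_filter => /andP[/eqP].
pose q1 := \prod_(a <- alpha) Pfactor a; pose q2 := \prod_(x <- c) sym_factor x.
have q10 : q1 != 0 by rewrite /q1; elim/big_ind: _ => // [|x y|i _]; [exact: oner_neq0|exact: mulf_neq0|exact: Pfactor_neq0].
have q20 : q2 != 0 by rewrite /q2; elim/big_ind: _ => // [|x y|i _]; [exact: oner_neq0|exact: mulf_neq0|exact: sym_factor_neq0].
exists c, alpha, (q1 * q2), (size alpha + 2 * size c)%N; split; split.
- move=> z; rewrite cnt -mups; case: ifP => h.
    by rewrite mem_set //; apply/unit_diskE.
  by rewrite memNset // => /unit_diskE; rewrite h.
- move=> z; rewrite cl cnt -mups; case: ifP => h.
    by rewrite mem_set //; apply/unit_circleE/eqP.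
  by rewrite memNset // => /unit_circleE/eqP; rewrite h.
- exact: mulf_neq0.
- move=> z; rewrite hornerM /q1 /q2 /Pprod /Bprod; congr (_ * _).
    by rewrite horner_prod; apply: eq_bigr => a _; rewrite hornerZ hornerXsubC.
  by rewrite horner_prod; apply: eq_bigr => a _; rewrite sym_factorE.
- move=> z z0; have e1 : q1.[z] = z ^+ size alpha * (q1.[refl z])^*.
    rewrite /q1; elim: alpha {cl q10 q1} => [|a al ih]; first by rewrite !big_nil expr0 mul1r !hornerE rmorph1.
    by rewrite !big_cons !hornerM ih (Pfactor_refl a z0) cJM /= exprS mulrACA.
  have e2 : q2.[z] = z ^+ (2 * size c) * (q2.[refl z])^*.
    rewrite /q2; elim: c {c1 q20 q2} => [|a al ih]; first by rewrite !big_nil muln0 expr0 mul1r !hornerE rmorph1.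
    by rewrite !big_cons !(hornerM (sym_factor a)) ih (sym_factor_refl a z0) cJM /= mulnS exprD mulrACA.
  by rewrite !hornerM e1 e2 cJM exprD mulrACA.
- move=> z z1; rewrite mupM // mups.
  have m1 : mup z q1 = count_mem z l.
    rewrite -cl /q1; elim: alpha {cl q10 q1} => [|a al ih].
      by rewrite big_nil mupNroot // root1.
    rewrite big_cons mupM ?Pfactor_neq0 ?ih ?mup_Pfactor //.
    by elim/big_ind: _ => // [|x y|i _]; [exact: oner_neq0|exact: mulf_neq0|exact: Pfactor_neq0].
  have m2 : mup z q2 = count_mem z c.
    rewrite /q2; elim: c c1 {q20 q2} => [|a al ih] c1.
      by rewrite big_nil mupNroot // root1.
    rewrite big_cons mupM ?sym_factor_neq0 ?ih ?mup_sym_factor //; first last.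
    + by elim/big_ind: _ => // [|x y|i _]; [exact: oner_neq0|exact: mulf_neq0|exact: sym_factor_neq0].
    + by move=> x xl; apply: c1; rewrite in_cons xl orbT.
    + by apply: c1; rewrite mem_head.
  rewrite m1 m2 !cnt; case: ltgtP z1 => // _ _; rewrite ?addn0 //.
- have rs z : z \in s -> root p z.
    by move=> zs; rewrite ps rootZ ?lead_coef_eq0 // root_prod_XsubC.
  move=> z /eqP; rewrite hornerM mulf_eq0 /q1 /q2 !horner_prod !prodf_seq_eq0 => /orP[] /hasP[x xl /=].
    rewrite hornerZ mulf_eq0 (negbTE (cis_neq0 _)) hornerXsubC subr_eq0 => /eqP ->.
    rewrite cabs_cis lexx; apply: rs; have : cis x \in l by rewrite -cl; exact: map_f.
    by rewrite mem_filter => /andP[].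
  have x1 := c1 x xl; have xs : x \in s by move: xl; rewrite mem_filter => /andP[].
  rewrite sym_factorE mulf_eq0 !subr_eq0 => /orP[] /eqP e.
    by rewrite e (ltW x1); exact: rs.
  have x0 : x^* != 0 by apply/eqP => x0; move/eqP: e; rewrite x0 mul0r oner_eq0.
  have -> : z = refl x by apply: (mulfI x0); rewrite -e /refl mulfV.
  rewrite cabs_refl invf_le1 ?cabs_gt0 -?(conjC_eq0 x) // leNgt x1 /=.
  by rewrite /refl cJV cJK invrK; exact: rs.
Qed.

(** In the closed disk Q has the zeros and poles of N / D, so that the quotient F of the two, in
    lowest terms, has none there. By symmetry it has none outside either; it is a constant, and
    real, again by symmetry. *)
Lemma symmetric_product_form Q :
  (forall z, z != 0 -> (qeval Q (z^*)^-1)^* = z ^+ 4 * qeval Q z) -> has_product_form Q.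
Proof.
move=> sym.
have [c [al [N [n [[hc hal N0 NE] [Nr Nm Nroot]]]]]] := symmetric_part (qnum_neq0 Q).
have [p [be [D [d [[hp hbe D0 DE] [Dr Dm Droot]]]]]] := symmetric_part (qden_neq0 Q).
have nroot z : root (qnum Q) z -> root (qden Q) z -> False.
  by move=> /(coprimep_root (qcoprime Q)) /negP.
pose U := qnum Q * D; pose V := qden Q * N.
have U0 : U != 0 by rewrite mulf_neq0 ?qnum_neq0.
have V0 : V != 0 by rewrite mulf_neq0 ?qden_neq0.
have [F hF] := reduced_fraction U0 V0.
have Fm z : cabs z <= 1 -> (mup z (qden F) = mup z (qnum F))%N.
  move=> z1; have := congr1 (mup z) hF; rewrite !mupM ?qnum_neq0 ?qden_neq0 // (Nm z z1) (Dm z z1).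
  move=> h; apply: (@addIn (mup z (qnum Q) + mup z (qden Q))); rewrite addnC h.
  by rewrite (addnC (mup z (qden Q))).
have cF z : root (qnum F) z -> root (qden F) z -> False.
  by move=> /(coprimep_root (qcoprime F)) /negP.
have rm (q : {poly C}) z : q != 0 -> root q z = (0 < mup z q)%N by move=> q0; rewrite -XsubC_dvd // dvdp_XsubCl.
have nz z : cabs z <= 1 -> ~~ root (qnum F) z /\ ~~ root (qden F) z.
  move=> z1; have := cF z; rewrite !rm ?qnum_neq0 ?qden_neq0 // (Fm z z1).
  by case: (0 < _)%N => //; case.
have generic z : z != 0 -> \forall w \near z, w != z ->
    [/\ w != 0, V.[w] != 0 & V.[refl w] != 0].
  move=> z0; have hr : \forall w \near z, refl w != refl z -> V.[refl w] != 0.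
    by apply: (cont_nbhs (P := fun v => v != refl z -> V.[v] != 0) (cont_refl z0)); exact: near_root_free.
  near=> w => wz; split.
  - by near: w; exact: near_neq.
  - by move: wz; near: w; exact: near_root_free.
  - apply: (near hr w) => //; apply: contra wz => /eqP /(congr1 (@refl R)).
    by rewrite /refl !cJV !cJK !invrK => ->.
(* The symmetries of Q, N and D in polynomial form, proved where no denominator vanishes and
   extended by continuity. *)
have Fsym z : z != 0 ->
    ((qnum F).[refl z])^* * (qden F).[z] * z ^+ d = z ^+ (4 + n) * (qnum F).[z] * ((qden F).[refl z])^*.
  move=> z0; have cr (q : {poly C}) : cont_at (fun w => (q.[refl w])^*) z.
    by apply: cont_conj; apply: cont_comp (cont_refl z0) (cont_horner _ _).
  have cX k : cont_at (fun w : C => w ^+ k) z by apply: contX; exact: cont_id.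
  apply: (near_punctured_eq (f := fun w => ((qnum F).[refl w])^* * (qden F).[w] * w ^+ d)
     (g := fun w => w ^+ (4 + n) * (qnum F).[w] * ((qden F).[refl w])^*)).
  - by apply: contM => //; apply: contM => //; exact: cont_horner.
  - by apply: contM => //; apply: contM => //; exact: cont_horner.
  apply: filterS (generic z z0) => w h wz; have {h wz}[w0 Vw Vr] := h wz.
  have e1 := congr1 (horner^~ w) hF; have e2 := congr1 (fun q : {poly C} => (q.[refl w])^*) hF.
  move: e1 e2; rewrite /= !hornerM !cJM (Nr w w0) (Dr w w0).
  move: Vw Vr; rewrite !hornerM !mulf_eq0 !negb_or -[in X in _ -> X -> _]conjC_eq0 => /andP[dw Nw] /andP[].
  have := sym w w0; rewrite /qeval -/(refl w) cJM cJV.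
  have N'0 : (N.[refl w])^* != 0.
    by apply: contra Nw => /eqP; rewrite (Nr w w0) => ->; rewrite mulr0.
  move: dw N'0 => + + + + _.
  move: ((qnum Q).[refl w]^*) ((qden Q).[refl w]^*) ((qnum Q).[w]) ((qden Q).[w]) (w ^+ d) (D.[refl w]^*)
    ((qden F).[w]) ((qnum F).[w]) (N.[refl w]^*) ((qden F).[refl w]^*) ((qnum F).[refl w]^*) => A' B' A B W D' f g N' f' g'.
  rewrite exprD; move: (w ^+ n) (w ^+ 4) => Nn w4 B0 N'0 + B'0 e1 e2 => /eqP.
  have -> : w4 * (A / B) = w4 * A / B by rewrite mulrA.
  rewrite eqr_div // => /eqP e0.
  apply: (mulfI (mulf_neq0 (mulf_neq0 B'0 N'0) B0)).
  have -> : B' * N' * B * (g' * f * W) = g' * (B' * N') * (f * W * B) by ring.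
  have -> : B' * N' * B * (w4 * Nn * g * f') = g * (B * (Nn * N')) * (w4 * B' * f') by ring.
  rewrite -e1 -e2.
  have -> : A' * D' * f' * (f * W * B) = A' * B * (D' * f' * f * W) by ring.
  by rewrite e0; ring.
(* Outside the disk the reflected point is not a root, so that by [Fsym] a root of one polynomial at
   z would be a root of the other, against coprimality. *)
have noroot z : ~~ root (qnum F) z /\ ~~ root (qden F) z.
  have [/nz //|z1] := lerP (cabs z) 1.
  have z0 : z != 0 by rewrite -cabs_gt0; lra.
  have [|] := nz (refl z).
    by rewrite cabs_refl invf_le1 ?(ltW z1) // cabs_gt0.
  rewrite /root => h1 h2; have := Fsym z z0.
  have zk k : z ^+ k != 0 by rewrite expf_neq0.
  split; apply/negP => /eqP h.
    move/eqP: (Fsym z z0); rewrite h mulr0 mul0r !mulf_eq0 conjC_eq0 (negbTE (zk _)) (negbTE h1) orbF /=.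
    by move=> h3; apply: (cF z); rewrite /root ?h.
  move/esym/eqP: (Fsym z z0); rewrite h mulr0 mul0r -mulrA mulf_eq0 (negbTE (zk (4 + n)%N)) mulf_eq0 conjC_eq0 (negbTE h2) orbF /=.
  by move=> h3; apply: (cF z); rewrite /root ?h.
have cst (q : {poly C}) : (forall z, ~~ root q z) -> exists2 k, k != 0 & q = k%:P.
  by move=> h; apply/size_poly1P; apply/negPn/negP => /closed_rootP [z]; apply/negP.
have [k1 k10 E1] := cst _ (fun z => (noroot z).1).
have [k2 k20 E2] := cst _ (fun z => (noroot z).2).
pose K := k1 / k2.
(* 1 is a fixed point of the reflection. *)
have KJ : K^* = K.
  have := Fsym 1 (oner_neq0 _); rewrite E1 E2 !hornerC !expr1n mulr1 mul1r.
  by rewrite /K cJM cJV => h; apply/eqP; rewrite eqr_div ?conjC_eq0 // h.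
have UV z : (qnum Q).[z] * D.[z] = K * ((qden Q).[z] * N.[z]).
  have := congr1 (horner^~ z) hF; rewrite E1 E2 !hornerM !hornerC => h.
  by rewrite /K mulrAC -h mulfK.
exists c, p, al, be, (complex.Re K); split => //; split.
  by rewrite -(rC_eq0 (complex.Re K)) -conj_real // mulf_neq0 ?invr_neq0.
move=> z; rewrite -conj_real // -NE -DE /qeval.
(* At a pole both sides take the value x / 0 = 0. A common zero of D and N off the poles of Q would,
   by [Nroot] and [Droot], come from a common zero of the numerator and denominator of Q. *)
have [d0|d0] := eqVneq (qden Q).[z] 0.
  have := UV z; rewrite d0 mul0r mulr0 => /eqP; rewrite mulf_eq0 => /orP[/eqP h|/eqP ->].
    by exfalso; apply: (nroot z); rewrite /root ?h ?d0.
  by rewrite !invr0 !mulr0.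
have [D00|D00] := eqVneq D.[z] 0.
  have := UV z; rewrite D00 mulr0 => /esym/eqP; rewrite !mulf_eq0 (negbTE d0) invr_eq0 (negbTE k10) (negbTE k20) /= => /eqP N00.
  by exfalso; apply: nroot (Nroot z N00) (Droot z D00).
by apply/eqP; rewrite eqr_div // UV; apply/eqP; ring.
Unshelve. all: by end_near.
Qed.

End ProductForm.

(** * The radicals of the pullbacks near a point of the circle *)

Section Sides.
Context {R : realType}.
Local Notation C := (Cplx R).
Implicit Types (z w p : C) (s t a b e : R).

Definition Hq (Q : qdiff R) z : R := complex.Re (z ^+ 2 * qeval Q z).

Lemma Hq_real (Q : qdiff R) z : (forall z, z != 0 -> (qeval Q (z^*)^-1)^* = z ^+ 4 * qeval Q z) ->
  cabs z = 1 -> z ^+ 2 * qeval Q z = rC (Hq Q z).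
Proof.
move=> sym z1; have z0 : z != 0 by rewrite -cabs_gt0 z1.
apply: conj_real; rewrite cJM cJX -{2}(refl_unit z1) -/(refl z) sym //.
have := mulCJ z; rewrite z1 expr1n rC1 => zz.
have -> : z^* = z^-1 by apply: (mulfI z0); rewrite zz divff.
by field.
Qed.

Lemma cont_Hq (Q : qdiff R) z : (qden Q).[z] != 0 -> cont_at (Hq Q) z.
Proof.
move=> d0; apply: cont_Re; apply: contM; first by apply: contX; exact: cont_id.
by apply: contM; [exact: cont_horner | apply: contV => //; exact: cont_horner].
Qed.

(* In the application om = Re (W \o phi \o cis) with W' ^ 2 = 4 W Q, for a
   Riemann map phi, and H t is the value of z ^ 2 Q_D(z) at z = cis t. *)
Definition local_side (om H : R -> R) (t0 e : R) : Prop := exists dom : R -> R,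
  [/\ forall t, `|t - t0| < e -> is_derive t (1 : R) om (dom t),
      forall t, `|t - t0| < e -> cont_at dom t, om t0 = 0,
      forall t, `|t - t0| < e -> t != t0 -> om t != 0 &
      forall t, `|t - t0| < e -> t != t0 -> [/\ H t != 0, cont_at H t & dom t ^+ 2 = - 4 * om t * H t]].

(** The imaginary part of the integrand of the radical involves sqrt H, the real part sqrt (- H);
    this exchanges the two. *)
Lemma local_sideN om H t0 e : local_side om H t0 e ->
  local_side (fun t => - om t) (fun t => - H t) t0 e.
Proof.
move=> [dom [h1 h2 h3 h4 h5]]; exists (fun t => - dom t); split.
- by move=> t te; have ? := h1 t te; exact: is_deriveN.
- by move=> t te; apply: cont_oppr; exact: h2.
- by rewrite h3 oppr0.
- by move=> t te tt; rewrite oppr_eq0; exact: h4.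
- move=> t te tt; have [a b c] := h5 t te tt; split; first by rewrite oppr_eq0.
    exact: cont_oppr.
  by rewrite sqrrN c; ring.
Qed.

(** The exterior map is studied through w |-> phip (1 / w), and 1 / cis t = cis (- t). *)
Lemma local_side_opp om H t0 e : local_side om H t0 e ->
  local_side (fun t => om (- t)) (fun t => H (- t)) (- t0) e.
Proof.
move=> [dom [h1 h2 h3 h4 h5]].
have ball t : `|t - - t0| < e -> `|- t - t0| < e by rewrite -normrN opprD opprK.
have neq t : t != - t0 -> - t != t0 by apply: contra => /eqP <-; rewrite opprK.
have cN (f : R -> R) t : cont_at f (- t) -> cont_at (fun s => f (- s)) t.
  by move=> cf; apply: (cont_comp (f := fun s : R => - s)) cf; apply: cont_oppr; split; exact: cvg_id.
exists (fun t => - dom (- t)); split.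
- move=> t /ball te; have d1 := h1 _ te.
  have d2 : is_derive t (1 : R) (fun s : R => - s) (-1) by apply: is_deriveN.
  have := @is_derive1_comp _ om (fun s => - s) t _ _ d1 d2.
  by rewrite mulrN1.
- by move=> t /ball te; apply: cont_oppr; apply: cN; exact: h2.
- by rewrite opprK.
- by move=> t /ball te /neq tt; exact: h4.
- move=> t /ball te /neq tt; have [a b c] := h5 _ te tt; split => //; first exact: cN.
  by rewrite sqrrN c.
Qed.

Lemma local_side_defint om H t0 e : local_side om H t0 e ->
  forall a b, `|a - t0| < e -> `|b - t0| < e -> a <= b ->
    defint (fun t => Num.sqrt (H t)) a b (signed_root om t0 b - signed_root om t0 a) /\
    defint (fun t => Num.sqrt (- H t)) a b
      (signed_root (fun t => - om t) t0 b - signed_root (fun t => - om t) t0 a).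
Proof.
move=> h a b ae be ab; split.
  by have [dom [h1 h2 h3 h4 h5]] := h; exact: (defint_sqrt h1 h2 h3 h4 h5).
by have [dom [h1 h2 h3 h4 h5]] := local_sideN h; exact: (defint_sqrt h1 h2 h3 h4 h5).
Qed.

Section Map.
Variables (Q : qdiff R) (Gamma : set C) (psi : C -> C) (QD : qdiff R) (l : seq C).
Hypotheses (hGamma : jordan_curve Gamma) (harcs : made_of_trajectory_arcs Q Gamma)
  (hpsi : disk_map Gamma psi)
  (hl : forall z, cabs z < 1 -> z \notin l -> (qden QD).[z] * pullback Q psi z = (qnum QD).[z])
  (sym : forall z, z != 0 -> (qeval QD (z^*)^-1)^* = z ^+ 4 * qeval QD z).

(** The relation off the list [l] passes to z in the limit. As psi' does not vanish at z, the two
    functions given to [qeval_limit] have no common zero there, and the convention at poles is the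
    same on both sides. *)
Lemma pullback_eq z r : cabs z < 1 -> 0 < r -> holo psi z r -> psi^`()%classic z != 0 ->
  qeval QD z = pullback Q psi z.
Proof.
move=> z1 r0 hr dz; have zz : cabs (z - z) < r by rewrite subrr cabs0.
have cp := holo_cont hr zz.
rewrite (@qeval_limit R QD z (fun w => (qnum Q).[psi w] * (psi^`()%classic w) ^+ 2) (fun w => (qden Q).[psi w])).
- by rewrite /pullback /qeval mulrAC.
- apply: contM; first exact: cont_comp cp (cont_horner _ _).
  by apply: contX; apply: holo_cont (holo_derive hr) zz.
- exact: cont_comp cp (cont_horner _ _).
- rewrite mulf_eq0 expf_eq0 /= (negbTE dz) orbF -negb_and; apply/negP => /andP[/eqP a /eqP b].
  by have := coprimep_root (qcoprime Q) (x := psi z); rewrite /root a b eqxx => /(_ isT).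
- have hd : holo (fun w => (qden Q).[psi w]) z r.
    by move=> w /hr [k hk]; eexists; apply: hasd_comp hk; exact: hasd_poly.
  have iz : \forall w \near z, w != z -> (qden Q).[psi w] != 0.
    apply: isolated_zero r0 hd _ => e e0.
    by have [w [w1 _ _ _ w2]] := disk_map_avoid hpsi (qden_neq0 Q) (ltW z1) e0; exists w.
  have nl : \forall w \near z, w != z -> w \notin l by exact: near_notin.
  have z1' : cabs (z - 0) < 1 by rewrite subr0.
  apply: filterS3 iz nl (cabs_near z1') => w i n; rewrite subr0 => w1 wz.
  have := hl w1 (n wz); rewrite /pullback /qeval => <-.
  by move: (i wz); move: ((qden Q).[psi w]) ((qnum Q).[psi w]) (psi^`()%classic w) => a b c a0; field.
Qed.

Section Point.
Variables (W : C -> C) (t0 rho : R).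
Let z0 := cis t0 : C.
Let zeta0 := psi z0.
Hypotheses (rho0 : 0 < rho) (hW : holo W zeta0 rho) (W0 : W zeta0 = 0)
  (WQ : forall z, cabs (z - zeta0) < rho -> z != zeta0 ->
      [/\ W z != 0, (qnum Q).[z] != 0, (qden Q).[z] != 0 &
          (W^`()%classic z) ^+ 2 = 4 * W z * qeval Q z]).

(** As QD is rational, the relation G'^2 = 4 G QD passes from the disk to the circle by density.
    There G = om is real, its derivative in t is i z G', and the square of this is - 4 om z^2 QD. *)
Lemma side_local : exists2 e, 0 < e &
  local_side (fun t => complex.Re (W (psi (cis t)))) (fun t => Hq QD (cis t)) t0 e.
Proof.
have [X fX reg] := arcs_structure hGamma harcs.
have [cpsi dpsi ipsi Gpsi] := hpsi.
have [r [G [/andP[r0 r1] hG eG realG dG]]] := boundary_extension hpsi fX reg rho0 hW W0 WQ.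
have z01 : cabs z0 = 1 := cabs_cis t0.
have id1 z : cabs (z - z0) < r -> cabs z <= 1 ->
    (qden QD).[z] * (G^`()%classic z) ^+ 2 = 4 * G z * (qnum QD).[z].
  move=> zr z1.
  apply: (@disk_dense_eq R z (r - cabs (z - z0)) l (fun z => (qden QD).[z] * (G^`()%classic z) ^+ 2)
     (fun z => 4 * G z * (qnum QD).[z])) => //.
  - by rewrite subr_gt0.
  - apply: contM; first exact: cont_horner.
    by apply: contX; exact: holo_cont (holo_derive hG) zr.
  - apply: contM; last exact: cont_horner.
    by apply: contM; [exact: cont_cst | exact: holo_cont hG zr].
  - move=> w wr w1 wl; have wr' : cabs (w - z0) < r.
      by have := cabsD (w - z) (z - z0); rewrite addrA subrK; lra.
    rewrite (dG w wr' w1) -(hl w1 wl); ring.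
have rf : \forall w \near z0, w != z0 -> (qden QD).[w] != 0 /\ (qnum QD).[w] != 0.
  have h1 : \forall w \near z0, w != z0 -> (qden QD).[w] != 0 by exact: near_root_free (qden_neq0 QD).
  have h2 : \forall w \near z0, w != z0 -> (qnum QD).[w] != 0 by exact: near_root_free (qnum_neq0 QD).
  by apply: filterS2 h1 h2 => w a b wz; split; auto.
have z0r : cabs (z0 - z0) < r by rewrite subrr cabs0.
have /near_R[e1 e10 he1] : \forall t \near t0, cabs (cis t - z0) < r /\
    (cis t != z0 -> (qden QD).[cis t] != 0 /\ (qnum QD).[cis t] != 0).
  have h1 : \forall w \near z0, cabs (w - z0) < r by exact: cabs_near.
  by apply: (cont_nbhs (P := fun w => cabs (w - z0) < r /\ (w != z0 -> (qden QD).[w] != 0 /\ (qnum QD).[w] != 0)) (cont_cis t0)); exact: filterI h1 rf.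
pose e := Num.min e1 1; have e0 : 0 < e by rewrite lt_min e10 ltr01.
have he t : `|t - t0| < e -> [/\ cabs (cis t - z0) < r, `|t - t0| < 1 &
    cis t != z0 -> (qden QD).[cis t] != 0 /\ (qnum QD).[cis t] != 0].
  by rewrite lt_min => /andP[/he1 [a b] c].
have neq t : `|t - t0| < e -> t != t0 -> cis t != z0.
  move=> te tt; have [_ t1 _] := he t te; apply: contra tt => /eqP /cis_inj -> //.
  by apply: lt_trans t1 _; have := @pi_ge2 R; lra.
have omE t : `|t - t0| < e -> W (psi (cis t)) = G (cis t) /\ complex.Im (G (cis t)) = 0.
  move=> te; have [tr _ _] := he t te.
  have [|_ h] := eG _ tr; first by rewrite cabs_cis.
  by split; [rewrite h | exact: realG (cabs_cis t)].
have nball t : `|t - t0| < e -> \forall s \near t, `|s - t0| < e.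
  move=> te; apply/near_R; exists (e - `|t - t0|); first by rewrite subr_gt0.
  by move=> s hs; have := ler_normD (s - t) (t - t0); rewrite addrA subrK; lra.
pose vel t := G^`()%classic (cis t) * ('i * cis t).
have hder t : `|t - t0| < e -> hasdr (fun t => G (cis t)) t (vel t).
  by move=> te; have [tr _ _] := he t te; apply: hasdr_comp (hasdr_cis t); exact: (holo_hasd hG).
have vreal t : `|t - t0| < e -> complex.Im (vel t) = 0.
  move=> te; have h1 := hasdr_Im (hder t te).
  have h2 : is_derive t (1 : R) (fun s => complex.Im (G (cis s))) 0.
    apply: near_eq_is_derive (is_derive_cst (0 : R) _ _).
    by apply: filterS (nball t te) => s /omE [_ ->].
  by case: h1 => _ <-; case: h2 => _ ->.
exists e => //; exists (fun t => complex.Re (vel t)); split.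
- move=> t te; apply: near_eq_is_derive (hasdr_Re (hder t te)).
  by apply: filterS (nball t te) => s /omE [->].
- move=> t te; have [tr _ _] := he t te; apply: cont_Re; apply: contM.
    exact: cont_comp (cont_cis t) (holo_cont (holo_derive hG) tr).
  by apply: contM; [exact: cont_cst | exact: cont_cis].
- by rewrite -/z0 -/zeta0 W0.
- move=> t te tt; have [tr _ _] := he t te; have [WG i0] := omE t te.
  have [|pr _] := eG _ tr; first by rewrite cabs_cis.
  have [|Wn _ _ _] := WQ pr.
    apply: contra (neq t te tt) => /eqP /ipsi -> //; by rewrite ?cabs_cis ?cis_neq0.
  rewrite WG in Wn *; apply: contra Wn => /eqP h; by rewrite (real_rC i0) h.
- move=> t te tt; have [tr _ /(_ (neq t te tt)) [d0 n0]] := he t te; have [WG i0] := omE t te.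
  have HE := Hq_real sym (cabs_cis t); split.
  + by rewrite -rC_eq0 -HE mulf_neq0 ?expf_neq0 ?cis_neq0 // /qeval mulf_neq0 ?invr_neq0.
  + by apply: (cont_comp (cont_cis t)); exact: cont_Hq.
  + apply: (@rC_inj R); rewrite rCX -(real_rC (vreal t te)) !rCM -HE WG -(real_rC i0).
    have := id1 _ tr; rewrite cabs_cis lexx => /(_ isT) h.
    rewrite /vel !exprMn sqrCi /qeval; apply: (mulfI d0).
    rewrite [LHS]mulrA h rCN (_ : rC 4 = 4); last by rewrite rCE rmorph_nat.
    move: d0; move: ((qden QD).[cis t]) ((qnum QD).[cis t]) (G (cis t)) (cis t) => a b c d a0.
    by field.
Qed.

End Point.
End Map.
End Sides.

(** * The functional equation *)

Section Fingerprint.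
Context {R : realType}.
Local Notation C := (Cplx R).
Implicit Types (z w : C) (a b s t e : R).

Lemma interior_pullback (Q : qdiff R) Gamma phi : jordan_curve Gamma ->
  (forall z, Gamma z -> ~ infinite_critical Q z) -> made_of_trajectory_arcs Q Gamma ->
  interior_riemann_map Gamma phi -> exists (QD : qdiff R) (l : seq C),
  reflected_pullback unit_disk phi Q QD /\
  forall z, cabs z < 1 -> z \notin l -> (qden QD).[z] * pullback Q phi z = (qnum QD).[z].
Proof.
move=> hG hf ha hphi; have [hm hd hn] := interior_disk_map hG hphi.
have h01 : holo phi 0 1 by move=> z; rewrite subr0; exact: hd.
have [||QD [[l hl] sym]] := pullback_rational hG hf ha hm.
- exact: mero_holo ltr01 h01.
- by move=> z z1 _; exact: hn.
exists QD, l; split => //; split => // z /unit_diskE z1.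
apply: (@pullback_eq _ _ _ _ _ _ hm hl z (1 - cabs z)) => //; first by rewrite subr_gt0.
  by apply: holo_sub h01 _; rewrite subr0; lra.
exact: hn.
Qed.

Lemma derive_inv (phi : C -> C) z : z != 0 -> (exists k, hasd phi z^-1 k) ->
  (fun w => phi w^-1)^`()%classic z = - phi^`()%classic z^-1 / z ^+ 2.
Proof.
move=> z0 [k hk]; rewrite (hasd_derive1 hk).
by rewrite (hasd_derive1 (hasd_comp (f := fun w => w^-1) hk (hasd_inv z0))) mulrN mulNr.
Qed.

Lemma coprimep_conj (Q : qdiff R) :
  coprimep (map_poly (@Num.conj C) (qnum Q)) (map_poly (@Num.conj C) (qden Q)).
Proof. by rewrite coprimep_map; exact: qcoprime. Qed.

Lemma conj_qdiff (Q : qdiff R) : exists Q' : qdiff R, forall z, qeval Q' z = (qeval Q z^*)^*.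
Proof.
have h (p : {poly C}) z : (map_poly (@Num.conj C) p).[z] = (p.[z^*])^*.
  by rewrite -[z in LHS]cJK horner_map.
have n0 : map_poly (@Num.conj C) (qnum Q) != 0 by rewrite map_poly_eq0 qnum_neq0.
have d0 : map_poly (@Num.conj C) (qden Q) != 0 by rewrite map_poly_eq0 qden_neq0.
exists (QDiff n0 d0 (coprimep_conj Q)) => z.
by rewrite /qeval /= !h cJM cJV.
Qed.

(** QD belongs to psi w = phip (1 / w), a map of the punctured disk with a pole at 0. The pullback
    under phip is z^-4 QD (1 / z), which the reflection law turns into conj (QD (conj z)): this is
    Qp. *)
Lemma exterior_pullback (Q : qdiff R) Gamma phi : jordan_curve Gamma ->
  (forall z, Gamma z -> ~ infinite_critical Q z) -> made_of_trajectory_arcs Q Gamma ->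
  exterior_riemann_map Gamma phi -> exists (Qp QD : qdiff R) (l : seq C),
  [/\ reflected_pullback unit_exterior phi Q Qp, forall z, qeval Qp z = (qeval QD z^*)^*,
      forall z, z != 0 -> (qeval QD (z^*)^-1)^* = z ^+ 4 * qeval QD z &
      forall z, cabs z < 1 -> z \notin l ->
        (qden QD).[z] * pullback Q (fun w => phi w^-1) z = (qnum QD).[z]].
Proof.
move=> hG hf ha hphi; have [hm hd hn] := exterior_disk_map hG hphi.
pose psi w := phi w^-1.
have inv1 z : cabs z < 1 -> z != 0 -> 1 < cabs z^-1.
  by move=> z1; rewrite -cabs_gt0 => z0; rewrite cabsV invf_gt1.
have dpsi z : cabs z < 1 -> z != 0 -> psi^`()%classic z != 0.
  move=> z1 z0; have iz := inv1 z z1 z0.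
  rewrite (derive_inv z0 (hd _ iz)) mulf_neq0 ?oppr_eq0 ?invr_neq0 ?expf_neq0 //.
  exact: hn.
have mpsi : meromorphic psi 0.
  have [Om [_ _ _ _ [a _ la]]] := hphi.
  (* w psi w tends to [a] at 0, so that the singularity of [chi] is removable and psi has at most a
     simple pole. *)
  pose chi w := if w == 0 then rC a else w * psi w.
  exists 1%N, 1, chi; split => //.
    apply: holo_removable => z; rewrite subr0 => z1.
      case: (eqVneq z 0) => [->|z0].
        apply/cont_eps => e e0; move/cvg_C/(_ e e0): la; rewrite near_withinE.
        apply: filterS => w hw; rewrite /chi eqxx; case: eqVneq => [_|w0].
          by rewrite subrr cabs0.
        exact: hw.
      have [_ hdp _ _] := hm; have [k hk] := hdp z z1 z0.
      apply: (cont_near (f := fun w => w * psi w)).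
        by apply: filterS (near_neq z0) => w w0; rewrite /chi (negbTE w0).
      by apply: contM; [exact: cont_id | exact: hasd_cont hk].
    move=> z0; have [_ hdp _ _] := hm; have [k hk] := hdp z z1 z0.
    eexists; apply: (hasd_near (f := fun w => w * psi w)).
      by apply: filterS (near_neq z0) => w w0; rewrite /chi (negbTE w0).
    by apply: cderM; [exact: id_C_cont | exact: cder_iota | exact: hk].
  by move=> z _ z0; rewrite subr0 expr1 /chi (negbTE z0).
have [QD [[l hl] sym]] := pullback_rational hG hf ha hm mpsi dpsi.
have [Qp hQp] := conj_qdiff QD.
exists Qp, QD, l; split => //; split.
  move=> z /unit_exteriorE z1; have z0 : z != 0 by rewrite -cabs_gt0; lra.
  have zi0 : z^-1 != 0 by rewrite invr_eq0.
  have zi1 : cabs z^-1 < 1 by rewrite cabsV invf_lt1 //; lra.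
  have : qeval QD z^-1 = pullback Q psi z^-1.
    have m0 : 0 < Num.min (cabs z^-1) (1 - cabs z^-1) by rewrite lt_min cabs_gt0 zi0 subr_gt0.
    apply: (pullback_eq hm hl zi1 m0); last exact: dpsi.
    move=> w; rewrite lt_min => /andP[w1 w2]; have [_ hdp _ _] := hm; apply: hdp.
      by have := cabsD (w - z^-1) z^-1; rewrite subrK; lra.
    by rewrite -cabs_gt0; have := cabsB z^-1 (z^-1 - w); rewrite subKr cabsC; lra.
  have hz : exists k, hasd phi (z^-1)^-1 k by rewrite invrK; exact: hd.
  rewrite /pullback /psi (derive_inv zi0 hz) invrK hQp.
  have := sym _ zi0; rewrite -(cJV z^-1) invrK => -> ->.
  by move: (phi^`()%classic z) (qeval _ _) => x y; field.
move=> z z0; rewrite !hQp cJK cJV cJK.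
have := sym z^* _; rewrite conjC_eq0 cJK => /(_ z0) /(congr1 (@Num.conj C)).
by rewrite cJK cJM cJX cJK.
Qed.

Lemma Hq_conj (Qp QD : qdiff R) t : (forall z, qeval Qp z = (qeval QD z^*)^*) ->
  Hq Qp (cis t) = Hq QD (cis (- t)).
Proof.
by move=> h; rewrite /Hq h -conj_cis -ReJ cJM cJX cJK.
Qed.

Section Lift.
Variables (f : R -> R) (a b : R).
Hypotheses (ab : a < b) (cf : forall t, a <= t <= b -> cont_at f t)
  (inj : forall s t, a <= s <= b -> a <= t <= b -> `|s - t| < b - a -> f s = f t -> s = t).

(** If f a = f b, a value strictly between f a and f m, with m the midpoint, is taken on both sides
    of m, against [inj], which excepts only the pair of end points. In effect, a circle does not
    embed in the line. *)
Lemma almost_inj_endpoints : f a <> f b.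
Proof.
have ab' := ab; move=> e; pose m := (a + b) / 2; have am : a < m by rewrite /m; lra.
have mb : m < b by rewrite /m; lra.
have mab : a <= m <= b by apply/andP; split; lra.
have fm : f m <> f a.
  move=> h; have : m = a by apply: inj; rewrite ?lexx ?(ltW ab) // gtr0_norm; lra.
  by lra.
pose y := (f a + f m) / 2.
have [s /andP[s1 s2] fs] : exists2 s, a <= s <= m & f s = y.
  apply: IVT_between; first lra.
    by move=> t /andP[t1 t2]; apply: cf; apply/andP; split; lra.
  by rewrite /y; have [h|h] := lerP (f a) (f m); [left|right]; apply/andP; split; lra.
have [t /andP[t1 t2] ft] : exists2 t, m <= t <= b & f t = y.
  apply: IVT_between; first lra.
    by move=> t /andP[t1 t2]; apply: cf; apply/andP; split; lra.
  by rewrite /y -e; have [h|h] := lerP (f a) (f m); [right|left]; apply/andP; split; lra.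
have [sa|sa] := eqVneq s a; first by apply: fm; move: fs; rewrite sa /y; lra.
have sa' : a < s by rewrite lt_neqAle eq_sym sa.
have st : s = t.
  apply: inj; rewrite ?fs ?ft //; try (apply/andP; split; lra).
  by rewrite ltr_norml; apply/andP; split; lra.
have sm : s = m by lra.
by apply: fm; move: fs; rewrite sm /y; lra.
Qed.

Lemma almost_inj_mono :
  (forall s t, a <= s -> s < t -> t <= b -> f s < f t) \/
  (forall s t, a <= s -> s < t -> t <= b -> f t < f s).
Proof.
have ab' := ab; apply: cont_inj_mono => // s t /andP[s1 s2] /andP[t1 t2] e.
have [h|h] := ltrP `|s - t| (b - a); first by apply: inj => //; apply/andP.
have [st|st] := lerP s t.
  have sa : s = a by move: h; rewrite ler0_norm; lra.
  have tb : t = b by move: h; rewrite ler0_norm; lra.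
  by exfalso; apply: almost_inj_endpoints; rewrite -sa -tb.
have ta : t = a by move: h; rewrite gtr0_norm; lra.
have sb : s = b by move: h; rewrite gtr0_norm; lra.
by exfalso; apply: almost_inj_endpoints; rewrite -sb -ta.
Qed.

End Lift.

Section Circle_homeo.
Variables (Gamma : set C) (phim phip k : C -> C).
Hypotheses (hm : disk_map Gamma phim) (hp : disk_map Gamma (fun w => phip w^-1))
  (hk : fingerprint phim phip k).

Lemma k_unit z : cabs z = 1 -> cabs (k z) = 1 /\ phip (k z) = phim z.
Proof. by move=> /unit_circleE /hk [/unit_circleE]. Qed.

Lemma unit_neq0 z : cabs z = 1 -> z != 0.
Proof. by move=> z1; rewrite -cabs_gt0 z1. Qed.

Lemma phim_inj z w : cabs z = 1 -> cabs w = 1 -> phim z = phim w -> z = w.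
Proof. by move=> z1 w1; have [_ _ i _] := hm; apply: i; rewrite ?z1 ?w1 ?unit_neq0. Qed.

Lemma phip_inj z w : cabs z = 1 -> cabs w = 1 -> phip z = phip w -> z = w.
Proof.
move=> z1 w1 e; have [_ _ i _] := hp; apply: invr_inj; apply: i; rewrite ?invrK //.
- by rewrite cabsV z1 invr1.
- by rewrite cabsV w1 invr1.
- by rewrite invr_eq0 unit_neq0.
- by rewrite invr_eq0 unit_neq0.
Qed.

Lemma k_inj z w : cabs z = 1 -> cabs w = 1 -> k z = k w -> z = w.
Proof.
move=> z1 w1 e; have [_ ez] := k_unit z1; have [_ ew] := k_unit w1.
by apply: phim_inj => //; rewrite -ez -ew e.
Qed.

Lemma phip_cont z : cabs z = 1 -> cont_in [set v | cabs v = 1] phip z.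
Proof.
move=> z1; have -> : phip = fun w => (fun v => phip v^-1) w^-1 by apply/funext => w; rewrite invrK.
have z0 := unit_neq0 z1; have [cp _ _ _] := hp.
apply: (@cont_in_pre R [set v | cabs v = 1] [set w | cabs w <= 1] (fun v => phip v^-1) (fun w => w^-1)).
- by apply: contV => //; exact: cont_id.
- by move=> w /= w1; rewrite cabsV w1 invr1.
- by apply: cp; rewrite ?invr_eq0 // cabsV z1 invr1.
Qed.

(** On the circle k is phim followed by the inverse of phip, which is continuous by
    [gam_inv_cont]. *)
Lemma k_cont z : cabs z = 1 -> cont_in [set v | cabs v = 1] k z.
Proof.
move=> z1 e e0; have [kz1 ez] := k_unit z1.
have [d d0 hd] := gam_inv_cont phip_cont phip_inj kz1 e0.
have [cm _ _ _] := hm; have [|d' d'0 hd'] := cm z _ (unit_neq0 z1) d d0; first by rewrite z1.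
exists d' => // w /= w1 wd; have [kw1 ew] := k_unit w1.
by apply: hd => //; rewrite ez ew; apply: hd' => //=; rewrite w1.
Qed.

Lemma k_cis_cont t : cont_at (fun s => k (cis s)) t.
Proof.
apply: (cont_in_comp (A := [set v | cabs v = 1])).
- exact: k_cont (cabs_cis t).
- exact: cont_cis.
- by apply: filterE => s; exact: cabs_cis.
Qed.

Lemma cis_2pi_inj s t : 0 <= s <= 2 * pi -> 0 <= t <= 2 * pi -> `|s - t| < 2 * pi - 0 ->
  k (cis s) = k (cis t) -> s = t.
Proof.
move=> _ _; rewrite subr0 => st /(k_inj (cabs_cis s) (cabs_cis t)).
exact: cis_inj.
Qed.

(** If k missed z, stereographic projection from z after k would embed the circle in the line. *)
Lemma k_surj z : cabs z = 1 -> exists2 w, cabs w = 1 & k w = z.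
Proof.
move=> z1; apply: contrapT => nz.
have kz w : cabs w = 1 -> k w <> z by move=> w1 e; apply: nz; exists w.
pose f t := stereo z (k (cis t)).
have p0 : 0 < 2 * pi :> R by rewrite mulr_gt0 ?pi_gt0.
have k1 t : cabs (k (cis t)) = 1 by have [] := k_unit (cabs_cis t).
apply: (@almost_inj_endpoints f 0 (2 * pi) p0).
- move=> t _; apply: cont_stereo => //; last exact: k_cis_cont.
  exact: kz (cabs_cis t).
- move=> s t hs ht st /stereo_inj e; apply: cis_2pi_inj => //.
  by apply: e => //; exact: kz (cabs_cis _).
- by rewrite /f cis0 cis2pi.
Qed.

End Circle_homeo.
End Fingerprint.

(** * Integrals of the radicals along the circle, and the functional equation *)

Section Integration.
Context {R : realType}.
Local Notation C := (Cplx R).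
Implicit Types (z w : C) (a b s t e eps u v : R) (Q : qdiff R).
Local Notation mu := (@lebesgue_measure R).

(* On the circle z^2 Q(z) is a real number H, of which sqrt H + i sqrt (- H) is
   a square root, as Num.sqrt vanishes on the negative numbers. *)
Definition branch eps Q z : C :=
  rC eps * (rC (Num.sqrt (Hq Q z)) + 'i * rC (Num.sqrt (- Hq Q z))) / z.

Lemma branch_sqr eps Q z : eps ^+ 2 = 1 -> z != 0 -> z ^+ 2 * qeval Q z = rC (Hq Q z) ->
  branch eps Q z ^+ 2 = qeval Q z.
Proof.
move=> e1 z0 HE; apply: (mulfI (expf_neq0 2 z0)); rewrite HE /branch.
rewrite exprMn exprVn mulrCA divff ?expf_neq0 // mulr1 exprMn -rCX e1 rC1 mul1r.
move: (Hq Q z) => h; have [h0|h0] := lerP 0 h.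
  by rewrite (ler0_sqrtr (_ : - h <= 0)) ?oppr_le0 // rC0 mulr0 addr0 -rCX sqr_sqrtr.
rewrite (ler0_sqrtr (ltW h0)) rC0 add0r exprMn sqrCi -rCX sqr_sqrtr ?oppr_ge0 ?ltW //.
by rewrite rCN mulN1r opprK.
Qed.

Lemma branch_radical eps Q (E : set C) : eps ^+ 2 = 1 ->
  (forall z, z != 0 -> (qeval Q (z^*)^-1)^* = z ^+ 4 * qeval Q z) ->
  (forall z, cabs z = 1 -> ~ E z -> (qden Q).[z] != 0) -> radical_branch Q E (branch eps Q).
Proof.
move=> e1 sym hE; split => [z /unit_circleE z1 _|].
  by apply: branch_sqr (unit_neq0 z1) (Hq_real sym z1).
apply: continuous_in_subspaceT => z; rewrite inE => -[/unit_circleE z1 Ez].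
have cH := cont_Hq (hE z z1 Ez).
suff [] : cont_at (branch eps Q) z by [].
apply: contM; last by apply: contV; [exact: unit_neq0 | exact: cont_id].
apply: contM; first exact: cont_cst.
apply: contD; first by apply: cont_rC; exact: cont_sqrt.
by apply: contM; [exact: cont_cst | apply: cont_rC; apply: cont_sqrt; exact: cont_oppr].
Qed.

Lemma branch_integrand eps Q t :
  complex.Re (circle_integrand (branch eps Q) t) = - eps * Num.sqrt (- Hq Q (cis t)) /\
  complex.Im (circle_integrand (branch eps Q) t) = eps * Num.sqrt (Hq Q (cis t)).
Proof.
have -> : circle_integrand (branch eps Q) t =
    mkc (- eps * Num.sqrt (- Hq Q (cis t))) (eps * Num.sqrt (Hq Q (cis t))); last by [].
rewrite /circle_integrand /branch; have := cis_neq0 t.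
move: (Num.sqrt (Hq Q (cis t))) => x; move: (Num.sqrt (- Hq Q (cis t))) => y; move: (cis t) => z z0.
have -> : rC eps * (rC x + 'i * rC y) / z * ('i * z) = rC eps * ('i * rC x + ('i * 'i) * rC y).
  by field.
have [Ri Ii] : complex.Re ('i : C) = 0 /\ complex.Im ('i : C) = 1 by rewrite iE.
rewrite -expr2 sqrCi mulN1r; apply: complex_eq.
  rewrite [RHS](_ : _ = - eps * y) // !(cReM, ReD, ReN, cImM, ImD, ImN) Ri Ii !Re_rC !Im_rC; ring.
rewrite [RHS](_ : _ = eps * x) // !(cReM, ReD, ReN, cImM, ImD, ImN) Ri Ii !Re_rC !Im_rC; ring.
Qed.

Lemma defintZ (f : R -> R) a b u eps : defint f a b u -> defint (fun t => eps * f t) a b (eps * u).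
Proof.
move=> [i1 <-]; split; last by rewrite RintegralZl.
exact: (@integrableZl _ _ R mu _ _ eps _ i1).
Qed.

Definition abelian_defint Q a b u v : Prop :=
  defint (fun t => Num.sqrt (Hq Q (cis t))) a b u /\
  defint (fun t => Num.sqrt (- Hq Q (cis t))) a b v.

Lemma branch_defint eps Q a b u v : abelian_defint Q a b u v ->
  defint (fun t => complex.Re (circle_integrand (branch eps Q) t)) a b (- eps * v) /\
  defint (fun t => complex.Im (circle_integrand (branch eps Q) t)) a b (eps * u).
Proof.
move=> [hu hv]; split.
  rewrite (_ : (fun t => _) = fun t => - eps * Num.sqrt (- Hq Q (cis t))); first exact: defintZ.
  by apply/funext => t; case: (branch_integrand eps Q t).
rewrite (_ : (fun t => _) = fun t => eps * Num.sqrt (Hq Q (cis t))); first exact: defintZ.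
by apply/funext => t; case: (branch_integrand eps Q t).
Qed.

Lemma branch_forward eps Q a b u v : abelian_defint Q a b u v ->
  forward_circle_integral (branch eps Q) a b = mkc (- eps * v) (eps * u).
Proof. by move=> /(branch_defint eps) [[_ h1] [_ h2]]; rewrite /forward_circle_integral h1 h2. Qed.

Section Global.
Variable Q : qdiff R.
Hypothesis loc : forall t0, exists2 e, 0 < e & exists om, local_side om (fun t => Hq Q (cis t)) t0 e.

Lemma abelian_defint_cat a b c u v u' v' : a <= b -> b <= c -> abelian_defint Q a b u v ->
  abelian_defint Q b c u' v' -> abelian_defint Q a c (u + u') (v + v').
Proof. by move=> ab bc [h1 h2] [h3 h4]; split; [exact: defint_cat h1 h3 | exact: defint_cat h2 h4]. Qed.

Lemma abelian_defint_ex a b : a <= b -> exists u v, abelian_defint Q a b u v.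
Proof.
move=> ab; apply: (@interval_induction R (fun a b => exists u v, abelian_defint Q a b u v) a b ab).
  move=> x y z _ xy yz _ [u [v h]] [u' [v' h']]; exists (u + u'), (v + v').
  exact: abelian_defint_cat h h'.
move=> t _; have [e e0 [om ho]] := loc t; exists e => // x y _ xy _ xe ye.
by have [h1 h2] := local_side_defint ho xe ye xy; do 2!eexists; split; [exact: h1 | exact: h2].
Qed.

Lemma branch_integrable eps : circle_integrable (branch eps Q).
Proof.
move=> a b; have [ab|ab] := lerP a b.
  by have [u [v /(branch_defint eps) [[h1 _] [h2 _]]]] := abelian_defint_ex ab.
by rewrite set_itv_ge ?bnd_simp -?ltNge //; split; exact: integrable_set0.
Qed.

Lemma forward_cat eps a b c : a <= b -> b <= c ->
  forward_circle_integral (branch eps Q) a c =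
  forward_circle_integral (branch eps Q) a b + forward_circle_integral (branch eps Q) b c.
Proof.
move=> ab bc; have [u [v h]] := abelian_defint_ex ab; have [u' [v' h']] := abelian_defint_ex bc.
rewrite (branch_forward eps h) (branch_forward eps h').
rewrite (branch_forward eps (abelian_defint_cat ab bc h h')).
by apply: complex_eq; rewrite ?ReD ?ImD /= mulrDr.
Qed.

Lemma circle_integral_forward eps a b : a <= b ->
  circle_integral (branch eps Q) a b = forward_circle_integral (branch eps Q) a b.
Proof. by rewrite /circle_integral => ->. Qed.

Lemma circle_integral_backward eps a b : b <= a ->
  circle_integral (branch eps Q) a b = - forward_circle_integral (branch eps Q) b a.
Proof.
rewrite /circle_integral le_eqVlt => /orP[/eqP ->|ba]; last by rewrite leNgt ba.
(* For a = b the definition takes the forward integral, which is 0 by additivity. *)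
rewrite lexx; have := forward_cat eps (lexx a) (lexx a) => h.
have h0 : forward_circle_integral (branch eps Q) a a = 0 by apply: (addrI (forward_circle_integral (branch eps Q) a a)); rewrite -h addr0.
by rewrite h0 oppr0.
Qed.

Lemma circle_integral_cat eps a b c : (a <= b /\ b <= c) \/ (b <= a /\ c <= b) ->
  circle_integral (branch eps Q) a c =
  circle_integral (branch eps Q) a b + circle_integral (branch eps Q) b c.
Proof.
case=> -[h1 h2].
  by rewrite !circle_integral_forward ?(le_trans h1 h2) // (forward_cat eps h1 h2).
rewrite !circle_integral_backward ?(le_trans h2 h1) // (forward_cat eps h2 h1).
by rewrite opprD addrC.
Qed.

End Global.

Lemma within_itv_eps (f : R -> R) a b : {within `[a, b], continuous f} ->
  forall x e, a <= x <= b -> 0 < e -> exists2 d, 0 < d &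
    forall y, a <= y <= b -> `|y - x| < d -> `|f y - f x| < e.
Proof.
move=> /subspace_continuousP cf x e xab e0.
have /cvg_R/(_ e e0) : f @ within `[a, b] (nbhs x) --> f x by apply: cf; rewrite /= in_itv.
rewrite near_withinE => /near_R[d d0 hd]; exists d => // y yab /hd.
by rewrite /= in_itv /= => /(_ yab).
Qed.

Section Orientation.
Variables (Gamma : set C) (phim phip k : C -> C) (theta0 : R).
Hypotheses (hm : disk_map Gamma phim) (hp : disk_map Gamma (fun w => phip w^-1))
  (hk : fingerprint phim phip k).
Let b0 := theta0 + 2 * pi.

Lemma turn_pos : theta0 < b0.
Proof. by rewrite ltrDl mulr_gt0 ?pi_gt0. Qed.

(** A lift is continuous within one turn only; clamping its argument makes it continuous on the
    whole line, as the intermediate value and monotonicity lemmas require. *)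
Lemma lift_extension kappa : argument_lift k theta0 kappa ->
  exists f : R -> R, (forall t, cont_at f t) /\ forall t, theta0 <= t <= b0 -> f t = kappa t.
Proof.
move=> [ck hkap]; have p0 := @pi_gt0 R; pose c := clamp (theta0 + pi) pi.
have cin t : theta0 <= c t <= b0.
  by have := clamp_in (theta0 + pi) t (ltW p0); rewrite /b0 -/c; lra.
exists (fun t => kappa (c t)); split => [t|t tab]; last first.
  by rewrite /c clamp_id //; move: tab; rewrite /b0; lra.
split; apply/cvg_R => e e0; have [d d0 hd] := within_itv_eps ck (cin t) e0.
have [/cvg_R/(_ d d0)] := cont_clamp (theta0 + pi) t (ltW p0).
by apply: filterS => s hs; apply: hd.
Qed.

Lemma lift_mono kappa : argument_lift k theta0 kappa ->
  (forall s t, theta0 <= s -> s < t -> t <= b0 -> kappa s < kappa t) \/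
  (forall s t, theta0 <= s -> s < t -> t <= b0 -> kappa t < kappa s).
Proof.
move=> hl; have [f [cf fE]] := lift_extension hl; have tp := turn_pos.
have [h|h] : (forall s t, theta0 <= s -> s < t -> t <= b0 -> f s < f t) \/
    (forall s t, theta0 <= s -> s < t -> t <= b0 -> f t < f s).
  apply: almost_inj_mono => // s t sab tab st; rewrite !fE // => e.
  have [_ hkap] := hl; have := hkap s; rewrite in_itv /= => /(_ sab) e1.
  have := hkap t; rewrite in_itv /= => /(_ tab) e2.
  have : cis s = cis t by apply: (k_inj hm hk); rewrite ?cabs_cis // e1 e2 e.
  by apply: cis_inj; move: st; rewrite /b0 addrAC subrr add0r.
  by left => s t s1 st t1; have := h s t s1 st t1; rewrite !fE //; apply/andP; split; lra.
by right => s t s1 st t1; have := h s t s1 st t1; rewrite !fE //; apply/andP; split; lra.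
Qed.

(** The difference of two lifts is continuous with values in 2 pi Z, hence constant, whereas here it
    would grow from one end to the other. *)
Lemma lift_same_orientation kappa kappa' : argument_lift k theta0 kappa ->
  argument_lift k theta0 kappa' -> kappa theta0 < kappa b0 -> kappa' b0 < kappa' theta0 -> False.
Proof.
move=> hl hl' inc dec; have tp := turn_pos.
have [f [cf fE]] := lift_extension hl; have [f' [cf' fE']] := lift_extension hl'.
pose d t := f t - f' t; have cd t : cont_at d t.
  by have [c1] := cf t; have [c2] := cf' t; split; exact: cvgB.
have dE t : theta0 <= t <= b0 -> cis (d t) = 1.
  move=> tab; rewrite /d fE // fE' // cisB.
  have [_ h1] := hl; have [_ h2] := hl'.
  have := h1 t; rewrite in_itv /= => /(_ tab) <-; have := h2 t; rewrite in_itv /= => /(_ tab) <-.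
  by rewrite divff // h1 ?cis_neq0 // in_itv.
have ends : theta0 <= theta0 <= b0 /\ theta0 <= b0 <= b0 by rewrite !lexx (ltW tp).
have dlt : d theta0 < d b0.
  by case: ends => e1 e2; rewrite /d !fE // !fE' //; lra.
(* A value of [d] that exceeds d theta0 by at most 1, hence by less than 2 pi: [cis_inj] excludes
   it. *)
pose y := d theta0 + Num.min (d b0 - d theta0) 1.
have [m0 m1 m2] : [/\ 0 < Num.min (d b0 - d theta0) 1, Num.min (d b0 - d theta0) 1 <= 1 &
   Num.min (d b0 - d theta0) 1 <= d b0 - d theta0].
  by rewrite lt_min !ge_min !lexx orbT subr_gt0 dlt ltr01.
have [t tab dt] : exists2 t, theta0 <= t <= b0 & d t = y.
  by apply: IVT_between; [exact: ltW | by [] | left; rewrite /y; apply/andP; split; lra].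
have /cis_inj h : cis (d t) = cis (d theta0) by rewrite !dE //; case: ends.
have : d t = d theta0.
  by apply: h; rewrite dt /y addrAC subrr add0r gtr0_norm //; have := @pi_ge2 R; lra.
by rewrite dt /y; lra.
Qed.

(** The radicals are chosen before the lift, so the sign is defined from [k] and [theta0] through
    the existence of a lift that decreases over the turn; [lift_same_orientation] makes it the right
    one for every lift. *)
Definition orientation : R :=
  if `[< exists2 kappa, argument_lift k theta0 kappa & kappa b0 < kappa theta0 >] then -1 else 1.

Lemma orientation_sqr : orientation ^+ 2 = 1.
Proof. by rewrite /orientation; case: ifP => _; rewrite ?sqrrN expr1n. Qed.

Lemma orientationP kappa : argument_lift k theta0 kappa ->
  (orientation = 1 /\ forall s t, theta0 <= s -> s < t -> t <= b0 -> kappa s < kappa t) \/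
  (orientation = -1 /\ forall s t, theta0 <= s -> s < t -> t <= b0 -> kappa t < kappa s).
Proof.
move=> hl; have tp := turn_pos; rewrite /orientation; have [inc|dec] := lift_mono hl; last first.
  by right; rewrite asboolT //; exists kappa => //; exact: dec.
left; rewrite asboolF // => -[kappa' hl' h].
by apply: (lift_same_orientation hl hl' _ h); exact: inc.
Qed.

Section Equation.
Variables (Qm Qp : qdiff R).
Hypothesis sides : forall t0 kappa0, phim (cis t0) = phip (cis kappa0) ->
  exists W : C -> C, exists2 e, 0 < e &
    local_side (fun t => complex.Re (W (phim (cis t)))) (fun t => Hq Qm (cis t)) t0 e /\
    local_side (fun t => complex.Re (W (phip (cis t)))) (fun t => Hq Qp (cis t)) kappa0 e.
Hypothesis locm : forall t0, exists2 e, 0 < e & exists om, local_side om (fun t => Hq Qm (cis t)) t0 e.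
Hypothesis locp : forall t0, exists2 e, 0 < e & exists om, local_side om (fun t => Hq Qp (cis t)) t0 e.

(** Both sides are additive in the interval, and [interval_induction] leaves a neighbourhood of t0.
    There they are increments of signed roots of one function, since W o phip o cis o kappa = W o
    phim o cis. The sign of kappa t - kappa t0 is [orientation] times that of t - t0, and cancels
    against the sign of the branch. *)
Lemma functional_equation kappa theta : argument_lift k theta0 kappa -> theta0 <= theta <= b0 ->
  circle_integral (branch orientation Qp) (kappa theta0) (kappa theta) =
  circle_integral (branch 1 Qm) theta0 theta.
Proof.
move=> hl /andP[th1 th2].
have mono : (orientation = 1 /\ forall s t, theta0 <= s -> s <= t -> t <= b0 -> kappa s <= kappa t) \/
  (orientation = -1 /\ forall s t, theta0 <= s -> s <= t -> t <= b0 -> kappa t <= kappa s).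
  have [[-> h]|[-> h]] := orientationP hl; [left|right]; split => // s t s1; rewrite le_eqVlt => /orP[/eqP -> //|st] t1; exact/ltW/h.
have kE t : theta0 <= t <= b0 -> k (cis t) = cis (kappa t).
  by have [_ h] := hl => tab; apply: h; rewrite in_itv.
have pE t : theta0 <= t <= b0 -> phip (cis (kappa t)) = phim (cis t).
  by move=> tab; rewrite -kE //; have [] := k_unit hk (cabs_cis t).
apply: (@interval_induction R (fun x y => circle_integral (branch orientation Qp) (kappa x) (kappa y) =
  circle_integral (branch 1 Qm) x y) theta0 theta th1).
  move=> x y z x1 xy yz z1 h1 h2.
  have cm : circle_integral (branch 1 Qm) x z = circle_integral (branch 1 Qm) x y + circle_integral (branch 1 Qm) y z.
    exact: (@circle_integral_cat Qm locm 1 x y z (or_introl (conj xy yz))).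
  have cp : circle_integral (branch orientation Qp) (kappa x) (kappa z) =
    circle_integral (branch orientation Qp) (kappa x) (kappa y) + circle_integral (branch orientation Qp) (kappa y) (kappa z).
    apply: (@circle_integral_cat Qp locp orientation (kappa x) (kappa y) (kappa z)).
    have zb := le_trans z1 th2; have yb := le_trans yz zb; have y1 := le_trans x1 xy.
    by case: mono => -[_ h]; [left|right]; split; apply: h.
  exact: (etrans cp (etrans (congr2 +%R h1 h2) (esym cm))).
move=> t0 /andP[t1 t2]; have t0ab : theta0 <= t0 <= b0 by apply/andP; split; lra.
have [W [e e0 [hm1 hp1]]] := sides (esym (pE t0 t0ab)).
have [ck _] := hl; have [d d0 hd] := within_itv_eps ck t0ab e0.
exists (Num.min d e); first by rewrite lt_min d0.
move=> x y x1 xy y1; rewrite !lt_min => /andP[xd xe] /andP[yd ye].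
have xab : theta0 <= x <= b0 by apply/andP; split; lra.
have yab : theta0 <= y <= b0 by apply/andP; split; lra.
have kx := hd x xab xd; have ky := hd y yab yd.
have am := local_side_defint hm1 xe ye xy.
have cm := etrans (circle_integral_forward Qm 1 xy) (branch_forward 1 am).
have sgE t : theta0 <= t <= b0 -> Num.sg (kappa t - kappa t0) = orientation * Num.sg (t - t0).
  move=> /andP[ta tb]; have [tt|tt|->] := ltgtP t t0; last by rewrite !subrr sgr0 mulr0.
    rewrite (ltr0_sg (_ : t - t0 < 0)) ?subr_lt0 //.
    by have [[-> h]|[-> h]] := orientationP hl; [rewrite ltr0_sg ?mul1r // subr_lt0|rewrite gtr0_sg ?mulrNN ?mulr1 // subr_gt0]; apply: h => //; lra.
  rewrite (gtr0_sg (_ : 0 < t - t0)) ?subr_gt0 // mulr1.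
  by have [[-> h]|[-> h]] := orientationP hl; [rewrite gtr0_sg // subr_gt0|rewrite ltr0_sg // subr_lt0]; apply: h => //; lra.
have srE t : theta0 <= t <= b0 ->
    signed_root (fun t => complex.Re (W (phip (cis t)))) (kappa t0) (kappa t) =
      orientation * signed_root (fun t => complex.Re (W (phim (cis t)))) t0 t /\
    signed_root (fun t => - complex.Re (W (phip (cis t)))) (kappa t0) (kappa t) =
      orientation * signed_root (fun t => - complex.Re (W (phim (cis t)))) t0 t.
  by move=> tab; rewrite /signed_root sgE // pE // !mulrA.
have [sx sx'] := srE x xab; have [sy sy'] := srE y yab.
case: mono => -[oE h].
  have kxy : kappa x <= kappa y by apply: h => //; lra.
  have ap := local_side_defint hp1 kx ky kxy.
  have cp := etrans (circle_integral_forward Qp orientation kxy) (branch_forward orientation ap).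
  apply: (etrans cp); apply: (etrans _ (esym cm)); rewrite sx sx' sy sy' oE.
  by apply: complex_eq; rewrite /= !mul1r.
(* When kappa decreases the integral runs backwards: its minus sign restores the order of the end
   points, and the factors -1 of the branch and of the signed roots cancel. *)
have kxy : kappa y <= kappa x by apply: h => //; lra.
have ap := local_side_defint hp1 ky kx kxy.
have cp := etrans (circle_integral_backward locp orientation kxy) (congr1 -%R (branch_forward orientation ap)).
apply: (etrans cp); apply: (etrans _ (esym cm)); rewrite sx sx' sy sy' oE.
by apply: complex_eq; rewrite ?ReN ?ImN /=; ring.
Qed.

End Equation.
End Orientation.
End Integration.

Lemma local_side_le (R : realType) (om H : R -> R) t0 e e' : e' <= e ->
  local_side om H t0 e -> local_side om H t0 e'.
Proof.
move=> ee [dom [h1 h2 h3 h4 h5]]; have l t : `|t - t0| < e' -> `|t - t0| < e by move=> /lt_le_trans; exact.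
exists dom; split => //.
- by move=> t /l; exact: h1.
- by move=> t /l; exact: h2.
- by move=> t /l; exact: h4.
- by move=> t /l; exact: h5.
Qed.

Unset Implicit Arguments.

Theorem theorem4 (R : realType) (Q : qdiff R) (Gamma : set (Cplx R))
    (phim phip k : Cplx R -> Cplx R)
    (hGamma : jordan_curve Gamma)
    (hfree : forall z, Gamma z -> ~ infinite_critical Q z)
    (harcs : made_of_trajectory_arcs Q Gamma)
    (hphim : interior_riemann_map Gamma phim)
    (hphip : exterior_riemann_map Gamma phip)
    (hk : fingerprint phim phip k) :
  exists Qm Qp : qdiff R,
    [/\ reflected_pullback unit_disk phim Q Qm,
        reflected_pullback unit_exterior phip Q Qp,
        has_product_form Qm,
        has_product_form Qp &
        let E := [set z | unit_circle z /\
                          (critical Qm z \/ critical Qp (k z))] in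
        forall theta0 : R, 0 <= theta0 < 2 * pi ->
        exists sm sp : Cplx R -> Cplx R,
          [/\ radical_branch Qm E sm,
              radical_branch Qp (k @` E) sp,
              circle_integrable sm,
              circle_integrable sp &
              forall kappa : R -> R, argument_lift k theta0 kappa ->
              forall theta : R, theta0 <= theta <= theta0 + 2 * pi ->
                circle_integral sp (kappa theta0) (kappa theta)
                = circle_integral sm theta0 theta]].
Proof.
have [hm _ _] := interior_disk_map hGamma hphim.
have [hp _ _] := exterior_disk_map hGamma hphip.
have [Qm [lm [rm hlm]]] := interior_pullback hGamma hfree harcs hphim.
have [Qp [QD [lp [rp hQp symD hlp]]]] := exterior_pullback hGamma hfree harcs hphip.
have [_ symm] := rm; have [_ symp] := rp.
have sides t0 kappa0 : phim (cis t0) = phip (cis kappa0) ->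
    exists W : Cplx R -> Cplx R, exists2 e, 0 < e &
    local_side (fun t => complex.Re (W (phim (cis t)))) (fun t => Hq Qm (cis t)) t0 e /\
    local_side (fun t => complex.Re (W (phip (cis t)))) (fun t => Hq Qp (cis t)) kappa0 e.
  move=> e0; have [_ _ _ Gm] := hm.
  have [rho [W [rho0 hW W0 WQ]]] := square_of_abelian_integral (hfree _ (Gm _ (cabs_cis t0))).
  have [e1 e10 h1] := side_local hGamma harcs hm hlm symm rho0 hW W0 WQ.
  (* The same W is used at the point cis (- kappa0) for the disk map w |-> phip (1 / w). *)
  have eD : phim (cis t0) = phip (cis (- kappa0))^-1 by rewrite cisN invrK.
  rewrite eD in hW W0 WQ.
  have [e2 e20 h2] := side_local hGamma harcs hp hlp symD rho0 hW W0 WQ.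
  exists W, (Num.min e1 e2); first by rewrite lt_min e10.
  split; first by apply: local_side_le h1; rewrite ge_min lexx.
  apply: (@local_side_le _ _ _ _ e2); first by rewrite ge_min lexx orbT.
  have := local_side_opp h2; rewrite opprK.
  rewrite (_ : (fun t => complex.Re _) = fun t => complex.Re (W (phip (cis t)))); last first.
    by apply/funext => t; rewrite cisN invrK.
  by rewrite (_ : (fun t => Hq QD _) = fun t => Hq Qp (cis t)) //; apply/funext => t; rewrite (Hq_conj _ hQp).
have locm t0 : exists2 e, 0 < e & exists om, local_side om (fun t => Hq Qm (cis t)) t0 e.
  have [k1 ek] := k_unit hk (cabs_cis t0); have [kappa0 _ e0] := cabs1_cis k1.
  rewrite e0 in ek; have [W [e e_gt0 [h _]]] := sides _ _ (esym ek).
  by exists e => //; eexists; exact: h.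
have locp kappa0 : exists2 e, 0 < e & exists om, local_side om (fun t => Hq Qp (cis t)) kappa0 e.
  (* [sides] speaks of pairs of corresponding points; as k is onto, every point of the circle
     belongs to such a pair. *)
  have [w w1 ew] := k_surj hm hp hk (cabs_cis kappa0); have [t0 _ e0] := cabs1_cis w1.
  have [_ ek] := k_unit hk w1; rewrite ew e0 in ek.
  have [W [e e_gt0 [_ h]]] := sides _ _ (esym ek).
  by exists e => //; eexists; exact: h.
exists Qm, Qp; split => //; [exact: symmetric_product_form|exact: symmetric_product_form|].
move=> E theta0 _; exists (branch 1 Qm), (branch (orientation k theta0) Qp); split.
- apply: branch_radical; [exact: expr1n | exact: symm |].
  move=> z z1 nE; apply/negP => h; apply: nE; split; first exact/unit_circleE.
  by left; right.
- apply: branch_radical; [exact: orientation_sqr | exact: symp |].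
  (* A pole of Qp on the circle is k w for some w, which is then in E. *)
  move=> z z1 nE; have [w w1 ew] := k_surj hm hp hk z1.
  apply/negP => h; apply: nE; exists w => //; split; first exact/unit_circleE.
  by right; right; rewrite ew.
- exact: branch_integrable.
- exact: branch_integrable.
- by move=> kappa hl theta hth; exact: (functional_equation hm hk sides locm locp hl hth).
Qed.
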